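(* Let $G$ be a finite weakly connected directed graph without multiple edges, with edges colored $1$ and $2$. The following are equivalent (isomorphisms are understood to preserve directions and colors of edges): (a) $G$ is isomorphic to a regular $B_2$-crystal; (b) $G$ is isomorphic to a finite S-graph $S(a,b)$ for some $a,b\in\mathbb{Z}_{\ge 0}$; (c) one can distinguish some vertices and some $1$-edges of $G$ as central so that Axioms (B0)--(B4), (B3$'$), (B4$'$), (BA) hold.
   Context: **Regular $B_2$-crystals.** A regular $B_2$-crystal is the crystal graph (Kashiwara) of an irreducible highest weight integrable module over $U_q(sp_4)$: vertices are the elements of the crystal basis and there is an edge of color $i\in\{1,2\}$ from $u$ to $v$ iff $v=\tilde f_i u$. The numbering of simple roots is such that $\langle h_2,\alpha_1\rangle=-2$ and $\langle h_1,\alpha_2\rangle=-1$ ($\alpha_1$ long, $\alpha_2$ short). **RA2-graphs.** Let each of $A,B$ be one of the index sets $\{0,1,\dots,a\}$ ($a\in\mathbb{Z}_{\ge0}$), $\mathbb{Z}_{\ge 0}$, $\mathbb{Z}_{\le 0}$, $\mathbb{Z}$. The right $A$-sail $R$ has vertices $(i,j)\in A^2$ with $j\le i$; the left $A$-sail $L$ has vertices $(i,j)\in B^2$ with $i\le j$; in both, all pairs $((i,j),(i+1,j))$ are edges of color I and all pairs $((i,j),(i,j+1))$ are edges of color II. The RA2-graph $C(A,B)$ is obtained from disjoint copies $R_j$ ($j\in B$) of $R$ and $L_i$ ($i\in A$) of $L$ by identifying, for every $(i,j)\in A\times B$, the vertex $(i,i)$ of $R_j$ with the vertex $(j,j)$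 of $L_i$; the resulting vertex is called the principal vertex $(i,j)$. Each maximal path of color I (I-string) and each maximal path of color II (II-string) contains exactly one principal vertex. A vertex of $C(A,B)$ is an $\otimes$-vertex if it is a vertex $(k,l)$ of some $L_i$ with $l-k$ odd; the other vertices are ordinary. **$B$-sails.** For $r,m\in\mathbb{Z}_{\ge0}\cup\{\infty\}$, the left $B$-sail has as vertices the integer points $(p,q)$ with $-r\le p\le q\le m$, $q\ge 2p$, and the half-integer points $(k+\frac12,2k+1)$ with $k\in\mathbb{Z}_{\ge0}$, $2k+1\le m$. Its edges are all pairs $((p,q),(p+1,q))$ (color 1) and $((p,q),(p,q+1))$ (color 2) of its integer vertices, and the left half-edges $((k,2k+1),(k+\frac12,2k+1))$ (color 1). Its diagonal is the sequence $d_t$, $t\in\mathbb{Z}$, $-r\le t\le m$, where $d_t=(t,t)$ for $t\le 0$ and $d_t=(t/2,t)$ for $t\ge0$. For $n,q\in\mathbb{Z}_{\ge0}\cup\{\infty\}$, the right $B$-sail has as vertices the integer points $(p,s)$ with $-n\le s\le p\le q$, $s\le 2p$, and the points $(-k-\frac12,-2k-1)$ with $k\in\mathbb{Z}_{\ge0}$, $2k+1\le n$. Its edges are all pairs $((p,s),(p+1,s))$ (color 1) and $((p,s),(p,s+1))$ (color 2) of its integer vertices, and the right half-edges $((-k-\frac12,-2k-1),(-k,-2k-1))$ (color 1). Its diagonal is $d_t$, $-n\le t\le q$, with $d_t=(t/2,t)$ for $t\le0$ and $d_t=(t,t)$ for $t\ge0$. **S-graphs.** The S-graph $S(A,B)$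 is obtained from $C=C(A,B)$ as follows. For each II-string $P$ with principal vertex $(i,j)$ take a left $B$-sail with $r=|\{k\in A:k<i\}|$, $m=|\{k\in B:k>j\}|$ and identify the vertices of $P$, in their order, with the diagonal $(d_t)$, the principal vertex being identified with $d_0$. For each I-string $P$ with principal vertex $(i,j)$ take a right $B$-sail with $q=|\{k\in A:k>i\}|$, $n=|\{k\in B:k<j\}|$ and identify the vertices of $P$, in their order, with its diagonal, the principal vertex being identified with $d_0$. Delete all edges of $C$. Each $\otimes$-vertex $w$ is then incident to exactly one left half-edge $(u,w)$ and one right half-edge $(w,z)$; replace these by a single edge $(u,z)$ of color 1 and delete $w$. For finite $A=\{0,\dots,a\}$, $B=\{0,\dots,b\}$ one writes $S(a,b)$. **Axioms.** $G$ is a weakly connected 2-edge-colored digraph (colors $1,2$) without multiple edges, possibly infinite; an edge of color $i$ is an $i$-edge; some vertices and some 1-edges are distinguished as central. (B0) For $i=1,2$, each vertex has at most one entering $i$-edge and at most one leaving $i$-edge, and the components of the subgraph formed by all vertices and all $i$-edges (called $i$-strings) are finite or infinite directed paths (possibly single vertices). For $i=1,2$ let $\mathbf{i}$ be the partial invertible operator with $\mathbf{i}u=v$ iff $(u,v)$ is an $i$-edge. (B1) Each 1-string has exactly one central element, which is either a vertex or an edge. A vertex is left (right) if it lies before (after) the central element of its 1-string; a 1-edge $(u,v)$ that is not central is left if $u$ is left and right if $v$ is right. (B2) Each 2-string $P$ contains exactly one central vertex $v$; all vertices of $P$ before $v$ are right and all vertices of $P$ after $v$ are left. A 2-edge $(u,v)$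 is left if $v$ is left, and right if $u$ is right. A commutative square is a quadruple $u,v,u',v'$ with $v=\mathbf1u$, $u'=\mathbf2u$, $v'=\mathbf1u'=\mathbf2v$, together with its four edges. (B3) (i) If $(u,v)$ is a left 1-edge and there is a 2-edge leaving $u$ or $v$, then these two edges belong to a commutative square. (ii) If $(v,w)$ is a left 2-edge and there is a 1-edge entering $v$ or $w$, then these two edges belong to a commutative square. (B3$'$) (i) If $(u,v)$ is a right 1-edge and there is a 2-edge entering $u$ or $v$, then these two edges belong to a commutative square. (ii) If $(v,w)$ is a right 2-edge and there is a 1-edge leaving $v$ or $w$, then these two edges belong to a commutative square. (B4) If $u$ is the beginning vertex of a central edge and there are a 2-edge $(u,w)$, a 1-edge $(w,w')$ and a 2-edge $(w',v)$, then $v$ is the beginning vertex of a central edge. (B4$'$) If $u$ is the end vertex of a central edge and there are a 2-edge $(w,u)$, a 1-edge $(w',w)$ and a 2-edge $(v,w')$, then $v$ is the end vertex of a central edge. Central graph $C(G)$ (for $G$ satisfying the axioms above): its vertices are the central vertices of $G$ and the mid-points of central edges of $G$ (one for each central edge); the mid-points are its $\otimes$-vertices. Cutting $G$ at all central vertices (one copy keeps the entering 1-edge and leaving 2-edge, the other the leaving 1-edge and entering 2-edge) and at mid-points of central edges gives left components (formed by left edges and left half-edges) and right components; the central points in such a component form its linearly ordered diagonal. $C(G)$ has an edge of color II from $u$ to $v$ iff $v$ is next to $u$ in the diagonal of a left component, and an edge of color I from $u$ to $v$ iff $v$ is next to $u$ in the diagonal of a right component. Explicitly, II-edges go: from a central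 vertex $v$ to $\mathbf1\mathbf2v$ if this is defined and central; from a central vertex $v$ to the mid-point of $(\mathbf2v,\mathbf1\mathbf2v)$ if this is a central edge; from the mid-point of a central edge $(x,x')$ to $\mathbf1\mathbf2x$ if defined (it is then a central vertex). I-edges go: to a central vertex $v$ from $\mathbf1^{-1}\mathbf2^{-1}v$ if this is defined and central; to a central vertex $v$ from the mid-point of $(\mathbf1^{-1}\mathbf2^{-1}v,\mathbf2^{-1}v)$ if this is a central edge; to the mid-point of a central edge $(x,x')$ from $\mathbf1^{-1}\mathbf2^{-1}x'$ if defined (it is then a central vertex). (BA) $C(G)$ is an RA2-graph with the same $\otimes$-vertices, i.e. for some $A,B$ there is an isomorphism $C(G)\to C(A,B)$ preserving directions and colors of edges and mapping the set of $\otimes$-vertices of $C(G)$ onto the set of $\otimes$-vertices of $C(A,B)$. *)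

(* Defs.v *)
From HB Require Import structures.
From mathcomp Require Import all_boot all_order all_algebra.
From mathcomp Require Import fraction.
From Stdlib Require Import Relation_Operators.

Set Implicit Arguments.
Unset Strict Implicit.
Unset Printing Implicit Defensive.

Import Order.TTheory GRing.Theory Num.Theory.
Local Open Scope ring_scope.

(* col1 stands for the colors 1 and I, col2 for the colors 2 and II; color is
   also the index set of the simple roots. *)
Inductive color := col1 | col2.

Definition eq_color (i j : color) : bool :=
  match i, j with col1, col1 | col2, col2 => true | _, _ => false end.

(* An edge is an ordered pair of vertices. *)
Record cgraph := CGraph {
  vert :> Type;
  edge : color -> vert -> vert -> Prop }.

Definition finite_graph (T : finType) (E : color -> rel T) : cgraph :=
  @CGraph T (fun i u v => E i u v).

Definition no_multiple_edges (G : cgraph) : Prop :=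
  forall u v : G, ~ (edge col1 u v /\ edge col2 u v).

Definition weakly_connected (G : cgraph) : Prop :=
  forall u v : G, clos_refl_sym_trans G (fun x y => exists i, edge i x y) u v.

Definition graph_iso (G H : cgraph) (f : G -> H) : Prop :=
  bijective f /\ forall i (u v : G), edge i u v <-> edge i (f u) (f v).

Definition isomorphic (G H : cgraph) : Prop :=
  exists f : G -> H, graph_iso f.

(* The base field Q(q), and its local subring A of the rational functions that
   are regular at q = 0; A / qA is identified with Q. *)
Definition Qq : fieldType := {fraction {poly rat}}.
Definition qvar : Qq := tofrac 'X.
Definition ratQq (a : rat) : Qq := tofrac a%:P.
Definition regular0 (x : Qq) : Prop :=
  exists n d : {poly rat}, d.[0] != 0 /\ x = (tofrac n : Qq) / tofrac d.

(* <h_i, alpha_j> *)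
Definition cartan (i j : color) : int :=
  match i, j with
  | col1, col1 | col2, col2 => 2
  | col1, col2 => -1
  | col2, col1 => -2
  end.

(* (alpha_i, alpha_i) / 2 *)
Definition halfnorm (i : color) : nat := if i is col1 then 2 else 1.

Definition qv (i : color) : Qq := qvar ^+ halfnorm i.
Definition qint (i : color) (n : nat) : Qq :=
  (qv i ^+ n - qv i ^- n) / (qv i - (qv i)^-1).
Definition qfact (i : color) (n : nat) : Qq := \prod_(1 <= k < n.+1) qint i k.

Section Modules.

Variable V : lmodType Qq.

(* The divided power x_i^(n) = x_i^n / [n]_i!, applied to v. *)
Definition divpow (x : color -> V -> V) (i : color) (n : nat) (v : V) : V :=
  (qfact i n)^-1 *: iter n (x i) v.

Definition serre (x : color -> V -> V) : Prop :=
  forall i j (v : V), ~~ eq_color i j ->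
    let m := (`|1 - cartan i j|)%N in
    \sum_(k < m.+1)
      (-1) ^+ k *: divpow x i k (x j (divpow x i (m - k) v)) = 0.

End Modules.

(* A U_q(sp_4)-module: Uk i and UkV i are the actions of q^{h_i} and q^{- h_i},
   where (h_1, h_2) is a basis of the dual of the weight lattice, and
   t_i = q^{(alpha_i, alpha_i) / 2 * h_i}. *)
Record Uq_module := UqModule {
  carrier :> lmodType Qq;
  Ue : color -> {linear carrier -> carrier};
  Uf : color -> {linear carrier -> carrier};
  Uk : color -> {linear carrier -> carrier};
  UkV : color -> {linear carrier -> carrier};
  UkK : forall i v, UkV i (Uk i v) = v;
  UkVK : forall i v, Uk i (UkV i v) = v;
  UkC : forall i j v, Uk i (Uk j v) = Uk j (Uk i v);
  Uke : forall i j v, Uk i (Ue j v) = qvar ^ cartan i j *: Ue j (Uk i v);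
  Ukf : forall i j v, Uk i (Uf j v) = qvar ^ (- cartan i j) *: Uf j (Uk i v);
  Uef : forall i j v, Ue i (Uf j v) - Uf j (Ue i v) =
    if eq_color i j then
      (qv i - (qv i)^-1)^-1
        *: (iter (halfnorm i) (Uk i) v - iter (halfnorm i) (UkV i) v)
    else 0;
  serre_e : serre (fun i v => Ue i v);
  serre_f : serre (fun i v => Uf i v) }.

Arguments Ue {_} i.
Arguments Uf {_} i.
Arguments Uk {_} i.
Arguments UkV {_} i.

Section CrystalBases.

Variable M : Uq_module.

(* A weight lambda is given by the integers <h_i, lambda>. *)
Definition weight := color -> int.

Definition weight_vector (la : weight) (v : M) : Prop :=
  forall i, Uk i v = qvar ^ la i *: v.

Definition submodule (W : M -> Prop) : Prop :=
  [/\ W 0,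
      forall (a : Qq) u v, W u -> W v -> W (a *: u + v) &
      forall i v, W v -> [/\ W (Ue i v), W (Uf i v), W (Uk i v) & W (UkV i v)]].

Definition irreducible : Prop :=
  (exists v : M, v != 0) /\
  forall W, submodule W -> (forall v, W v -> v = 0) \/ (forall v, W v).

Definition highest_weight : Prop :=
  exists (la : weight) (v : M),
    [/\ v != 0, weight_vector la v, forall i, Ue i v = 0 &
        forall W, submodule W -> W v -> forall u, W u].

Definition integrable : Prop :=
  (forall v : M, exists s : seq M,
     (forall w, w \in s -> exists la, weight_vector la w) /\
     v = \sum_(w <- s) w) /\
  (forall i (v : M), exists n,
     iter n (Ue i) v = 0 /\ iter n (Uf i) v = 0).

(* Kashiwara's operators.  An integrable module is, for each i, the direct sum
   of the subspaces f_i^(n) (ker e_i /\ M_la) with 0 <= n <= <h_i, la>; on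
   them, the operators send f_i^(n) w to f_i^(n+1) w, resp. to f_i^(n-1) w
   (to 0 when n = 0).  They are given by their graphs; a list s of pairs (n, w)
   stands for a decomposition \sum f_i^(n) w. *)
Definition string_terms (i : color) (s : seq (nat * M)) : Prop :=
  forall nw, nw \in s -> Ue i nw.2 = 0 /\
    exists la, weight_vector la nw.2 /\ nw.1%:Z <= la i.

Definition fdiv (i : color) (n : nat) (v : M) : M :=
  divpow (fun j => Uf j) i n v.

Definition ktilde_f (i : color) (u v : M) : Prop :=
  exists s, [/\ string_terms i s,
    u = \sum_(nw <- s) fdiv i nw.1 nw.2 &
    v = \sum_(nw <- s) fdiv i nw.1.+1 nw.2].

Definition ktilde_e (i : color) (u v : M) : Prop :=
  exists s, [/\ string_terms i s,
    u = \sum_(nw <- s) fdiv i nw.1 nw.2 &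
    v = \sum_(nw <- s | (0 < nw.1)%N) fdiv i nw.1.-1 nw.2].

(* A free A-submodule L such that Q(q) (x)_A L -> M is an isomorphism is the
   A-span of a Q(q)-basis of M. *)
Definition lattice (L : M -> Prop) : Prop :=
  exists (I : eqType) (c : I -> M),
    [/\ forall (s : seq I) (a : I -> Qq), uniq s ->
          \sum_(i <- s) a i *: c i = 0 -> forall i, i \in s -> a i = 0,
        forall v, exists (s : seq I) (a : I -> Qq),
          v = \sum_(i <- s) a i *: c i &
        forall v, L v <-> exists (s : seq I) (a : I -> Qq),
          (forall i, regular0 (a i)) /\ v = \sum_(i <- s) a i *: c i].

Definition crystal_lattice (L : M -> Prop) : Prop :=
  [/\ lattice L,
      forall v, L v -> exists s : seq M,
        (forall w, w \in s -> L w /\ exists la, weight_vector la w) /\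
        v = \sum_(w <- s) w &
      forall i u v, L u ->
        (ktilde_e i u v -> L v) /\ (ktilde_f i u v -> L v)].

(* u and v have the same class modulo qL. *)
Definition eqmodq (L : M -> Prop) (u v : M) : Prop :=
  exists w, L w /\ u - v = qvar *: w.

(* (L, B) is a crystal basis of M, where the subset B of L / qL is the set of
   the classes of the b x, x in X.  Linear independence makes these classes
   pairwise distinct, and the condition B = \bigsqcup B_la is expressed by
   taking the representatives b x to be weight vectors. *)
Definition crystal_basis (L : M -> Prop) (X : eqType) (b : X -> M) : Prop :=
  [/\ crystal_lattice L,
      forall x, L (b x) /\ (exists la, weight_vector la (b x)),
      (forall (s : seq X) (a : X -> rat), uniq s ->
         eqmodq L (\sum_(x <- s) ratQq (a x) *: b x) 0 ->
         forall x, x \in s -> a x = 0) /\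
      (forall v, L v -> exists (s : seq X) (a : X -> rat),
         eqmodq L v (\sum_(x <- s) ratQq (a x) *: b x)),
      forall i x v, ktilde_e i (b x) v \/ ktilde_f i (b x) v ->
        eqmodq L v 0 \/ exists y, eqmodq L v (b y) &
      forall i x y,
        (exists v, ktilde_f i (b x) v /\ eqmodq L v (b y)) <->
        (exists v, ktilde_e i (b y) v /\ eqmodq L v (b x))].

Definition crystal_graph (L : M -> Prop) (X : eqType) (b : X -> M) : cgraph :=
  @CGraph X (fun i x y => exists v, ktilde_f i (b x) v /\ eqmodq L v (b y)).

End CrystalBases.

Definition regular_B2_crystal (G : cgraph) : Prop :=
  exists M : Uq_module,
    [/\ irreducible M, highest_weight M, integrable M &
        exists (L : M -> Prop) (X : eqType) (b : X -> M),
          crystal_basis L b /\ G = crystal_graph L b].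

(* Seg a = {0, ..., a} *)
Inductive index_set := Seg of nat | Nonneg | Nonpos | AllInt.

Definition mem_ix (A : index_set) (x : int) : bool :=
  match A with
  | Seg a => 0 <= x <= a%:Z
  | Nonneg => 0 <= x
  | Nonpos => x <= 0
  | AllInt => true
  end.

(* |{k in A : k < i}| and |{k in A : k > i}| for i in A; None is infinity. *)
Definition card_lt (A : index_set) (i : int) : option nat :=
  match A with
  | Seg _ | Nonneg => Some (`|i|)%N
  | Nonpos | AllInt => None
  end.

Definition card_gt (A : index_set) (i : int) : option nat :=
  match A with
  | Seg a => Some (`|a%:Z - i|)%N
  | Nonpos => Some (`|i|)%N
  | Nonneg | AllInt => None
  end.

(* (x, y, k, l) encodes the vertex (x, y) of R_j, where k = l = j, or the vertex
   (k, l) of L_i, where x = y = i; the identified vertices, (i, i) of R_j and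
   (j, j) of L_i, have the same code (i, i, j, j). *)
Definition cpoint := (int * int * int * int)%type.
Definition inR (j x y : int) : cpoint := (x, y, j, j).
Definition inL (i k l : int) : cpoint := (i, i, k, l).

Definition is_RA2_vertex (A B : index_set) (w : cpoint) : bool :=
  let: (x, y, k, l) := w in
  [&& mem_ix A x, mem_ix A y, y <= x, mem_ix B k, mem_ix B l, k <= l
    & (x == y) || (k == l)].

Definition is_otimes (w : cpoint) : bool :=
  let: (x, y, k, l) := w in odd (`|l - k|)%N.

Definition step (c : color) (x y : int) : int * int :=
  if c is col1 then (x + 1, y) else (x, y + 1).

Definition RA2_edge (c : color) (u v : cpoint) : Prop :=
  (exists j x y, u = inR j x y /\ v = inR j (step c x y).1 (step c x y).2) \/
  (exists i k l, u = inL i k l /\ v = inL i (step c k l).1 (step c k l).2).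

Definition RA2_graph (A B : index_set) : cgraph :=
  @CGraph {w : cpoint | is_RA2_vertex A B w}
          (fun c u v => RA2_edge c (val u) (val v)).

(* Pt p s is the integer point (p, s); Half h is the point (h + 1/2, 2h + 1) of
   a left sail, resp. (- h - 1/2, - 2h - 1) of a right sail. *)
Inductive sail_point := Pt of int & int | Half of nat.

Definition ge_opp (x : int) (n : option nat) : bool :=
  if n is Some n' then - n'%:Z <= x else true.
Definition le_opt (x : int) (n : option nat) : bool :=
  if n is Some n' then x <= n'%:Z else true.

Definition left_sail (r m : option nat) (z : sail_point) : bool :=
  match z with
  | Pt p s => [&& ge_opp p r, p <= s, le_opt s m & 2 * p <= s]
  | Half h => le_opt (2 * h%:Z + 1) m
  end.

Definition right_sail (n q : option nat) (z : sail_point) : bool :=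
  match z with
  | Pt p s => [&& ge_opp s n, s <= p, le_opt p q & s <= 2 * p]
  | Half h => le_opt (2 * h%:Z + 1) n
  end.

(* Full edges of a sail with vertex set D. *)
Definition sail_edge (D : sail_point -> bool) (c : color) (y z : sail_point)
    : Prop :=
  exists p s, [/\ y = Pt p s, z = Pt (step c p s).1 (step c p s).2, D y & D z].

Definition left_half_edge (r m : option nat) (y z : sail_point) : Prop :=
  exists h : nat, [/\ y = Pt h%:Z (2 * h%:Z + 1), z = Half h,
    left_sail r m y & left_sail r m z].

Definition right_half_edge (n q : option nat) (y z : sail_point) : Prop :=
  exists h : nat, [/\ y = Half h, z = Pt (- h%:Z) (- (2 * h%:Z) - 1),
    right_sail n q y & right_sail n q z].

(* left_diag z = Some t iff z = d_t; None if z is not on the diagonal. *)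
Definition left_diag (z : sail_point) : option int :=
  match z with
  | Pt p s => if (p == s) && (p <= 0) then Some p
              else if (s == 2 * p) && (0 <= p) then Some s else None
  | Half h => Some (2 * h%:Z + 1)
  end.

Definition right_diag (z : sail_point) : option int :=
  match z with
  | Pt p s => if (s == 2 * p) && (p <= 0) then Some s
              else if (p == s) && (0 <= p) then Some p else None
  | Half h => Some (- (2 * h%:Z) - 1)
  end.

(* The vertex at (signed) distance t from the principal vertex (i, j) on its
   II-string, resp. on its I-string.  The II-string runs up the column of
   abscissa i of R_j to the vertex (i, i) of R_j, identified with (j, j) of L_i,
   then up the column of abscissa j of L_i. *)
Definition stringII (i j t : int) : cpoint :=
  if t <= 0 then inR j i (i + t) else inL i j (j + t).
Definition stringI (i j t : int) : cpoint :=
  if t <= 0 then inL i (j + t) j else inR j (i + t) i.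

(* SC w is a vertex w of C(A, B); SL i j p s (SR i j p s) is the point (p, s),
   not on the diagonal, of the left (right) B-sail attached to the II-string
   (I-string) with principal vertex (i, j). *)
Inductive spoint :=
  | SC of cpoint
  | SL of int & int & int & int
  | SR of int & int & int & int.

(* The class, after identification, of a point of an attached sail.  Half
   points are on the diagonal. *)
Definition at_left (i j : int) (z : sail_point) : spoint :=
  match left_diag z, z with
  | Some t, _ => SC (stringII i j t)
  | None, Pt p s => SL i j p s
  | None, Half h => SC (stringII i j (2 * h%:Z + 1))
  end.
Definition at_right (i j : int) (z : sail_point) : spoint :=
  match right_diag z, z with
  | Some t, _ => SC (stringI i j t)
  | None, Pt p s => SR i j p s
  | None, Half h => SC (stringI i j (- (2 * h%:Z) - 1))
  end.

Section SGraph.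

Variables A B : index_set.

Definition lsail (i j : int) : sail_point -> bool :=
  left_sail (card_lt A i) (card_gt B j).
Definition rsail (i j : int) : sail_point -> bool :=
  right_sail (card_lt B j) (card_gt A i).

Definition is_S_vertex (u : spoint) : bool :=
  match u with
  | SC w => is_RA2_vertex A B w && ~~ is_otimes w
  | SL i j p s => [&& mem_ix A i, mem_ix B j, lsail i j (Pt p s)
                    & left_diag (Pt p s) == None]
  | SR i j p s => [&& mem_ix A i, mem_ix B j, rsail i j (Pt p s)
                    & right_diag (Pt p s) == None]
  end.

Definition S_left_edge (c : color) (u v : spoint) : Prop :=
  exists i j y z, [/\ mem_ix A i && mem_ix B j, sail_edge (lsail i j) c y z,
    u = at_left i j y & v = at_left i j z].

Definition S_right_edge (c : color) (u v : spoint) : Prop :=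
  exists i j y z, [/\ mem_ix A i && mem_ix B j, sail_edge (rsail i j) c y z,
    u = at_right i j y & v = at_right i j z].

Definition S_left_half_edge (u w : spoint) : Prop :=
  exists i j y z, [/\ mem_ix A i && mem_ix B j,
    left_half_edge (card_lt A i) (card_gt B j) y z,
    u = at_left i j y & w = at_left i j z].

Definition S_right_half_edge (w v : spoint) : Prop :=
  exists i j y z, [/\ mem_ix A i && mem_ix B j,
    right_half_edge (card_lt B j) (card_gt A i) y z,
    w = at_right i j y & v = at_right i j z].

Definition S_edge (c : color) (u v : spoint) : Prop :=
  [\/ S_left_edge c u v, S_right_edge c u v |
      c = col1 /\ exists w : cpoint, [/\ is_RA2_vertex A B w, is_otimes w,
        S_left_half_edge u (SC w) & S_right_half_edge (SC w) v]].

Definition S_graph : cgraph :=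
  @CGraph {u : spoint | is_S_vertex u} (fun c u v => S_edge c (val u) (val v)).

End SGraph.

Section CentralElements.

(* cv and ce are the sets of the central vertices and of the central edges. *)
Variables (G : cgraph) (cv : G -> bool) (ce : G -> G -> bool).

Local Notation E1 := (edge col1).
Local Notation E2 := (edge col2).

Definition same_string (i : color) : G -> G -> Prop :=
  clos_refl_sym_trans G (edge i).
Definition before (i : color) : G -> G -> Prop := clos_trans G (edge i).
Definition before_eq (i : color) : G -> G -> Prop :=
  clos_refl_trans G (edge i).

Definition central_edges_wf : Prop := forall u v : G, ce u v -> E1 u v.

(* When all in- and outdegrees are at most 1, a component that is not a directed
   path is a directed cycle. *)
Definition axiom_B0 : Prop := forall i,
  [/\ forall u u' v : G, edge i u v -> edge i u' v -> u = u',
      forall u v v' : G, edge i u v -> edge i u v' -> v = v' &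
      forall u : G, ~ before i u u].

Definition central_in_1string (u : G) (x : G + G * G) : Prop :=
  match x with
  | inl v => cv v /\ same_string col1 u v
  | inr (v, w) => [/\ ce v w, same_string col1 u v & same_string col1 u w]
  end.

Definition axiom_B1 : Prop :=
  forall u : G, exists! x : G + G * G, central_in_1string u x.

Definition left_vertex (u : G) : Prop :=
  (exists v, cv v /\ before col1 u v) \/
  (exists v w, ce v w /\ before_eq col1 u v).
Definition right_vertex (u : G) : Prop :=
  (exists v, cv v /\ before col1 v u) \/
  (exists v w, ce v w /\ before_eq col1 w u).

Definition left_1edge (u v : G) : Prop := [/\ E1 u v, ~ ce u v & left_vertex u].
Definition right_1edge (u v : G) : Prop :=
  [/\ E1 u v, ~ ce u v & right_vertex v].

Definition axiom_B2 : Prop :=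
  (forall u : G, exists! v : G, cv v /\ same_string col2 u v) /\
  (forall v : G, cv v ->
     (forall u, before col2 u v -> right_vertex u) /\
     (forall u, before col2 v u -> left_vertex u)).

Definition left_2edge (u v : G) : Prop := E2 u v /\ left_vertex v.
Definition right_2edge (u v : G) : Prop := E2 u v /\ right_vertex u.

Definition square (u v u' v' : G) : Prop :=
  [/\ E1 u v, E2 u u', E1 u' v' & E2 v v'].

Definition axiom_B3 : Prop :=
  (forall u v : G, left_1edge u v ->
     (forall x, E2 u x -> exists y, square u v x y) /\
     (forall y, E2 v y -> exists x, square u v x y)) /\
  (forall v w : G, left_2edge v w ->
     (forall x, E1 x v -> exists y, square x v y w) /\
     (forall y, E1 y w -> exists x, square x v y w)).

Definition axiom_B3' : Prop :=
  (forall u v : G, right_1edge u v ->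
     (forall x, E2 x u -> exists y, square x y u v) /\
     (forall y, E2 y v -> exists x, square x y u v)) /\
  (forall v w : G, right_2edge v w ->
     (forall x, E1 v x -> exists y, square v x w y) /\
     (forall y, E1 w y -> exists x, square v x w y)).

Definition begins_central (u : G) : Prop := exists u', ce u u'.
Definition ends_central (u : G) : Prop := exists u', ce u' u.

Definition axiom_B4 : Prop :=
  forall u w w' v : G, begins_central u ->
    E2 u w -> E1 w w' -> E2 w' v -> begins_central v.

Definition axiom_B4' : Prop :=
  forall u w w' v : G, ends_central u ->
    E2 w u -> E1 w' w -> E2 v w' -> ends_central v.

(* inr (x, x') is the mid-point of the central edge (x, x'). *)
Definition central_vertex : Type :=
  ({v : G | cv v} + {xx : G * G | ce xx.1 xx.2})%type.

Definition is_midpoint (z : central_vertex) : bool :=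
  if z is inr _ then true else false.

Definition central_edgeII (y z : central_vertex) : Prop :=
  match y, z with
  | inl v, inl w => exists x, E2 (val v) x /\ E1 x (val w)
  | inl v, inr xx => E2 (val v) (val xx).1
  | inr xx, inl w => exists x, E2 (val xx).1 x /\ E1 x (val w)
  | inr _, inr _ => False
  end.

Definition central_edgeI (y z : central_vertex) : Prop :=
  match y, z with
  | inl v, inl w => exists x, E1 (val v) x /\ E2 x (val w)
  | inr xx, inl w => E2 (val xx).2 (val w)
  | inl v, inr xx => exists x, E1 (val v) x /\ E2 x (val xx).2
  | inr _, inr _ => False
  end.

Definition central_graph : cgraph :=
  @CGraph central_vertex
          (fun c => if c is col1 then central_edgeI else central_edgeII).

Definition axiom_BA : Prop :=
  exists (A B : index_set) (g : central_graph -> RA2_graph A B),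
    graph_iso g /\ forall z, is_midpoint z = is_otimes (val (g z)).

Definition B2_axioms : Prop :=
  [/\ axiom_B0, axiom_B1, axiom_B2, axiom_B3 & axiom_B3'] /\
  [/\ axiom_B4, axiom_B4' & axiom_BA].

End CentralElements.

(* Main.v *)
From HB Require Import structures.
From mathcomp Require Import all_boot all_order all_algebra fraction generic_quotient.
From mathcomp Require Import zify ring lra.
From Stdlib Require Import Relation_Operators Operators_Properties Classical IndefiniteDescription.
Require Import Defs.

Set Implicit Arguments.
Unset Strict Implicit.
Unset Printing Implicit Defensive.

Import Order.TTheory GRing.Theory Num.Theory.
Local Open Scope ring_scope.

(** All three conditions are compared with one explicit finite coloured graph, [model_graph a b].
    Its vertices are integer points (x, y, k, j, s): here (x, y, k, k + 2j) is an ordinary vertex of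
    C(A, B) with A = {0, ..., a} and B = {0, ..., b}, which plays the role of the centre of a
    2-string, and s is the signed distance from that centre along the 2-string. The arrows of both
    colours are piecewise linear in these coordinates, so most combinatorial checks are case
    analyses closed by linear arithmetic.

    Crystals ([regular_iff_model]). The irreducible module of highest weight (a, b) is built inside
    tensor products with the four-dimensional module V. The data carried along ([crystal_module])
    are a weight basis b spanning a lattice L over the local ring at q = 0, a contravariant form for
    which b is orthonormal modulo q, and, for each colour i, a basis congruent to b modulo qL on
    which e_i and f_i act by exact sl_2-strings. Tensoring with V preserves these data and produces
    Kashiwara's tensor product of crystals ([tensor_crystal_module]). Since a sum of rational
    squares vanishes only trivially, the form is anisotropic. Hence a highest weight vector
    generates an irreducible module, generated modules of different highest weights are orthogonal,
    and a connected component of the tensor crystal is realized by the submodule generated by one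
    highest weight vector ([crystal_component]). These vectors are explicit
    ([tensor_highest_weight]), and so are the embeddings of the model (a, b + 1) into (a, b) tensor
    V and of (a + 1, b) into (a, b + 1) tensor V ([embB], [embA]); an induction from the trivial
    module gives [model_realizable]. Conversely, an irreducible integrable highest weight module has
    a highest weight (a, b) with a, b nonnegative, is isomorphic to the realized module of that
    weight ([hw_model_basis]), and its crystal basis agrees with the realized one up to a scalar
    ([crystal_graph_uniq]).

    S-graphs ([S_graph_model]). Each colour 2 line of a sail meets the diagonal in exactly one
    ordinary vertex of C(A, B); that vertex and the distance to it are the model coordinates of a
    point of the sail.

    Axioms. In the model the central vertices are the points of height s = 0, and the central edges
    go from height 1 to height -1 ([model_axioms]). Conversely ([axioms_model]), finiteness makes A
    and B segments, (BA) gives coordinates to the centres, and (B2) gives each 2-string one centre,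
    with left vertices after it and right vertices before it. Squares from (B3), stacked along
    2-strings above the arrow leading to the next centre, determine by induction the number of
    vertices above each centre ([left_count]) and the 1-arrow leaving each left vertex
    ([left_steps]). Reversing all arrows exchanges left and right and replaces C(A, B) by its dual,
    which settles the other half; [assembly] glues the halves. *)

(** * The local ring of Q(q) at q = 0 *)

Lemma fraction_ratio (R : idomainType) (x : {fraction R}) :
  exists n d : R, d != 0 /\ x = tofrac n / tofrac d.
Proof.
exists (frac (repr x)).1, (frac (repr x)).2; have d0 := denom_ratioP (repr x).
split=> //; have d0' : tofrac (frac (repr x)).2 != 0 by rewrite tofrac_eq0.
apply: (canRL (mulfK d0')); rewrite -{1}[x]reprK /GRing.mul /= !piE.
apply/eqmodP; rewrite /= FracField.equivfE !numden_Ratio ?mulf_neq0 ?oner_eq0 //.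
by rewrite !mulr1 mulrC.
Qed.

Lemma tofrac_unit0 (d : {poly rat}) : d.[0] != 0 -> (tofrac d : Qq) != 0.
Proof. by rewrite tofrac_eq0; apply: contraNneq => ->; rewrite horner0. Qed.

Lemma qvar_neq0 : qvar != 0 :> Qq.
Proof. by rewrite tofrac_eq0 polyX_eq0. Qed.

(** The maximal ideal of the local ring: a regular element that is not [small] is a unit
    ([regular0_inv]). *)
Definition small (x : Qq) : Prop := exists2 y, regular0 y & x = qvar * y.

Lemma regular0_poly (p : {poly rat}) : regular0 (tofrac p).
Proof. by exists p, 1; rewrite hornerC oner_eq0 rmorph1 divr1. Qed.

Lemma regular0_0 : regular0 0.
Proof. by rewrite -[0](rmorph0 (@tofrac {poly rat})); apply: regular0_poly. Qed.

Lemma regular0_1 : regular0 1.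
Proof. by rewrite -[1](rmorph1 (@tofrac {poly rat})); apply: regular0_poly. Qed.

Lemma regular0_qvar : regular0 qvar.
Proof. exact: regular0_poly. Qed.

Lemma regular0_rat r : regular0 (ratQq r).
Proof. exact: regular0_poly. Qed.

Lemma regular0_add x y : regular0 x -> regular0 y -> regular0 (x + y).
Proof.
move=> [n [d [d0 ->]]] [m [e [e0 ->]]]; exists (n * e + m * d), (d * e).
split; first by rewrite hornerM mulf_neq0.
by rewrite addf_div ?tofrac_unit0 // rmorphD !rmorphM.
Qed.

Lemma regular0_mul x y : regular0 x -> regular0 y -> regular0 (x * y).
Proof.
move=> [n [d [d0 ->]]] [m [e [e0 ->]]]; exists (n * m), (d * e).
split; first by rewrite hornerM mulf_neq0.
by rewrite mulf_div !rmorphM.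
Qed.

Lemma regular0_opp x : regular0 x -> regular0 (- x).
Proof. by move=> [n [d [d0 ->]]]; exists (- n), d; rewrite rmorphN mulNr. Qed.

Lemma regular0_sub x y : regular0 x -> regular0 y -> regular0 (x - y).
Proof. by move=> xA /regular0_opp; apply: regular0_add. Qed.

Lemma regular0_exp x n : regular0 x -> regular0 (x ^+ n).
Proof.
move=> xA; elim: n => [|n IHn]; first exact: regular0_1.
by rewrite exprS; apply: regular0_mul.
Qed.

Lemma regular0_sum I (r : seq I) (P : pred I) (F : I -> Qq) :
  (forall i, P i -> regular0 (F i)) -> regular0 (\sum_(i <- r | P i) F i).
Proof. exact: (big_ind regular0 regular0_0 regular0_add). Qed.

Lemma small_regular0 x : small x -> regular0 x.
Proof. by move=> [y yA ->]; apply: regular0_mul regular0_qvar yA. Qed.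

Lemma small0 : small 0.
Proof. by exists 0; [apply: regular0_0 | rewrite mulr0]. Qed.

Lemma small_qvar : small qvar.
Proof. by exists 1; [apply: regular0_1 | rewrite mulr1]. Qed.

Lemma smallD x y : small x -> small y -> small (x + y).
Proof.
move=> [x' xA ->] [y' yA ->]; exists (x' + y'); last by rewrite mulrDr.
exact: regular0_add.
Qed.

Lemma smallN x : small x -> small (- x).
Proof. by move=> [y yA ->]; exists (- y); rewrite ?mulrN //; apply: regular0_opp. Qed.

Lemma smallB x y : small x -> small y -> small (x - y).
Proof. by move=> xA /smallN; apply: smallD. Qed.

Lemma smallMl x y : regular0 x -> small y -> small (x * y).
Proof.
move=> xA [y' yA ->]; exists (x * y'); last by rewrite mulrCA.
exact: regular0_mul.
Qed.

Lemma smallMr x y : small x -> regular0 y -> small (x * y).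
Proof. by move=> xs yA; rewrite mulrC; apply: smallMl. Qed.

Lemma small_sum I (r : seq I) (P : pred I) (F : I -> Qq) :
  (forall i, P i -> small (F i)) -> small (\sum_(i <- r | P i) F i).
Proof. exact: (big_ind small small0 smallD). Qed.

(** Evaluation at 0 detects the maximal ideal: a numerator vanishing at 0 is divisible by X, and
    cross-multiplying and evaluating at 0 gives the converse. *)
Lemma small_tofrac_div (n d : {poly rat}) :
  d.[0] != 0 -> small (tofrac n / tofrac d) <-> n.[0] = 0.
Proof.
move=> d0; split=> [[_ [m [e [e0 ->]]]]|n0]; last first.
  have /factor_theorem[p ->] : root n 0 by apply/rootP.
  exists (tofrac p / tofrac d); first by exists p, d.
  by rewrite subr0 [p * 'X]mulrC rmorphM mulrA.
have dF := tofrac_unit0 d0; have eF := tofrac_unit0 e0.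
rewrite mulrA => /eqP; rewrite eqr_div // -!rmorphM tofrac_eq => /eqP.
move=> /(congr1 (fun p => p.[0])); rewrite !hornerM hornerX !mul0r => /eqP.
by rewrite mulf_eq0 (negPf e0) orbF => /eqP.
Qed.

Lemma small_rat r : small (ratQq r) -> r = 0.
Proof.
have -> : ratQq r = (tofrac r%:P : Qq) / tofrac 1 by rewrite rmorph1 divr1.
by move/small_tofrac_div; rewrite !hornerC; apply; rewrite oner_eq0.
Qed.

Lemma not_small1 : ~ small 1.
Proof.
have -> : 1 = ratQq 1 :> Qq by rewrite /ratQq polyC1 rmorph1.
by move/small_rat/eqP; rewrite oner_eq0.
Qed.

Lemma regular0_residue x : regular0 x -> exists r, small (x - ratQq r).
Proof.
move=> [n [d [d0 ->]]]; exists (n.[0] / d.[0]).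
have -> : ratQq (n.[0] / d.[0]) = (tofrac ((n.[0] / d.[0])%:P * d) : Qq) / tofrac d.
  by rewrite rmorphM mulfK ?tofrac_unit0.
rewrite -mulrBl -rmorphB; apply/small_tofrac_div => //.
by rewrite hornerD hornerN hornerM hornerC divfK // subrr.
Qed.

Lemma smallVnot x : regular0 x -> small x \/ ~ small x.
Proof.
move=> [n [d [d0 ->]]]; have [n0|n0] := eqVneq n.[0] 0.
  by left; apply/small_tofrac_div.
by right=> /small_tofrac_div => /(_ d0) /eqP; rewrite (negPf n0).
Qed.

Lemma regular0_inv x : regular0 x -> ~ small x -> regular0 x^-1.
Proof.
move=> [n [d [d0 ->]]] xns; exists d, n; rewrite invfM invrK mulrC; split => //.
by apply: contra_notN xns => /eqP n0; apply/small_tofrac_div.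
Qed.

Lemma not_smallM x y : regular0 x -> regular0 y -> ~ small x -> ~ small y ->
  ~ small (x * y).
Proof.
move=> xA yA xns yns xys; apply: yns.
have x0 : x != 0 by apply: contra_notN xns => /eqP ->; apply: small0.
by rewrite -[y](mulKf x0); apply: smallMl xys; apply: regular0_inv.
Qed.

(** The exponent is the multiplicity of the root 0 in the numerator minus that in the
    denominator. *)
Lemma valuation (x : Qq) : x != 0 ->
  exists (k : int) (u : Qq), [/\ regular0 u, ~ small u & x = qvar ^ k * u].
Proof.
have [n [d [d0 ->]]] := fraction_ratio x => x0.
have n0 : n != 0 by apply: contraNneq x0 => ->; rewrite rmorph0 mul0r.
have [i [n' +]] := multiplicity_XsubC n 0; rewrite n0 /= => /rootP/eqP n'0 nE.
have [j [d' +]] := multiplicity_XsubC d 0; rewrite d0 /= => /rootP/eqP d'0 dE.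
exists (i%:Z - j%:Z), (tofrac n' / tofrac d'); split.
- by exists n', d'.
- by move/small_tofrac_div => /(_ d'0) /eqP; rewrite (negPf n'0).
rewrite nE dE subr0 !rmorphM !rmorphXn expfzDr ?qvar_neq0 // -invr_expz -!exprnP.
by rewrite -/qvar invfM mulrACA mulrC.
Qed.

Lemma small_exprz k : 0 < k -> small (qvar ^ k).
Proof.
case: k => [[|k]|//] // _; rewrite -exprnP exprS; exists (qvar ^+ k) => //.
exact: regular0_exp regular0_qvar.
Qed.

Lemma regular0_exprz k : 0 <= k -> regular0 (qvar ^ k).
Proof. by case: k => [k|//] _; apply: regular0_exp regular0_qvar. Qed.

Lemma regular0_valuation k u : regular0 u -> ~ small u ->
  regular0 (qvar ^ k * u) -> 0 <= k.
Proof.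
move=> uA uns xA; rewrite leNgt; apply/negP => k0; apply: uns.
rewrite -[u](mulKf (expfz_neq0 k qvar_neq0)) invr_expz; apply: smallMr xA.
by apply: small_exprz; rewrite oppr_gt0.
Qed.

Lemma regular0Vnot x : regular0 x \/ ~ regular0 x.
Proof.
have [->|/valuation [k [u [uA uns ->]]]] := eqVneq x 0; first by left; apply: regular0_0.
have [k0|k0] := leP 0 k; first by left; apply: regular0_mul => //; apply: regular0_exprz.
by right=> /(regular0_valuation uA uns); rewrite leNgt k0.
Qed.

Lemma not_regular0_inv x : ~ regular0 x -> small x^-1.
Proof.
have [->|/valuation [k [u [uA uns ->]]]] := eqVneq x 0; first by case; apply: regular0_0.
move=> xnA; have k0 : k < 0.
  rewrite ltNge; apply: contra_notN xnA => k0.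
  by apply: regular0_mul => //; apply: regular0_exprz.
rewrite invfM invr_expz; apply: smallMr (regular0_inv uA uns).
by apply: small_exprz; rewrite oppr_gt0.
Qed.

Lemma qvar_exp_neq1 k : k != 0 -> qvar ^ k != 1.
Proof.
have pos j : 0 < j -> qvar ^ j != 1.
  by move=> j0; apply/eqP => j1; apply: not_small1; rewrite -j1; apply: small_exprz.
case: (ltrgt0P k) => // [/pos //|k0 _]; apply: contraNneq (pos (- k) _).
  by rewrite -invr_expz => ->; rewrite invr1.
by rewrite oppr_gt0.
Qed.

Lemma qvar_exp_inj : injective (fun k : int => qvar ^ k).
Proof.
move=> j k /= jk; apply/eqP; rewrite -subr_eq0; apply/negPn/negP => /qvar_exp_neq1/eqP.
by apply; rewrite expfzDr ?qvar_neq0 // jk -invr_expz divff // expfz_neq0 // qvar_neq0.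
Qed.

Lemma qvar_neg_small_0 x : (forall n, regular0 (qvar ^- n * x)) -> x = 0.
Proof.
move=> xA; apply/eqP/negPn/negP => /valuation [k [u [uA uns xE]]].
have := xA (`|k|.+1)%N; rewrite xE mulrA exprnN -expfzDr ?qvar_neq0 //.
move/(regular0_valuation uA uns); lia.
Qed.

(** Dividing by [q] to the least valuation among the nonzero entries makes every entry regular and a
    minimal one a unit. *)
Lemma primitive_scaling (X : finType) (a : X -> Qq) (x0 : X) : a x0 != 0 ->
  exists k : int, (forall x, regular0 (qvar ^ k * a x)) /\
                  exists x, ~ small (qvar ^ k * a x).
Proof.
move=> ax0; have /fin_all_exists[k kP] : forall x, exists k, a x != 0 ->
    exists u, [/\ regular0 u, ~ small u & a x = qvar ^ k * u].
  by move=> x; have [_|/valuation [k]] := eqVneq (a x) 0; [exists 0|exists k].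
case: (@arg_minP _ _ _ x0 (fun x => a x != 0) k ax0) => x ax kmin; exists (- k x); split=> [y|]; last first.
  exists x; have [u [uA uns ->]] := kP x ax.
  by rewrite mulrA -expfzDr ?qvar_neq0 // addNr expr0z mul1r.
have [->|ay] := eqVneq (a y) 0; first by rewrite mulr0; apply: regular0_0.
have [u [uA uns ->]] := kP y ay; rewrite mulrA -expfzDr ?qvar_neq0 //.
by apply: regular0_mul => //; apply: regular0_exprz; have := kmin y ay; lia.
Qed.

(** * Finite bases, the lattices they span, and reduction modulo q *)

(** A basis is carried together with its coordinate functions, so that the lattice it spans and [q]
    times this lattice become conditions on coordinates: all regular ([inL]), all small ([inqL]). *)
Record coords (M : lmodType Qq) (X : finType) (b : X -> M) (co : X -> M -> Qq)
    : Prop := Coords {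
  co_linear : forall x a u v, co x (a *: u + v) = a * co x u + co x v;
  co_basis : forall x y, co x (b y) = (y == x)%:R;
  co_span : forall v, v = \sum_x co x v *: b x }.

Section Coords.
Variables (M : lmodType Qq) (X : finType) (b : X -> M) (co : X -> M -> Qq).
Hypothesis bco : coords b co.

Lemma coD x u v : co x (u + v) = co x u + co x v.
Proof. by rewrite -[u in LHS]scale1r (co_linear bco) // mul1r. Qed.

Lemma co0 x : co x 0 = 0.
Proof. by apply: (addrI (co x 0)); rewrite -coD !addr0. Qed.

Lemma coZ x a u : co x (a *: u) = a * co x u.
Proof. by rewrite -[a *: u]addr0 (co_linear bco) // co0 addr0. Qed.

Lemma coN x u : co x (- u) = - co x u.
Proof. by rewrite -scaleN1r coZ mulN1r. Qed.

Lemma coB x u v : co x (u - v) = co x u - co x v.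
Proof. by rewrite coD coN. Qed.

Lemma co_sum x I (r : seq I) (P : pred I) (F : I -> M) :
  co x (\sum_(i <- r | P i) F i) = \sum_(i <- r | P i) co x (F i).
Proof. by apply: (big_morph (co x)); [apply: coD | apply: co0]. Qed.

Lemma co_eq u v : (forall x, co x u = co x v) -> u = v.
Proof.
by move=> uv; rewrite (co_span bco u) (co_span bco v); apply: eq_bigr => x _; rewrite uv.
Qed.

Lemma co_comb x (a : X -> Qq) : co x (\sum_y a y *: b y) = a x.
Proof.
rewrite co_sum (bigD1 x) //= big1 ?addr0 => [|y yx]; first last.
  by rewrite coZ (co_basis bco) (negPf yx) mulr0.
by rewrite coZ (co_basis bco) eqxx mulr1.
Qed.

Lemma coords_linear_ext (N : lmodType Qq) (f g : {linear M -> N}) :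
  (forall x, f (b x) = g (b x)) -> forall v, f v = g v.
Proof.
move=> fg v; rewrite (co_span bco v) !linear_sum; apply: eq_bigr => x _.
by rewrite !linearZ fg.
Qed.

Definition inL v := forall x, regular0 (co x v).
Definition inqL v := forall x, small (co x v).

Lemma inL0 : inL 0. Proof. by move=> x; rewrite co0; apply: regular0_0. Qed.
Lemma inLD u v : inL u -> inL v -> inL (u + v).
Proof. by move=> uL vL x; rewrite coD; apply: regular0_add. Qed.
Lemma inLZ a v : regular0 a -> inL v -> inL (a *: v).
Proof. by move=> aA vL x; rewrite coZ; apply: regular0_mul. Qed.
Lemma inLN v : inL v -> inL (- v).
Proof. by move=> vL x; rewrite coN; apply: regular0_opp. Qed.
Lemma inLB u v : inL u -> inL v -> inL (u - v).
Proof. by move=> uL vL; apply: inLD => //; apply: inLN. Qed.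
Lemma inL_sum I (r : seq I) (P : pred I) (F : I -> M) :
  (forall i, P i -> inL (F i)) -> inL (\sum_(i <- r | P i) F i).
Proof. exact: (big_ind inL inL0 inLD). Qed.
Lemma inL_basis x : inL (b x).
Proof.
by move=> y; rewrite (co_basis bco); case: eqP => _; [apply: regular0_1|apply: regular0_0].
Qed.

Lemma inqL0 : inqL 0. Proof. by move=> x; rewrite co0; apply: small0. Qed.
Lemma inqLD u v : inqL u -> inqL v -> inqL (u + v).
Proof. by move=> uL vL x; rewrite coD; apply: smallD. Qed.
Lemma inqLN v : inqL v -> inqL (- v).
Proof. by move=> vL x; rewrite coN; apply: smallN. Qed.
Lemma inqLB u v : inqL u -> inqL v -> inqL (u - v).
Proof. by move=> uL vL; apply: inqLD => //; apply: inqLN. Qed.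
Lemma inqLZ a v : regular0 a -> inqL v -> inqL (a *: v).
Proof. by move=> aA vL x; rewrite coZ; apply: smallMl. Qed.
Lemma inqL_smallZ a v : small a -> inL v -> inqL (a *: v).
Proof. by move=> aA vL x; rewrite coZ; apply: smallMr. Qed.
Lemma inqL_sum I (r : seq I) (P : pred I) (F : I -> M) :
  (forall i, P i -> inqL (F i)) -> inqL (\sum_(i <- r | P i) F i).
Proof. exact: (big_ind inqL inqL0 inqLD). Qed.
Lemma inqL_inL v : inqL v -> inL v.
Proof. by move=> vL x; apply: small_regular0. Qed.
Lemma inqL_sym u v : inqL (u - v) -> inqL (v - u).
Proof. by rewrite -opprB => /inqLN; rewrite opprK. Qed.
Lemma inqL_trans u v w : inqL (u - v) -> inqL (v - w) -> inqL (u - w).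
Proof. by move=> uv vw; rewrite -(subrK v u) -addrA; apply: inqLD. Qed.
Lemma inL_congr u v : inqL (u - v) -> inL v -> inL u.
Proof. by move=> /inqL_inL uv vL; rewrite -(subrK v u); apply: inLD. Qed.

Lemma inqLP v : inqL v <-> inL (qvar^-1 *: v).
Proof.
split=> vL x; have := vL x; rewrite coZ.
  by case=> y yA ->; rewrite mulKf ?qvar_neq0.
by move=> h; exists (qvar^-1 * co x v) => //; rewrite mulVKf ?qvar_neq0.
Qed.

Lemma primitive_vector v : v != 0 -> exists k : int,
  inL (qvar ^ k *: v) /\ exists x, ~ small (co x (qvar ^ k *: v)).
Proof.
move=> v0; have [x vx|vx] := pickP (fun x => co x v != 0).
  have [k [kA [y ky]]] := primitive_scaling (a := fun x => co x v) vx.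
  by exists k; split=> [z|]; [rewrite coZ|exists y; rewrite coZ].
case/negP: v0; apply/eqP/co_eq => x; rewrite co0.
by apply/eqP; have /negbFE := vx x.
Qed.

Variable c : X -> M.
Hypothesis cb : forall y, inqL (c y - b y).

Lemma co_near_comb (a : X -> Qq) x : (forall y, regular0 (a y)) ->
  small (co x (\sum_y a y *: c y) - a x).
Proof.
move=> aA; rewrite -[a x](co_comb x) -coB -sumrB co_sum; apply: small_sum => y _.
by rewrite -scalerBr coZ; apply: smallMl => //; apply: cb.
Qed.

(** A nontrivial relation, scaled to be primitive, would reduce modulo [q] to a nontrivial relation
    between the [b y], to which the [c y] are congruent. *)
Lemma near_basis_free (a : X -> Qq) : \sum_y a y *: c y = 0 -> forall x, a x = 0.
Proof.
move=> ac x; apply/eqP/negPn/negP => ax.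
have [k [kA [y ky]]] := primitive_scaling ax; apply: ky.
have := co_near_comb y kA; under eq_bigr do rewrite -scalerA.
by rewrite -scaler_sumr ac scaler0 co0 sub0r => /smallN; rewrite opprK.
Qed.

(** The coordinates of the family form a square matrix with independent rows, hence an invertible
    one; its inverse gives the new coordinate functions. *)
Lemma free_basis : (forall a : X -> Qq, \sum_y a y *: c y = 0 -> forall x, a x = 0) ->
  exists co', coords c co'.
Proof.
move=> cfree; pose P := \matrix_(i < #|X|, j < #|X|) co (enum_val j) (c (enum_val i)).
have eX (V : zmodType) (F : X -> V) : \sum_x F x = \sum_(i < #|X|) F (enum_val i).
  rewrite (reindex (@enum_val X predT)) /=; first exact: eq_bigl.
  by exists enum_rank => x _; [apply: enum_valK|apply: enum_rankK].
have Pu : P \in unitmx.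
  rewrite -row_free_unit; apply: inj_row_free => v vP; apply/rowP => j.
  have /(_ _ (enum_val j)) := cfree (fun x => v 0 (enum_rank x)).
  rewrite enum_valK mxE; apply; apply: co_eq => x; rewrite co0 co_sum eX.
  have /rowP/(_ (enum_rank x)) := vP; rewrite !mxE => vP0; rewrite -[RHS]vP0.
  by apply: eq_bigr => i _; rewrite coZ enum_valK mxE enum_rankK.
pose row v := \row_(j < #|X|) co (enum_val j) v.
have rowc y : row (c y) = delta_mx 0 (enum_rank y) *m P.
  by rewrite -rowE; apply/rowP => j; rewrite !mxE enum_rankK.
have co'P v : v = \sum_x (row v *m invmx P) 0 (enum_rank x) *: c x.
  apply: co_eq => x; rewrite co_sum eX.
  have -> : co x v = (row v *m invmx P *m P) 0 (enum_rank x).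
    by rewrite mulmxKV // mxE enum_rankK.
  by rewrite mxE; apply: eq_bigr => i _; rewrite coZ enum_valK !mxE enum_rankK.
exists (fun x v => (row v *m invmx P) 0 (enum_rank x)); split=> //.
- move=> x a u v; have -> : row (a *: u + v) = a *: row u + row v.
    by apply/rowP => j; rewrite !mxE (co_linear bco).
  by rewrite mulmxDl -scalemxAl !mxE.
- move=> x y; rewrite rowc mulmxK // mxE eqxx /= eq_sym.
  by rewrite (inj_eq enum_rank_inj).
Qed.

Lemma near_basis : exists co', coords c co'.
Proof. exact/free_basis/near_basis_free. Qed.

Variable co' : X -> M -> Qq.
Hypothesis cco' : coords c co'.

(** A form of Nakayama's lemma: a basis congruent to [b] modulo [q] spans the same lattice. If a new
    coordinate of [v] were not regular, primitive scaling would use a positive power of [q]; the old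
    coordinates of the scaled vector would then be small, although they are congruent to the new
    ones, one of which is a unit. *)
Lemma near_basis_inL v : inL v <-> (forall x, regular0 (co' x v)).
Proof.
split=> vL x; last first.
  rewrite [v](co_span cco') co_sum; apply: regular0_sum => y _; rewrite coZ.
  by apply: regular0_mul => //; apply: (inL_congr (cb y)); apply: inL_basis.
case: (regular0Vnot (co' x v)) => // ns.
have nz : co' x v != 0 by apply: contra_notN ns => /eqP ->; apply: regular0_0.
have [k [kA [y ky]]] := primitive_scaling (a := fun x => co' x v) nz.
have k0 : 0 < k.
  rewrite ltNge; apply: contra_notN ns => k0.
  rewrite -[co' x v](mulKf (expfz_neq0 k qvar_neq0)) invr_expz.
  by apply: regular0_mul (kA x); apply: regular0_exprz; lia.
case: ky; have := co_near_comb y kA; under eq_bigr do rewrite -scalerA.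
rewrite -scaler_sumr -(co_span cco') coZ => h.
rewrite -[_ * _](subKr (qvar ^ k * co y v)); apply: smallB => //.
by apply: smallMr => //; apply: small_exprz.
Qed.

Lemma near_basis_co x v : inL v -> small (co x v - co' x v).
Proof.
move=> /near_basis_inL vL; rewrite {1}[v](co_span cco').
by apply: co_near_comb.
Qed.

Lemma near_basis_inqL v : inqL v <-> (forall x, small (co' x v)).
Proof.
split=> vL x.
  rewrite -[co' x v](subKr (co x v)); apply: smallB => //.
  by apply: near_basis_co; apply: inqL_inL.
rewrite -[co x v](subrK (co' x v)); apply: smallD => //; apply: near_basis_co.
by apply/near_basis_inL => y; apply: small_regular0.
Qed.

End Coords.

(** * Quantum integers *)

Lemma qv_neq0 i : qv i != 0.
Proof. by rewrite expf_neq0 // qvar_neq0. Qed.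

Lemma qv_exp_inj i : injective (fun k : int => qv i ^ k).
Proof.
move=> j k /=; rewrite /qv exprnP !exprz_exp => /qvar_exp_inj.
by case: i => /=; lia.
Qed.

Lemma qv_sub_neq0 i : qv i - (qv i)^-1 != 0.
Proof.
rewrite subr_eq0; apply/eqP => h; have := @qv_exp_inj i 1 (-1).
by rewrite /= expr1z -invr_expz expr1z => /(_ h).
Qed.

Lemma qint_neq0 i n : qint i n.+1 != 0.
Proof.
rewrite mulf_neq0 ?invr_eq0 ?qv_sub_neq0 // subr_eq0 exprnN exprnP.
by apply/eqP => /qv_exp_inj; lia.
Qed.

Lemma qint0 i : qint i 0 = 0.
Proof. by rewrite /qint expr0 invr1 subrr mul0r. Qed.

Lemma qint1 i : qint i 1 = 1.
Proof. by rewrite /qint expr1 divff ?qv_sub_neq0. Qed.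

Lemma bracketM (F : fieldType) (q : F) (n m : nat) : q != 0 -> q - q^-1 != 0 ->
  (q ^+ n - q ^- n) / (q - q^-1) * ((q ^+ m - q ^- m) / (q - q^-1)) * (q - q^-1) ^+ 2 =
  q ^ (n + m)%:Z + (q ^ (n + m)%:Z)^-1 - (q ^ (m%:Z - n%:Z) + q ^ (n%:Z - m%:Z)).
Proof.
move=> q0 qq0; rewrite PoszD !expfzDr // -!invr_expz -!exprnP.
have := expf_neq0 n q0; have := expf_neq0 m q0.
move: (q ^+ n) (q ^+ m) => A B B0 A0; field.
rewrite A0 B0 q0 /=; apply: contraNneq qq0 => qq.
have -> : q - q^-1 = (q * q - 1) / q by field.
by rewrite qq mul0r.
Qed.

Lemma add_inv_eq (F : fieldType) (x y : F) : x != 0 -> y != 0 ->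
  y + y^-1 = x + x^-1 -> y = x \/ y * x = 1.
Proof.
move=> x0 y0 h; have /eqP : (y - x) * (y * x - 1) = 0.
  have -> : (y - x) * (y * x - 1) = x * y * ((y + y^-1) - (x + x^-1)).
    by field; rewrite x0 y0.
  by rewrite h subrr mulr0.
by rewrite mulf_eq0 !subr_eq0 => /orP[] /eqP; [left|right].
Qed.

(** Up to the factor of [bracketM], the product [n][m] is Q + 1/Q minus a term depending only on m -
    n, where Q is the power n + m of [qv i]. With m - n fixed, the product therefore determines Q up
    to inversion, hence n + m. *)
Lemma qintM_inj i (n m n' m' : nat) : (m + n' = m' + n)%N -> (0 < m)%N -> (0 < m')%N ->
  qint i n * qint i m = qint i n' * qint i m' -> n = n'.
Proof.
move=> d m0 m'0 e.
have := bracketM n m (qv_neq0 i) (qv_sub_neq0 i).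
have := bracketM n' m' (qv_neq0 i) (qv_sub_neq0 i).
rewrite -!/(qint i _) -e (_ : m'%:Z - n'%:Z = m%:Z - n%:Z); last by lia.
rewrite (_ : n'%:Z - m'%:Z = n%:Z - m%:Z); last by lia.
move=> -> /addIr /add_inv_eq[]; rewrite ?expfz_neq0 ?qv_neq0 // => /esym.
  by move/qv_exp_inj; lia.
rewrite -expfzDr ?qv_neq0 // -(expr0z (qv i)) => /qv_exp_inj; lia.
Qed.

Lemma qfactS i n : qfact i n.+1 = qfact i n * qint i n.+1.
Proof. by rewrite /qfact big_nat_recr. Qed.

Lemma qfact0 i : qfact i 0 = 1.
Proof. by rewrite /qfact big_geq. Qed.

Lemma qfact_neq0 i n : qfact i n != 0.
Proof.
elim: n => [|n IHn]; first by rewrite qfact0 oner_eq0.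
by rewrite qfactS mulf_neq0 ?qint_neq0.
Qed.

(** * Abstract crystals and exact string bases *)

(** String lengths are stored as data instead of being derived from the arrows, so that weights are
    differences of stored numbers and the fields of a concrete crystal are arithmetic statements.
    The fields force [ceps] and [cphi] to be the numbers of steps to the two ends of a string. *)
Record crystal (X : finType) := Crystal {
  ce : color -> X -> option X;
  cf : color -> X -> option X;
  ceps : color -> X -> nat;
  cphi : color -> X -> nat;
  ce_cf : forall i x y, ce i x = Some y <-> cf i y = Some x;
  ce_None : forall i x, (ce i x == None) = (ceps i x == 0%N);
  cf_None : forall i x, (cf i x == None) = (cphi i x == 0%N);
  ceps_cf : forall i x y, cf i x = Some y -> ceps i y = (ceps i x).+1;
  cphi_cf : forall i x y, cf i x = Some y -> cphi i x = (cphi i y).+1;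
  cwt_cf : forall i x y, cf i x = Some y -> forall j,
    (cphi j y)%:Z - (ceps j y)%:Z = (cphi j x)%:Z - (ceps j x)%:Z - cartan j i }.

Definition cwt X (C : crystal X) (x : X) : weight :=
  fun i => (cphi C i x)%:Z - (ceps C i x)%:Z.

Lemma subspaceZ (M : lmodType Qq) (W : M -> Prop) :
  W 0 -> (forall (a : Qq) u v, W u -> W v -> W (a *: u + v)) ->
  forall a u, W u -> W (a *: u).
Proof. by move=> W0 WP a u Wu; rewrite -[a *: u]addr0; apply: WP. Qed.

Lemma subspaceD (M : lmodType Qq) (W : M -> Prop) :
  (forall (a : Qq) u v, W u -> W v -> W (a *: u + v)) ->
  forall u v, W u -> W v -> W (u + v).
Proof. by move=> WP u v Wu Wv; rewrite -[u]scale1r; apply: WP. Qed.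

Lemma subspace_sum (M : lmodType Qq) (W : M -> Prop) :
  W 0 -> (forall (a : Qq) u v, W u -> W v -> W (a *: u + v)) ->
  forall I (r : seq I) (P : pred I) (F : I -> M),
  (forall i, P i -> W (F i)) -> W (\sum_(i <- r | P i) F i).
Proof. by move=> W0 WP I r P F; apply: (big_ind W) => // u v; apply: subspaceD. Qed.

(** Applying [T - l0] removes one eigenvector and scales the others by nonzero factors; induction
    then puts these in [W], and the removed one follows by subtraction. *)
Lemma subspace_eigenvectors (M : lmodType Qq) (W : M -> Prop) (T : M -> M)
    (r : seq Qq) (vs : Qq -> M) :
  W 0 -> (forall (a : Qq) u v, W u -> W v -> W (a *: u + v)) ->
  (forall u, W u -> W (T u)) ->
  (forall a u v, T (a *: u + v) = a *: T u + T v) ->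
  uniq r -> (forall la, T (vs la) = la *: vs la) ->
  W (\sum_(la <- r) vs la) -> forall la, la \in r -> W (vs la).
Proof.
move=> W0 WP WT Tlin + Tvs.
have Tsum s (a : Qq -> Qq) : T (\sum_(la <- s) a la *: vs la) = \sum_(la <- s) (la * a la) *: vs la.
  elim: s => [|la s IHs]; last by rewrite !big_cons Tlin IHs Tvs scalerA mulrC.
  by have := Tlin (-1) 0 0; rewrite !big_nil scaler0 addr0 scaleN1r addNr.
(* The nonzero coefficients [a] absorb the factors [la - l0] produced in the induction. *)
suff key : forall a : Qq -> Qq, uniq r -> (forall la, la \in r -> a la != 0) ->
    W (\sum_(la <- r) a la *: vs la) -> forall la, la \in r -> W (vs la).
  move=> ru h; apply: (key (fun=> 1)) => // [la _|]; first exact: oner_neq0.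
  by under eq_bigr do rewrite scale1r.
elim: r => [|l0 r IHr] a //= /andP[l0r ru] anz Wv.
have IH : forall la, la \in r -> W (vs la).
  apply: (IHr (fun la => (la - l0) * a la)) => // [la lar|].
    rewrite mulf_neq0 ?anz ?inE ?lar ?orbT // subr_eq0.
    by apply: contraNneq l0r => <-.
  have := WP (- l0) _ _ Wv (WT _ Wv); rewrite Tsum scaler_sumr -big_split /=.
  rewrite big_cons scalerA -scalerDl mulNr addNr scale0r add0r.
  by congr W; apply: eq_bigr => la _; rewrite scalerA -scalerDl mulNr mulrBl addrC.
move=> la; rewrite inE => /predU1P[->|/IH //].
rewrite -[vs l0](scalerK (anz l0 _)) ?inE ?eqxx //; apply: subspaceZ => //.
move: Wv; rewrite big_cons => Wv.
rewrite -[a l0 *: _](addrK (\sum_(j <- r) a j *: vs j)) -scaleN1r addrC; apply: (WP) => //.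
by rewrite big_seq; apply: (subspace_sum W0 WP) => j /IH; apply: subspaceZ.
Qed.

Section Strings.
Variables (M : Uq_module) (X : finType) (C : crystal X) (i : color).
Variable c : X -> M.

Definition oc (o : option X) : M := if o is Some x then c x else 0.

(** For one fixed colour, a weight basis on which [e_i] and [f_i] act exactly as on divided power
    bases of irreducible sl_2-modules. A basis of this kind depends on [i] in general; only its
    class modulo [q] will be common to both colours. *)
Definition string_vectors : Prop := forall y,
  [/\ weight_vector (cwt C y) (c y),
      Uf i (c y) = qint i (ceps C i y).+1 *: oc (cf C i y) &
      Ue i (c y) = qint i (cphi C i y).+1 *: oc (ce C i y)].

Variable cc : X -> M -> Qq.
Hypotheses (ccc : coords c cc) (cs : string_vectors).

(** The linear extension of the crystal arrows along the string basis; [ktilde_fE] identifies it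
    with Kashiwara's operator. *)
Definition crystal_f (v : M) : M := \sum_y cc y v *: oc (cf C i y).
Definition crystal_e (v : M) : M := \sum_y cc y v *: oc (ce C i y).

Lemma crystal_f_linear a u v : crystal_f (a *: u + v) = a *: crystal_f u + crystal_f v.
Proof.
rewrite /crystal_f scaler_sumr -big_split /=; apply: eq_bigr => y _.
by rewrite (co_linear ccc) scalerDl scalerA.
Qed.

Lemma crystal_e_linear a u v : crystal_e (a *: u + v) = a *: crystal_e u + crystal_e v.
Proof.
rewrite /crystal_e scaler_sumr -big_split /=; apply: eq_bigr => y _.
by rewrite (co_linear ccc) scalerDl scalerA.
Qed.

Lemma sum_basis_coord (G : X -> M) y : \sum_z cc z (c y) *: G z = G y.
Proof.
rewrite (bigD1 y) //= big1 ?addr0 => [|z /negPf zy]; first last.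
  by rewrite (co_basis ccc) eq_sym zy scale0r.
by rewrite (co_basis ccc) eqxx scale1r.
Qed.

Lemma crystal_f_basis y : crystal_f (c y) = oc (cf C i y).
Proof. exact: sum_basis_coord. Qed.

Lemma crystal_e_basis y : crystal_e (c y) = oc (ce C i y).
Proof. exact: sum_basis_coord. Qed.

Lemma crystal_f0 : crystal_f 0 = 0.
Proof. by rewrite /crystal_f big1 // => y _; rewrite (co0 ccc) scale0r. Qed.

Lemma crystal_e0 : crystal_e 0 = 0.
Proof. by rewrite /crystal_e big1 // => y _; rewrite (co0 ccc) scale0r. Qed.

Lemma crystal_f_sum I (r : seq I) (P : pred I) (F : I -> M) :
  crystal_f (\sum_(j <- r | P j) F j) = \sum_(j <- r | P j) crystal_f (F j).
Proof.
apply: (big_morph crystal_f) => [u v|]; last exact: crystal_f0.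
by rewrite -{1}[u]scale1r crystal_f_linear scale1r.
Qed.

Lemma crystal_e_sum I (r : seq I) (P : pred I) (F : I -> M) :
  crystal_e (\sum_(j <- r | P j) F j) = \sum_(j <- r | P j) crystal_e (F j).
Proof.
apply: (big_morph crystal_e) => [u v|]; last exact: crystal_e0.
by rewrite -{1}[u]scale1r crystal_e_linear scale1r.
Qed.

Lemma crystal_fZ a u : crystal_f (a *: u) = a *: crystal_f u.
Proof. by rewrite -[a *: u]addr0 crystal_f_linear crystal_f0 addr0. Qed.

Lemma crystal_eZ a u : crystal_e (a *: u) = a *: crystal_e u.
Proof. by rewrite -[a *: u]addr0 crystal_e_linear crystal_e0 addr0. Qed.

Definition cpow n (y : X) : option X := iter n (obind (cf C i)) (Some y).

Lemma cpowS n y : cpow n.+1 y = obind (cf C i) (cpow n y).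
Proof. by []. Qed.

Lemma ceps_cpow n y z : cpow n y = Some z -> ceps C i z = (ceps C i y + n)%N.
Proof.
elim: n z => [|n IHn] z; first by case=> ->; rewrite addn0.
rewrite cpowS; case E: (cpow n y) => [w|//] /= /ceps_cf ->.
by rewrite (IHn w E) addnS.
Qed.

Lemma cphi_cpow n y z : cpow n y = Some z -> cphi C i y = (cphi C i z + n)%N.
Proof.
elim: n z => [|n IHn] z; first by case=> ->; rewrite addn0.
by rewrite cpowS; case E: (cpow n y) => [w|//] /= /cphi_cf h; rewrite (IHn w E) h addSnnS.
Qed.

Lemma cpow_defined n y : (n <= cphi C i y)%N -> cpow n y != None.
Proof.
elim: n => // n IHn n_phi; have := IHn (ltnW n_phi).
rewrite cpowS; case E: (cpow n y) => [w|//] _ /=; rewrite cf_None.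
by have := cphi_cpow E; lia.
Qed.

Lemma string_top y : exists t, ce C i t = None /\ cpow (ceps C i y) t = Some y.
Proof.
elim: (ceps C i y) {-2}y (erefl (ceps C i y)) => [|n IHn] {}y yn.
  by exists y; split=> //; have := ce_None C i y; rewrite yn eqxx => /eqP.
case E: (ce C i y) => [z|]; last by have := ce_None C i y; rewrite E yn eqxx.
have zy : cf C i z = Some y by apply/ce_cf.
have zn : ceps C i z = n by have := ceps_cf zy; rewrite yn => -[].
have [t [t0 tz]] := IHn z zn; exists t; split=> //.
by rewrite yn cpowS -zn tz.
Qed.

Lemma fdiv_linear n : linear (fdiv i n : M -> M).
Proof.
move=> a u v; rewrite /fdiv /divpow.
have -> : iter n (Uf i) (a *: u + v) = a *: iter n (Uf i) u + iter n (Uf i) v.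
  by elim: n => // n IHn; rewrite /= IHn linearP.
by rewrite scalerDr !scalerA mulrC.
Qed.

Lemma fdiv0 n : fdiv i n (0 : M) = 0.
Proof. by have := fdiv_linear n (-1) 0 0; rewrite scaler0 addr0 scaleN1r addNr. Qed.

Lemma fdiv_sum n I (r : seq I) (P : pred I) (F : I -> M) :
  fdiv i n (\sum_(j <- r | P j) F j) = \sum_(j <- r | P j) fdiv i n (F j).
Proof.
apply: (big_morph (fdiv i n)) => [u v|]; last exact: fdiv0.
by rewrite -{1}[u]scale1r fdiv_linear scale1r.
Qed.

Lemma fdivZ n a (u : M) : fdiv i n (a *: u) = a *: fdiv i n u.
Proof. by rewrite -[a *: u]addr0 fdiv_linear fdiv0 addr0. Qed.

Lemma fdiv_top n y : ce C i y = None -> fdiv i n (c y) = oc (cpow n y).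
Proof.
move/eqP; rewrite ce_None => /eqP y0.
have -> : fdiv i n (c y) = (qfact i n)^-1 *: (qfact i n *: oc (cpow n y)); last first.
  by rewrite scalerK ?qfact_neq0.
congr (_ *: _); elim: n => [|n IHn]; first by rewrite qfact0 scale1r.
rewrite [LHS]/= IHn linearZ cpowS.
case E: (cpow n y) => [z|] /=; last by rewrite raddf0 !scaler0.
have [_ -> _] := cs z; rewrite (ceps_cpow E) y0 add0n scalerA -qfactS.
by [].
Qed.

Lemma crystal_f_oc n y : crystal_f (oc (cpow n y)) = oc (cpow n.+1 y).
Proof.
rewrite cpowS; case E: (cpow n y) => [z|] /=; first by rewrite crystal_f_basis.
exact: crystal_f0.
Qed.

Lemma crystal_e_oc n y : cpow n.+1 y != None ->
  crystal_e (oc (cpow n.+1 y)) = oc (cpow n y).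
Proof.
rewrite cpowS; case E: (cpow n y) => [z|//] /=.
case Ez: (cf C i z) => [w|//] _ /=; rewrite crystal_e_basis.
by move/ce_cf: Ez => ->.
Qed.

(** [e_i] sends the basis vectors that are not tops of strings to nonzero multiples of distinct
    basis vectors, so its kernel is spanned by the tops. *)
Lemma e_kernel_coord w y : Ue i w = 0 -> ce C i y != None -> cc y w = 0.
Proof.
move=> ew; case E: (ce C i y) => [z|//] _; have /ce_cf Ez := E.
have : cc z (Ue i w) = 0 by rewrite ew (co0 ccc).
rewrite {1}[w](co_span ccc) linear_sum (co_sum ccc) (bigD1 y) //= big1 ?addr0.
  rewrite linearZ (coZ ccc) /=; have [_ _ ->] := cs y; rewrite E (coZ ccc) /=.
  rewrite (co_basis ccc) eqxx mulr1 => /eqP; rewrite mulf_eq0 (negPf (qint_neq0 _ _)).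
  by rewrite orbF => /eqP.
move=> x xy; rewrite linearZ (coZ ccc) /=; have [_ _ ->] := cs x; rewrite (coZ ccc).
case Ex: (ce C i x) => [z'|] /=; last by rewrite (co0 ccc) !mulr0.
rewrite (co_basis ccc); case: eqP => [z'z|_]; last by rewrite !mulr0.
by move/ce_cf: Ex; rewrite z'z Ez => -[yx]; rewrite yx eqxx in xy.
Qed.

Lemma weight_coord la w y : weight_vector la w -> cc y w != 0 -> la =1 cwt C y.
Proof.
move=> lw cyw j; have := congr1 (cc y) (lw j); rewrite (coZ ccc).
rewrite {1}[w](co_span ccc) linear_sum (co_sum ccc) (bigD1 y) //= big1 ?addr0.
  rewrite linearZ (coZ ccc) /=; have [wy _ _] := cs y; rewrite wy (coZ ccc).
  rewrite (co_basis ccc) eqxx mulr1 mulrC => /(mulIf cyw) /qvar_exp_inj.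
  by [].
move=> x /negPf xy; rewrite linearZ (coZ ccc) /=; have [wx _ _] := cs x.
by rewrite wx (coZ ccc) (co_basis ccc) xy !mulr0.
Qed.

Lemma crystal_f_fdiv n w : Ue i w = 0 -> crystal_f (fdiv i n w) = fdiv i n.+1 w.
Proof.
move=> ew; rewrite [w](co_span ccc) !fdiv_sum crystal_f_sum; apply: eq_bigr => y _.
rewrite !fdivZ crystal_fZ; case E: (ce C i y == None).
  by rewrite !fdiv_top ?(eqP E) // crystal_f_oc.
by rewrite e_kernel_coord ?E // !scale0r.
Qed.

(** The bound on [n] keeps the divided powers inside the string: beyond it [f_i^(n) w] could vanish
    while [f_i^(n-1) w] does not. *)
Lemma crystal_e_fdiv n w la : Ue i w = 0 -> weight_vector la w -> n%:Z <= la i ->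
  crystal_e (fdiv i n w) = if (0 < n)%N then fdiv i n.-1 w else 0.
Proof.
move=> ew lw nla; rewrite [w](co_span ccc).
have -> : (if (0 < n)%N then fdiv i n.-1 (\sum_x cc x w *: c x) else 0) =
   \sum_x cc x w *: (if (0 < n)%N then fdiv i n.-1 (c x) else 0).
  case: ifP => _; last by rewrite big1 // => y _; rewrite scaler0.
  by rewrite fdiv_sum; apply: eq_bigr => y _; rewrite fdivZ.
rewrite fdiv_sum crystal_e_sum; apply: eq_bigr => y _; rewrite fdivZ crystal_eZ.
have [->|cyw] := eqVneq (cc y w) 0; first by rewrite !scale0r.
congr (_ *: _); have E : ce C i y == None by apply: contraNT cyw => /e_kernel_coord ->.
rewrite !fdiv_top ?(eqP E) //.
case: n nla => [|n] nla; first by rewrite /= crystal_e_basis (eqP E).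
rewrite crystal_e_oc //; apply: cpow_defined.
move: nla; rewrite (weight_coord lw cyw) /cwt.
by move: E; rewrite ce_None => /eqP ->; lia.
Qed.

Lemma string_decomposition u : exists s, [/\ string_terms i s,
  u = \sum_(nw <- s) fdiv i nw.1 nw.2,
  crystal_f u = \sum_(nw <- s) fdiv i nw.1.+1 nw.2 &
  crystal_e u = \sum_(nw <- s | (0 < nw.1)%N) fdiv i nw.1.-1 nw.2].
Proof.
have /fin_all_exists[t tP] := string_top.
pose s := [seq (ceps C i y, cc y u *: c (t y)) | y <- index_enum X].
have sP : string_terms i s.
  move=> nw /mapP[y _ ->] /=; have [ty ey] := tP y; have [wy _ ety] := cs (t y); split.
    by rewrite linearZ /= ety ty !scaler0.
  exists (cwt C (t y)); split; first by move=> j; rewrite linearZ /= wy !scalerA mulrC.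
  have := cphi_cpow ey; have := ceps_cpow ey; rewrite /cwt; lia.
have uE : u = \sum_(nw <- s) fdiv i nw.1 nw.2.
  rewrite big_map {1}[u](co_span ccc); apply: eq_bigr => y _ /=.
  by have [ty ey] := tP y; rewrite fdivZ fdiv_top // ey.
have ss : forall nw, nw \in s -> nw \in s by [].
exists s; split=> //.
  rewrite [in LHS]uE crystal_f_sum big_seq [RHS]big_seq; apply: eq_bigr => nw /sP[ew _].
  exact: crystal_f_fdiv.
rewrite [in LHS]uE crystal_e_sum big_mkcond big_seq [RHS]big_mkcond [RHS]big_seq.
apply: eq_bigr => nw /sP[ew [la [lw n_la]]] /=.
by rewrite (crystal_e_fdiv ew lw n_la).
Qed.

(** [crystal_f] raises divided powers of kernel vectors correctly, so it gives the right value on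
    any decomposition; hence the relation defining Kashiwara's operator is the graph of a
    function. *)
Lemma ktilde_fE u v : ktilde_f i u v <-> v = crystal_f u.
Proof.
split=> [[s [sP -> ->]]|->]; last by have [s [sP uE fE _]] := string_decomposition u; exists s.
rewrite crystal_f_sum big_seq [RHS]big_seq; apply: eq_bigr => nw /sP[ew _].
by rewrite crystal_f_fdiv.
Qed.

Lemma ktilde_eE u v : ktilde_e i u v <-> v = crystal_e u.
Proof.
split=> [[s [sP -> ->]]|->]; last by have [s [sP uE _ eE]] := string_decomposition u; exists s.
rewrite crystal_e_sum big_mkcond big_seq [RHS]big_seq.
by apply: eq_bigr => nw /sP[ew [la [lw n_la]]]; rewrite (crystal_e_fdiv ew lw n_la).
Qed.

(** The eigenvalue of [f_i e_i] on [c y]. Within one weight space it separates the strings by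
    length, thanks to [qintM_inj]. *)
Let ev y : Qq := qint i (ceps C i y) * qint i (cphi C i y).+1.

Lemma fe_basis y : Uf i (Ue i (c y)) = ev y *: c y.
Proof.
have [_ _ ->] := cs y; rewrite linearZ /=; case E: (ce C i y) => [z|] /=; last first.
  by move/eqP: E; rewrite ce_None /ev => /eqP ->; rewrite qint0 mul0r scale0r linear0 scaler0.
have [_ -> _] := cs z; move/ce_cf: E => E; rewrite E /= scalerA.
by rewrite -(ceps_cf E) mulrC.
Qed.

(** The components of [v] in the eigenspaces of [f_i e_i] lie in [W]. On each of them the string
    lengths are constant, so the crystal operators are scalar multiples of [f_i] and [e_i]. *)
Lemma crystal_op_submodule W la v : submodule W -> weight_vector la v -> W v ->
  W (crystal_f v) /\ W (crystal_e v).
Proof.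
move=> [W0 WP Wop] lv Wv; pose vs l := \sum_(y | ev y == l) cc y v *: c y.
pose r := undup [seq ev y | y <- index_enum X].
have vE : v = \sum_(l <- r) vs l.
  rewrite {1}[v](co_span ccc) /vs; under [RHS]eq_bigr do rewrite big_mkcond.
  rewrite exchange_big /=; apply: eq_bigr => y _.
  have yr : ev y \in r by rewrite mem_undup map_f // mem_index_enum.
  rewrite (bigD1_seq (ev y)) ?undup_uniq //= eqxx big1 ?addr0 // => l /negPf.
  by rewrite eq_sym => ->.
have Wvs : forall l, l \in r -> W (vs l).
  apply: (@subspace_eigenvectors _ _ (fun u => Uf i (Ue i u))) => //.
  - by move=> u /(Wop i)[/(Wop i)[]].
  - by move=> a u w; rewrite !linearP.
  - exact: undup_uniq.
  - move=> l; rewrite /vs !linear_sum; apply: eq_bigr => y /eqP <-.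
    by rewrite !linearZ /= fe_basis scalerA mulrC -scalerA.
  - by rewrite -vE.
have evP y z : cc y v != 0 -> cc z v != 0 -> ev y = ev z ->
    ceps C i y = ceps C i z /\ cphi C i y = cphi C i z.
  move=> /(weight_coord lv)/(_ i) + /(weight_coord lv)/(_ i).
  rewrite /cwt /ev => -> e /qintM_inj h.
  have : ceps C i y = ceps C i z by apply: h; lia.
  by move: e; lia.
split; rewrite vE ?crystal_f_sum ?crystal_e_sum big_seq; apply: subspace_sum => // l lr.
- have [y /andP[/eqP yl yv]|none] := pickP (fun y => (ev y == l) && (cc y v != 0)); last first.
    rewrite /vs big1 ?crystal_f0 // => y yl; have := none y; rewrite yl /= => /negbFE /eqP ->.
    by rewrite scale0r.
  suff -> : crystal_f (vs l) = (qint i (ceps C i y).+1)^-1 *: Uf i (vs l).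
    by apply: subspaceZ => //; have [] := Wop i _ (Wvs l lr).
  rewrite /vs linear_sum scaler_sumr crystal_f_sum; apply: eq_bigr => z /eqP zl.
  rewrite crystal_fZ crystal_f_basis linearZ /=; have [_ -> _] := cs z.
  have [->|zv] := eqVneq (cc z v) 0; first by rewrite !scale0r scaler0.
  have [-> _] := evP z y zv yv (etrans zl (esym yl)).
  by rewrite !scalerA mulrAC mulVf ?qint_neq0 // mul1r.
have [y /andP[/eqP yl yv]|none] := pickP (fun y => (ev y == l) && (cc y v != 0)); last first.
  rewrite /vs big1 ?crystal_e0 // => y yl; have := none y; rewrite yl /= => /negbFE /eqP ->.
  by rewrite scale0r.
suff -> : crystal_e (vs l) = (qint i (cphi C i y).+1)^-1 *: Ue i (vs l).
  by apply: subspaceZ => //; have [] := Wop i _ (Wvs l lr).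
rewrite /vs linear_sum scaler_sumr crystal_e_sum; apply: eq_bigr => z /eqP zl.
rewrite crystal_eZ crystal_e_basis linearZ /=; have [_ _ ->] := cs z.
have [->|zv] := eqVneq (cc z v) 0; first by rewrite !scale0r scaler0.
have [_ ->] := evP z y zv yv (etrans zl (esym yl)).
by rewrite !scalerA mulrAC mulVf ?qint_neq0 // mul1r.
Qed.

Lemma crystal_f_weight la v : weight_vector la v ->
  weight_vector (fun j => la j - cartan j i) (crystal_f v).
Proof.
move=> lv j; rewrite /crystal_f scaler_sumr linear_sum; apply: eq_bigr => y _.
have [->|yv] := eqVneq (cc y v) 0; first by rewrite scale0r linear0 scaler0.
case E: (cf C i y) => [z|] /=; last by rewrite scaler0 linear0 scaler0.
have [wz _ _] := cs z; rewrite linearZ /= wz !scalerA mulrC; congr (_ ^ _ * _ *: _).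
by rewrite /cwt (cwt_cf E) (weight_coord lv yv).
Qed.

Variables (b : X -> M) (co : X -> M -> Qq).
Hypotheses (bco : coords b co) (cb : forall y, inqL co (c y - b y)).

Definition ob (o : option X) : M := if o is Some x then b x else 0.

Lemma inL_oc o : inL co (oc o).
Proof.
by case: o => [x|]; [exact: (inL_congr bco (cb x) (inL_basis bco x)) | exact: (inL0 bco)].
Qed.

Lemma oc_ob o : inqL co (oc o - ob o).
Proof. by case: o => [x|] //=; rewrite subrr; apply: (inqL0 bco). Qed.

Lemma crystal_f_inL v : inL co v -> inL co (crystal_f v).
Proof.
move=> vL; apply: (inL_sum bco) => // y _; apply: (inLZ bco); last exact: inL_oc.
by have /(near_basis_inL bco cb ccc) := vL.
Qed.

Lemma crystal_e_inL v : inL co v -> inL co (crystal_e v).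
Proof.
move=> vL; apply: (inL_sum bco) => // y _; apply: (inLZ bco); last exact: inL_oc.
by have /(near_basis_inL bco cb ccc) := vL.
Qed.

Lemma crystal_f_inqL v : inqL co v -> inqL co (crystal_f v).
Proof. by move=> /(inqLP bco)/crystal_f_inL; rewrite crystal_fZ => /(inqLP bco). Qed.

Lemma crystal_e_inqL v : inqL co v -> inqL co (crystal_e v).
Proof. by move=> /(inqLP bco)/crystal_e_inL; rewrite crystal_eZ => /(inqLP bco). Qed.

Lemma crystal_fB u v : crystal_f (u - v) = crystal_f u - crystal_f v.
Proof. by rewrite -scaleN1r addrC crystal_f_linear scaleN1r addrC. Qed.

Lemma crystal_eB u v : crystal_e (u - v) = crystal_e u - crystal_e v.
Proof. by rewrite -scaleN1r addrC crystal_e_linear scaleN1r addrC. Qed.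

(** The operator preserves the lattice and [q] times it, so [b y] may be replaced by the congruent
    [c y], on which the action is exact. *)
Lemma crystal_f_modq y : inqL co (crystal_f (b y) - ob (cf C i y)).
Proof.
apply: (inqL_trans bco (v := crystal_f (c y))); last by rewrite crystal_f_basis; apply: oc_ob.
by rewrite -crystal_fB; apply: crystal_f_inqL; apply: (inqL_sym bco).
Qed.

Lemma crystal_e_modq y : inqL co (crystal_e (b y) - ob (ce C i y)).
Proof.
apply: (inqL_trans bco (v := crystal_e (c y))); last by rewrite crystal_e_basis; apply: oc_ob.
by rewrite -crystal_eB; apply: crystal_e_inqL; apply: (inqL_sym bco).
Qed.

End Strings.

(** * Deciding linear identities in a module *)

(** Reified linear combinations: [lmod_eq] reduces an identity between them to equality of the
    coefficients of each atom, which are identities in the base field. *)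
Inductive lexpr (R : Type) :=
  LVar of nat | LAdd of lexpr R & lexpr R | LOpp of lexpr R | LScale of R & lexpr R | LZero.
Arguments LVar {R}. Arguments LZero {R}.

Section LinearExpressions.
Variables (R : pzRingType) (M : lmodType R).

Fixpoint leval (env : seq M) (e : lexpr R) : M :=
  match e with
  | LVar n => nth 0 env n
  | LAdd e1 e2 => leval env e1 + leval env e2
  | LOpp e1 => - leval env e1
  | LScale a e1 => a *: leval env e1
  | LZero => 0
  end.

Fixpoint lcoef (e : lexpr R) (n : nat) : R :=
  match e with
  | LVar m => if Nat.eqb m n then 1 else 0
  | LAdd e1 e2 => lcoef e1 n + lcoef e2 n
  | LOpp e1 => - lcoef e1 n
  | LScale a e1 => a * lcoef e1 n
  | LZero => 0
  end.

Lemma leval_coef env e : leval env e = \sum_(i < size env) lcoef e i *: nth 0 env i.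
Proof.
elim: e => [n|e1 IH1 e2 IH2|e IH|a e IH|] /=.
- have eqbE i : Nat.eqb n i = (n == i) by apply/idP/eqP => /PeanoNat.Nat.eqb_eq.
  have [n_s|s_n] := ltnP n (size env); last first.
    rewrite nth_default // big1 // => i _; rewrite eqbE ifN ?scale0r //.
    by apply: contraTneq (ltn_ord i) => <-; rewrite -leqNgt.
  rewrite (bigD1 (Ordinal n_s)) //= eqbE eqxx scale1r big1 ?addr0 // => i.
  by rewrite eqbE -val_eqE eq_sym /= => /negPf ->; rewrite scale0r.
- by rewrite IH1 IH2 -big_split; apply: eq_bigr => i _; rewrite scalerDl.
- by rewrite IH -sumrN; apply: eq_bigr => i _; rewrite scaleNr.
- by rewrite IH scaler_sumr; apply: eq_bigr => i _; rewrite scalerA.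
- by rewrite big1 // => i _; rewrite scale0r.
Qed.

Fixpoint leq_coefs (e1 e2 : lexpr R) (n : nat) : Prop :=
  match n with
  | 0%N => True
  | S m => lcoef e1 m = lcoef e2 m /\ leq_coefs e1 e2 m
  end.

Lemma leval_eq env e1 e2 : leq_coefs e1 e2 (size env) -> leval env e1 = leval env e2.
Proof.
move=> h; rewrite !leval_coef; apply: eq_bigr => i _; congr (_ *: _).
elim: (size env) h i => [_ []//|n IHn [en /IHn h] i].
have [i_n|] := ltnP i n; first exact: (h (Ordinal i_n)).
by rewrite leq_eqVlt ltnNge -ltnS ltn_ord orbF => /eqP <-.
Qed.

End LinearExpressions.

Ltac lmod_find x env :=
  lazymatch env with
  | x :: _ => constr:(0%N)
  | _ :: ?env' => let n := lmod_find x env' in constr:(S n)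
  end.

Ltac lmod_atoms e env :=
  lazymatch e with
  | GRing.add ?a ?b => let env := lmod_atoms a env in lmod_atoms b env
  | GRing.opp ?a => lmod_atoms a env
  | GRing.scale _ ?a => lmod_atoms a env
  | GRing.zero => env
  | _ => lazymatch env with
         | context [e :: _] => env
         | _ => constr:(e :: env)
         end
  end.

Ltac lmod_reify R e env :=
  lazymatch e with
  | GRing.add ?a ?b =>
      let a' := lmod_reify R a env in let b' := lmod_reify R b env in constr:(@LAdd R a' b')
  | GRing.opp ?a => let a' := lmod_reify R a env in constr:(@LOpp R a')
  | GRing.scale ?k ?a => let a' := lmod_reify R a env in constr:(@LScale R k a')
  | GRing.zero => constr:(@LZero R)
  | _ => let n := lmod_find e env in constr:(@LVar R n)
  end.

                                                                                     
Ltac lmod_eq R M :=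
  lazymatch goal with
  | |- ?u = ?v =>
      let env := lmod_atoms u (@nil (GRing.Lmodule.sort M)) in
      let env := lmod_atoms v env in
      let u' := lmod_reify (GRing.Field.sort R) u env in
      let v' := lmod_reify (GRing.Field.sort R) v env in
      let H := fresh in
      have H := @leval_eq R M env u' v';
      cbn [leval nth size leq_coefs lcoef Nat.eqb] in H;
      apply: H; repeat split
  end.

                                                                       
(** The base field and [q] are abstracted first, so that [field] works over an arbitrary field with
    a nonzero parameter. *)
Ltac qfield :=
  generalize qvar_neq0; generalize qvar; clear;
  let F := fresh "F" in generalize Qq; move=> F;
  let q := fresh "q" in let q0 := fresh "q0" in move=> q q0; field; rewrite ?oner_eq0 ?q0 //.

Lemma qvar_sqr_neq1 k : qvar ^+ k.+1 - 1 != 0 :> Qq.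
Proof. by rewrite subr_eq0 exprnP qvar_exp_neq1. Qed.

Lemma bracket2 (F : fieldType) (q : F) : q != 0 -> q - q^-1 != 0 ->
  (q ^+ 2 - q ^- 2) / (q - q^-1) = q + q^-1.
Proof.
move=> q0 qq0; have q1 : q * q - 1 != 0.
  by apply: contraNneq qq0 => qq; have -> : q - q^-1 = (q * q - 1) / q by [field]; rewrite qq mul0r.
by field; rewrite q0 q1.
Qed.

Lemma bracket3 (F : fieldType) (q : F) : q != 0 -> q - q^-1 != 0 ->
  (q ^+ 3 - q ^- 3) / (q - q^-1) = q ^+ 2 + 1 + q ^- 2.
Proof.
move=> q0 qq0; have q1 : q * q - 1 != 0.
  by apply: contraNneq qq0 => qq; have -> : q - q^-1 = (q * q - 1) / q by [field]; rewrite qq mul0r.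
by field; rewrite q0 q1.
Qed.

Lemma qint2 i : qint i 2 = qv i + (qv i)^-1.
Proof. exact: bracket2 (qv_neq0 i) (qv_sub_neq0 i). Qed.

Lemma qint3 i : qint i 3 = qv i ^+ 2 + 1 + qv i ^- 2.
Proof. exact: bracket3 (qv_neq0 i) (qv_sub_neq0 i). Qed.

(** * Serre and commutation relations as rewriting rules *)

Section Serre.
Variables (V : lmodType Qq) (x : color -> {linear V -> V}).

Let xZ j (a : Qq) u : x j (a *: u) = a *: x j u.
Proof. exact: linearZ. Qed.

(** Multiplying by the quantum factorial clears the denominators of the divided powers and leaves
    the usual relation with coefficient [2]. *)
Lemma serre_sum2 i j v (s := fun k => divpow (fun i v => x i v) i k) :
  qfact i 2 *: (\sum_(k < 3) (-1) ^+ k *: s k (x j (s (2 - k)%N v))) =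
  x i (x i (x j v)) - qint i 2 *: x i (x j (x i v)) + x j (x i (x i v)).
Proof.
rewrite !big_ord_recl big_ord0 /= /s /divpow /= !qfactS qfact0 qint1 /bump /=.
rewrite !xZ.
have := qint_neq0 i 1; move: (qint i 2) => a a0.
lmod_eq Qq V; move: a a0; clear; generalize Qq => F a a0; field; by rewrite ?oner_eq0 ?a0.
Qed.

Lemma serre_sum3 i j v (s := fun k => divpow (fun i v => x i v) i k) :
  qfact i 3 *: (\sum_(k < 4) (-1) ^+ k *: s k (x j (s (3 - k)%N v))) =
  x j (x i (x i (x i v))) - qint i 3 *: x i (x j (x i (x i v)))
   + qint i 3 *: x i (x i (x j (x i v))) - x i (x i (x i (x j v))).
Proof.
rewrite !big_ord_recl big_ord0 /= /s /divpow /= !qfactS qfact0 qint1 /bump /=.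
rewrite !xZ.
have := qint_neq0 i 1; have := qint_neq0 i 2.
move: (qint i 2) (qint i 3) => a b b0 a0.
lmod_eq Qq V; move: a a0 b b0; clear; generalize Qq => F a a0 b b0; field; by rewrite ?oner_eq0 ?a0 ?b0.
Qed.

Definition serre112 (v : V) :=
  x col1 (x col1 (x col2 v)) - (qvar ^+ 2 + qvar ^- 2) *: x col1 (x col2 (x col1 v))
   + x col2 (x col1 (x col1 v)) = 0.
Definition serre2221 (v : V) :=
  x col1 (x col2 (x col2 (x col2 v)))
   - (qvar ^+ 2 + 1 + qvar ^- 2) *: x col2 (x col1 (x col2 (x col2 v)))
   + (qvar ^+ 2 + 1 + qvar ^- 2) *: x col2 (x col2 (x col1 (x col2 v)))
   - x col2 (x col2 (x col2 (x col1 v))) = 0.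

Lemma serreE : serre (fun i v => x i v) <-> (forall v, serre112 v) /\ (forall v, serre2221 v).
Proof.
rewrite /serre112 /serre2221; have e1 := qint2 col1; have e2 := qint3 col2; rewrite /qv /= in e1 e2.
rewrite expr1 in e2; rewrite -e1 -e2; split=> [h|[h1 h2] [] [] v // _].
  split=> v.
    by rewrite -serre_sum2; have /= -> := h col1 col2 v isT; rewrite scaler0.
  by rewrite -serre_sum3; have /= -> := h col2 col1 v isT; rewrite scaler0.
- by apply: (scalerI (qfact_neq0 col1 2)); rewrite scaler0 -[RHS](h1 v) -serre_sum2.
- by apply: (scalerI (qfact_neq0 col2 3)); rewrite scaler0 -[RHS](h2 v) -serre_sum3.
Qed.
End Serre.

Section Rules.
Variable M : Uq_module.
Implicit Types (u v : M) (a : Qq) (i j : color).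

Lemma UfD i u v : Uf i (u + v) = Uf i u + Uf i v. Proof. exact: linearD. Qed.
Lemma UeD i u v : Ue i (u + v) = Ue i u + Ue i v. Proof. exact: linearD. Qed.
Lemma UkD i u v : Uk i (u + v) = Uk i u + Uk i v. Proof. exact: linearD. Qed.
Lemma UfZ i a u : Uf i (a *: u) = a *: Uf i u. Proof. exact: linearZ. Qed.
Lemma UeZ i a u : Ue i (a *: u) = a *: Ue i u. Proof. exact: linearZ. Qed.
Lemma UkZ i a u : Uk i (a *: u) = a *: Uk i u. Proof. exact: linearZ. Qed.
Lemma UkVZ i a u : UkV i (a *: u) = a *: UkV i u. Proof. exact: linearZ. Qed.
Lemma UfN i u : Uf i (- u) = - Uf i u. Proof. exact: linearN. Qed.
Lemma UeN i u : Ue i (- u) = - Ue i u. Proof. exact: linearN. Qed.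
Lemma UkN i u : Uk i (- u) = - Uk i u. Proof. exact: linearN. Qed.
Lemma Uf0 i : Uf i (0 : M) = 0. Proof. exact: linear0. Qed.
Lemma Ue0 i : Ue i (0 : M) = 0. Proof. exact: linear0. Qed.
Lemma Uk0 i : Uk i (0 : M) = 0. Proof. exact: linear0. Qed.

Lemma Ukf11 u : Uk col1 (Uf col1 u) = qvar ^- 2 *: Uf col1 (Uk col1 u).
Proof. by rewrite Ukf. Qed.
Lemma Ukf12 u : Uk col1 (Uf col2 u) = qvar *: Uf col2 (Uk col1 u).
Proof. by rewrite Ukf. Qed.
Lemma Ukf21 u : Uk col2 (Uf col1 u) = qvar ^+ 2 *: Uf col1 (Uk col2 u).
Proof. by rewrite Ukf. Qed.
Lemma Ukf22 u : Uk col2 (Uf col2 u) = qvar ^- 2 *: Uf col2 (Uk col2 u).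
Proof. by rewrite Ukf. Qed.
Lemma Uke11 u : Uk col1 (Ue col1 u) = qvar ^+ 2 *: Ue col1 (Uk col1 u).
Proof. by rewrite Uke. Qed.
Lemma Uke12 u : Uk col1 (Ue col2 u) = qvar^-1 *: Ue col2 (Uk col1 u).
Proof. by rewrite Uke. Qed.
Lemma Uke21 u : Uk col2 (Ue col1 u) = qvar ^- 2 *: Ue col1 (Uk col2 u).
Proof. by rewrite Uke. Qed.
Lemma Uke22 u : Uk col2 (Ue col2 u) = qvar ^+ 2 *: Ue col2 (Uk col2 u).
Proof. by rewrite Uke. Qed.

Lemma UkC21 u : Uk col2 (Uk col1 u) = Uk col1 (Uk col2 u).
Proof. exact: UkC. Qed.

Lemma Uef11 u : Ue col1 (Uf col1 u) = Uf col1 (Ue col1 u) +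
  (qvar ^+ 2 - qvar ^- 2)^-1 *: (Uk col1 (Uk col1 u) - UkV col1 (UkV col1 u)).
Proof. by apply/eqP; rewrite addrC -subr_eq; apply/eqP; exact: (Uef col1 col1). Qed.
Lemma Uef22 u : Ue col2 (Uf col2 u) = Uf col2 (Ue col2 u) +
  (qvar - qvar^-1)^-1 *: (Uk col2 u - UkV col2 u).
Proof. by apply/eqP; rewrite addrC -subr_eq; apply/eqP; exact: (Uef col2 col2). Qed.
Lemma Uef12 u : Ue col1 (Uf col2 u) = Uf col2 (Ue col1 u).
Proof. by apply/eqP; rewrite -subr_eq0; apply/eqP; exact: (Uef col1 col2). Qed.
Lemma Uef21 u : Ue col2 (Uf col1 u) = Uf col1 (Ue col2 u).
Proof. by apply/eqP; rewrite -subr_eq0; apply/eqP; exact: (Uef col2 col1). Qed.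

(** This and the three following relations are oriented so as to eliminate one word in the
    generators, for use as rewriting rules. *)
Lemma serre_f112 u : Uf col1 (Uf col1 (Uf col2 u)) =
  (qvar ^+ 2 + qvar ^- 2) *: Uf col1 (Uf col2 (Uf col1 u)) - Uf col2 (Uf col1 (Uf col1 u)).
Proof.
apply/eqP; rewrite -subr_eq0 opprB addrA; have [h _] := (serreE (@Uf M)).1 (@serre_f M).
by rewrite addrAC; apply/eqP/(h u).
Qed.
Lemma serre_e112 u : Ue col1 (Ue col1 (Ue col2 u)) =
  (qvar ^+ 2 + qvar ^- 2) *: Ue col1 (Ue col2 (Ue col1 u)) - Ue col2 (Ue col1 (Ue col1 u)).
Proof.
apply/eqP; rewrite -subr_eq0 opprB addrA; have [h _] := (serreE (@Ue M)).1 (@serre_e M).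
by rewrite addrAC; apply/eqP/(h u).
Qed.
Lemma serre_f1222 u : Uf col1 (Uf col2 (Uf col2 (Uf col2 u))) =
  (qvar ^+ 2 + 1 + qvar ^- 2) *: Uf col2 (Uf col1 (Uf col2 (Uf col2 u)))
  - (qvar ^+ 2 + 1 + qvar ^- 2) *: Uf col2 (Uf col2 (Uf col1 (Uf col2 u)))
  + Uf col2 (Uf col2 (Uf col2 (Uf col1 u))).
Proof.
apply/eqP; rewrite -subr_eq0; have [_ h] := (serreE (@Uf M)).1 (@serre_f M).
by rewrite !opprD !opprK !addrA; apply/eqP/(h u).
Qed.
Lemma serre_e1222 u : Ue col1 (Ue col2 (Ue col2 (Ue col2 u))) =
  (qvar ^+ 2 + 1 + qvar ^- 2) *: Ue col2 (Ue col1 (Ue col2 (Ue col2 u)))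
  - (qvar ^+ 2 + 1 + qvar ^- 2) *: Ue col2 (Ue col2 (Ue col1 (Ue col2 u)))
  + Ue col2 (Ue col2 (Ue col2 (Ue col1 u))).
Proof.
apply/eqP; rewrite -subr_eq0; have [_ h] := (serreE (@Ue M)).1 (@serre_e M).
by rewrite !opprD !opprK !addrA; apply/eqP/(h u).
Qed.

Definition Ulin := (UfD, UeD, UkD, UfZ, UeZ, UkZ, UfN, UeN, UkN, Uf0, Ue0, Uk0).
Definition Ukin := (Ukf11, Ukf12, Ukf21, Ukf22, Uke11, Uke12, Uke21, Uke22).

Definition Unorm := (Ulin, Ukin).

End Rules.

(** * Tensor product with the four-dimensional module *)

Section Tensor.
Variable M : Uq_module.

                                                                                          
                                                                               
                                                
                                                                         
(** The product of [M] with the module V having weight basis v1, v2, v3, v4, where [f_2], [f_1],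
    [f_2] send each vector to the next; the components are the coefficients in [M] of these four
    vectors. With [t_i] the operator [iter (halfnorm i) (Uk i)], the coproduct is f tensor 1 plus t
    tensor f for [tf], and e tensor the inverse of t plus 1 tensor e for [te]. *)
Definition tcarrier : lmodType Qq := (M * M * M * M)%type.
Implicit Types u v : tcarrier.

Definition tc1 u : M := u.1.1.1.
Definition tc2 u : M := u.1.1.2.
Definition tc3 u : M := u.1.2.
Definition tc4 u : M := u.2.
Definition tmk (m1 m2 m3 m4 : M) : tcarrier := (m1, m2, m3, m4).

Lemma t_ext u v : tc1 u = tc1 v -> tc2 u = tc2 v -> tc3 u = tc3 v -> tc4 u = tc4 v -> u = v.
Proof.
by case: u v => [[[u1 u2] u3] u4] [[[v1 v2] v3] v4]; rewrite /tc1 /tc2 /tc3 /tc4 /= => -> -> -> ->.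
Qed.

Lemma tc1D u v : tc1 (u + v) = tc1 u + tc1 v. Proof. by []. Qed.
Lemma tc2D u v : tc2 (u + v) = tc2 u + tc2 v. Proof. by []. Qed.
Lemma tc3D u v : tc3 (u + v) = tc3 u + tc3 v. Proof. by []. Qed.
Lemma tc4D u v : tc4 (u + v) = tc4 u + tc4 v. Proof. by []. Qed.
Lemma tc1N u : tc1 (- u) = - tc1 u. Proof. by []. Qed.
Lemma tc2N u : tc2 (- u) = - tc2 u. Proof. by []. Qed.
Lemma tc3N u : tc3 (- u) = - tc3 u. Proof. by []. Qed.
Lemma tc4N u : tc4 (- u) = - tc4 u. Proof. by []. Qed.
Lemma tc1Z a u : tc1 (a *: u) = a *: tc1 u. Proof. by []. Qed.
Lemma tc2Z a u : tc2 (a *: u) = a *: tc2 u. Proof. by []. Qed.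
Lemma tc3Z a u : tc3 (a *: u) = a *: tc3 u. Proof. by []. Qed.
Lemma tc4Z a u : tc4 (a *: u) = a *: tc4 u. Proof. by []. Qed.
Lemma tc1_0 : tc1 0 = 0. Proof. by []. Qed.
Lemma tc2_0 : tc2 0 = 0. Proof. by []. Qed.
Lemma tc3_0 : tc3 0 = 0. Proof. by []. Qed.
Lemma tc4_0 : tc4 0 = 0. Proof. by []. Qed.
Lemma tc1mk m1 m2 m3 m4 : tc1 (tmk m1 m2 m3 m4) = m1. Proof. by []. Qed.
Lemma tc2mk m1 m2 m3 m4 : tc2 (tmk m1 m2 m3 m4) = m2. Proof. by []. Qed.
Lemma tc3mk m1 m2 m3 m4 : tc3 (tmk m1 m2 m3 m4) = m3. Proof. by []. Qed.
Lemma tc4mk m1 m2 m3 m4 : tc4 (tmk m1 m2 m3 m4) = m4. Proof. by []. Qed.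

Definition tlin := (tc1D, tc2D, tc3D, tc4D, tc1N, tc2N, tc3N, tc4N, tc1Z, tc2Z, tc3Z, tc4Z,
  tc1_0, tc2_0, tc3_0, tc4_0, tc1mk, tc2mk, tc3mk, tc4mk).

Definition tf i u : tcarrier :=
  if i is col1 then
    tmk (Uf col1 (tc1 u)) (Uf col1 (tc2 u))
        (Uf col1 (tc3 u) + Uk col1 (Uk col1 (tc2 u))) (Uf col1 (tc4 u))
  else
    tmk (Uf col2 (tc1 u)) (Uf col2 (tc2 u) + Uk col2 (tc1 u))
        (Uf col2 (tc3 u)) (Uf col2 (tc4 u) + Uk col2 (tc3 u)).

Definition te i u : tcarrier :=
  if i is col1 then
    tmk (Ue col1 (tc1 u)) (qvar ^- 2 *: Ue col1 (tc2 u) + tc3 u)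
        (qvar ^+ 2 *: Ue col1 (tc3 u)) (Ue col1 (tc4 u))
  else
    tmk (qvar^-1 *: Ue col2 (tc1 u) + tc2 u) (qvar *: Ue col2 (tc2 u))
        (qvar^-1 *: Ue col2 (tc3 u) + tc4 u) (qvar *: Ue col2 (tc4 u)).

Definition tk i u : tcarrier :=
  if i is col1 then
    tmk (Uk col1 (tc1 u)) (qvar *: Uk col1 (tc2 u))
        (qvar^-1 *: Uk col1 (tc3 u)) (Uk col1 (tc4 u))
  else
    tmk (qvar *: Uk col2 (tc1 u)) (qvar^-1 *: Uk col2 (tc2 u))
        (qvar *: Uk col2 (tc3 u)) (qvar^-1 *: Uk col2 (tc4 u)).

Definition tkV i u : tcarrier :=
  if i is col1 then
    tmk (UkV col1 (tc1 u)) (qvar^-1 *: UkV col1 (tc2 u))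
        (qvar *: UkV col1 (tc3 u)) (UkV col1 (tc4 u))
  else
    tmk (qvar^-1 *: UkV col2 (tc1 u)) (qvar *: UkV col2 (tc2 u))
        (qvar^-1 *: UkV col2 (tc3 u)) (qvar *: UkV col2 (tc4 u)).

Lemma tf_linear i : linear (tf i).
Proof.
move=> a u v; case: i; apply: t_ext; rewrite /tf !tlin !Ulin ?scalerDr //; by rewrite addrACA.
Qed.

Lemma te_linear i : linear (te i).
Proof.
move=> a u v; case: i; apply: t_ext; rewrite /te !tlin !Ulin ?scalerDr ?scalerA ?[_ * a]mulrC //.
all: by rewrite addrACA.
Qed.

Lemma tk_linear i : linear (tk i).
Proof.
by move=> a u v; case: i; apply: t_ext; rewrite /tk !tlin !Ulin ?scalerDr ?scalerA ?[_ * a]mulrC.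
Qed.

Lemma tkV_linear i : linear (tkV i).
Proof.
move=> a u v; case: i; apply: t_ext; rewrite /tkV !tlin linearP ?scalerDr ?scalerA ?[_ * a]mulrC //.
Qed.

HB.instance Definition _ i := GRing.isLinear.Build Qq tcarrier tcarrier *:%R (tf i) (tf_linear i).
HB.instance Definition _ i := GRing.isLinear.Build Qq tcarrier tcarrier *:%R (te i) (te_linear i).
HB.instance Definition _ i := GRing.isLinear.Build Qq tcarrier tcarrier *:%R (tk i) (tk_linear i).
HB.instance Definition _ i := GRing.isLinear.Build Qq tcarrier tcarrier *:%R (tkV i) (tkV_linear i).

Lemma tkK i u : tkV i (tk i u) = u.
Proof.
have q0 := qvar_neq0; case: i; apply: t_ext; rewrite /tk /tkV !tlin ?UkVZ ?UkK ?scalerA //.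
all: by rewrite ?mulVf ?divff ?scale1r.
Qed.

Lemma tkVK i u : tk i (tkV i u) = u.
Proof.
have q0 := qvar_neq0; case: i; apply: t_ext; rewrite /tk /tkV !tlin ?UkZ ?UkVK ?scalerA //.
all: by rewrite ?mulVf ?divff ?scale1r.
Qed.

Lemma tkC i j u : tk i (tk j u) = tk j (tk i u).
Proof.
case: i; case: j => //; apply: t_ext; rewrite /tk !tlin !Ulin ?UkC21.
all: lmod_eq Qq M; qfield.
Qed.

Lemma tke i j u : tk i (te j u) = qvar ^ cartan i j *: te j (tk i u).
Proof.
by case: i; case: j; apply: t_ext; rewrite /tk /te !tlin /= ?Unorm;
  rewrite -?exprnP -?exprnN; lmod_eq Qq M; qfield.
Qed.

Lemma tkf i j u : tk i (tf j u) = qvar ^ (- cartan i j) *: tf j (tk i u).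
Proof.
by case: i; case: j; apply: t_ext; rewrite /tk /tf !tlin /= ?Unorm ?UkC21;
  rewrite -?exprnP -?exprnN; lmod_eq Qq M; qfield.
Qed.

Lemma qvar_frac_nz : qvar * qvar - 1 != 0 /\ (qvar * qvar) ^+ 2 - 1 != 0.
Proof. by rewrite -expr2 -exprM !subr_eq0 !exprnP; split; apply: qvar_exp_neq1. Qed.

Lemma tef i j u : te i (tf j u) - tf j (te i u) =
  if eq_color i j then (qv i - (qv i)^-1)^-1
      *: (iter (halfnorm i) (tk i) u - iter (halfnorm i) (tkV i) u) else 0.
Proof.
case: i; case: j; apply: t_ext;
  rewrite /te /tf /qv /= ?tlin /= ?Ulin ?UkVZ ?Uef11 ?Uef12 ?Uef21 ?Uef22 ?Unorm.
all: lmod_eq Qq M.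
all: have [h1 h2] := qvar_frac_nz; have := qvar_neq0; move: h1 h2; generalize qvar; clear; generalize Qq.
all: move=> F q h1 h2 q0; field; rewrite ?q0 ?h1 ?h2 ?oner_eq0 //=.
Qed.

(** In each component the [Uk] are moved to the right; what remains follows from the Serre relations
    of [M] and an identity between coefficients. *)
Lemma serre_tf : serre (fun i u => tf i u).
Proof.
apply/(serreE tf); split=> u; rewrite /serre112 /serre2221; apply: t_ext; rewrite /tf !tlin.
all: rewrite ?Unorm ?UkC21.
all: rewrite ?serre_f112 ?serre_f1222.
all: lmod_eq Qq M; qfield.
Qed.

Lemma serre_te : serre (fun i u => te i u).
Proof.
apply/(serreE te); split=> u; rewrite /serre112 /serre2221; apply: t_ext; rewrite /te !tlin.
all: rewrite ?Unorm ?UkC21.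
all: rewrite ?serre_e112 ?serre_e1222.
all: lmod_eq Qq M; qfield.
Qed.

End Tensor.

Definition tensor (M : Uq_module) : Uq_module :=
  @UqModule (tcarrier M) (@te M) (@tf M) (@tk M) (@tkV M) (@tkK M) (@tkVK M) (@tkC M)
    (@tke M) (@tkf M) (@tef M) (@serre_te M) (@serre_tf M).

                        
(** * Tensor product of crystals *)

(** The crystal of V: in lexicographic order the four pairs of booleans stand for v1, v2, v3, v4. *)
Definition spin := (bool * bool)%type.

Definition vf (i : color) (v : spin) : option spin :=
  match i, v with
  | col1, (false, true) => Some (true, false)
  | col2, (p, false) => Some (p, true)
  | _, _ => None
  end.
Definition ve (i : color) (v : spin) : option spin :=
  match i, v with
  | col1, (true, false) => Some (false, true)
  | col2, (p, true) => Some (p, false)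
  | _, _ => None
  end.
Definition vphi i v : nat := vf i v != None.
Definition veps i v : nat := ve i v != None.
Definition vwt (v : spin) : weight := fun i => (vphi i v)%:Z - (veps i v)%:Z.

Lemma ve_vf i v w : ve i v = Some w <-> vf i w = Some v.
Proof. by case: i; case: v => [[] []]; case: w => [[] []]; split. Qed.

Lemma vf_string i v w : vf i v = Some w ->
  [/\ vphi i v = 1%N, veps i v = 0%N, vphi i w = 0%N & veps i w = 1%N].
Proof. by case: i; case: v => [[] []]; case: w => [[] []]. Qed.

Lemma vwt_vf i v w : vf i v = Some w -> forall j, vwt w j = vwt v j - cartan j i.
Proof. by case: i; case: v => [[] []]; case: w => [[] []] // _ []. Qed.

Section TensorCrystal.
Variables (X : finType) (C : crystal X).
Local Notation XV := (X * spin)%type.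

(** Kashiwara's tensor product rule, in the convention matching the coproduct of [tf] and [te]. *)
Definition txf i (t : XV) : option XV :=
  if (veps i t.2 < cphi C i t.1)%N then omap (fun y => (y, t.2)) (cf C i t.1)
  else omap (fun w => (t.1, w)) (vf i t.2).
Definition txe i (t : XV) : option XV :=
  if (veps i t.2 <= cphi C i t.1)%N then omap (fun y => (y, t.2)) (ce C i t.1)
  else omap (fun w => (t.1, w)) (ve i t.2).
Definition txeps i (t : XV) : nat := (ceps C i t.1 + (veps i t.2 - cphi C i t.1))%N.
Definition txphi i (t : XV) : nat := (vphi i t.2 + (cphi C i t.1 - veps i t.2))%N.

Lemma cf_Some i x : (0 < cphi C i x)%N -> exists y, cf C i x = Some y.
Proof.
move=> h; case E: (cf C i x) => [y|]; first by exists y.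
by have := cf_None C i x; rewrite E eqxx; case: (cphi _ _ _) h.
Qed.

Lemma ce_Some i x : (0 < ceps C i x)%N -> exists y, ce C i x = Some y.
Proof.
move=> h; case E: (ce C i x) => [y|]; first by exists y.
by have := ce_None C i x; rewrite E eqxx; case: (ceps _ _ _) h.
Qed.

Lemma cf_phi i x y : cf C i x = Some y -> (0 < cphi C i x)%N.
Proof. by move/cphi_cf->. Qed.

Lemma ce_eps i x y : ce C i x = Some y -> (0 < ceps C i x)%N.
Proof. by move/ce_cf/ceps_cf->. Qed.

Lemma ve_eps1 i v w : ve i v = Some w -> veps i v = 1%N.
Proof. by rewrite /veps => ->. Qed.

Lemma veps_le1 i v : (veps i v <= 1)%N. Proof. exact: leq_b1. Qed.

Lemma txe_txf i s t : txe i s = Some t <-> txf i t = Some s.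
Proof.
case: s t => [x v] [y w]; rewrite /txe /txf /=; split.
  case: (leqP (veps i v)) => h.
    case E: (ce C i x) => [z|//] /= [<- <-]; have /ce_cf F := E.
    by have := cphi_cf F => hc; rewrite F hc ltnS h.
  case E: (ve i v) => [z|//] /= [<- <-]; have /ve_vf F := E.
  have [h1 h2 h3 h4] := vf_string F; rewrite h2.
  by move: h; rewrite h4 ltnS leqn0 => /eqP ->; rewrite F.
case: (ltnP (veps i w) (cphi C i y)) => h.
  case E: (cf C i y) => [z|//] /= [<- <-]; have /ce_cf F := E.
  by move: h; rewrite (cphi_cf E) ltnS => ->; rewrite F.
case E: (vf i w) => [z|//] /= [<- <-]; have /ve_vf F := E.
have [h1 h2 h3 h4] := vf_string E; rewrite h4.
by move: h; rewrite h2 leqn0 => /eqP ->; rewrite F.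
Qed.

Lemma txe_None i t : (txe i t == None) = (txeps i t == 0%N).
Proof.
case: t => x v; rewrite /txe /txeps /=; case: leqP => h.
  rewrite (eqP (h : (_ - _ == 0)%N)) addn0 -ce_None; by case: (ce C i x).
rewrite addn_eq0 subn_eq0 leqNgt h andbF.
by move: h; rewrite /veps; case: (ve i v).
Qed.

Lemma txf_None i t : (txf i t == None) = (txphi i t == 0%N).
Proof.
case: t => x v; rewrite /txf /txphi /=; case: ltnP => h.
  have [y ->] := cf_Some (leq_ltn_trans (leq0n _) h).
  by rewrite /= addn_eq0 subn_eq0 leqNgt h andbF.
rewrite (eqP (h : (_ - _ == 0)%N)) addn0 /vphi.
by case: (vf i v).
Qed.

Lemma txf_string i s t : txf i s = Some t ->
  txeps i t = (txeps i s).+1 /\ txphi i s = (txphi i t).+1.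
Proof.
case: s t => [x v] [y w]; rewrite /txf /txphi /txeps /=; case: ltnP => h.
  case E: (cf C i x) => [z|//] /= [<- <-].
  have := ceps_cf E; have := cphi_cf E; lia.
case E: (vf i v) => [z|//] /= [<- <-].
have [h1 h2 h3 h4] := vf_string E; lia.
Qed.

Lemma txf_wt i s t : txf i s = Some t -> forall j,
  (txphi j t)%:Z - (txeps j t)%:Z = (txphi j s)%:Z - (txeps j s)%:Z - cartan j i.
Proof.
case: s t => [x v] [y w]; rewrite /txf /txphi /txeps /=; case: ltnP => h.
  case E: (cf C i x) => [z|//] /= [<- <-] j.
  have := cwt_cf E j; lia.
case E: (vf i v) => [z|//] /= [<- <-] j.
have := vwt_vf E j; rewrite /vwt; lia.
Qed.

Definition tensor_crystal : crystal (X * spin)%type := @Crystal (X * spin)%type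
  txe txf txeps txphi txe_txf txe_None txf_None
  (fun i s t h => (txf_string h).1) (fun i s t h => (txf_string h).2) txf_wt.

Lemma tensor_cwt x v i : cwt tensor_crystal (x, v) i = cwt C x i + vwt v i.
Proof. by rewrite /cwt /vwt /= /txphi /txeps /=; lia. Qed.

End TensorCrystal.

(** * Orders of quantum integers, contravariant forms, pure tensors *)

Lemma qintS_rec i n : qv i ^+ n * qint i n.+1 = 1 + qv i ^+ n.+1 * qint i n.
Proof.
have := qv_neq0 i; have := qv_sub_neq0 i; rewrite /qint !exprS.
have := expf_neq0 n (qv_neq0 i).
move: (qv i) (qv i ^+ n); clear; generalize Qq => F q N N0 qq0 q0.
have q1 : q * q - 1 != 0.
  by apply: contraNneq qq0 => qq; have -> : q - q^-1 = (q * q - 1) / q by [field]; rewrite qq mul0r.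
by field; rewrite q0 q1 N0.
Qed.

Lemma small_qv i n : small (qv i ^+ n.+1).
Proof.
by rewrite /qv -exprM exprnP; apply: small_exprz; case: i.
Qed.

Lemma regular0_qv i n : regular0 (qv i ^+ n).
Proof. by do 2!apply: regular0_exp; apply: regular0_qvar. Qed.

(** By the recursion, [n + 1] is the power -n of [qv i] times a unit congruent to 1 modulo [q]. *)
Lemma qint_leading i n :
  regular0 (qv i ^+ n * qint i n.+1) /\ ~ small (qv i ^+ n * qint i n.+1).
Proof.
suff h : small (qv i ^+ n * qint i n.+1 - 1).
  split; first by rewrite -[_ * _](subrK 1); apply: regular0_add regular0_1; apply: small_regular0.
  by move=> h'; apply: not_small1; rewrite -[1](subKr (qv i ^+ n * qint i n.+1)); apply: smallB.
elim: n => [|n IHn]; first by rewrite qint1 expr0 mulr1 subrr; apply: small0.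
rewrite qintS_rec addrAC subrr add0r (_ : n.+2 = (2 + n)%N) // exprD -mulrA.
apply: smallMr (small_qv i 1) _; rewrite -[_ * _](subrK 1).
by apply: regular0_add regular0_1; apply: small_regular0.
Qed.

(** The order of this expression in [qv i] is p + m - n, which is positive. *)
Lemma qint_ratio_small i m n p : (n < p + m)%N ->
  small (qv i ^+ p * qint i n.+1 / qint i m.+1).
Proof.
move=> h; have [mA mns] := qint_leading i m; have [nA _] := qint_leading i n.
have -> : qv i ^+ p * qint i n.+1 / qint i m.+1 =
  qv i ^+ (p + m - n) * (qv i ^+ n * qint i n.+1) / (qv i ^+ m * qint i m.+1).
  rewrite mulrA -exprD subnK ?(ltnW h) // exprD [(qv i ^+ m * _)^-1]invfM [_ * qv i ^+ m * _]mulrAC -[RHS]mulrA.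
  by rewrite mulVKf ?expf_neq0 ?qvar_neq0.
apply: smallMr; last exact: regular0_inv.
case E: (p + m - n)%N => [|k]; first by have := subn_gt0 n (p + m); rewrite E h.
by apply: smallMr (small_qv i k) nA.
Qed.

(** In Kashiwara's normalization: the adjoint of [f_i] is [t_i e_i] divided by [qv i]. With it the
    product form on [M] tensor V is again contravariant, V having an orthonormal weight basis. *)
Definition contravariant (M : Uq_module) (B : M -> M -> Qq) : Prop :=
  [/\ forall a u v w, B (a *: u + v) w = a * B u w + B v w,
      forall u v, B u v = B v u,
      forall i u v, B (Uf i u) v = (qv i)^-1 * B u (iter (halfnorm i) (Uk i) (Ue i v)) &
      forall i u v, B (Uk i u) v = B u (Uk i v)].

Section Forms.
Variables (M : Uq_module) (B : M -> M -> Qq).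
Hypothesis BM : contravariant B.

Lemma formDl u v w : B (u + v) w = B u w + B v w.
Proof. by have [Bl _ _ _] := BM; rewrite -{1}[u]scale1r Bl mul1r. Qed.
Lemma form0l w : B 0 w = 0.
Proof. by apply: (addrI (B 0 w)); rewrite -formDl !addr0. Qed.
Lemma formZl a u w : B (a *: u) w = a * B u w.
Proof. by have [Bl _ _ _] := BM; rewrite -[a *: u]addr0 Bl form0l addr0. Qed.
Lemma form_sym u v : B u v = B v u.
Proof. by have [_ Bs _ _] := BM. Qed.
Lemma formDr u v w : B w (u + v) = B w u + B w v.
Proof. by rewrite form_sym formDl !(form_sym _ w). Qed.
Lemma formZr a u w : B w (a *: u) = a * B w u.
Proof. by rewrite ![B w _]form_sym formZl. Qed.
Lemma form0r w : B w 0 = 0.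
Proof. by rewrite form_sym form0l. Qed.
Lemma form_suml I (r : seq I) (P : pred I) (F : I -> M) w :
  B (\sum_(j <- r | P j) F j) w = \sum_(j <- r | P j) B (F j) w.
Proof. by apply: (big_morph (B^~ w)) => [u v|]; [apply: formDl|apply: form0l]. Qed.
Lemma form_sumr I (r : seq I) (P : pred I) (F : I -> M) w :
  B w (\sum_(j <- r | P j) F j) = \sum_(j <- r | P j) B w (F j).
Proof. by rewrite form_sym form_suml; apply: eq_bigr => j _; rewrite form_sym. Qed.

Lemma form_weight la mu i u v : weight_vector la u -> weight_vector mu v ->
  la i != mu i -> B u v = 0.
Proof.
move=> lu mv lm; have [_ _ _ Bk] := BM; have := Bk i u v.
rewrite lu mv formZl formZr => /eqP; rewrite -subr_eq0 -mulrBl mulf_eq0 subr_eq0.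
by case/orP => [/eqP/qvar_exp_inj/eqP|/eqP //]; rewrite (negPf lm).
Qed.
End Forms.

Section TensorVectors.
Variable M : Uq_module.

Definition tinj (v : spin) (m : M) : tensor M :=
  match v with
  | (false, false) => tmk m 0 0 0
  | (false, true) => tmk 0 m 0 0
  | (true, false) => tmk 0 0 m 0
  | (true, true) => tmk 0 0 0 m
  end.

Definition tcomp (v : spin) (u : tensor M) : M :=
  match v with
  | (false, false) => tc1 u
  | (false, true) => tc2 u
  | (true, false) => tc3 u
  | (true, true) => tc4 u
  end.

Lemma tinjD v m n : tinj v (m + n) = tinj v m + tinj v n.
Proof. by case: v => [[] []]; apply: t_ext; rewrite /tinj !tlin ?addr0. Qed.
Lemma tinjZ v a m : tinj v (a *: m) = a *: tinj v m.
Proof. by case: v => [[] []]; apply: t_ext; rewrite /tinj !tlin ?scaler0. Qed.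
Lemma tinj0 v : tinj v 0 = 0.
Proof. by case: v => [[] []]; apply: t_ext. Qed.
Lemma tinj_sum v I (r : seq I) (P : pred I) (F : I -> M) :
  tinj v (\sum_(j <- r | P j) F j) = \sum_(j <- r | P j) tinj v (F j).
Proof. by apply: (big_morph (tinj v)) => [m n|]; [apply: tinjD|apply: tinj0]. Qed.
Lemma tcomp_tinj v w m : tcomp v (tinj w m) = (w == v)%:R *: m.
Proof.
by case: v => [[] []]; case: w => [[] []]; rewrite /tcomp /tinj !tlin ?scale1r ?scale0r.
Qed.
Lemma tcomp_linear v a u w : tcomp v (a *: u + w) = a *: tcomp v u + tcomp v w.
Proof. by case: v => [[] []]. Qed.
Lemma tinj_span u : u = \sum_(v : spin) tinj v (tcomp v u).
Proof.
transitivity (\sum_(v : spin) tinj (v.1, v.2) (tcomp (v.1, v.2) u)); last by apply: eq_bigr => -[].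
rewrite -(pair_bigA _ (fun p r => tinj (p, r) (tcomp (p, r) u))) /= !big_bool.
by apply: t_ext; rewrite /tinj /tcomp !tlin ?addr0 ?add0r.
Qed.

Lemma tf_tinj i v m : Uf i (tinj v m) = tinj v (Uf i m) +
  (if vf i v is Some w then tinj w (iter (halfnorm i) (Uk i) m) else 0).
Proof.
by case: i; case: v => [[] []]; apply: t_ext;
  rewrite /= /tf /tinj ?tlin ?Uf0 ?Uk0 ?addr0 ?add0r //.
Qed.

Lemma te_tinj i v m : Ue i (tinj v m) = qv i ^ (- vwt v i) *: tinj v (Ue i m) +
  (if ve i v is Some w then tinj w m else 0).
Proof.
rewrite -tinjZ; case: i; case: v => [[] []]; apply: t_ext;
  rewrite /= /te /tinj ?tlin ?Ue0 ?scaler0 ?addr0 ?add0r ?scale1r //.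
Qed.

Lemma tk_tinj i v m : Uk i (tinj v m) = qvar ^ vwt v i *: tinj v (Uk i m).
Proof.
rewrite -tinjZ; case: i; case: v => [[] []]; apply: t_ext;
  rewrite /= /tk /tinj ?tlin ?Uk0 ?scaler0 ?addr0 ?add0r ?scale1r //.
Qed.

Lemma tinj_weight la v m : weight_vector la m ->
  weight_vector (fun i => la i + vwt v i) (tinj v m).
Proof.
move=> lm i; rewrite tk_tinj lm tinjZ scalerA -expfzDr ?qvar_neq0 //.
by rewrite addrC.
Qed.

Variables (X : finType) (b : X -> M) (co : X -> M -> Qq).
Hypothesis bco : coords b co.

Definition tbasis (t : X * spin) : tensor M := tinj t.2 (b t.1).
Definition tcoord (t : X * spin) (u : tensor M) : Qq := co t.1 (tcomp t.2 u).

Lemma tcoords : coords tbasis tcoord.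
Proof.
split=> [[x v] a u w|[x v] [y w]|u]; rewrite /tcoord /tbasis /=.
- by rewrite tcomp_linear (co_linear bco).
- rewrite tcomp_tinj (coZ bco) (co_basis bco) -natrM mulnb andbC.
  by rewrite xpair_eqE.
rewrite {1}[u]tinj_span -(pair_bigA _ (fun x v => co x (tcomp v u) *: tinj v (b x))) /=.
rewrite exchange_big /=; apply: eq_bigr => v _.
by rewrite {1}[tcomp v u](co_span bco) tinj_sum; apply: eq_bigr => x _; rewrite tinjZ.
Qed.

Variable B : M -> M -> Qq.
Hypothesis BM : contravariant B.

Definition tform (u w : tensor M) : Qq :=
  B (tc1 u) (tc1 w) + B (tc2 u) (tc2 w) + B (tc3 u) (tc3 w) + B (tc4 u) (tc4 w).

Lemma tform_contravariant : contravariant tform.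
Proof.
have [Bl Bs Bf Bk] := BM; split; rewrite /tform.
- by move=> a u v w; rewrite !tlin !Bl; ring.
- by move=> u v; congr (_ + _ + _ + _); exact: (Bs).
- move=> [] u v; rewrite /= /tf /te /tk !tlin ?(Ulin, formDl BM, formDr BM, formZr BM) !Bf ?Bk ?(Ulin, formDr BM, formZr BM) /=.
    repeat match goal with |- context [B ?x ?y] => let r := fresh "r" in generalize (B x y) => r end.
    match goal with |- @eq _ ?x ?y => change (@eq Qq x y) end; rewrite /qv; move: qvar_neq0; generalize qvar; clear -r r0 r1 r2 r3;
      move: r r0 r1 r2 r3; generalize Qq => F r r0 r1 r2 r3 q q0 /=; field; rewrite ?expf_neq0 ?q0 ?oner_eq0 //.
  repeat match goal with |- context [B ?x ?y] => let r := fresh "r" in generalize (B x y) => r end.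
  match goal with |- @eq _ ?x ?y => change (@eq Qq x y) end; rewrite /qv; move: qvar_neq0; generalize qvar; clear -r r0 r1 r2 r3 r4;
    move: r r0 r1 r2 r3 r4; generalize Qq => F r r0 r1 r2 r3 r4 q q0 /=; field; rewrite ?q0 //.
- by move=> [] u v; rewrite /= /tk !tlin ?(formZl BM, formZr BM) ?Bk.
Qed.

Lemma tform_tinj v w m n : tform (tinj v m) (tinj w n) = (v == w)%:R * B m n.
Proof.
by case: v => [[] []]; case: w => [[] []]; rewrite /tform /tinj !tlin
  ?(form0l BM) ?(form0r BM) ?addr0 ?add0r ?mul1r ?mul0r.
Qed.

Lemma tform_gram : (forall x y, small (B (b x) (b y) - (x == y)%:R)) ->
  forall s t, small (tform (tbasis s) (tbasis t) - (s == t)%:R).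
Proof.
move=> gram [x v] [y w]; rewrite /tbasis tform_tinj /= xpair_eqE andbC.
by case: (v == w); rewrite ?mul1r ?mul0r ?subrr //; apply: small0.
Qed.

End TensorVectors.

Local Opaque tensor.

Lemma sub_inv_neq0 (F : fieldType) (x : F) : x != 0 -> x - x^-1 != 0 -> x * x - 1 != 0.
Proof.
move=> x0; apply: contraNneq => e.
by have -> : x - x^-1 = (x * x - 1) / x by [field]; rewrite e mul0r.
Qed.

Lemma subr3C (V : zmodType) (t a b d : V) : t - a - b - d = (t - d) - (a + b).
Proof. by rewrite opprD addrA [t - d - a]addrAC [RHS]addrAC. Qed.

(** * Strings in the tensor product *)

Section TensorStrings.
Variables (M : Uq_module) (X : finType) (C : crystal X) (i : color) (c : X -> M).
Hypothesis cs : string_vectors C i c.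

                                                                                          
                                                                      
                                      
(** The product of a string with a two-dimensional string splits into two strings, of lengths one
    more and one less. The first formula runs along the long string, whose last vector is the pure
    tensor of the two bottoms (the case [cphi C i x = 0]); the formula with the quotient runs along
    the short string. When [v] forms a string by itself, nothing changes. *)
Definition tstring (t : X * spin) : tensor M :=
  let (x, v) := t in
  if vf i v is Some w then
    tinj v (c x) + qv i ^+ (cphi C i x).+1 *: tinj w (oc c (ce C i x))
  else if ve i v is Some w then
    if cphi C i x is m.+1 then
      (qint i (ceps C i x + m).+1)^-1 *:
        ((qv i ^- ceps C i x * qint i m.+1) *: tinj v (c x)
         - (qv i * qint i (ceps C i x).+1) *: tinj w (oc c (cf C i x)))
    else tinj v (c x)
  else tinj v (c x).

Lemma ti_weight la (m : M) : weight_vector la m ->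
  iter (halfnorm i) (Uk i) m = qv i ^ (la i) *: m.
Proof.
move=> lm; rewrite /qv; case: i => /=; rewrite !lm ?expr1 //.
rewrite linearZ /= lm scalerA -expfzDr ?qvar_neq0 // exprnP exprz_exp.
by congr (_ ^ _ *: _); lia.
Qed.

Lemma ti_c x : iter (halfnorm i) (Uk i) (c x) = (qv i ^+ cphi C i x / qv i ^+ ceps C i x) *: c x.
Proof.
have [wx _ _] := cs x; rewrite (ti_weight wx) /cwt expfzDr ?qv_neq0 //.
by rewrite -invr_expz.
Qed.

Lemma ti_oc_cf x y : cf C i x = Some y ->
  iter (halfnorm i) (Uk i) (c y) = (qv i ^+ cphi C i x / qv i ^+ (ceps C i x).+2) *: c y.
Proof.
move=> xy; rewrite ti_c (cphi_cf xy) (ceps_cf xy) !exprS.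
have := expf_neq0 (ceps C i x) (qv_neq0 i); have := qv_neq0 i.
move: (qv i ^+ _) (qv i ^+ _) => A B q0 B0; congr (_ *: _); move: (qv i) A B q0 B0.
by clear; generalize Qq => F q A B q0 B0; field; rewrite ?q0 ?B0.
Qed.

Lemma oc_ce_f x : Uf i (oc c (ce C i x)) = qint i (ceps C i x) *: c x.
Proof.
case E: (ce C i x) => [y|] /=.
  by have [_ -> _] := cs y; move/ce_cf: E => E; rewrite E -(ceps_cf E).
by rewrite Uf0; have := ce_None C i x; rewrite E eqxx => /esym /eqP ->; rewrite qint0 scale0r.
Qed.

Lemma oc_cf_e x : Ue i (oc c (cf C i x)) = qint i (cphi C i x) *: c x.
Proof.
case E: (cf C i x) => [y|] /=.
  by have [_ _ ->] := cs y; rewrite (cphi_cf E); move/ce_cf: E => ->.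
by rewrite Ue0; have := cf_None C i x; rewrite E eqxx => /esym /eqP ->; rewrite qint0 scale0r.
Qed.

Lemma oc_ce_e x y : ce C i x = Some y ->
  Ue i (c y) = qint i (cphi C i x).+2 *: oc c (ce C i y).
Proof. by have [_ _ ->] := cs y; move/ce_cf/cphi_cf ->. Qed.

Lemma oc_cf_f x y : cf C i x = Some y ->
  Uf i (c y) = qint i (ceps C i x).+2 *: oc c (cf C i y).
Proof. by have [_ -> _] := cs y; move/ceps_cf ->. Qed.

End TensorStrings.

Arguments tstring [M X] C i c t : simpl never.

Ltac qint_field_with i tac :=
  match goal with |- @eq _ ?x ?y => change (@eq Qq x y) end;
  rewrite /qint ?(exprS, exprD, expr0);
  move: (qv_neq0 i) (sub_inv_neq0 (qv_neq0 i) (qv_sub_neq0 i));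
  repeat match goal with |- context [@GRing.exp ?R (qv i) ?n] =>
    let h := fresh in
    have h : (@GRing.exp R (qv i) n : Qq) != 0 by [exact: expf_neq0 (qv_neq0 i)];
    move: h; generalize (@GRing.exp R (qv i) n) end;
  generalize (qv i); tac; generalize Qq; intros;
  field; repeat (apply/andP; split); rewrite ?oner_eq0 //.
Ltac qint_field i := qint_field_with i ltac:(idtac).

Section TensorStrings2.
Variables (M : Uq_module) (X : finType) (C : crystal X) (i : color) (c : X -> M).
Hypothesis cs : string_vectors C i c.
Local Notation T := (tstring C i c).

Lemma tstring_weight t : weight_vector (cwt (tensor_crystal C) t) (T t).
Proof.
case: t => x v; have [wx _ _] := cs x; move=> j; rewrite tensor_cwt.
have wv := tinj_weight v wx j; have Dw : forall w, vf i v = Some w ->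
    Uk j (tinj w (oc c (ce C i x))) = qvar ^ (cwt C x j + vwt v j) *: tinj w (oc c (ce C i x)).
  move=> w vw; case E: (ce C i x) => [y|]; last by rewrite /= tinj0 linear0 scaler0.
  have [wy _ _] := cs y; rewrite (tinj_weight w wy j) (vwt_vf vw) /cwt.
  by move/ce_cf/cwt_cf: E => ->; congr (_ ^ _ *: _); lia.
have Uw : forall w, ve i v = Some w ->
    Uk j (tinj w (oc c (cf C i x))) = qvar ^ (cwt C x j + vwt v j) *: tinj w (oc c (cf C i x)).
  move=> w /ve_vf vw; case E: (cf C i x) => [y|]; last by rewrite /= tinj0 linear0 scaler0.
  have [wy _ _] := cs y; rewrite (tinj_weight w wy j) (vwt_vf vw) /cwt (cwt_cf E).
  by congr (_ ^ _ *: _); lia.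
have EZ (k a : Qq) (u : tensor M) : Uk j u = k *: u -> Uk j (a *: u) = k *: (a *: u).
  by move=> h; rewrite UkZ h !scalerA mulrC.
have ED (k : Qq) (u w : tensor M) : Uk j u = k *: u -> Uk j w = k *: w -> Uk j (u + w) = k *: (u + w).
  by move=> h1 h2; rewrite UkD h1 h2 scalerDr.
have EN (k : Qq) (u : tensor M) : Uk j u = k *: u -> Uk j (- u) = k *: - u.
  by move=> h; rewrite -scaleN1r; apply: (EZ).
rewrite /tstring; case: (vf i v) Dw => [w /(_ w erefl) h|_]; first by apply: (ED) => //; apply: (EZ).
case: (ve i v) Uw => [w /(_ w erefl) h|//]; case: (cphi C i x) => [//|m].
by apply: (EZ); apply: (ED); [|apply: (EN)]; apply: (EZ).
Qed.

(** All correction terms carry positive powers of [q], so modulo [q] the string vectors are pure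
    tensors. *)
Lemma tstring_congr (b : X -> M) (co : X -> M -> Qq) : coords b co ->
  (forall y, inqL co (c y - b y)) ->
  forall t, inqL (tcoord co) (T t - tbasis b t).
Proof.
move=> bco cb [x v].
have inj_q w m : inqL co m -> inqL (tcoord co) (tinj w m).
  move=> mq [y u]; rewrite /tcoord tcomp_tinj (coZ bco) /=.
  by apply: smallMl (mq y); case: (w == u); [apply: regular0_1|apply: regular0_0].
have inj_sq w a m : small a -> inL co m -> inqL (tcoord co) (a *: tinj w m).
  by move=> sa mL; rewrite -tinjZ; apply: inj_q; apply: (inqL_smallZ bco).
have TC := tcoords bco.
have base : inqL (tcoord co) (tinj v (c x) - tbasis b (x, v)).
  rewrite /tbasis /= -[- tinj v (b x)]scaleN1r -tinjZ -tinjD scaleN1r.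
  exact: inj_q (cb x).
have ocL o : inL co (oc c o) by apply: (inL_oc bco cb).
rewrite /tstring; case E: (vf i v) => [w|].
  rewrite addrAC; apply: (inqLD TC) base _.
  by apply: inj_sq => //; apply: small_qv.
case: (ve i v) => [w|//]; case: (cphi C i x) => [//|m].
set l := (ceps C i x + m)%N.
rewrite scalerBr !scalerA mulrA.
(* With l = ceps + m, this is [l + 1] = q^(-ceps) [m + 1] + q^(m+1) [ceps], written with [qv i] for
   q and divided by [l + 1]. *)
rewrite (_ : _ *: tinj v (c x) = tinj v (c x) -
   (qv i ^+ m.+1 * qint i (ceps C i x) / qint i l.+1) *: tinj v (c x)); last first.
  rewrite -[in X in X - _](scale1r (tinj v (c x))) -scalerBl; congr (_ *: _).
  have := qint_neq0 i l; rewrite /qint /l -addnS !exprD !exprS.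
  have := qv_neq0 i; have := qv_sub_neq0 i; have := expf_neq0 m (qv_neq0 i).
  have := expf_neq0 (ceps C i x) (qv_neq0 i).
  move: (qv i) (_ ^+ ceps C i x) (_ ^+ m); clear; generalize Qq => F q N P N0 P0 qq q0 h.
  have q1 := sub_inv_neq0 q0 qq.
  have h1 : N * (q * P) * (N * (q * P)) - 1 != 0.
    apply: sub_inv_neq0; first by rewrite !mulf_neq0.
    by apply: contraNneq h => ->; rewrite mul0r.
  by field; rewrite q0 q1 P0 N0 h1.
rewrite subr3C; apply: (inqLB TC) => //; apply: (inqLD TC); apply: inj_sq => //.
- case E': (ceps C i x) => [|n]; first by rewrite qint0 mulr0 mul0r; apply: small0.
  by apply: qint_ratio_small; lia.
- exact: (inL_congr bco (cb x) (inL_basis bco x)).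
by rewrite mulrC -[X in X * _ / _]expr1; apply: qint_ratio_small; rewrite /l; lia.
Qed.

Let T_top x v w : vf i v = Some w ->
  T (x, v) = tinj v (c x) + qv i ^+ (cphi C i x).+1 *: tinj w (oc c (ce C i x)).
Proof. by rewrite /tstring => ->. Qed.
Let vf_None v w : ve i v = Some w -> vf i v = None.
Proof. by move/ve_vf/vf_string => [_ _ + _]; rewrite /vphi; case: (vf i v). Qed.
Let ve_None v w : vf i v = Some w -> ve i v = None.
Proof. by move/vf_string => [_ + _ _]; rewrite /veps; case: (ve i v). Qed.
Let T_bot0 x v w : ve i v = Some w -> cphi C i x = 0%N -> T (x, v) = tinj v (c x).
Proof. by move=> vw p0; rewrite /tstring p0 (vf_None vw) vw. Qed.
Let T_bot x v w m : ve i v = Some w -> cphi C i x = m.+1 ->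
  T (x, v) = (qint i (ceps C i x + m).+1)^-1 *:
        ((qv i ^- ceps C i x * qint i m.+1) *: tinj v (c x)
         - (qv i * qint i (ceps C i x).+1) *: tinj w (oc c (cf C i x))).
Proof. by move=> vw pm; rewrite /tstring pm (vf_None vw) vw. Qed.
Let T_single x v : vf i v = None -> ve i v = None -> T (x, v) = tinj v (c x).
Proof. by rewrite /tstring => -> ->. Qed.

Let fT x v : Uf i (T (x, v)) = qint i (txeps C i (x, v)).+1 *: oc T (txf C i (x, v)).
Proof.
rewrite /txf /txeps /=; have [_ fx _] := cs x.
case Ev: (vf i v) => [w|].
  have [h1 h2 h3 h4] := vf_string Ev; have vw : ve i w = Some v by apply/ve_vf.
  rewrite h2 sub0n addn0 (T_top _ Ev) UfD UfZ !tf_tinj Ev (vf_None vw) fx (ti_c cs) (oc_ce_f cs).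
  rewrite addr0 !tinjZ; case Ex: (cf C i x) => [y|] /=.
    rewrite (cphi_cf Ex) /= (T_top _ Ev); have /ce_cf -> := Ex; rewrite [oc c _]/=.
    by lmod_eq Qq (carrier (tensor M)); qint_field i.
  have /eqP := Ex; rewrite cf_None => /eqP p0; rewrite p0 /= (T_bot0 vw p0) tinj0.
  by lmod_eq Qq (carrier (tensor M)); qint_field i.
case Ew: (ve i v) => [w|]; last first.
  have e0 : veps i v = 0%N by rewrite /veps Ew.
  rewrite e0 sub0n addn0 T_single // tf_tinj Ev addr0 fx tinjZ.
  case Ex: (cf C i x) => [y|] /=; last by rewrite tinj0; case: ifP.
  by rewrite (cphi_cf Ex) /= T_single.
rewrite (ve_eps1 Ew); case Ep: (cphi C i x) => [|m].
  rewrite (T_bot0 Ew Ep) tf_tinj Ev addr0 fx /=.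
  by have /eqP -> : cf C i x == None; rewrite ?cf_None ?Ep //= scaler0 tinj0 scaler0.
rewrite (T_bot Ew Ep) subSS sub0n addn0 ltnS UfZ UfD UfN !UfZ !tf_tinj Ev fx.
have /ve_vf -> := Ew; have [y Ey] : exists y, cf C i x = Some y by apply: cf_Some; rewrite Ep.
have hp : cphi C i y = m by have := cphi_cf Ey; rewrite Ep => -[].
rewrite Ey [oc c _]/= (ti_oc_cf cs Ey) (oc_cf_f cs Ey) Ep addr0 !tinjZ.
case: m hp Ep => [|m] hp Ep.
  have /eqP -> : cf C i y == None; rewrite ?cf_None ?hp //= tinj0.
  set L := (qint i _)^-1; clearbody L.
  by lmod_eq Qq (carrier (tensor M)); qint_field_with i ltac:(move: L).
rewrite [omap _ _]/= [oc T _]/= (T_bot Ew hp) (ceps_cf Ey) addSnnS.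
set L := (qint i _.+1)^-1; clearbody L.
by lmod_eq Qq (carrier (tensor M)); qint_field_with i ltac:(move: L).
Qed.

Let eT x v : Ue i (T (x, v)) = qint i (txphi C i (x, v)).+1 *: oc T (txe C i (x, v)).
Proof.
rewrite /txe /txphi /=; have [_ _ ex] := cs x.
case Ev: (vf i v) => [w|].
  have [h1 h2 h3 h4] := vf_string Ev; have vw : ve i w = Some v by apply/ve_vf.
  rewrite h1 h2 subn0 (T_top _ Ev) UeD UeZ !te_tinj (ve_None Ev) vw ex addr0 /vwt h1 h2 h3 h4.
  case Ex: (ce C i x) => [y|] /=; last first.
    by rewrite Ue0 ?(tinj0, scaler0, addr0).
  have p : cphi C i y = (cphi C i x).+1 by move/ce_cf/cphi_cf: Ex.
  rewrite (T_top _ Ev) p (oc_ce_e cs Ex) !tinjZ subr0 sub0r opprK add1n !expr1z -invr_expz expr1z.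
  by lmod_eq Qq (carrier (tensor M)); qint_field i.
case Ew: (ve i v) => [w|]; last first.
  have e0 : veps i v = 0%N by rewrite /veps Ew.
  have p0 : vphi i v = 0%N by rewrite /vphi Ev.
  rewrite e0 p0 subn0 add0n T_single // te_tinj Ew addr0 ex tinjZ /vwt e0 p0 subr0 oppr0 expr0z scale1r.
  case Ex: (ce C i x) => [y|] /=; last by rewrite tinj0.
  by rewrite T_single.
have /ve_vf Fw := Ew; have [h1 h2 h3 h4] := vf_string Fw.
rewrite h3 h4 add0n; case Ep: (cphi C i x) => [|m].
  rewrite (T_bot0 Ew Ep) te_tinj Ew ex /= (T_top _ Fw) Ep /vwt h3 h4 sub0r opprK expr1z tinjZ.
  by lmod_eq Qq (carrier (tensor M)); qint_field i.
rewrite (T_bot Ew Ep) subSS subn0 /= UeZ UeD UeN !UeZ !te_tinj Ew (ve_None Fw) (oc_cf_e cs) ex.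
rewrite Ep addr0 !tinjZ /vwt h1 h2 h3 h4 sub0r subr0 opprK expr1z -invr_expz expr1z.
case Ex: (ce C i x) => [y|] /=.
  have p : cphi C i y = m.+2 by move/ce_cf/cphi_cf: (Ex); rewrite Ep.
  have n : ceps C i x = (ceps C i y).+1 by move/ce_cf/ceps_cf: (Ex).
  rewrite (T_bot Ew p) n addSnnS; have /ce_cf -> := Ex; rewrite [oc c _]/=.
  set L := (qint i _.+1)^-1; clearbody L.
  by lmod_eq Qq (carrier (tensor M)); qint_field_with i ltac:(move: L).
have n0 : ceps C i x = 0%N by apply/eqP; rewrite -ce_None Ex.
rewrite n0 add0n qint1 ?tinj0; set L := (qint i _)^-1; clearbody L.
by lmod_eq Qq (carrier (tensor M)); qint_field_with i ltac:(move: L).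
Qed.

Lemma tstring_vectors : string_vectors (tensor_crystal C) i T.
Proof. by case=> x v; split; [apply: tstring_weight|apply: fT|apply: eT]. Qed.
End TensorStrings2.
Local Transparent tensor.

(** * Highest weight vectors in the tensor product *)

Section MoreRules.
Variable M : Uq_module.
Implicit Types u v : M.

Lemma UkVf i j v : UkV i (Uf j v) = qvar ^ cartan i j *: Uf j (UkV i v).
Proof.
rewrite -{1}[v](UkVK i) -[Uf j _](scalerK (expfz_neq0 (- cartan i j) qvar_neq0)).
by rewrite -Ukf UkVZ UkK invr_expz opprK.
Qed.

Lemma UkVf11 u : UkV col1 (Uf col1 u) = qvar ^+ 2 *: Uf col1 (UkV col1 u).
Proof. by rewrite UkVf. Qed.
Lemma UkVf12 u : UkV col1 (Uf col2 u) = qvar^-1 *: Uf col2 (UkV col1 u).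
Proof. by rewrite UkVf. Qed.
Lemma UkVf21 u : UkV col2 (Uf col1 u) = qvar ^- 2 *: Uf col1 (UkV col2 u).
Proof. by rewrite UkVf. Qed.
Lemma UkVf22 u : UkV col2 (Uf col2 u) = qvar ^+ 2 *: Uf col2 (UkV col2 u).
Proof. by rewrite UkVf. Qed.

Lemma Uf_weight la i u : weight_vector la u -> weight_vector (fun j => la j - cartan j i) (Uf i u).
Proof. by move=> lu j; rewrite Ukf lu linearZ scalerA -expfzDr ?qvar_neq0 //= addrC. Qed.

Lemma Ue_weight la i u : weight_vector la u -> weight_vector (fun j => la j + cartan j i) (Ue i u).
Proof. by move=> lu j; rewrite Uke lu linearZ scalerA -expfzDr ?qvar_neq0 //= addrC. Qed.

Lemma UkV_weight la i u : weight_vector la u -> UkV i u = (qvar ^ la i)^-1 *: u.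
Proof.
move=> lu; rewrite -{2}[u](UkK i) lu UkVZ scalerK // expfz_neq0 ?qvar_neq0 //.
Qed.
End MoreRules.

Section TensorHighestWeight.
Variables (M : Uq_module).

                                                                                                
(** A vector killed by [e_1] and [e_2] is determined by its coefficient [m] at v1: the equations
    give the other three coefficients in turn, and the hypotheses of [hw_vector_e] are the remaining
    ones. *)
Definition hw_vector (m : M) : tensor M :=
  tmk m (- qvar^-1 *: Ue col2 m) (qvar ^- 3 *: Ue col1 (Ue col2 m))
    (- qvar ^- 4 *: Ue col2 (Ue col1 (Ue col2 m))).

Lemma hw_vector_e m : Ue col1 m = 0 -> Ue col2 (Ue col2 m) = 0 ->
  Ue col1 (Ue col1 (Ue col2 m)) = 0 -> Ue col2 (Ue col2 (Ue col1 (Ue col2 m))) = 0 ->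
  Ue col1 (Ue col2 (Ue col1 (Ue col2 m))) = 0 -> forall i, Ue i (hw_vector m) = 0.
Proof.
move=> h1 h2 h3 h4 h5 i; rewrite /hw_vector; case: i; apply: t_ext;
  rewrite [Ue _ _]/(te _ _) /te ?tlin ?Ulin ?h1 ?h2 ?h3 ?h4 ?h5 ?scaler0 //;
  lmod_eq Qq M; qfield.
Qed.

Lemma hw_vector_weight la m : weight_vector la m ->
  weight_vector (fun i => la i + vwt (false, false) i) (hw_vector m).
Proof.
move=> lm i; have e2 := Ue_weight col2 lm; have e12 := Ue_weight col1 e2.
have e212 := Ue_weight col2 e12; rewrite /hw_vector.
case: i; apply: t_ext; rewrite [Uk _ _]/(tk _ _) /tk ?tlin ?UkZ ?lm ?e2 ?e12 ?e212 /vwt /=;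
  rewrite ?expfzDr ?qvar_neq0 //; lmod_eq Qq M.
all: rewrite -?[qvar ^ 1%Z]/qvar -?[qvar ^ 2]/(qvar ^+ 2) -?[qvar ^ (-1)]/(qvar^-1) -?[qvar ^ (-2)]/(qvar ^- 2).
all: rewrite -?[qvar ^ 0]/(1 : Qq).
all: move: qvar_neq0; generalize (qvar ^ la col1) (qvar ^ la col2); generalize qvar; generalize Qq.
all: intros; field; rewrite ?qvar_neq0 //.
Qed.

Variables (u : M) (A B : Qq).
Hypotheses (A0 : A != 0) (B0 : B != 0).
Hypotheses (eu1 : Ue col1 u = 0) (eu2 : Ue col2 u = 0).
Hypotheses (ku1 : Uk col1 u = A *: u) (ku2 : Uk col2 u = B *: u).

Let kVu1 : UkV col1 u = A^-1 *: u.
Proof. by rewrite -{2}[u](UkK col1) ku1 UkVZ scalerK. Qed.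
Let kVu2 : UkV col2 u = B^-1 *: u.
Proof. by rewrite -{2}[u](UkK col2) ku2 UkVZ scalerK. Qed.

Let urules := (@Uef11 M, @Uef12 M, @Uef21 M, @Uef22 M, Unorm M, @UkVf11 M, @UkVf12 M,
  @UkVf21 M, @UkVf22 M, @UkVZ M, eu1, eu2, ku1, ku2, kVu1, kVu2).

                                                                                             
Let br (x : Qq) : Qq := (x - x^-1) / (qvar - qvar^-1).
Let br2 (x : Qq) : Qq := (x - x^-1) / (qvar ^+ 2 - qvar ^- 2).

Ltac hw_field :=
  move: A0 B0 qvar_neq0 (qvar_frac_nz) => + + + [];
  rewrite /br /br2; generalize A B; generalize qvar; generalize Qq; intros;
  field; repeat (apply/andP; split); rewrite ?oner_eq0 //.

(** With [u] itself, the elements [hw2], [hw3], [hw4] are the coefficients at v1 of highest weight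
    vectors whose weights are that of [u] plus the weights of v1, v2, v3, v4. Here [A] and [B] stand
    for [q] to the coordinates of the highest weight; the brackets are fixed by the vanishing
    conditions of [hw_vector_e]. *)
Definition hw2 : M := Uf col2 u.
Definition hw3 : M := br2 (A ^+ 2) *: Uf col1 (Uf col2 u)
  - br2 (qvar ^+ 2 * A ^+ 2) *: Uf col2 (Uf col1 u).
Definition hw4 : M :=
  (br (qvar ^+ 2) * br (qvar * B) * br (qvar ^+ 3 * A ^+ 2 * B)
     - br (qvar ^+ 2 * A ^+ 2 * B ^+ 2)) *: Uf col2 (Uf col1 (Uf col2 u))
  - (br B * br (qvar ^+ 3 * A ^+ 2 * B)) *: Uf col2 (Uf col2 (Uf col1 u))
  - (br (qvar * B) * br (qvar ^+ 2 * A ^+ 2 * B)) *: Uf col1 (Uf col2 (Uf col2 u)).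

Lemma hw2_e1 : Ue col1 hw2 = 0.
Proof. by rewrite /hw2 ?urules. Qed.
Lemma hw2_e2 : Ue col2 hw2 = br B *: u.
Proof. by rewrite /hw2 ?urules; lmod_eq Qq M; hw_field. Qed.
Lemma hw3_e1 : Ue col1 hw3 = 0.
Proof. by rewrite /hw3 ?urules; lmod_eq Qq M; hw_field. Qed.
Lemma hw3_e2 : Ue col2 hw3 = - br (qvar ^+ 2 * A ^+ 2 * B) *: Uf col1 u.
Proof. by rewrite /hw3 ?urules; lmod_eq Qq M; hw_field. Qed.
Lemma f1_e1 : Ue col1 (Uf col1 u) = br2 (A ^+ 2) *: u.
Proof. by rewrite ?urules; lmod_eq Qq M; hw_field. Qed.
Lemma f1_e2 : Ue col2 (Uf col1 u) = 0.
Proof. by rewrite ?urules. Qed.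

Let hw4' : M := br B *: Uf col2 (Uf col1 u) - br (qvar ^+ 2 * B) *: Uf col1 (Uf col2 u).
Lemma hw4_e1 : Ue col1 hw4 = 0.
Proof. by rewrite /hw4 ?urules; lmod_eq Qq M; hw_field. Qed.
Lemma hw4_e2 : Ue col2 hw4 = - br (qvar ^+ 2 * A ^+ 2 * B ^+ 2) *: hw4'.
Proof. by rewrite /hw4 /hw4' ?urules; lmod_eq Qq M; hw_field. Qed.
Lemma hw4'_e1 : Ue col1 hw4' = - br (qvar ^+ 2 * A ^+ 2 * B) *: Uf col2 u.
Proof. by rewrite /hw4' ?urules; lmod_eq Qq M; hw_field. Qed.
Lemma hw4'_e2 : Ue col2 hw4' = 0.
Proof. by rewrite /hw4' ?urules; lmod_eq Qq M; hw_field. Qed.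

Lemma hw2_killed i : Ue i (hw_vector hw2) = 0.
Proof. by apply: hw_vector_e; rewrite ?hw2_e1 ?hw2_e2 ?(UeZ, eu1, eu2, scaler0, Ue0). Qed.
Lemma hw3_killed i : Ue i (hw_vector hw3) = 0.
Proof.
by apply: hw_vector_e; rewrite ?hw3_e1 ?hw3_e2 ?(UeZ, f1_e1, f1_e2, eu1, eu2, scaler0, Ue0).
Qed.
Lemma hw4_killed i : Ue i (hw_vector hw4) = 0.
Proof.
by apply: hw_vector_e;
  rewrite ?hw4_e1 ?hw4_e2 ?(UeZ, hw4'_e1, hw4'_e2, hw2_e1, hw2_e2, eu1, eu2, scaler0, Ue0).
Qed.

End TensorHighestWeight.

Lemma br_neq0 (d : Qq) k : k != 0 -> d != 0 -> (qvar ^ k - (qvar ^ k)^-1) / d != 0.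
Proof.
move=> k0 d0; apply: mulf_neq0; last by rewrite invr_eq0.
rewrite subr_eq0; apply/eqP => h; have := @qvar_exp_inj k (- k); rewrite /= -invr_expz.
by move=> /(_ h); lia.
Qed.

(** The bound on [veps] is the condition for the crystal element u tensor v to be a source. Each
    vector is nonzero because its component at [v] is [u] times a product of brackets of nonzero
    integers. *)
Lemma tensor_highest_weight (M : Uq_module) (u : M) la v :
  u != 0 -> weight_vector la u -> (forall i, Ue i u = 0) ->
  (forall i, (veps i v)%:Z <= la i) ->
  exists x : tensor M, [/\ x != 0, weight_vector (fun i => la i + vwt v i) x &
    forall i, Ue i x = 0].
Proof.
move=> u0 lu eu lav.
have A0 := expfz_neq0 (la col1) qvar_neq0; have B0 := expfz_neq0 (la col2) qvar_neq0.
have ku1 := lu col1; have ku2 := lu col2; have eu1 := eu col1; have eu2 := eu col2.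
have d0 : qvar - qvar^-1 != 0 :> Qq by rewrite subr_eq0; apply/eqP => /(@qvar_exp_inj 1 (-1)).
have d2 : qvar ^+ 2 - qvar ^- 2 != 0 :> Qq by exact: (qv_sub_neq0 col1).
have q0 := qvar_neq0.
have la1 := lav col1; have la2 := lav col2.
have W (w : M) mu : weight_vector mu w ->
    (forall i, mu i + vwt (false, false) i = la i + vwt v i) ->
    weight_vector (fun i => la i + vwt v i) (hw_vector w).
  by move=> mw h i; rewrite -h; apply: hw_vector_weight.
have snz (a : Qq) (w : M) : a != 0 -> w != 0 -> a *: w != 0.
  by move=> a0 w0; rewrite scaler_eq0 negb_or a0.
have nq n : qvar ^- n != 0 :> Qq by rewrite invr_eq0 expf_neq0.
have pow (k l m : nat) (x y : int) : qvar ^+ k * (qvar ^ x) ^+ l * (qvar ^ y) ^+ m =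
    qvar ^ (k%:Z + x * l%:Z + y * m%:Z).
  by rewrite !expfzDr // !exprnP !exprz_exp.
have neq0 (x : tensor M) w : tcomp w x != 0 -> x != 0.
  by apply: contraNneq => ->; case: w => [[] []].
case: v lav la1 la2 W => [[] []] lav; rewrite /veps /= => la1 la2 W.
- exists (hw_vector (hw4 u (qvar ^ la col1) (qvar ^ la col2))); split; last exact: (hw4_killed A0 B0 eu1 eu2 ku1 ku2).
    apply: (neq0 _ (true, true)); rewrite /tcomp /hw_vector tlin.
    rewrite (hw4_e2 A0 B0 eu2 ku2) UeZ (hw4'_e1 A0 B0 eu1 ku1) !UeZ (hw2_e2 A0 B0 eu2 ku2).
    apply: (snz); first by rewrite oppr_eq0 nq.
    apply: (snz); first by rewrite oppr_eq0 pow; apply: (br_neq0 _ d0); lia.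
    apply: (snz); first by rewrite oppr_eq0 -[_ ^ la col2]expr1 pow; apply: (br_neq0 _ d0); lia.
    by apply: (snz) u0; apply: (br_neq0 _ d0); lia.
  have w1 := Uf_weight col2 (Uf_weight col1 (Uf_weight col2 lu)).
  have w2 := Uf_weight col2 (Uf_weight col2 (Uf_weight col1 lu)).
  have w3 := Uf_weight col1 (Uf_weight col2 (Uf_weight col2 lu)).
  pose mu i : int := la i - cartan i col2 - cartan i col1 - cartan i col2.
  apply: (W _ mu); last by move=> i; rewrite /mu /vwt /vphi /veps; case: i => /=; lia.
  move=> i; rewrite /hw4 !UkD !UkN !UkZ w1 w2 w3.
  have -> : la i - cartan i col1 - cartan i col2 - cartan i col2 = mu i by rewrite /mu; lia.
  have -> : la i - cartan i col2 - cartan i col2 - cartan i col1 = mu i by rewrite /mu; lia.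
  by rewrite -/(mu i); lmod_eq Qq M; ring.
- exists (hw_vector (hw3 u (qvar ^ la col1))); split; last exact: (hw3_killed A0 B0 eu1 eu2 ku1 ku2).
    apply: (neq0 _ (true, false)); rewrite /tcomp /hw_vector tlin.
    rewrite (hw3_e2 A0 B0 eu2 ku2) !UeZ (f1_e1 A0 B0 eu1 ku1).
    apply: (snz); first by rewrite nq.
    apply: (snz); first by rewrite oppr_eq0 -[_ ^ la col2]expr1 pow; apply: (br_neq0 _ d0); lia.
    by apply: (snz) u0; rewrite exprnP exprz_exp; apply: (br_neq0 _ d2); lia.
  have w1 := Uf_weight col1 (Uf_weight col2 lu).
  have w2 := Uf_weight col2 (Uf_weight col1 lu).
  pose mu i : int := la i - cartan i col2 - cartan i col1.
  apply: (W _ mu); last by move=> i; rewrite /mu /vwt /vphi /veps; case: i => /=; lia.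
  move=> i; rewrite /hw3 !UkD !UkN !UkZ w1 w2.
  have -> : la i - cartan i col1 - cartan i col2 = mu i by rewrite /mu; lia.
  by rewrite -/(mu i); lmod_eq Qq M; ring.
- exists (hw_vector (hw2 u)); split; last exact: (hw2_killed A0 B0 eu1 eu2 ku2).
    apply: (neq0 _ (false, true)); rewrite /tcomp /hw_vector tlin.
    rewrite (hw2_e2 A0 B0 eu2 ku2); apply: (snz); first by rewrite oppr_eq0 invr_eq0.
    by apply: (snz) u0; apply: (br_neq0 _ d0); lia.
  apply: (W _ _ (Uf_weight col2 lu)) => i; rewrite /vwt /vphi /veps; case: i => /=; lia.
exists (hw_vector u); split.
- by apply: (neq0 _ (false, false)); rewrite /tcomp /hw_vector tlin.
- exact: hw_vector_weight.
- by apply: hw_vector_e; rewrite ?(eu, Ue0).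
Qed.

(** * Forms orthonormal modulo q and irreducibility *)

Lemma ratQqD r s : ratQq (r + s) = ratQq r + ratQq s.
Proof. by rewrite /ratQq polyCD rmorphD. Qed.
Lemma ratQqM r s : ratQq (r * s) = ratQq r * ratQq s.
Proof. by rewrite /ratQq polyCM rmorphM. Qed.
Lemma ratQq0 : ratQq 0 = 0.
Proof. by rewrite /ratQq polyC0 rmorph0. Qed.
Lemma ratQq_sum I (r : seq I) (F : I -> rat) : ratQq (\sum_(i <- r) F i) = \sum_(i <- r) ratQq (F i).
Proof. by apply: (big_morph ratQq); [apply: ratQqD|apply: ratQq0]. Qed.

(** Modulo [q] this is a sum of squares of rational numbers, not all zero. *)
Lemma sum_sqr_not_small (X : finType) (a : X -> Qq) :
  (forall x, regular0 (a x)) -> (exists x, ~ small (a x)) -> ~ small (\sum_x a x * a x).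
Proof.
move=> aA [x xns] ss; have /fin_all_exists[r ra] := fun x => regular0_residue (aA x).
have sr : small (ratQq (\sum_x r x * r x)).
  rewrite -[ratQq _](subKr (\sum_x a x * a x)); apply: smallB => //.
  rewrite ratQq_sum -sumrB; apply: small_sum => y _; rewrite ratQqM.
  have -> : a y * a y - ratQq (r y) * ratQq (r y) = (a y - ratQq (r y)) * (a y + ratQq (r y)).
    by ring.
  by apply: smallMr => //; apply: regular0_add => //; apply: regular0_rat.
have /eqP := small_rat sr; rewrite psumr_eq0 => [/allP/(_ x)|y _]; last by rewrite -expr2 sqr_ge0.
rewrite mem_index_enum => /(_ isT) /=; rewrite mulf_eq0 orbb => /eqP rx.
by apply: xns; have := ra x; rewrite rx ratQq0 subr0.
Qed.

(** The induction data: a weight basis spanning the crystal lattice, a contravariant form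
    orthonormal on it modulo [q], and for each colour an exact string basis congruent to it modulo
    [q]. *)
Record crystal_module (X : finType) (C : crystal X) (M : Uq_module) (b : X -> M)
    (co : X -> M -> Qq) (B : M -> M -> Qq) : Prop := CrystalModule {
  cm_coords : coords b co;
  cm_weight : forall x, weight_vector (cwt C x) (b x);
  cm_form : contravariant B;
  cm_gram : forall x y, small (B (b x) (b y) - (x == y)%:R);
  cm_string : forall i, exists c, string_vectors C i c /\ forall y, inqL co (c y - b y) }.

Lemma tensor_crystal_module X (C : crystal X) M b co B : @crystal_module X C M b co B ->
  crystal_module (tensor_crystal C) (tbasis b) (tcoord co) (tform B).
Proof.
move=> [bco bw Bf gram str]; split.
- exact: tcoords.
- by case=> x v i; rewrite tensor_cwt; apply: (tinj_weight v (bw x)).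
- exact: tform_contravariant.
- exact: tform_gram.
move=> i; have [c [cs cb]] := str i; exists (tstring C i c); split.
  exact: tstring_vectors.
exact: tstring_congr.
Qed.

Lemma weight_vector_ext (M : Uq_module) la mu (v : M) :
  la =1 mu -> weight_vector la v -> weight_vector mu v.
Proof. by move=> lm lv i; rewrite -lm. Qed.

Lemma weight_basis_coord (M : Uq_module) (X : finType) (b : X -> M) co (wt : X -> weight) :
  coords b co -> (forall x, weight_vector (wt x) (b x)) ->
  forall la v y, weight_vector la v -> co y v != 0 -> la =1 wt y.
Proof.
move=> bco bw la v y lv vy j; have := congr1 (co y) (lv j); rewrite (coZ bco).
rewrite {1}[v](co_span bco) linear_sum (co_sum bco) (bigD1 y) //= big1 ?addr0.
  by rewrite linearZ (coZ bco) /= bw (coZ bco) (co_basis bco) eqxx mulr1 mulrC => /(mulIf vy)/qvar_exp_inj.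
move=> x /negPf xy; rewrite linearZ (coZ bco) /= bw (coZ bco) (co_basis bco) xy.
by rewrite !mulr0.
Qed.

                                                   
(** The coefficients are chosen so that both simple roots have height 2; thus every [e_i] raises the
    height by 2, and heights serve as the measure of all inductions along the crystal. *)
Definition ht (la : weight) : int := 4 * la col1 + 3 * la col2.

Lemma ht_ext la mu : la =1 mu -> ht la = ht mu.
Proof. by move=> h; rewrite /ht !h. Qed.

Lemma ht_add la i : ht (fun j => la j + cartan j i) = ht la + 2.
Proof. by rewrite /ht; case: i => /=; lia. Qed.

Lemma ht_ce X (C : crystal X) i x y : ce C i x = Some y -> ht (cwt C y) = ht (cwt C x) + 2.
Proof.
move/ce_cf/cwt_cf => h; rewrite -(ht_add _ i); apply: ht_ext => j.
by have := h j; rewrite /cwt; lia.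
Qed.

Lemma ht_bound (X : finType) (C : crystal X) : exists n : nat, forall x, ht (cwt C x) <= n%:Z.
Proof.
exists (\max_x `|ht (cwt C x)|)%N => x.
by have := @leq_bigmax _ (fun x => `|ht (cwt C x)|)%N x; rewrite /=; lia.
Qed.

Section FSpan.
Variable M : Uq_module.

(** Only the [f_i] occur: for a highest weight vector [x] the commutation relations make this span
    stable under all generators ([fspan_submodule]). *)
Inductive fspan (x : M) : M -> Prop :=
  | fspan_gen : fspan x x
  | fspan0 : fspan x 0
  | fspan_lin a u v : fspan x u -> fspan x v -> fspan x (a *: u + v)
  | fspan_f i u : fspan x u -> fspan x (Uf i u).

Variables (x : M) (la : weight).
Hypotheses (lx : weight_vector la x) (ex : forall i, Ue i x = 0).

Lemma fspanZ a u : fspan x u -> fspan x (a *: u).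
Proof. by move=> xu; rewrite -[_ *: u]addr0; apply: fspan_lin => //; apply: fspan0. Qed.

Lemma fspanD u v : fspan x u -> fspan x v -> fspan x (u + v).
Proof. by move=> xu xv; rewrite -[u]scale1r; apply: fspan_lin. Qed.

Lemma fspan_k i u : fspan x u -> fspan x (Uk i u).
Proof.
elim=> [||a {}u v _ IHu _ IHv|j {}u _ IHu].
- by rewrite lx; apply: fspanZ; apply: fspan_gen.
- by rewrite linear0; apply: fspan0.
- by rewrite linearP; apply: fspan_lin.
- by rewrite Ukf; apply: fspanZ; apply: fspan_f.
Qed.

Lemma fspan_kV i u : fspan x u -> fspan x (UkV i u).
Proof.
elim=> [||a {}u v _ IHu _ IHv|j {}u _ IHu].
- by rewrite (UkV_weight i lx); apply: fspanZ; apply: fspan_gen.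
- by rewrite linear0; apply: fspan0.
- by rewrite linearP; apply: fspan_lin.
- by rewrite UkVf; apply: fspanZ; apply: fspan_f.
Qed.

Lemma fspan_e i u : fspan x u -> fspan x (Ue i u).
Proof.
elim=> [||a {}u v _ IHu _ IHv|j {}u xu IHu].
- by rewrite ex; apply: fspan0.
- by rewrite linear0; apply: fspan0.
- by rewrite linearP; apply: fspan_lin.
rewrite -[Ue i _](subrK (Uf j (Ue i u))) Uef; apply: fspanD; last exact: fspan_f.
case: eq_color; last exact: fspan0.
apply: fspanZ; rewrite addrC -scaleN1r; apply: fspan_lin.
  by elim: (halfnorm i) => //= n; apply: fspan_kV.
by elim: (halfnorm i) => //= n; apply: fspan_k.
Qed.

Lemma fspan_submodule : submodule (fspan x).
Proof.
split; [exact: fspan0|exact: fspan_lin|move=> i v xv; split].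
- exact: fspan_e.
- exact: fspan_f.
- exact: fspan_k.
- exact: fspan_kV.
Qed.

Variable B : M -> M -> Qq.
Hypothesis BM : contravariant B.

(** The adjoint of [f_i] is a multiple of [t_i e_i], which kills [z]. *)
Lemma fspan_orthogonal_hw z : (forall i, Ue i z = 0) -> B z x = 0 ->
  forall v, fspan x v -> B z v = 0.
Proof.
move=> ez zx v; elim=> [//||a {}u w _ IHu _ IHw|i {}u _ IHu].
- exact: (form0r BM).
- by rewrite (formDr BM) (formZr BM) IHu IHw mulr0 addr0.
have [_ _ Bf _] := BM; rewrite (form_sym BM) Bf ez.
have -> : iter (halfnorm i) (Uk i) (0 : M) = 0 by elim: (halfnorm i) => //= n ->; rewrite linear0.
by rewrite (form0r BM) mulr0.
Qed.

End FSpan.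

Lemma fspan_orthogonal (M : Uq_module) (B : M -> M -> Qq) (x y : M) la mu i :
  contravariant B -> weight_vector la x -> weight_vector mu y ->
  (forall i, Ue i x = 0) -> (forall i, Ue i y = 0) -> la i != mu i ->
  forall u v, fspan x u -> fspan y v -> B u v = 0.
Proof.
move=> BM lx my ex ey lm u v xu yv; elim: xu v yv => [v yv||a {}u w _ IHu _ IHw v yv|j {}u _ IHu v yv].
- by apply: (fspan_orthogonal_hw BM ex) yv; apply: (form_weight BM lx my lm).
- by move=> v _; apply: (form0l BM).
- by rewrite (formDl BM) (formZl BM) IHu // IHw // mulr0 addr0.
have [_ _ Bf _] := BM; rewrite Bf IHu ?mulr0 //.
by elim: (halfnorm j) => /= [|n]; [apply: (fspan_e my ey)|apply: (fspan_k my)].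
Qed.

Section CrystalModule.
Variables (X : finType) (C : crystal X) (M : Uq_module) (b : X -> M).
Variables (co : X -> M -> Qq) (B : M -> M -> Qq).
Hypothesis CM : crystal_module C b co B.
Let bco := cm_coords CM.
Let BM := cm_form CM.

Lemma form_inL u v : inL co u -> inL co v ->
  small (B u v - \sum_x co x u * co x v).
Proof.
move=> uL vL; rewrite {1}[u](co_span bco) (form_suml BM) -sumrB.
apply: small_sum => x _; rewrite (formZl BM) -mulrBr; apply: smallMl => //.
rewrite -[X in _ - X](co_comb bco x (fun y => co y v)) (co_sum bco) {1}[v](co_span bco).
rewrite (form_sumr BM) -sumrB; apply: small_sum => y _.
rewrite (formZr BM) (coZ bco) -mulrBr; apply: smallMl => //.
by rewrite (co_basis bco) eq_sym; apply: (cm_gram CM).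
Qed.

Lemma form_small u v : inqL co u -> inL co v -> small (B u v).
Proof.
move=> uq vL; rewrite -[B u v](subrK (\sum_x co x u * co x v)); apply: smallD.
  by apply: form_inL => //; apply: inqL_inL.
by apply: small_sum => x _; apply: smallMr.
Qed.

(** Scaled to be primitive, a nonzero [v] has a norm congruent modulo [q] to a nonzero sum of
    squares. *)
Lemma form_anisotropic v : B v v = 0 -> v = 0.
Proof.
move=> Bv; apply/eqP/negPn/negP => /(primitive_vector bco)[k [kL ns]].
have := form_inL kL kL; rewrite (formZl BM) (formZr BM) Bv !mulr0 sub0r => /smallN.
by rewrite opprK; apply: sum_sqr_not_small.
Qed.

(** Subtract from [z] its orthogonal projection on [x]. The difference is a highest weight vector
    orthogonal to [x], hence to all of [fspan x], hence to itself. *)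
Lemma hw_vector_unique (x : M) la z : weight_vector la x -> (forall i, Ue i x = 0) -> x != 0 ->
  fspan x z -> (forall i, Ue i z = 0) -> exists a, z = a *: x.
Proof.
move=> lx ex x0 xz ez; pose a := B z x / B x x; exists a.
have Bx : B x x != 0 by apply: contra_neq x0; apply: form_anisotropic.
apply/eqP; rewrite -subr_eq0; apply/eqP/form_anisotropic.
have xz' : fspan x (z - a *: x).
  by rewrite addrC -scaleNr; apply: fspan_lin => //; apply: fspan_gen.
apply: (fspan_orthogonal_hw BM _ _ xz') => [i|].
  by rewrite linearB linearZ /= ez ex scaler0 subr0.
by rewrite -scaleNr (formDl BM) (formZl BM) mulNr divfK // subrr.
Qed.

(** Each [e_i] raises the heights of the weights occurring in a vector, and these heights are
    bounded. *)
Lemma climb (W : M -> Prop) (v : M) : (forall i (u : M), W u -> W (Ue i u)) -> W v -> v != 0 ->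
  exists y, [/\ W y, y != 0 & forall i, Ue i y = 0].
Proof.
move=> We; have [H Hb] := ht_bound C.
suff key : forall n v, (forall x, co x v != 0 -> H%:Z - ht (cwt C x) < n%:Z) -> W (v : M) -> v != 0 ->
    exists y, [/\ W y, y != 0 & forall i, Ue i y = 0].
  move=> Wv v0; apply: (key (\max_x `|H%:Z - ht (cwt C x)|.+1)%N v) => // x _.
  have := @leq_bigmax _ (fun x => `|H%:Z - ht (cwt C x)|.+1)%N x; rewrite /=; lia.
elim=> [|n IHn] {}v vn Wv v0.
  case/negP: v0; apply/eqP/(co_eq bco) => x; rewrite (co0 bco); apply/eqP/negPn/negP => /vn.
  by have := Hb x; lia.
have step i : Ue i v != 0 -> exists y, [/\ W y, y != 0 & forall i, Ue i y = 0].
  move=> ev; apply: (IHn (Ue i v)); [|exact: (We)|exact: ev].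
  move=> x; rewrite {1}[v](co_span bco) linear_sum (co_sum bco) => xv.
  have [y vy] : exists y, co x (Ue i (co y v *: b y)) != 0.
    have [y vy|none] := pickP (fun y => co x (Ue i (co y v *: b y)) != 0); first by exists y.
    case/negP: xv; rewrite big1 // => y _; apply/eqP; by have /negbFE := none y.
  move: vy; rewrite linearZ (coZ bco) /= mulf_eq0 negb_or => /andP[/vn yn xy].
  have := weight_basis_coord bco (cm_weight CM) (Ue_weight i (cm_weight CM y)) xy.
  by move/ht_ext; rewrite ht_add; lia.
have [e1|/step //] := eqVneq (Ue col1 v) 0; have [e2|/step //] := eqVneq (Ue col2 v) 0.
by exists v; split => // -[].
Qed.

(** A nonzero submodule contains, by climbing, a nonzero highest weight vector, which is a multiple
    of the generator [x]. *)
Lemma fspan_irreducible (x : M) la : weight_vector la x -> (forall i, Ue i x = 0) ->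
  (forall v, fspan x v) -> x != 0 -> irreducible M.
Proof.
move=> lx ex xM x0; split; first by exists x.
move=> W [W0 WP Wop]; have [[w [Ww w0]]|none] := classic (exists w, W w /\ w != 0); last first.
  by left=> v Wv; apply/eqP/negPn/negP => v0; apply: none; exists v.
right=> v; have We i u : W u -> W (Ue i u) by case/(Wop i).
have [y [Wy y0 ey]] := climb We Ww w0.
have [a ya] := hw_vector_unique lx ex x0 (xM y) ey.
have a0 : a != 0 by apply: contra_neq y0 => a0; rewrite ya a0 scale0r.
have Wx : W x by rewrite -[x](scalerK a0) -ya; apply: subspaceZ.
elim: (xM v) => // [a' u u' _ Wu _|i u _ /(Wop i)[]//]; exact: WP.
Qed.
End CrystalModule.

(** * Cutting out one connected component *)

Section Submodule.
Variables (M : Uq_module) (V : lmodType Qq) (io : {linear V -> M}) (pr : {linear M -> V}).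
Variable N : M -> Prop.
Hypotheses (Nsub : submodule N) (ioN : forall a, N (io a)).
Hypotheses (ioK : forall a, pr (io a) = a) (prK : forall v, N v -> io (pr v) = v).

(** On the submodule [N] the maps [io] and [pr] are mutually inverse, so conjugating the generators
    turns [N] into a module carried by [V]; each relation is checked after the injection [io]. *)
Definition se i : {linear V -> V} := pr \o (Ue i \o io).
Definition sf i : {linear V -> V} := pr \o (Uf i \o io).
Definition sk i : {linear V -> V} := pr \o (Uk i \o io).
Definition skV i : {linear V -> V} := pr \o (UkV i \o io).

Lemma io_e i a : io (se i a) = Ue i (io a).
Proof. by rewrite [LHS]prK //; have [_ _ h] := Nsub; have [] := h i _ (ioN a). Qed.
Lemma io_f i a : io (sf i a) = Uf i (io a).
Proof. by rewrite [LHS]prK //; have [_ _ h] := Nsub; have [] := h i _ (ioN a). Qed.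
Lemma io_k i a : io (sk i a) = Uk i (io a).
Proof. by rewrite [LHS]prK //; have [_ _ h] := Nsub; have [] := h i _ (ioN a). Qed.
Lemma io_kV i a : io (skV i a) = UkV i (io a).
Proof. by rewrite [LHS]prK //; have [_ _ h] := Nsub; have [] := h i _ (ioN a). Qed.

Lemma io_inj : injective io. Proof. exact: can_inj ioK. Qed.

Lemma io_iter (s : V -> V) (S : M -> M) n a : (forall a, io (s a) = S (io a)) ->
  io (iter n s a) = iter n S (io a).
Proof. by move=> h; elim: n => //= n IHn; rewrite h IHn. Qed.

Lemma skK i a : skV i (sk i a) = a.
Proof. by apply: io_inj; rewrite io_kV io_k UkK. Qed.
Lemma skVK i a : sk i (skV i a) = a.
Proof. by apply: io_inj; rewrite io_k io_kV UkVK. Qed.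
Lemma skC i j a : sk i (sk j a) = sk j (sk i a).
Proof. by apply: io_inj; rewrite !io_k UkC. Qed.
Lemma ske i j a : sk i (se j a) = qvar ^ cartan i j *: se j (sk i a).
Proof. by apply: io_inj; rewrite linearZ io_k !io_e io_k Uke. Qed.
Lemma skf i j a : sk i (sf j a) = qvar ^ (- cartan i j) *: sf j (sk i a).
Proof. by apply: io_inj; rewrite linearZ io_k !io_f io_k Ukf. Qed.
Lemma sef i j a : se i (sf j a) - sf j (se i a) =
  if eq_color i j then (qv i - (qv i)^-1)^-1
      *: (iter (halfnorm i) (sk i) a - iter (halfnorm i) (skV i) a) else 0.
Proof.
apply: io_inj; rewrite linearB io_e !io_f io_e Uef; case: eq_color; last by rewrite linear0.
rewrite linearZ; congr (_ *: _); rewrite [RHS]linearB; congr (_ - _); apply/esym/io_iter => b.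
  exact: io_k.
exact: io_kV.
Qed.

Lemma io_serre (s : color -> {linear V -> V}) (S : color -> {linear M -> M}) :
  (forall i a, io (s i a) = S i (io a)) -> serre (fun i v => S i v) -> serre (fun i v => s i v).
Proof.
move=> h /serreE[h1 h2]; apply/serreE; rewrite /serre112 /serre2221.
have ioD a b : io (a + b) = io a + io b by exact: linearD.
have ioB a : io (- a) = - io a by exact: linearN.
have ioZ c a : io (c *: a) = c *: io a by exact: linearZ.
split=> v; apply: io_inj; rewrite linear0 !(ioD, ioB, ioZ) !h.
  by rewrite -[RHS](h1 (io v)).
by rewrite -[RHS](h2 (io v)).
Qed.

Definition sub_module : Uq_module :=
  @UqModule V se sf sk skV skK skVK skC ske skf sef
    (io_serre io_e (@serre_e M)) (io_serre io_f (@serre_f M)).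

Lemma sub_contravariant (B : M -> M -> Qq) : contravariant B ->
  @contravariant sub_module (fun a a' => B (io a) (io a')).
Proof.
move=> BM; have [Bl Bs Bf Bk] := BM; split=> [a u v w|u v|i u v|i u v].
- by rewrite linearP Bl.
- exact: Bs.
- rewrite [Uf i u]/(sf i u) io_f Bf; congr (_ * B _ _).
  by rewrite (io_iter _ _ (io_k i)) io_e.
- by rewrite [Uk i u]/(sk i u) [Uk i v]/(sk i v) !io_k Bk.
Qed.

End Submodule.

Definition source X (C : crystal X) (x : X) : Prop := forall i, ce C i x = None.

Section Component.
Variables (X : finType) (C : crystal X) (M : Uq_module) (b : X -> M).
Variables (co : X -> M -> Qq) (B : M -> M -> Qq).
Hypothesis CM : crystal_module C b co B.
Hypothesis source_wt : forall c d, source C c -> source C d -> cwt C c =1 cwt C d -> c = d.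
Hypothesis source_hw : forall c, source C c ->
  exists x : M, [/\ x != 0, weight_vector (cwt C c) x & forall i, Ue i x = 0].
Let bco := cm_coords CM.
Let BM := cm_form CM.

(** A highest weight vector scaled to be primitive is killed by the [e_i], so its coordinates that
    are not small sit at sources of its own weight, that is, at [c] alone; divide by that
    coordinate. *)
Lemma source_lift c : source C c ->
  exists x : M, [/\ weight_vector (cwt C c) x, forall i, Ue i x = 0 & inqL co (x - b c)].
Proof.
move=> sc; have [x [x0 lx ex]] := source_hw sc.
have [k [xL [z zns]]] := primitive_vector bco x0; set y := qvar ^ k *: x in xL zns.
have ly : weight_vector (cwt C c) y by move=> i; rewrite linearZ /= lx !scalerA mulrC.
have ey i : Ue i y = 0 by rewrite linearZ /= ex scaler0.
clearbody y.
have only t : ~ small (co t y) -> t = c.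
  move=> tns; apply: source_wt => //.
    move=> i; have [cc [cs cb]] := cm_string CM i.
    have [ccc ccco] := near_basis bco cb; apply/eqP/negPn/negP => h.
    have := near_basis_co bco cb ccco t xL.
    by rewrite (e_kernel_coord ccco cs (ey i) h) subr0.
  move=> i; apply/esym; apply: (weight_basis_coord bco (cm_weight CM) ly).
  by apply: contra_notN tns => /eqP ->; apply: small0.
have ans : ~ small (co c y) by rewrite -(only z zns).
exists ((co c y)^-1 *: y); split.
- by move=> i; rewrite linearZ /= ly !scalerA mulrC.
- by move=> i; rewrite linearZ /= ey scaler0.
have aA := regular0_inv (xL c) ans.
have a0 : co c y != 0 by apply: contra_notN ans => /eqP ->; apply: small0.
move=> t; rewrite (coB bco) (coZ bco) (co_basis bco); case: eqP => [<-|ct].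
  by rewrite mulVf // subrr; apply: small0.
rewrite subr0; apply: smallMl => //; have [//|/only tc] := smallVnot (xL t).
by case: ct.
Qed.

Variables (Y : finType) (D : crystal Y) (io : Y -> X) (y0 : Y).
Hypotheses (io_inj : injective io).
Hypotheses (io_f : forall i y, cf C i (io y) = omap io (cf D i y)).
Hypotheses (io_e : forall i y, ce C i (io y) = omap io (ce D i y)).
Hypotheses (io_eps : forall i y, ceps C i (io y) = ceps D i y).
Hypotheses (io_phi : forall i y, cphi C i (io y) = cphi D i y).
Hypothesis y0_source : forall y, source D y <-> y = y0.

Let lift_data (xh : X -> M) := forall h, source C h ->
  [/\ weight_vector (cwt C h) (xh h), forall i, Ue i (xh h) = 0 & inqL co (xh h - b h)].

(** Starting from the lifted sources, Kashiwara's operators [f_i] descend the crystal. They preserve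
    congruence modulo [q], and by [crystal_op_submodule] the generated submodule, so each crystal
    element gets a lift in the module generated by the source of its component. *)
Lemma component_lifts (xh : X -> M) : lift_data xh -> forall c, exists h v,
  [/\ source C h, (h == io y0) = (c \in codom io), fspan (xh h) v,
      weight_vector (cwt C c) v & inqL co (v - b c)] /\ (c = h -> v = xh h).
Proof.
move=> xP; have [H Hb] := ht_bound C.
suff key : forall n c, H%:Z - ht (cwt C c) < n%:Z -> exists h v,
  [/\ source C h, (h == io y0) = (c \in codom io), fspan (xh h) v,
      weight_vector (cwt C c) v & inqL co (v - b c)] /\ (c = h -> v = xh h).
  by move=> c; apply: (key (`|H%:Z - ht (cwt C c)|.+1)); lia.
elim=> [|n IHn] c cn; first by have := Hb c; lia.
have step i d : ce C i c = Some d -> exists h v,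
  [/\ source C h, (h == io y0) = (c \in codom io), fspan (xh h) v,
      weight_vector (cwt C c) v & inqL co (v - b c)] /\ (c = h -> v = xh h).
  move=> cd; have [|h [v [[hs hc hv lv vb] _]]] := IHn d; first by have := ht_ce cd; lia.
  have [lx ex _] := xP h hs.
  have [cc [cs cb]] := cm_string CM i; have [ccc ccco] := near_basis bco cb.
  have /ce_cf dc := cd.
  exists h, (crystal_f C i cc ccc v); split; last by move=> ch; move: (hs i); rewrite -ch cd.
  split=> //.
  - rewrite hc; apply/codomP/codomP => -[y yE].
      by move: dc; rewrite yE io_f; case E: (cf D i y) => [z|//] [<-]; exists z.
    by move: cd; rewrite yE io_e; case E: (ce D i y) => [z|//] [<-]; exists z.
  - by have [] := crystal_op_submodule ccco cs (fspan_submodule lx ex) lv hv.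
  - apply: weight_vector_ext (crystal_f_weight ccco cs lv) => j.
    by have := cwt_cf dc j; rewrite /cwt; lia.
  have := crystal_f_modq C i ccco bco cb d; rewrite dc /= => h1.
  apply: (inqL_trans bco _ h1); rewrite -(crystal_fB C i ccco).
  exact: (crystal_f_inqL C i ccco bco cb vb).
case e1: (ce C col1 c) => [d|]; first exact: step e1.
case e2: (ce C col2 c) => [d|]; first exact: step e2.
have sc : source C c by case.
have [lx ex xb] := xP c sc; exists c, (xh c); split=> //; split=> //; last exact: fspan_gen.
apply/eqP/codomP => [->|[y yE]]; first by exists y0.
rewrite yE; congr io; apply/y0_source => i; have := sc i; rewrite yE io_e.
by case: (ce D i y).
Qed.

(** The lifts form a basis by the Nakayama argument, distributed in blocks lying in the modules
    generated by the various sources. These modules are mutually orthogonal, so the block of [io y0]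
    spans exactly the module generated by its source, and this module carries the crystal [D]. *)
Theorem crystal_component : exists (N : Uq_module) (b2 : Y -> N) co2 B2,
  [/\ crystal_module D b2 co2 B2, forall i, Ue i (b2 y0) = 0 & forall v, fspan (b2 y0) v].
Proof.
have /fin_all_exists[xh xP] : forall h, exists x : M, source C h ->
    [/\ weight_vector (cwt C h) x, forall i, Ue i x = 0 & inqL co (x - b h)].
  move=> h; have [sh|ns] := boolP [forall i : bool, ce C (if i then col1 else col2) h == None].
    have /source_lift[x xP] : source C h.
      by case; [have /forallP/(_ true)/eqP := sh|have /forallP/(_ false)/eqP := sh].
    by exists x.
  exists 0 => sh; case/negP: ns; apply/forallP => i; by rewrite sh.
have /fin_all_exists[hh hP] := component_lifts xP.
have {hP} /fin_all_exists[c cP] := hP.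
have hs x : source C (hh x) by have [[]] := cP x.
have hio x : (hh x == io y0) = (x \in codom io) by have [[]] := cP x.
have hc x : fspan (xh (hh x)) (c x) by have [[]] := cP x.
have cw x : weight_vector (cwt C x) (c x) by have [[]] := cP x.
have cb x : inqL co (c x - b x) by have [[]] := cP x.
have ch x : x = hh x -> c x = xh (hh x) by have [] := cP x.
have [cc ccco] := near_basis bco cb.
have ort h h' u v : source C h -> source C h' -> h != h' -> fspan (xh h) u -> fspan (xh h') v ->
    B u v = 0.
  move=> sh sh' hh' hu hv; have [lx ex _] := xP h sh; have [lx' ex' _] := xP h' sh'.
  have [e1|n1] := eqVneq (cwt C h col1) (cwt C h' col1); last first.
    exact: (fspan_orthogonal BM lx lx' ex ex' n1 hu hv).
  have [e2|n2] := eqVneq (cwt C h col2) (cwt C h' col2); last first.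
    exact: (fspan_orthogonal BM lx lx' ex ex' n2 hu hv).
  by case/eqP: hh'; apply: source_wt => // -[].
(* The part [v1] of [v] outside the block of [h] lies in [fspan (xh h)] and is a sum of vectors from
   blocks orthogonal to it; anisotropy makes it zero. *)
have supp h v : source C h -> fspan (xh h) v -> forall x, hh x != h -> cc x v = 0.
  move=> sh hv; pose v1 := \sum_(x | hh x != h) cc x v *: c x.
  have v1h : fspan (xh h) v1.
    have -> : v1 = v - \sum_(x | hh x == h) cc x v *: c x.
      by rewrite [X in X - _](co_span ccco) (bigID (fun x => hh x == h)) /= [RHS]addrC addKr.
    rewrite addrC -scaleN1r; apply: fspan_lin => //.
    apply: (big_ind (fspan (xh h))) => [|u w|x /eqP hx]; [exact: fspan0|exact: fspanD|].
    by apply: fspanZ; rewrite -hx.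
  have v10 : v1 = 0.
    apply: (form_anisotropic CM); rewrite {2}/v1 (form_sumr BM) big1 // => x hx.
    rewrite (formZr BM) (@ort h (hh x)) ?mulr0 //; by rewrite eq_sym.
  move=> x hx; have := congr1 (cc x) v10; rewrite (co0 ccco) (co_sum ccco) (bigD1 x) //= big1.
    by rewrite addr0 (coZ ccco) (co_basis ccco) eqxx mulr1.
  by move=> z /andP[_ /negPf zx]; rewrite (coZ ccco) (co_basis ccco) zx mulr0.
have hio0 y : hh (io y) = io y0 by apply/eqP; rewrite hio codom_f.
have s0 : source C (io y0) by rewrite -(hio0 y0).
have [lx ex xb] := xP _ s0.
have Nsub := fspan_submodule lx ex.
pose V : lmodType Qq := {ffun Y -> Qq^o}.
pose iof (a : V) : M := \sum_y a y *: c (io y).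
pose prf (v : M) : V := [ffun y => cc (io y) v].
have iof_lin : linear iof.
  move=> a u v; rewrite /iof scaler_sumr -big_split; apply: eq_bigr => y _ /=.
  by rewrite !ffunE scalerDl scalerA.
have prf_lin : linear prf.
  by move=> a u v; apply/ffunP => y; rewrite !ffunE (co_linear ccco).
pose iol : {linear V -> M} := HB.pack iof (GRing.isLinear.Build _ _ _ _ iof iof_lin).
pose prl : {linear M -> V} := HB.pack prf (GRing.isLinear.Build _ _ _ _ prf prf_lin).
have cc_io x a : cc x (iof a) = \sum_y (if io y == x then a y else 0).
  rewrite /iof (co_sum ccco); apply: eq_bigr => y _; rewrite (coZ ccco) (co_basis ccco).
  by case: eqP => _; rewrite ?mulr1 ?mulr0.
have cc_io1 y a : cc (io y) (iof a) = a y.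
  rewrite cc_io (bigD1 y) //= eqxx big1 ?addr0 // => z /negPf zy.
  by rewrite (inj_eq io_inj) zy.
have cc_io0 x a : x \notin codom io -> cc x (iof a) = 0.
  move=> xn; rewrite cc_io big1 // => y _; case: eqP => // yx.
  by case/negP: xn; rewrite -yx codom_f.
have ioN a : fspan (xh (io y0)) (iol a).
  apply: (big_ind (fspan (xh (io y0)))) => [|u w|y _]; [exact: fspan0|exact: fspanD|].
  by apply: fspanZ; rewrite -(hio0 y).
have prK v : fspan (xh (io y0)) v -> iol (prl v) = v.
  move=> Nv; apply: (co_eq ccco) => x; have [/codomP[y ->]|xn] := boolP (x \in codom io).
    by rewrite cc_io1 ffunE.
  by rewrite cc_io0 // (supp _ _ s0 Nv) // hio.
have ioK a : prl (iol a) = a by apply/ffunP => y; rewrite ffunE cc_io1.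
have iolE a : iol a = \sum_y a y *: c (io y) by [].
have prlE v y : prl v y = cc (io y) v by rewrite ffunE.
clearbody iol prl; clear iof_lin prf_lin cc_io cc_io1 cc_io0 iof prf.
(* An operator preserving every block commutes with the projection on the block of [io y0]. *)
have prT (T : {linear M -> M}) : (forall h, source C h -> forall u, fspan (xh h) u -> fspan (xh h) (T u)) ->
    forall v, prl (T v) = prl (T (iol (prl v))).
  move=> Tsp v; apply/ffunP => y; rewrite !prlE; apply/eqP; rewrite -subr_eq0 -(coB ccco) -linearB.
  apply/eqP; set w := v - _; rewrite [w](co_span ccco) linear_sum (co_sum ccco) big1 // => x _.
  rewrite linearZ (coZ ccco) /=; have [/codomP[z ->]|xn] := boolP (x \in codom io).
    by rewrite /w (coB ccco) -!prlE ioK subrr mul0r.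
  rewrite (supp _ _ (hs x) (Tsp _ (hs x) _ (hc x))) ?mulr0 // hio0 eq_sym.
  by rewrite hio.
have prE i v : prl (Ue i v) = prl (Ue i (iol (prl v))).
  by apply: prT => h sh u; have [l e _] := xP h sh; apply: (fspan_e l e).
have prF i v : prl (Uf i v) = prl (Uf i (iol (prl v))).
  by apply: prT => h sh u; apply: fspan_f.
have prU i v : prl (Uk i v) = prl (Uk i (iol (prl v))).
  by apply: prT => h sh u; have [l e _] := xP h sh; apply: (fspan_k l).
have cio0 : c (io y0) = xh (io y0) by rewrite -[in RHS](hio0 y0) ch // hio0.
have cwio y : cwt C (io y) =1 cwt D y by move=> i; rewrite /cwt io_phi io_eps.
have b2K y : iol (prl (c (io y))) = c (io y) by apply: prK; rewrite -(hio0 y).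
pose N := sub_module Nsub ioN ioK prK.
have NkE i (a : N) : Uk i a = prl (Uk i (iol a)) by [].
have NfE i (a : N) : Uf i a = prl (Uf i (iol a)) by [].
have NeE i (a : N) : Ue i a = prl (Ue i (iol a)) by [].
exists N, (fun y => prl (c (io y)) : N), (fun y (a : N) => (a : V) y), (fun a a' : N => B (iol a) (iol a')).
split=> [|i|v].
- split.
  + split=> [x a u v|x y|v].
    * by rewrite !ffunE.
    * by rewrite prlE (co_basis ccco) (inj_eq io_inj).
    * rewrite -[LHS]ioK iolE linear_sum; apply: eq_bigr => y _.
      exact: linearZ.
  + move=> y i; rewrite (NkE i (prl (c (io y)))) b2K cw linearZ /=; congr (_ ^ _ *: _).
    exact: cwio.
  + exact: sub_contravariant.
  + move=> x y; rewrite !b2K -(inj_eq io_inj).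
    have bL z : inL co (b z) by apply: inL_basis.
    have cL z : inL co (c z) by apply: (inL_congr bco (cb z)).
    have -> : B (c (io x)) (c (io y)) = B (c (io x) - b (io x)) (c (io y)) +
        B (c (io y) - b (io y)) (b (io x)) + B (b (io x)) (b (io y)).
      rewrite [B (_ - _) (b _)](form_sym BM) -addrA -(formDr BM) subrK -(formDl BM).
      by rewrite subrK.
    rewrite -addrA; apply: smallD; last exact: (cm_gram CM).
    by apply: smallD; apply: (form_small CM).
  + move=> i; have [c1 [cs c1b]] := cm_string CM i; exists (fun y => prl (c1 (io y)) : N).
    have ocio o : prl (oc c1 (omap io o)) = oc (M := N) (fun y => prl (c1 (io y))) o.
      by case: o => [y|] //; exact: (linear0 prl).
    split=> [y|y x]; last first.
      rewrite -linearB prlE; apply/(near_basis_inqL bco cb ccco): (io x).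
      by apply: (inqL_trans bco (c1b _)); apply: (inqL_sym bco).
    have [wy fy ey] := cs (io y); split.
    * move=> j; rewrite (NkE j (prl (c1 (io y)))) -prU wy linearZ /=; congr (_ ^ _ *: _).
      exact: cwio.
    * rewrite (NfE i (prl (c1 (io y)))) -prF fy linearZ /= io_f io_eps; congr (_ *: _).
      exact: ocio.
    * rewrite (NeE i (prl (c1 (io y)))) -prE ey linearZ /= io_e io_phi; congr (_ *: _).
      exact: ocio.
- by rewrite (NeE i (prl (c (io y0)))) b2K cio0 ex; exact: (linear0 prl).
have key w : fspan (xh (io y0)) w -> @fspan N (prl (c (io y0))) (prl w).
  elim=> [||a u u' _ IHu _ IHu'|i u Nu IHu].
  - by rewrite cio0; apply: fspan_gen.
  - by rewrite linear0; apply: fspan0.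
  - by rewrite linearP; apply: fspan_lin.
  - by rewrite prF; apply: (@fspan_f N).
by rewrite -[v]ioK; apply: key.
Qed.
End Component.

                                                                                          
                                                    
(** * The combinatorial model *)

(** The tuple (x, y, k, j, s) is the point at signed distance [s] from the centre (x, y, k, k + 2j)
    on its 2-string; ordinary vertices are those whose last two coordinates differ by an even
    number. The bounds on [s] in [in_model] are the lengths of the two halves of the string. *)
Definition qpoint := (int * int * int * int * int)%type.

Section Model.
Variables a b : nat.

Definition in_model (p : qpoint) : bool :=
  let: (x, y, k, j, s) := p in
  [&& 0 <= y, y <= x, x <= a%:Z, 0 <= k, 0 <= j, k + 2 * j <= b%:Z, (x == y) || (j == 0),
      - (x - y + k) <= s & s <= x - y + b%:Z - k - 2 * j].

(** A 1-arrow moves the centre along II-edges of C(A, B) when s > 0 and along I-edges when s <= 0,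
    each diagonal step costing one unit of height. Where the next diagonal vertex is not ordinary
    two steps are made at once. From s = 1 with x = y one step of each colour is made, through the
    mid-point of a central edge. *)
Definition qf (i : color) (p : qpoint) : option qpoint :=
  let: (x, y, k, j, s) := p in
  if i is col1 then
    if 1 <= s then
      if y < x then Some (x, y + 1, k, j, s - 1)
      else if 2 <= s then Some (x, y, k, j + 1, s - 2) else Some (x, y, k + 1, j, -1)
    else if 0 < j then Some (x, y, k + 2, j - 1, s - 2)
    else if x < a%:Z then Some (x + 1, y, k, j, s - 1) else None
  else if s < x - y + b%:Z - k - 2 * j then Some (x, y, k, j, s + 1) else None.

Definition qe (i : color) (p : qpoint) : option qpoint :=
  let: (x, y, k, j, s) := p in
  if i is col1 then
    if s <= -1 then
      if y < x then Some (x - 1, y, k, j, s + 1)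
      else if s <= -2 then Some (x, y, k - 2, j + 1, s + 2) else Some (x, y, k - 1, j, 1)
    else if 0 < j then Some (x, y, k, j - 1, s + 2)
    else if 0 < y then Some (x, y - 1, k, j, s + 1) else None
  else if - (x - y + k) < s then Some (x, y, k, j, s - 1) else None.

Definition qphi (i : color) (p : qpoint) : nat :=
  let: (x, y, k, j, s) := p in
  if i is col1 then absz (Num.max s 0 + j + a%:Z - x)%R else absz (x - y + b%:Z - k - 2 * j - s)%R.

Definition qeps (i : color) (p : qpoint) : nat :=
  let: (x, y, k, j, s) := p in
  if i is col1 then absz (Num.max (- s) 0 + j + y)%R else absz (x - y + k + s)%R.

Ltac qcases := repeat match goal with
  | |- context [if ?c then _ else _] => case: (boolP c) => ? end.

Lemma qf_in p r i : in_model p -> qf i p = Some r -> in_model r.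
Proof.
move: p r => [[[[x y] k] j] s] [[[[x' y'] k'] j'] s']; rewrite /in_model /qf => h.
by case: i; qcases => // -[<- <- <- <- <-]; lia.
Qed.

Lemma qe_in p r i : in_model p -> qe i p = Some r -> in_model r.
Proof.
move: p r => [[[[x y] k] j] s] [[[[x' y'] k'] j'] s']; rewrite /in_model /qe => h.
by case: i; qcases => // -[<- <- <- <- <-]; lia.
Qed.

Lemma qe_qf p r i : in_model p -> in_model r -> qe i p = Some r <-> qf i r = Some p.
Proof.
move: p r => [[[[x y] k] j] s] [[[[x' y'] k'] j'] s']; rewrite /in_model /qe /qf => h h'.
by case: i; split; qcases => // -[? ? ? ? ?]; subst;
  first [by exfalso; lia | congr (Some (_, _, _, _, _)); lia].
Qed.

Lemma qe_None p i : in_model p -> (qe i p == None) = (qeps i p == 0%N).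
Proof.
move: p => [[[[x y] k] j] s]; rewrite /in_model /qe /qeps => h.
by case: i; qcases; apply/idP/idP => //; lia.
Qed.

Lemma qf_None p i : in_model p -> (qf i p == None) = (qphi i p == 0%N).
Proof.
move: p => [[[[x y] k] j] s]; rewrite /in_model /qf /qphi => h.
by case: i; qcases; apply/idP/idP => //; lia.
Qed.

Lemma qf_string p r i : in_model p -> qf i p = Some r ->
  qeps i r = (qeps i p).+1 /\ qphi i p = (qphi i r).+1.
Proof.
move: p r => [[[[x y] k] j] s] [[[[x' y'] k'] j'] s']; rewrite /in_model /qf /qeps /qphi => h.
by case: i; qcases => // -[? ? ? ? ?]; subst; lia.
Qed.

Lemma qf_wt p r i : in_model p -> qf i p = Some r -> forall j,
  (qphi j r)%:Z - (qeps j r)%:Z = (qphi j p)%:Z - (qeps j p)%:Z - cartan j i.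
Proof.
move=> h pr jj; have := qf_in h pr; move: p r h pr => [[[[x y] k] j] s] [[[[x' y'] k'] j'] s'].
rewrite /in_model /qf /qeps /qphi => h.
by case: i; case: jj; qcases => // -[? ? ? ? ?]; subst => /=; lia.
Qed.

Definition model_points : seq qpoint :=
  let A := [seq n%:Z | n <- iota 0 a.+1] in let B := [seq n%:Z | n <- iota 0 b.+1] in
  let S := [seq n%:Z - (a + b)%:Z | n <- iota 0 (2 * (a + b)).+1] in
  [seq p <- [seq (t, s) | t <- [seq (t, j) | t <- [seq (t, k) | t <- [seq (x, y) | x <- A, y <- A],
      k <- B], j <- B], s <- S] | in_model p].

Lemma mem_model_points p : (p \in model_points) = in_model p.
Proof.
rewrite mem_filter; apply/andb_idr; move: p => [[[[x y] k] j] s] h.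
have memi (z : int) n : 0 <= z -> z <= n%:Z -> z \in [seq m%:Z | m <- iota 0 n.+1].
  by move=> z0 zn; apply/mapP; exists (absz z); rewrite ?mem_iota; lia.
rewrite /in_model in h.
apply: allpairs_f; last first.
  by apply/mapP; exists (absz (s + (a + b)%:Z)); rewrite ?mem_iota; lia.
do 3!(apply: allpairs_f; last by apply: memi; lia).
by apply: memi; lia.
Qed.

Definition model := seq_sub model_points.
HB.instance Definition _ := Finite.on model.
Implicit Types u : model.

Lemma model_in u : in_model (val u).
Proof. by rewrite -mem_model_points; apply: valP. Qed.

Definition to_model p (h : in_model p) : model := SeqSub (etrans (mem_model_points p) h).

Definition model_f i u : option model := obind insub (qf i (val u)).
Definition model_e i u : option model := obind insub (qe i (val u)).

Lemma model_fP i u w : model_f i u = Some w <-> qf i (val u) = Some (val w).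
Proof.
rewrite /model_f; case E: (qf i (val u)) => [r|//] /=; have rin := qf_in (model_in u) E.
by split=> [/(congr1 (omap val))|[->]]; [rewrite insubT ?mem_model_points //= => -[->]|rewrite valK].
Qed.

Lemma model_eP i u w : model_e i u = Some w <-> qe i (val u) = Some (val w).
Proof.
rewrite /model_e; case E: (qe i (val u)) => [r|//] /=; have rin := qe_in (model_in u) E.
by split=> [/(congr1 (omap val))|[->]]; [rewrite insubT ?mem_model_points //= => -[->]|rewrite valK].
Qed.

Lemma model_f_omap i u : omap val (model_f i u) = qf i (val u).
Proof.
rewrite /model_f; case E: (qf i (val u)) => [r|//] /=; have rin := qf_in (model_in u) E.
by rewrite insubT ?mem_model_points.
Qed.

Lemma model_e_omap i u : omap val (model_e i u) = qe i (val u).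
Proof.
rewrite /model_e; case E: (qe i (val u)) => [r|//] /=; have rin := qe_in (model_in u) E.
by rewrite insubT ?mem_model_points.
Qed.

Lemma model_e_f i u w : model_e i u = Some w <-> model_f i w = Some u.
Proof. by rewrite model_eP model_fP; apply: qe_qf; apply: model_in. Qed.

Lemma model_e_None i u : (model_e i u == None) = (qeps i (val u) == 0%N).
Proof. by rewrite -qe_None ?model_in // -model_e_omap; case: (model_e i u). Qed.

Lemma model_f_None i u : (model_f i u == None) = (qphi i (val u) == 0%N).
Proof. by rewrite -qf_None ?model_in // -model_f_omap; case: (model_f i u). Qed.

Definition model_crystal : crystal model := @Crystal model model_e model_f
  (fun i u => qeps i (val u)) (fun i u => qphi i (val u)) model_e_f model_e_None model_f_None
  (fun i u w h => (qf_string (model_in u) ((model_fP i u w).1 h)).1)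
  (fun i u w h => (qf_string (model_in u) ((model_fP i u w).1 h)).2)
  (fun i u w h => qf_wt (model_in u) ((model_fP i u w).1 h)).

Lemma source_in : in_model (0, 0, 0, 0, 0).
Proof. by rewrite /in_model; lia. Qed.

Definition model_source : model := to_model source_in.

Lemma model_sourceP u : source model_crystal u <-> u = model_source.
Proof.
split=> [su|->]; last first.
  by move=> i; apply/eqP; rewrite model_e_None /= /qeps; case: i.
have := su col1; have := su col2; move/eqP; rewrite model_e_None => e2 /eqP; rewrite model_e_None.
move: e2; rewrite /= => e2 e1; apply: val_inj; have := model_in u; move: e1 e2.
case: u {su} => -[[[[x y] k] j] s] /= _; rewrite /qeps /in_model => e1 e2 h.
by congr (_, _, _, _, _); lia.
Qed.

End Model.

(** * Realizing the model inside tensor products *)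

Definition realizable (X : finType) (C : crystal X) (x0 : X) : Prop :=
  exists (M : Uq_module) (b : X -> M) co B,
    [/\ crystal_module C b co B, forall i, Ue i (b x0) = 0 & forall v, fspan (b x0) v].

Section TensorComponent.
Variables (X : finType) (C : crystal X) (x0 : X).
Hypothesis x0_source : forall x, source C x <-> x = x0.
Variables (Y : finType) (D : crystal Y) (y0 : Y) (io : Y -> X * spin).
Hypothesis y0_source : forall y, source D y <-> y = y0.
Hypotheses (io_inj : injective io).
Hypotheses (io_f : forall i y, cf (tensor_crystal C) i (io y) = omap io (cf D i y)).
Hypotheses (io_eps : forall i y, ceps (tensor_crystal C) i (io y) = ceps D i y).
Hypotheses (io_phi : forall i y, cphi (tensor_crystal C) i (io y) = cphi D i y).

Lemma tensor_source x v : source (tensor_crystal C) (x, v) ->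
  x = x0 /\ forall i, (veps i v <= cphi C i x0)%N.
Proof.
move=> s; have h i : (ceps C i x == 0%N) && (veps i v <= cphi C i x)%N.
  by have := txe_None C i (x, v); rewrite [txe C i (x, v)](s i) eqxx /txeps /= => /esym; rewrite addn_eq0 subn_eq0.
have <- : x = x0.
  by apply/x0_source => i; apply/eqP; rewrite ce_None; have /andP[] := h i.
by split=> // i; have /andP[] := h i.
Qed.

Lemma spin_wt_inj v w : (forall i, vwt v i = vwt w i) -> v = w.
Proof.
by move=> h; have := h col1; have := h col2; case: v w {h} => [[] []] [[] []].
Qed.

(** A source of the tensor crystal is [x0] tensor some [v]. The weights of V are distinct, so
    weights separate sources, and [tensor_highest_weight] provides a highest weight vector for each;
    hence [crystal_component] applies. *)
Lemma tensor_component : realizable C x0 -> realizable D y0.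
Proof.
move=> [M [b [co [B [CM eb fb]]]]].
have TM := tensor_crystal_module CM; have bco := cm_coords CM.
apply: (crystal_component TM _ _ io_inj io_f _ io_eps io_phi y0_source).
- move=> [x v] [y w] /tensor_source[-> _] /tensor_source[-> _] h.
  by congr pair; apply: spin_wt_inj => i; have := h i; rewrite !tensor_cwt; lia.
- move=> [x v] /tensor_source[-> hv].
  have b0 : b x0 != 0.
    apply: contraNneq (oner_neq0 Qq) => b0; have := co_basis bco x0 x0.
    by rewrite b0 (co0 bco) eqxx mulr1n => <-.
  have [i|z [z0 lz ez]] := tensor_highest_weight (v := v) b0 (cm_weight CM x0) eb.
    have sx : source C x0 by apply/x0_source.
    have : ceps C i x0 = 0%N by apply/eqP; rewrite -ce_None sx.
    by rewrite /cwt; have := hv i; lia.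
  exists z; split=> //; apply: weight_vector_ext lz => i.
  by rewrite tensor_cwt.
move=> i y; case E: (ce D i y) => [z|].
  have /ce_cf E' := E; transitivity (Some (io z)) => //; apply/ce_cf; by rewrite io_f E'.
apply/eqP; rewrite [omap _ _]/=; by rewrite ce_None io_eps -ce_None E.
Qed.

End TensorComponent.

Lemma qpoint_split (P : qpoint -> Prop) : (forall x y k j s, P (x, y, k, j, s)) -> forall p, P p.
Proof. by move=> h [[[[x y] k] j] s]. Qed.

Ltac embcases := repeat match goal with
  | |- context [if ?c then _ else _] =>
    lazymatch c with context [if _ then _ else _] => fail | _ => case: (boolP c); rewrite ?/veps ?/qphi /= => ? end end.

Section EmbeddingB.
Variables a b : nat.

(** The component of source tensor v1 in the product of the model (a, b) with V, in closed form; the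
    weight of v1 is (0, 1). *)
Definition embB (p : qpoint) : qpoint * spin :=
  let: (x, y, k, j, s) := p in
  if k + 2 * j <= b%:Z then
    if s < x - y + b%:Z + 1 - k - 2 * j then (p, (false, false))
    else ((x, y, k, j, s - 1), (false, true))
  else if 0 < j then ((x, y, k + 1, j - 1, s - 1), (false, true))
  else if x < a%:Z then ((x + 1, y, k - 1, j, s), (false, true))
  else if s < x - y then ((x, y, k - 1, j, s + 1), (true, false))
  else ((x, y, k - 1, j, s), (true, true)).

Lemma embB_in p : in_model a b.+1 p -> in_model a b (embB p).1.
Proof.
by elim/qpoint_split: p => x y k j s; rewrite /in_model /embB => h; embcases => /=; lia.
Qed.

Lemma embB_inj p r : in_model a b.+1 p -> in_model a b.+1 r -> embB p = embB r -> p = r.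
Proof.
elim/qpoint_split: p => x y k j s; elim/qpoint_split: r => x' y' k' j' s'.
rewrite /in_model /embB => h h'; embcases; case=> *; subst; first [by exfalso; lia | congr (_, _, _, _, _); lia].
Qed.

Lemma embB_eps p i : in_model a b.+1 p ->
  (qeps i (embB p).1 + (veps i (embB p).2 - qphi a b i (embB p).1))%N = qeps i p.
Proof.
elim/qpoint_split: p => x y k j s; rewrite /in_model /embB => h.
by case: i; embcases; rewrite /veps /qphi /qeps /=; lia.
Qed.

Lemma embB_phi p i : in_model a b.+1 p ->
  (vphi i (embB p).2 + (qphi a b i (embB p).1 - veps i (embB p).2))%N = qphi a b.+1 i p.
Proof.
elim/qpoint_split: p => x y k j s; rewrite /in_model /embB => h.
by case: i; embcases; rewrite /vphi /veps /qphi /=; lia.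
Qed.

Lemma embB_f p i : in_model a b.+1 p ->
  (if (veps i (embB p).2 < qphi a b i (embB p).1)%N
   then omap (fun y => (y, (embB p).2)) (qf a b i (embB p).1)
   else omap (fun w => ((embB p).1, w)) (vf i (embB p).2)) = omap embB (qf a b.+1 i p).
Proof.
elim/qpoint_split: p => x y k j s; rewrite /in_model /embB => h.
case: i; embcases; rewrite /veps /= /qphi /qf /=; embcases; try by exfalso; lia.
all: rewrite /=; embcases; first [by exfalso; lia | by congr (Some (_, _, _, _, _, _)); lia | done].
Qed.
End EmbeddingB.

Section EmbeddingA.
Variables a b : nat.

(** The component of source tensor v2 in the product of the model (a, b + 1) with V; the weight of
    v2 is (1, -1), which leads to (a + 1, b). *)
Definition embA (p : qpoint) : qpoint * spin :=
  let: (x, y, k, j, s) := p in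
  if x <= a%:Z then (p, (false, true))
  else if y < x then
    if s < x - y + b%:Z - k - 2 * j then ((x - 1, y, k, j, s + 1), (true, false))
    else ((x - 1, y, k, j, s), (true, true))
  else if k + 2 * j < b%:Z then
    if s < b%:Z - k - 2 * j then ((x - 1, y - 1, k, j + 1, s), (true, false))
    else ((x - 1, y - 1, k, j + 1, s - 1), (true, true))
  else ((x - 1, y - 1, k + 1, j, s - 1), (true, true)).

Lemma embA_in p : in_model a.+1 b p -> in_model a b.+1 (embA p).1.
Proof.
by elim/qpoint_split: p => x y k j s; rewrite /in_model /embA => h; embcases => /=; lia.
Qed.

Lemma embA_inj p r : in_model a.+1 b p -> in_model a.+1 b r -> embA p = embA r -> p = r.
Proof.
elim/qpoint_split: p => x y k j s; elim/qpoint_split: r => x' y' k' j' s'.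
rewrite /in_model /embA => h h'; embcases; case=> *; subst; first [by exfalso; lia | congr (_, _, _, _, _); lia].
Qed.

Lemma embA_eps p i : in_model a.+1 b p ->
  (qeps i (embA p).1 + (veps i (embA p).2 - qphi a b.+1 i (embA p).1))%N = qeps i p.
Proof.
elim/qpoint_split: p => x y k j s; rewrite /in_model /embA => h.
by case: i; embcases; rewrite /veps /qphi /qeps /=; lia.
Qed.

Lemma embA_phi p i : in_model a.+1 b p ->
  (vphi i (embA p).2 + (qphi a b.+1 i (embA p).1 - veps i (embA p).2))%N = qphi a.+1 b i p.
Proof.
elim/qpoint_split: p => x y k j s; rewrite /in_model /embA => h.
by case: i; embcases; rewrite /vphi /veps /qphi /=; lia.
Qed.

Lemma embA_f p i : in_model a.+1 b p ->
  (if (veps i (embA p).2 < qphi a b.+1 i (embA p).1)%N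
   then omap (fun y => (y, (embA p).2)) (qf a b.+1 i (embA p).1)
   else omap (fun w => ((embA p).1, w)) (vf i (embA p).2)) = omap embA (qf a.+1 b i p).
Proof.
elim/qpoint_split: p => x y k j s; rewrite /in_model /embA => h.
case: i; embcases; rewrite /veps /= /qphi /qf /=; embcases; try by exfalso; lia.
all: rewrite /=; embcases; first [by exfalso; lia | by congr (Some (_, _, _, _, _, _)); lia | done].
Qed.
End EmbeddingA.

Section ModelEmbedding.
Variables (a b a' b' : nat) (emb : qpoint -> qpoint * spin).
Hypothesis emb_in : forall p, in_model a' b' p -> in_model a b (emb p).1.
Hypothesis emb_inj : forall p r, in_model a' b' p -> in_model a' b' r -> emb p = emb r -> p = r.
Hypothesis emb_eps : forall p i, in_model a' b' p ->
  (qeps i (emb p).1 + (veps i (emb p).2 - qphi a b i (emb p).1))%N = qeps i p.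
Hypothesis emb_phi : forall p i, in_model a' b' p ->
  (vphi i (emb p).2 + (qphi a b i (emb p).1 - veps i (emb p).2))%N = qphi a' b' i p.
Hypothesis emb_f : forall p i, in_model a' b' p ->
  (if (veps i (emb p).2 < qphi a b i (emb p).1)%N
   then omap (fun y => (y, (emb p).2)) (qf a b i (emb p).1)
   else omap (fun w => ((emb p).1, w)) (vf i (emb p).2)) = omap emb (qf a' b' i p).

Lemma realizable_embedding : realizable (model_crystal a b) (model_source a b) ->
  realizable (model_crystal a' b') (model_source a' b').
Proof.
pose io (u : model a' b') : model a b * spin :=
  (to_model (emb_in (model_in u)), (emb (val u)).2).
apply: (tensor_component (@model_sourceP a b) (io := io) (@model_sourceP a' b')).
- move=> u w [h1 h2]; apply: val_inj; apply: emb_inj; try exact: model_in.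
  by rewrite [LHS]surjective_pairing [RHS]surjective_pairing h1 h2.
- move=> i u; pose vio (t : model a b * spin) := (val t.1, t.2).
  have vio_inj : injective (omap vio).
    by move=> [[t v]|] [[t' v']|] //= [h ->]; congr (Some (_, _)); apply: val_inj.
  have vio_io w : vio (io w) = emb (val w) by rewrite [RHS]surjective_pairing.
  have vio1 (w : model a b) v o : omap vio (omap (fun y => (y, v)) o) = omap (fun y => (y, v)) (omap val o).
    by case: o.
  have vio2 (w : model a b) o : omap vio (omap (fun v => (w, v)) o) = omap (fun v => (val w, v)) o.
    by case: o.
  have vio3 o : omap vio (omap io o) = omap emb (omap val o).
    by case: o => [w|] //=; rewrite vio_io.
  apply: vio_inj; rewrite vio3 [cf (model_crystal a' b') i u]/(model_f i u) model_f_omap.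
  rewrite -(emb_f i (model_in u)) [cf _ _ _]/(txf _ _ _) /txf [cphi _ _ _]/(qphi a b i _) [(io u).2]/=.
  case: ifP => _; last by rewrite vio2.
  by rewrite (vio1 (io u).1) [cf _ _ _]/(model_f i _) model_f_omap.
- by move=> i u; apply: (emb_eps i (model_in u)).
- by move=> i u; apply: (emb_phi i (model_in u)).
Qed.
End ModelEmbedding.

Section TrivialModule.
Let V : lmodType Qq := Qq^o.
Let zero (i : color) : {linear V -> V} := GRing.null_fun V.
Let one (i : color) : {linear V -> V} := idfun.

Lemma trivial_ef i j (v : V) : zero i (zero j v) - zero j (zero i v) =
  if eq_color i j then (qv i - (qv i)^-1)^-1
      *: (iter (halfnorm i) (one i) v - iter (halfnorm i) (one i) v) else 0.
Proof. by rewrite !subrr scaler0 if_same. Qed.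

Lemma trivial_serre : serre (fun i v => zero i v).
Proof.
have z i (v : V) : zero i v = 0 by [].
by apply/serreE; split=> v; rewrite /serre112 /serre2221 !z !scaler0 ?subr0 ?addr0.
Qed.

Definition trivial_module : Uq_module :=
  @UqModule V zero zero one one (fun _ _ => erefl) (fun _ _ => erefl) (fun _ _ _ => erefl)
    (fun i j v => esym (scaler0 _ _)) (fun i j v => esym (scaler0 _ _)) trivial_ef trivial_serre trivial_serre.

Lemma realizable_trivial : realizable (model_crystal 0 0) (model_source 0 0).
Proof.
have only (u : model 0 0) : u = model_source 0 0.
  apply/model_sourceP => i; apply/eqP; rewrite model_e_None; have := model_in u.
  case: u => [[[[[x y] k] j] s] ?] /=; rewrite /in_model /qeps => h; case: i; lia.
exists trivial_module, (fun=> 1 : V), (fun _ v => v), (fun u v : Qq => u * v).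
split=> [|i|v]; first split.
- split=> [x a u v|x y|v] //.
    by rewrite (only x) (only y) eqxx.
  rewrite (big_pred1 (model_source 0 0)) => [|x]; last by rewrite /= (only x) eqxx.
  by rewrite [RHS]mulr1.
- move=> x i; rewrite (only x) /= /cwt.
  have -> : (cphi (model_crystal 0 0) i (model_source 0 0))%:Z
      - (ceps (model_crystal 0 0) i (model_source 0 0))%:Z = 0 by case: i.
  by rewrite expr0z scale1r.
- split=> [a u v w|u v|i u v|i u v] //=; first by rewrite mulrDl mulrA.
    by rewrite mulrC.
  rewrite mul0r; have -> : iter (halfnorm i) (one i) (0 : V) = 0 by elim: (halfnorm i).
  by rewrite !mulr0.
- move=> x y; rewrite (only x) (only y) eqxx mulr1 subrr; exact: small0.
- move=> i; exists (fun=> 1 : V); split=> [y|y x]; last by rewrite subrr; apply: small0.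
  have e0 : cf (model_crystal 0 0) i y = None.
    by apply/eqP; rewrite cf_None (only y); case: i.
  have e1 : ce (model_crystal 0 0) i y = None.
    by apply/eqP; rewrite ce_None (only y); clear e0; case: i.
  split; last by rewrite e1 /= scaler0.
    move=> j; rewrite (only y) /cwt.
    have -> : (cphi (model_crystal 0 0) j (model_source 0 0))%:Z
      - (ceps (model_crystal 0 0) j (model_source 0 0))%:Z = 0 by case: j.
    by rewrite expr0z scale1r.
  by rewrite e0 /= scaler0.
- by [].
rewrite -[v]mulr1; apply: (@fspanZ trivial_module _ v); apply: fspan_gen.
Qed.
End TrivialModule.

(** From (a, 0) one passes to (a, 1) by v1 and then to (a + 1, 0) by v2; repeated use of v1 then
    reaches (a, b). *)
Theorem model_realizable a b : realizable (model_crystal a b) (model_source a b).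
Proof.
have stepB a' b' : realizable (model_crystal a' b') (model_source a' b') ->
    realizable (model_crystal a' b'.+1) (model_source a' b'.+1).
  apply: (realizable_embedding (@embB_in a' b') (@embB_inj a' b')).
  - exact: embB_eps.
  - exact: embB_phi.
  - exact: embB_f.
have stepA a' b' : realizable (model_crystal a' b'.+1) (model_source a' b'.+1) ->
    realizable (model_crystal a'.+1 b') (model_source a'.+1 b').
  apply: (realizable_embedding (@embA_in a' b') (@embA_inj a' b')).
  - exact: embA_eps.
  - exact: embA_phi.
  - exact: embA_f.
elim: b => [|b IHb]; last exact: stepB.
elim: a => [|a IHa]; first exact: realizable_trivial.
by apply: stepA; apply: stepB.
Qed.

(** * From a realization to a regular crystal *)

Definition cgraph_of (X : finType) (C : crystal X) : cgraph :=
  @CGraph X (fun i x y => cf C i x = Some y).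

Lemma eqmodqP (M : Uq_module) (X : finType) (b : X -> M) co : coords b co ->
  forall u v, eqmodq (inL co) u v <-> inqL co (u - v).
Proof.
move=> bco u v; split=> [[w [wL ->]] x|h].
  by rewrite (coZ bco) mulrC; apply: smallMl => //; apply: small_qvar.
exists (qvar^-1 *: (u - v)); split; first exact/(inqLP bco).
by rewrite scalerA divff ?qvar_neq0 // scale1r.
Qed.

Section Regular.
Variables (X : finType) (C : crystal X) (M : Uq_module) (b : X -> M) (co : X -> M -> Qq).
Hypotheses (bco : coords b co) (bw : forall x, weight_vector (cwt C x) (b x)).
Hypothesis str : forall i, exists c, string_vectors C i c /\ forall y, inqL co (c y - b y).

Lemma ob_modq o y : inqL co (ob b o - b y) <-> o = Some y.
Proof.
split=> [h|->]; last by rewrite /= subrr; exact: (inqL0 bco).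
have := h y; case: o h => [z|] _ /=; rewrite (coB bco) !(co_basis bco) eqxx.
  by case: eqP => [->//|_]; rewrite sub0r => /smallN; rewrite opprK => /not_small1.
by rewrite (co0 bco) sub0r => /smallN; rewrite opprK => /not_small1.
Qed.

(** Kashiwara's operator is [crystal_f] for a string basis of colour [i], and modulo [q] this acts
    on [b] by the arrows of the crystal. *)
Lemma crystal_graphE i x y :
  (exists v, ktilde_f i (b x) v /\ inqL co (v - b y)) <-> cf C i x = Some y.
Proof.
have [c [cs cb]] := str i; have [cc ccco] := near_basis bco cb.
have h := crystal_f_modq C i ccco bco cb x.
split=> [[v [/(ktilde_fE ccco cs) -> hv]]|h'].
  apply/ob_modq; apply: (inqL_trans bco _ hv); exact: (inqL_sym bco).
exists (@crystal_f M X C i c cc (b x)); split; first exact/(ktilde_fE ccco cs).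
by apply: (inqL_trans bco h); apply/ob_modq.
Qed.

Lemma crystal_graph_eE i x y :
  (exists v, ktilde_e i (b x) v /\ inqL co (v - b y)) <-> ce C i x = Some y.
Proof.
have [c [cs cb]] := str i; have [cc ccco] := near_basis bco cb.
have h := crystal_e_modq C i ccco bco cb x.
split=> [[v [/(ktilde_eE ccco cs) -> hv]]|h'].
  apply/ob_modq; apply: (inqL_trans bco _ hv); exact: (inqL_sym bco).
exists (@crystal_e M X C i c cc (b x)); split; first exact/(ktilde_eE ccco cs).
by apply: (inqL_trans bco h); apply/ob_modq.
Qed.

Lemma co_big (s : seq X) (a : X -> Qq) x : uniq s ->
  co x (\sum_(y <- s) a y *: b y) = if x \in s then a x else 0.
Proof.
move=> us; rewrite (co_sum bco).
under eq_bigr do rewrite (coZ bco) (co_basis bco).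
case: ifP => [xs|xs].
  rewrite (bigD1_seq x) //= eqxx mulr1 big1 ?addr0 // => y /negPf ->.
  by rewrite mulr0.
rewrite big_seq big1 // => y ys; case: eqP => [yx|]; last by rewrite mulr0.
by rewrite -yx ys in xs.
Qed.

Lemma basis_lattice : lattice (inL co).
Proof.
exists X, b; split.
- move=> s a us s0 x xs; have := co_big a x us.
  by rewrite s0 (co0 bco) xs.
- by move=> v; exists (index_enum X), (co^~ v); apply: co_span.
move=> v; split=> [vL|[s [a [aA ->]]]].
  by exists (index_enum X), (co^~ v); split=> //; apply: co_span.
by apply: (inL_sum bco) => x _; apply: (inLZ bco) (aA x) _; exact: (inL_basis bco).
Qed.

Lemma basis_weight_sum v : exists s : seq M,
  (forall w, w \in s -> exists x, w = co x v *: b x) /\ v = \sum_(w <- s) w.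
Proof.
exists [seq co x v *: b x | x <- index_enum X]; split; last by rewrite big_map -co_span.
by move=> w /mapP[x _ ->]; exists x.
Qed.

Lemma basis_crystal_basis : crystal_basis (inL co) b.
Proof.
have P := eqmodqP bco; split.
- split; first exact: basis_lattice.
    move=> v vL; have [s [sP vE]] := basis_weight_sum v; exists s; split=> // w /sP[x ->].
    split; first by apply: (inLZ bco) (vL x) _; exact: (inL_basis bco).
    by exists (cwt C x) => i; rewrite linearZ /= bw !scalerA mulrC.
  move=> i u v uL; have [c [cs cb]] := str i; have [cc ccco] := near_basis bco cb.
  split=> [/(ktilde_eE ccco cs) ->|/(ktilde_fE ccco cs) ->].
    exact: (crystal_e_inL C i ccco bco cb).
  exact: (crystal_f_inL C i ccco bco cb).
- by move=> x; split; [exact: (inL_basis bco)|exists (cwt C x)].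
- split=> [s a us|v vL].
    move=> /P; rewrite subr0 => h x xs; have := h x; rewrite (co_big (fun x => ratQq (a x)) x us) xs.
    exact: small_rat.
  have /fin_all_exists[r rP] := fun x => regular0_residue (vL x).
  exists (index_enum X), r; apply/P => x; rewrite (coB bco) (co_comb bco).
  exact: rP.
- move=> i x v; have [c [cs cb]] := str i; have [cc ccco] := near_basis bco cb.
  case=> [/(ktilde_eE ccco cs) ->|/(ktilde_fE ccco cs) ->].
    have := crystal_e_modq C i ccco bco cb x; case: (ce C i x) => [y|] h.
      by right; exists y; apply/P.
    by left; apply/P.
  have := crystal_f_modq C i ccco bco cb x; case: (cf C i x) => [y|] h.
    by right; exists y; apply/P.
  by left; apply/P.
move=> i x y; split=> -[v [kv /P hv]].
  have /crystal_graphE/ce_cf/crystal_graph_eE[w [kw hw]] : exists v, ktilde_f i (b x) v /\ inqL co (v - b y).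
    by exists v.
  by exists w; split=> //; apply/P.
have /crystal_graph_eE/ce_cf/crystal_graphE[w [kw hw]] : exists v, ktilde_e i (b y) v /\ inqL co (v - b x).
  by exists v.
by exists w; split=> //; apply/P.
Qed.

Lemma iter_support (T : {linear M -> M}) d n v x :
  (forall la (u : M), weight_vector la u -> exists mu, weight_vector mu (T u) /\ ht mu = ht la + d) ->
  co x (iter n T v) != 0 -> exists y, ht (cwt C x) = ht (cwt C y) + d * n%:Z.
Proof.
move=> Tw; elim: n x => [|n IHn] x; first by exists x; rewrite mulr0 addr0.
rewrite iterS [iter n T v](co_span bco) linear_sum (co_sum bco) => xv.
have [z] : exists z, co x (T (co z (iter n T v) *: b z)) != 0.
  have [z vz|none] := pickP (fun z => co x (T (co z (iter n T v) *: b z)) != 0); first by exists z.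
  case/negP: xv; rewrite big1 // => z _; apply/eqP; by have /negbFE := none z.
rewrite linearZ (coZ bco) /= mulf_eq0 negb_or => /andP[/IHn[y yz] xz].
have [mu [mw mh]] := Tw _ _ (bw z).
have /ht_ext h := weight_basis_coord bco bw mw xz.
by exists y; rewrite -h mh yz intS; lia.
Qed.

Lemma basis_integrable : integrable M.
Proof.
split=> [v|i v].
  have [s [sP vE]] := basis_weight_sum v; exists s; split=> // w /sP[x ->].
  by exists (cwt C x) => i; rewrite linearZ /= bw !scalerA mulrC.
have [H Hb] := ht_bound C.
pose K := (\max_x `|ht (cwt C x)|)%N.
have Kb x : `|ht (cwt C x)| <= K%:Z.
  by have := @leq_bigmax _ (fun x => `|ht (cwt C x)|)%N x; rewrite -/K; lia.
(* All heights lie between -K and K, so K + 1 shifts by 2 leave the set of weights. *)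
exists K.+1; split; apply: (co_eq bco) => x; rewrite (co0 bco); apply/eqP/negPn/negP => h.
  have [|y] := @iter_support (Ue i) 2 _ _ _ _ h.
    by move=> la u lu; exists (fun j => la j + cartan j i); split; [apply: Ue_weight|apply: ht_add].
  by have := Kb x; have := Kb y; lia.
have [|y] := @iter_support (Uf i) (-2) _ _ _ _ h.
  move=> la u lu; exists (fun j => la j - cartan j i); split; first exact: Uf_weight.
  by rewrite /ht; case: (i) => /=; lia.
by have := Kb x; have := Kb y; lia.
Qed.

End Regular.

Lemma basis_neq0 (M : lmodType Qq) (X : finType) (b : X -> M) co x : coords b co -> b x != 0.
Proof.
move=> bco; apply: contraNneq (oner_neq0 Qq) => b0; have := co_basis bco x x.
by rewrite b0 (co0 bco) eqxx mulr1n => <-.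
Qed.

Lemma realizable_regular X (C : crystal X) x0 : realizable C x0 ->
  exists H, regular_B2_crystal H /\ isomorphic (cgraph_of C) H.
Proof.
move=> [M [b [co [B [CM eb fb]]]]]; have bco := cm_coords CM.
have bw := cm_weight CM; have str := cm_string CM.
exists (crystal_graph (inL co) b); split.
  exists M; split.
  - exact: (fspan_irreducible CM (bw x0) eb fb (basis_neq0 x0 bco)).
  - exists (cwt C x0), (b x0); split=> //; first exact: (basis_neq0 x0 bco).
    move=> W [W0 WP Wop] Wx u; elim: (fb u) => // [a v v' _ Wv _|i v _ /(Wop i)[]//].
    exact: WP.
  - exact: (basis_integrable bco bw).
  by exists (inL co), X, b; split=> //; apply: (basis_crystal_basis bco bw str).
exists id; split; first by exists id.
move=> i x y /=; rewrite -(crystal_graphE bco str); split=> -[v [kv hv]]; exists v; split=> //;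
  exact/(eqmodqP bco).
Qed.

(** * Highest weights of integrable modules, isomorphism of irreducible modules *)

Lemma bracket_step (F : fieldType) (q t y : F) : q != 0 -> t != 0 -> y != 0 -> q - q^-1 != 0 ->
  (q * t - (q * t)^-1) * (y / t - (y / t)^-1) / (q - q^-1) ^+ 2
   + (q - q^-1)^-1 * (y / (q * t) ^+ 2 - (y / (q * t) ^+ 2)^-1) =
  (q * (q * t) - (q * (q * t))^-1) * (y / (q * t) - (y / (q * t))^-1) / (q - q^-1) ^+ 2.
Proof.
move=> q0 t0 y0 qq0; have qq : q * q - 1 != 0.
  apply: contraNneq qq0 => qq; have -> : q - q^-1 = (q * q - 1) / q by field.
  by rewrite qq mul0r.
by field; rewrite q0 t0 y0 qq.
Qed.

Lemma bracket_stepz (F : fieldType) (q : F) (m : int) (n : nat) : q != 0 -> q - q^-1 != 0 ->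
  (q ^ n.+1%:Z - (q ^ n.+1%:Z)^-1) * (q ^ (m - n%:Z) - (q ^ (m - n%:Z))^-1) / (q - q^-1) ^+ 2
    + (q - q^-1)^-1 * (q ^ (m - n.+1%:Z * 2) - (q ^ (m - n.+1%:Z * 2))^-1) =
  (q ^ n.+2%:Z - (q ^ n.+2%:Z)^-1) * (q ^ (m - n.+1%:Z) - (q ^ (m - n.+1%:Z))^-1) / (q - q^-1) ^+ 2.
Proof.
move=> q0 qq.
have := bracket_step q0 (expfz_neq0 n%:Z q0) (expfz_neq0 m q0) qq.
rewrite !intS.
have -> : q ^ (1 + n%:Z) = q * q ^ n%:Z by rewrite expfzDr // expr1z.
have -> : q ^ (1 + (1 + n%:Z)) = q * (q * q ^ n%:Z) by rewrite !expfzDr // expr1z.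
have -> : q ^ (m - n%:Z) = q ^ m / q ^ n%:Z by rewrite expfzDr // -invr_expz.
have -> : q ^ (m - (1 + n%:Z)) = q ^ m / (q * q ^ n%:Z) by rewrite expfzDr // -invr_expz expfzDr // expr1z.
have -> // : q ^ (m - (1 + n%:Z) * 2) = q ^ m / (q * q ^ n%:Z) ^+ 2.
rewrite expfzDr // -invr_expz; congr (_ / _); rewrite -exprz_exp exprnP; congr (_ ^ _).
by rewrite expfzDr // expr1z.
Qed.

Lemma iter_Uf_weight (M : Uq_module) la (v : M) i n : weight_vector la v ->
  weight_vector (fun j => la j - n%:Z * cartan j i) (iter n (Uf i) v).
Proof.
move=> lv; elim: n => [|n IHn]; first by apply: weight_vector_ext lv => j; rewrite mul0r subr0.
apply: weight_vector_ext (Uf_weight i IHn) => j; rewrite intS; ring.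
Qed.

Lemma iter_UkV_weight (M : Uq_module) la (v : M) i : weight_vector la v ->
  iter (halfnorm i) (UkV i) v = (qv i ^ la i)^-1 *: v.
Proof.
move=> lv; case: i => /=; rewrite !(UkV_weight _ lv) ?linearZ /= ?(UkV_weight _ lv) ?scalerA;
  congr (_ *: _).
by rewrite /qv /= expr2 expfzMl invfM.
Qed.

(** The sl_2 formula e f^(n+1) v = [n + 1][m - n] f^n v with m = [la i], by induction on n through
    [bracket_stepz]. *)
Lemma Ue_iter_Uf (M : Uq_module) la (v : M) i n : weight_vector la v -> Ue i v = 0 ->
  Ue i (iter n.+1 (Uf i) v) =
  ((qv i ^ n.+1%:Z - (qv i ^ n.+1%:Z)^-1) * (qv i ^ (la i - n%:Z) - (qv i ^ (la i - n%:Z))^-1)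
     / (qv i - (qv i)^-1) ^+ 2) *: iter n (Uf i) v.
Proof.
move=> lv ev; have kk mu (u : M) : weight_vector mu u ->
    Ue i (Uf i u) = Uf i (Ue i u) + (qv i - (qv i)^-1)^-1 * (qv i ^ mu i - (qv i ^ mu i)^-1) *: u.
  move=> muu; have /eqP := Uef i i u; rewrite subr_eq => /eqP ->.
  rewrite addrC; congr (_ + _); rewrite (_ : eq_color i i); last by case: (i).
  by rewrite (ti_weight i muu) (iter_UkV_weight i muu) -scalerBl scalerA.
have q0 := qv_neq0 i; have qq := qv_sub_neq0 i.
elim: n => [|n IHn].
  rewrite /= (kk _ _ lv) ev linear0 add0r subr0 expr1z; congr (_ *: _).
  by rewrite mulrAC expr2 invfM mulrA divff // mul1r.
rewrite iterS (kk _ _ (iter_Uf_weight i n.+1 lv)) IHn linearZ /= -scalerDl; congr (_ *: _).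
have -> : cartan i i = 2 by case: (i).
exact: bracket_stepz.
Qed.

(** At the least n with f^(n+1) v = 0, the formula forces [m - n] to vanish. *)
Lemma highest_weight_nonneg (M : Uq_module) la (v : M) i : integrable M -> v != 0 ->
  weight_vector la v -> Ue i v = 0 -> exists n : nat, la i = n%:Z.
Proof.
move=> [_ /(_ i v)[N [_ fN]]] v0 lv ev.
have ex : exists n, iter n (Uf i) v == 0 by exists N; apply/eqP.
case: (ex_minnP ex) => -[/=|n] /eqP fn nmin; first by rewrite fn eqxx in v0.
exists n; have := Ue_iter_Uf n lv ev; rewrite fn linear0 => /esym/eqP.
rewrite scaler_eq0 => /orP[|fn0]; last by have := nmin n fn0; rewrite ltnn.
rewrite mulf_eq0 invr_eq0 expf_eq0 /= (negPf (qv_sub_neq0 i)) orbF mulf_eq0 !subr_eq0 !invr_expz.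
by case/orP => /eqP /qv_exp_inj; lia.
Qed.

                                                                               
(** The element of the torus acting on a vector of weight [la] by [q] to the power [ht la]; each
    [f_i] lowers its exponent by 2. *)
Definition kht (M : Uq_module) (u : M) : M := iter 4 (Uk col1) (iter 3 (Uk col2) u).

Lemma iter_k_weight (M : Uq_module) la (v : M) i n : weight_vector la v ->
  iter n (Uk i) v = qvar ^ (la i * n%:Z) *: v.
Proof.
move=> lv; elim: n => [|n IHn]; first by rewrite mulr0 scale1r.
rewrite iterS IHn linearZ /= lv scalerA -expfzDr ?qvar_neq0 //; congr (_ ^ _ *: _); rewrite intS; ring.
Qed.

Lemma iter_k_f (M : Uq_module) (v : M) i j n :
  iter n (Uk j) (Uf i v) = qvar ^ (- cartan j i * n%:Z) *: Uf i (iter n (Uk j) v).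
Proof.
elim: n => [|n IHn]; first by rewrite mulr0 scale1r.
rewrite !iterS IHn linearZ /= Ukf scalerA -expfzDr ?qvar_neq0 //; congr (_ ^ _ *: _); rewrite intS; ring.
Qed.

Lemma iter_kP (M : Uq_module) a (u v : M) i n :
  iter n (Uk i) (a *: u + v) = a *: iter n (Uk i) u + iter n (Uk i) v.
Proof. by elim: n => //= n ->; rewrite linearP. Qed.

Lemma kht_linear (M : Uq_module) a (u v : M) : kht (a *: u + v) = a *: kht u + kht v.
Proof. by rewrite /kht !iter_kP. Qed.

Lemma kht0 (M : Uq_module) : kht (0 : M) = 0.
Proof. by have := kht_linear (-1) (0 : M) 0; rewrite scaler0 addr0 scaleN1r addNr. Qed.

Lemma khtZ (M : Uq_module) a (u : M) : kht (a *: u) = a *: kht u.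
Proof. by rewrite -[a *: u]addr0 kht_linear kht0 addr0. Qed.

Lemma kht_weight (M : Uq_module) la (v : M) : weight_vector la v -> kht v = qvar ^ ht la *: v.
Proof.
move=> lv; rewrite /kht (iter_k_weight _ _ lv).
have -> a : iter 4 (Uk col1) (a *: v) = a *: iter 4 (Uk col1) v.
  have := iter_kP a v 0 col1 4; rewrite !addr0 => ->.
  by rewrite [X in _ + X](_ : _ = 0) ?addr0 //=; rewrite !linear0.
rewrite (iter_k_weight _ _ lv) scalerA -expfzDr ?qvar_neq0 //.
by congr (_ ^ _ *: _); rewrite /ht; ring.
Qed.

Lemma kht_f (M : Uq_module) i (v : M) : kht (Uf i v) = qvar ^ (- 2) *: Uf i (kht v).
Proof.
rewrite /kht iter_k_f; set w := iter 3 _ v.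
have -> a u : iter 4 (Uk col1) (a *: u) = a *: iter 4 (Uk col1) u :> M.
  have := iter_kP a u 0 col1 4; rewrite !addr0 => ->.
  by rewrite [X in _ + X](_ : _ = 0) ?addr0 //=; rewrite !linear0.
rewrite iter_k_f scalerA -expfzDr ?qvar_neq0 //.
by congr (_ ^ _ *: _); case: i.
Qed.

Section Leading.
Variables (M : Uq_module) (d : int) (v : M).

                                                 
(** [c] is the coefficient of [v] in [m], read off from a decomposition of [m] into eigenvectors of
    [kht] whose top term is [c *: v]. It is a relation because no basis of [M] is at hand yet;
    eigenvalues being distinct, the zero vector has only coefficient 0 ([leading0]). *)
Definition leading (c : Qq) (m : M) : Prop :=
  exists N (vs : nat -> M), [/\ vs 0 = c *: v, forall n, (N < n)%N -> vs n = 0,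
    forall n, kht (vs n) = qvar ^ (d - 2 * n%:Z) *: vs n & m = \sum_(n < N.+1) vs n].

Lemma leading_scale c : kht v = qvar ^ d *: v -> leading c (c *: v).
Proof.
move=> kv; exists 0%N, (fun n => if n is 0%N then c *: v else 0); split=> //.
- by case.
- by case=> [|n]; [rewrite mulr0 subr0 khtZ kv !scalerA mulrC|rewrite kht0 scaler0].
by rewrite big_ord1.
Qed.

Lemma leading_pad c m : leading c m -> exists N, forall N', (N <= N')%N ->
  exists (vs : nat -> M), [/\ vs 0 = c *: v, forall n, (N < n)%N -> vs n = 0,
    forall n, kht (vs n) = qvar ^ (d - 2 * n%:Z) *: vs n & m = \sum_(n < N'.+1) vs n].
Proof.
move=> [N [vs [v0 vN kv ->]]]; exists N => N' NN; exists vs; split=> //.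
rewrite -!(big_mkord predT vs) (@big_cat_nat _ _ _ N.+1 0 N'.+1) //= [X in _ = _ + X]big_nat.
rewrite [X in _ = _ + X]big1 ?addr0 // => n /andP[nN _]; exact: vN.
Qed.

Lemma leading_lin a c c' m m' : leading c m -> leading c' m' -> leading (a * c + c') (a *: m + m').
Proof.
move=> /leading_pad[N PN] /leading_pad[N' PN'].
have [vs [v0 vN kv ->]] := PN _ (leq_maxl N N'); have [ws [w0 wN kw ->]] := PN' _ (leq_maxr N N').
exists (maxn N N'), (fun n => a *: vs n + ws n); split.
- by rewrite v0 w0 scalerA scalerDl.
- by move=> n; rewrite gtn_max => /andP[h h']; rewrite vN // wN // scaler0 addr0.
- by move=> n; rewrite kht_linear kv kw scalerDr !scalerA mulrC.
by rewrite big_split scaler_sumr.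
Qed.

Lemma leading_f c m i : leading c m -> leading 0 (Uf i m).
Proof.
move=> [N [vs [v0 vN kv ->]]]; exists N.+1, (fun n => if n is n'.+1 then Uf i (vs n') else 0); split.
- by rewrite scale0r.
- by case=> // n; rewrite ltnS => /vN ->; rewrite linear0.
- case=> [|n]; first by rewrite kht0 scaler0.
  rewrite kht_f kv linearZ scalerA -expfzDr ?qvar_neq0 //=; congr (_ ^ _ *: _); lia.
by rewrite linear_sum [RHS]big_ord_recl add0r.
Qed.

Lemma eigensum0 N (vs : nat -> M) (e : nat -> Qq) : injective e ->
  (forall n, kht (vs n) = e n *: vs n) -> \sum_(n < N.+1) vs n = 0 -> vs 0 = 0.
Proof.
move=> einj; elim: N vs => [|N IHN] vs kv; first by rewrite big_ord1.
have ksum n : kht (\sum_(m < n) vs m) = \sum_(m < n) e m *: vs m.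
  elim: n => [|n IHn]; first by rewrite !big_ord0 kht0.
  by rewrite !big_ord_recr /= addrC -[vs n]scale1r kht_linear IHn kv !scale1r addrC.
move=> v0; have h : \sum_(n < N.+1) (e n - e N.+1) *: vs n = 0.
  under eq_bigr do rewrite scalerBl; rewrite sumrB -ksum -scaler_sumr.
  have -> : \sum_(i < N.+1) vs i = - vs N.+1.
    by apply/eqP; rewrite -addr_eq0; move/eqP: v0; rewrite big_ord_recr.
  have -> : kht (- vs N.+1) = - kht (vs N.+1) by rewrite -scaleN1r khtZ scaleN1r.
  by rewrite kv scalerN subrr.
have /eqP : (e 0 - e N.+1) *: vs 0 = 0.
  by apply: (IHN (fun n => (e n - e N.+1) *: vs n)) h => n; rewrite khtZ kv !scalerA mulrC.
by rewrite scaler_eq0 subr_eq0 => /orP[/eqP/einj|/eqP].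
Qed.

Lemma leading0 c : v != 0 -> leading c 0 -> c = 0.
Proof.
move=> v0 [N [vs [vs0 _ kvs /esym vsum]]]; apply/eqP.
have einj : injective (fun n : nat => qvar ^ (d - 2 * n%:Z)) by move=> m n /qvar_exp_inj; lia.
by have /eqP := eigensum0 einj kvs vsum; rewrite vs0 scaler_eq0 (negPf v0) orbF.
Qed.

End Leading.

Section Isomorphism.
Variables (M N : Uq_module) (v : M) (w : N) (la : weight).
Hypotheses (lv : weight_vector la v) (lw : weight_vector la w).
Hypotheses (ev : forall i, Ue i v = 0) (ew : forall i, Ue i w = 0).

                                                       
(** The submodule of the product of [M] and [N] generated by the pair of highest weight vectors; it
    turns out to be the graph of an isomorphism. *)
Inductive hw_rel : M -> N -> Prop :=
  | hw_gen : hw_rel v w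
  | hw_0 : hw_rel 0 0
  | hw_lin a u u' x x' : hw_rel u x -> hw_rel u' x' -> hw_rel (a *: u + u') (a *: x + x')
  | hw_f i u x : hw_rel u x -> hw_rel (Uf i u) (Uf i x).

Lemma hw_Z a u x : hw_rel u x -> hw_rel (a *: u) (a *: x).
Proof. by move=> ux; rewrite -[a *: u]addr0 -[a *: x]addr0; apply: hw_lin => //; apply: hw_0. Qed.

Lemma hw_D u x u' x' : hw_rel u x -> hw_rel u' x' -> hw_rel (u + u') (x + x').
Proof. by move=> ux ux'; rewrite -[u]scale1r -[x]scale1r; apply: hw_lin. Qed.

Lemma hw_sum I (r : seq I) (F : I -> M) (G : I -> N) : (forall i, hw_rel (F i) (G i)) ->
  hw_rel (\sum_(i <- r) F i) (\sum_(i <- r) G i).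
Proof.
move=> FG; elim: r => [|i r IHr]; rewrite ?big_nil ?big_cons; first exact: hw_0.
exact: hw_D.
Qed.

Lemma hw_k i u x : hw_rel u x -> hw_rel (Uk i u) (Uk i x).
Proof.
elim=> [||a u0 u' x0 x' _ IHu _ IHv|j u' x' _ IHu].
- by rewrite lv lw; apply: hw_Z; apply: hw_gen.
- by rewrite !linear0; apply: hw_0.
- by rewrite !linearP; apply: hw_lin.
by rewrite !Ukf; apply: hw_Z; apply: hw_f.
Qed.

Lemma hw_kV i u x : hw_rel u x -> hw_rel (UkV i u) (UkV i x).
Proof.
elim=> [||a u0 u' x0 x' _ IHu _ IHv|j u' x' _ IHu].
- by rewrite (UkV_weight i lv) (UkV_weight i lw); apply: hw_Z; apply: hw_gen.
- by rewrite !linear0; apply: hw_0.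
- by rewrite !linearP; apply: hw_lin.
by rewrite !UkVf; apply: hw_Z; apply: hw_f.
Qed.

Lemma hw_e i u x : hw_rel u x -> hw_rel (Ue i u) (Ue i x).
Proof.
elim=> [||a u0 u' x0 x' _ IHu _ IHv|j u' x' ux IHu].
- by rewrite ev ew; apply: hw_0.
- by rewrite !linear0; apply: hw_0.
- by rewrite !linearP; apply: hw_lin.
rewrite -[Ue i (Uf j u')](subrK (Uf j (Ue i u'))) -[Ue i (Uf j x')](subrK (Uf j (Ue i x'))) !Uef.
apply: hw_D; last exact: hw_f.
case: eq_color; last exact: hw_0.
apply: hw_Z; rewrite addrC [X in hw_rel _ X]addrC -scaleN1r -[X in hw_rel _ (X + _)]scaleN1r.
apply: hw_lin.
  by elim: (halfnorm i) => //= n; apply: hw_kV.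
by elim: (halfnorm i) => //= n; apply: hw_k.
Qed.

Lemma hw_leading u x : hw_rel u x -> exists c, leading (ht la) v c u /\ leading (ht la) w c x.
Proof.
have kv := kht_weight lv; have kw := kht_weight lw.
elim=> [||a u0 u' x0 x' _ [c [h1 h2]] _ [c' [h1' h2']]|j u' x' ux [c [h1 h2]]].
- by exists 1; split; [have := leading_scale 1 kv|have := leading_scale 1 kw]; rewrite scale1r.
- by exists 0; split; [have := leading_scale 0 kv|have := leading_scale 0 kw]; rewrite scale0r.
- by exists (a * c + c'); split; apply: leading_lin.
by exists 0; split; [apply: leading_f h1|apply: leading_f h2].
Qed.

Hypotheses (v0 : v != 0) (w0 : w != 0).
Hypotheses (Mirr : irreducible M) (Nirr : irreducible N).

(** The vectors related to 0 form a submodule of the irreducible [M]. If it were everything, [v]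
    would be related to 0; related vectors share a leading coefficient, which would be both 1 and
    0. *)
Lemma hw_inj u : hw_rel u 0 -> u = 0.
Proof.
have sub : submodule (fun u => hw_rel u 0).
  split; first exact: hw_0.
    by move=> a u1 u2 h1 h2; have := hw_lin a h1 h2; rewrite scaler0 addr0.
  by move=> i u1 h1; split; [have := hw_e i h1|have := hw_f i h1|have := hw_k i h1|have := hw_kV i h1];
    rewrite linear0.
have [h /h //|all_] := Mirr.2 _ sub.
have [c [cv cw]] := hw_leading (all_ v); case/eqP: v0.
have c0 := leading0 w0 cw; rewrite c0 in cv.
have := leading_lin (-1) cv (leading_scale 1 (kht_weight lv)).
rewrite scaleN1r scale1r addNr mulr0 add0r => /(leading0 v0)/eqP.
by rewrite oner_eq0.
Qed.

Lemma hw_fun x : hw_rel 0 x -> x = 0.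
Proof.
have sub : submodule (fun x => hw_rel 0 x).
  split; first exact: hw_0.
    by move=> a u1 u2 h1 h2; have := hw_lin a h1 h2; rewrite scaler0 addr0.
  by move=> i u1 h1; split; [have := hw_e i h1|have := hw_f i h1|have := hw_k i h1|have := hw_kV i h1];
    rewrite linear0.
have [h /h //|all_] := Nirr.2 _ sub.
have [c [cv cw]] := hw_leading (all_ w); case/eqP: w0.
have c0 := leading0 v0 cv; rewrite c0 in cw.
have := leading_lin (-1) cw (leading_scale 1 (kht_weight lw)).
rewrite scaleN1r scale1r addNr mulr0 add0r => /(leading0 w0)/eqP.
by rewrite oner_eq0.
Qed.

Lemma hw_injective u u' x : hw_rel u x -> hw_rel u' x -> u = u'.
Proof.
move=> h h'; apply/eqP; rewrite -subr_eq0; apply/eqP/hw_inj.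
by have := hw_lin (-1) h' h; rewrite !scaleN1r addNr addrC.
Qed.

Lemma hw_functional u x x' : hw_rel u x -> hw_rel u x' -> x = x'.
Proof.
move=> h h'; apply/eqP; rewrite -subr_eq0; apply/eqP/hw_fun.
by have := hw_lin (-1) h' h; rewrite !scaleN1r addNr addrC.
Qed.

Lemma hw_total : (forall W, submodule W -> W v -> forall u, W u) -> forall u, exists x, hw_rel u x.
Proof.
move=> gen; apply: gen; last by exists w; apply: hw_gen.
split; first by exists 0; apply: hw_0.
  by move=> a u u' [x ux] [x' ux']; exists (a *: x + x'); apply: hw_lin.
by move=> i u [x ux]; split; [exists (Ue i x); apply: hw_e|exists (Uf i x); apply: hw_f|
  exists (Uk i x); apply: hw_k|exists (UkV i x); apply: hw_kV].
Qed.

Lemma hw_onto x : fspan w x -> exists u, hw_rel u x.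
Proof.
elim=> [||a x0 x' _ [u ux] _ [u' ux']|i {}x _ [u ux]].
- by exists v; apply: hw_gen.
- by exists 0; apply: hw_0.
- by exists (a *: u + u'); apply: hw_lin.
by exists (Uf i u); apply: hw_f.
Qed.

End Isomorphism.

(** The basis and the string bases of the realized module are transported through [hw_rel], which
    respects all generators and is a bijection. *)
Lemma hw_model_basis (M : Uq_module) (v : M) la X (C : crystal X) x0 :
  irreducible M -> v != 0 -> weight_vector la v -> (forall i, Ue i v = 0) ->
  (forall W, submodule W -> W v -> forall u, W u) ->
  realizable C x0 -> la =1 cwt C x0 ->
  exists (b : X -> M) co, [/\ coords b co, forall x, weight_vector (cwt C x) (b x) &
    forall i, exists c, string_vectors C i c /\ forall y, inqL co (c y - b y)].
Proof.
move=> Mirr v0 lv ev gen [N [b0 [co0 [B [CM eb fb]]]]] lx.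
have bco := cm_coords CM; have bw := cm_weight CM.
have w0 := basis_neq0 x0 bco; have lw := weight_vector_ext (fsym lx) (bw x0).
have Nirr : irreducible N := fspan_irreducible CM lw eb fb w0.
pose R := @hw_rel M N v (b0 x0).
have [phi phiP] : exists phi : M -> N, forall u, R u (phi u).
  by apply: (@functional_choice M N R); apply: (hw_total lv lw ev eb gen).
have [psi psiP] : exists psi : N -> M, forall x, R (psi x) x.
  by apply: (@functional_choice N M (fun x u => R u x)) => x; apply: hw_onto (fb x).
have inj u u' x : R u x -> R u' x -> u = u' := hw_injective lv lw ev eb v0 w0 Mirr (x := x).
have fun_ u x x' : R u x -> R u x' -> x = x' := hw_functional lv lw ev eb v0 w0 Nirr (x' := x').
pose co x u := co0 x (phi u).
have coE x u y : R u y -> co x u = co0 x y by move=> uy; rewrite /co (fun_ _ _ _ (phiP u) uy).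
exists (fun x => psi (b0 x)), co; split.
- split.
  + move=> x a u u'; rewrite (coE _ _ _ (hw_lin a (phiP u) (phiP u'))).
    by rewrite (co_linear bco).
  + by move=> x y; rewrite (coE _ _ _ (psiP _)) (co_basis bco).
  move=> u; apply: (inj _ _ _ (phiP u)); rewrite [phi u](co_span bco).
  by apply: hw_sum => x; apply: hw_Z; apply: psiP.
- move=> x i; apply: (inj _ _ _ (hw_k lv lw i (psiP _))); rewrite bw.
  exact/hw_Z/psiP.
move=> i; have [c [cs cb]] := cm_string CM i.
exists (fun y => psi (c y)); split=> y; last first.
  move=> x; rewrite /co.
  have := fun_ _ _ _ (phiP _) (hw_lin (-1) (psiP (b0 y)) (psiP (c y))).
  by rewrite !scaleN1r ![- _ + _]addrC => ->; apply: cb.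
have oP o : R (oc (fun y => psi (c y)) o) (oc c o).
  by case: o => [z|]; [apply: psiP|apply: hw_0].
have [cw cf ce] := cs y; split.
- move=> j; apply: (inj _ _ _ (hw_k lv lw j (psiP _))); rewrite cw; exact/hw_Z/psiP.
- by apply: (inj _ _ _ (hw_f i (psiP _))); rewrite cf; apply/hw_Z/oP.
by apply: (inj _ _ _ (hw_e lv lw ev eb i (psiP _))); rewrite ce; apply/hw_Z/oP.
Qed.

Lemma isomorphic_sym (G H : cgraph) : isomorphic G H -> isomorphic H G.
Proof.
move=> [f [[g fK gK] fe]]; exists g; split; first by exists f.
by move=> i u v; rewrite fe !gK.
Qed.

Lemma isomorphic_trans (G H K : cgraph) : isomorphic G H -> isomorphic H K -> isomorphic G K.
Proof.
move=> [f [fb fe]] [g [gb ge]]; exists (g \o f); split; first exact: bij_comp.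
by move=> i u v; rewrite fe ge.
Qed.

(** * Uniqueness of the crystal basis *)

Section Lattices.
Variables (M : Uq_module) (L : M -> Prop).
Hypothesis latL : lattice L.

(** The sequences of indices describing lattice vectors may have repetitions, while freeness is
    stated for duplicate-free ones; coefficients of equal indices are therefore collected. *)
Definition coef (I : eqType) (p : seq (Qq * I)) i : Qq := \sum_(x <- p | x.2 == i) x.1.

Lemma coef_sum (I : eqType) (c : I -> M) (p : seq (Qq * I)) s : uniq s ->
  {subset [seq x.2 | x <- p] <= s} ->
  \sum_(x <- p) x.1 *: c x.2 = \sum_(i <- s) coef p i *: c i.
Proof.
move=> us; elim: p => [|x p IHp] ps.
  by rewrite big_nil big1 // => i _; rewrite /coef big_nil scale0r.
rewrite big_cons IHp; last by move=> i ip; apply: ps; rewrite inE ip orbT.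
have xs : x.2 \in s by apply: ps; rewrite inE eqxx.
under [in RHS]eq_bigr do rewrite /coef big_cons.
rewrite !(bigD1_seq x.2) //= eqxx scalerDl addrA; congr (_ + _).
by apply: eq_bigr => i; rewrite eq_sym => /negPf ->.
Qed.

Lemma coef_sum_undup (I : eqType) (c : I -> M) (p : seq (Qq * I)) :
  \sum_(x <- p) x.1 *: c x.2 = \sum_(i <- undup [seq x.2 | x <- p]) coef p i *: c i.
Proof. by apply: coef_sum (undup_uniq _) _ => i; rewrite mem_undup. Qed.

Lemma coef_regular0 (I : eqType) (p : seq (Qq * I)) i : (forall x, x \in p -> regular0 x.1) ->
  regular0 (coef p i).
Proof.
rewrite /coef; elim: p => [|x p IHp] pA; first by rewrite big_nil; apply: regular0_0.
have xA : regular0 x.1 by apply: pA; rewrite inE eqxx.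
have cA := IHp (fun y yp => pA y (mem_behead (s := x :: p) yp)).
by rewrite big_cons; case: ifP => // _; apply: regular0_add.
Qed.

Lemma lattice_lin a u v : regular0 a -> L u -> L v -> L (a *: u + v).
Proof.
case: latL => I [c [_ _ cL]] aA /cL[s [f [fA ->]]] /cL[t [g [gA ->]]].
pose p := [seq (a * f i, i) | i <- s] ++ [seq (g i, i) | i <- t].
apply/cL; exists (undup [seq x.2 | x <- p]), (coef p); split=> [i|].
  apply: coef_regular0 => x; rewrite mem_cat => /orP[] /mapP[j _ ->] //=.
  exact: regular0_mul.
rewrite -coef_sum_undup big_cat !big_map scaler_sumr; congr (_ + _).
by apply: eq_bigr => i _; rewrite scalerA.
Qed.

Lemma lattice_0 : L 0.
Proof.
case: latL => I [c [_ _ cL]]; apply/cL; exists [::], (fun=> 0).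
by split; [move=> _; apply: regular0_0|rewrite big_nil].
Qed.

Lemma lattice_Z a u : regular0 a -> L u -> L (a *: u).
Proof. by move=> aA uL; rewrite -[a *: u]addr0; apply: lattice_lin lattice_0. Qed.

Lemma lattice_D u v : L u -> L v -> L (u + v).
Proof. by move=> uL vL; rewrite -[u]scale1r; apply: lattice_lin regular0_1 _ _. Qed.

Lemma lattice_sum I (r : seq I) (F : I -> M) : (forall i, L (F i)) -> L (\sum_(i <- r) F i).
Proof. by move=> FL; elim/big_ind: _ => //; [apply: lattice_0|apply: lattice_D]. Qed.

Lemma regular0_scaling (x : Qq) : exists k0 : nat, forall k, (k0 <= k)%N -> regular0 (qvar ^+ k * x).
Proof.
have [->|/valuation[m [u [uA _ ->]]]] := eqVneq x 0.
  by exists 0%N => k _; rewrite mulr0; apply: regular0_0.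
exists `|m|%N => k km; rewrite mulrA exprnP -expfzDr ?qvar_neq0 //.
by apply: regular0_mul => //; apply: regular0_exprz; lia.
Qed.

Lemma lattice_scaling v : exists k : nat, L (qvar ^+ k *: v).
Proof.
case: latL => I [c [_ cspan cL]]; have [s [a ->]] := cspan v.
have [k kA] : exists k0 : nat, forall i, i \in s -> forall k, (k0 <= k)%N -> regular0 (qvar ^+ k * a i).
  elim: s => [|i s [k0 IH]]; first by exists 0%N.
  have [k1 h1] := regular0_scaling (a i); exists (maxn k0 k1) => j.
  by rewrite inE => /predU1P[->|js] k; rewrite geq_max => /andP[h2 h3]; [apply: h1|apply: (IH)].
exists k; apply/cL; exists s, (fun i => if i \in s then qvar ^+ k * a i else 0); split.
  by move=> i; case: ifP => [/kA|_]; [apply|apply: regular0_0].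
rewrite scaler_sumr big_seq [RHS]big_seq; apply: eq_bigr => i ->.
by rewrite scalerA.
Qed.

(** Each coordinate of [u] in a basis of the lattice is divisible by every power of [q], hence
    zero. *)
Lemma lattice_separated u : (forall k, L (qvar ^- k *: u)) -> u = 0.
Proof.
case: latL => I [c [cfree cspan cL]] uL; have [s0 [a0 uE]] := cspan u.
pose p := [seq (a0 i, i) | i <- s0].
have uE' : u = \sum_(i <- undup [seq x.2 | x <- p]) coef p i *: c i.
  by rewrite -coef_sum_undup big_map.
rewrite uE' big1_seq // => i /= ip; rewrite (_ : coef p i = 0) ?scale0r //.
apply: qvar_neg_small_0 => k; have /cL[t [g [gA gE]]] := uL k.
pose r := [seq (g j, j) | j <- t]; pose p' := [seq (qvar ^- k * x.1, x.2) | x <- p] ++ [seq (- x.1, x.2) | x <- r].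
have p0 : \sum_(x <- p') x.1 *: c x.2 = 0.
  rewrite big_cat !big_map /=; apply/eqP; rewrite addr_eq0; apply/eqP.
  under eq_bigr do rewrite -scalerA.
  under [in RHS]eq_bigr do rewrite scaleNr.
  by rewrite -scaler_sumr -uE gE sumrN opprK.
rewrite coef_sum_undup in p0.
have := cfree _ _ (undup_uniq _) p0 i; rewrite mem_undup map_cat mem_cat -map_comp.
rewrite -[[seq _ | x <- p]]/[seq x.2 | x <- p] -(mem_undup [seq x.2 | x <- p]) ip => /(_ isT).
rewrite /coef big_cat !big_map /= sumrN -mulr_sumr => /eqP; rewrite subr_eq0 => /eqP.
move=> ->; have := @coef_regular0 I [seq (g j, j) | j <- t] i; rewrite /coef big_map; apply=> x.
by case/mapP => j _ -> /=; apply: gA.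
Qed.

End Lattices.

Section Sources.
Variables (X : finType) (C : crystal X) (x0 : X).
Hypothesis src : forall x, source C x -> x = x0.

(** The operators [e_i] raise the height, which is bounded, so every element is reached from the
    unique source by arrows. *)
Lemma crystal_ind (P : X -> Prop) : P x0 ->
  (forall i x y, cf C i x = Some y -> P x -> P y) -> forall x, P x.
Proof.
move=> P0 Pf; have [H Hb] := ht_bound C.
suff key n x : H%:Z - ht (cwt C x) < n%:Z -> P x.
  by move=> x; apply: (key `|H%:Z - ht (cwt C x)|.+1%N); lia.
elim: n x => [|n IHn] x xn; first by have := Hb x; lia.
have [/src -> //|ns] := classic (source C x).
have [i [y xy]] : exists i y, ce C i x = Some y.
  apply: NNPP => none; apply: ns => i; case E: (ce C i x) => [y|//].
  by case: none; exists i, y.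
apply: (Pf i y); first exact/ce_cf.
by apply: IHn; rewrite (ht_ce xy); lia.
Qed.

Lemma cwt_source_uniq x : cwt C x =1 cwt C x0 -> x = x0.
Proof.
move/ht_ext => h; suff : x = x0 \/ ht (cwt C x) < ht (cwt C x0) by case=> //; lia.
move: x {h}; apply: crystal_ind => [|i x y /ce_cf/ht_ce h [xx0|h']]; first by left.
  by right; rewrite -xx0; lia.
by right; lia.
Qed.
End Sources.

Lemma rescale_basis (M : Uq_module) (X : finType) (C : crystal X) (b : X -> M) co a : a != 0 ->
  coords b co -> (forall x, weight_vector (cwt C x) (b x)) ->
  (forall i, exists c, string_vectors C i c /\ forall y, inqL co (c y - b y)) ->
  exists co', [/\ coords (fun x => a *: b x) co', forall x, weight_vector (cwt C x) (a *: b x) &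
    forall i, exists c, string_vectors C i c /\ forall y, inqL co' (c y - a *: b y)].
Proof.
move=> a0 bco bw str; exists (fun x m => a^-1 * co x m); split.
- split=> [x e u v|x y|v].
  + by rewrite (co_linear bco) mulrDr mulrCA.
  + by rewrite (coZ bco) (co_basis bco) mulKf.
  by rewrite {1}[v](co_span bco); apply: eq_bigr => x _; rewrite scalerA mulrAC mulVf // mul1r.
- by move=> x i; rewrite linearZ /= bw !scalerA mulrC.
move=> i; have [c [cs cb]] := str i; exists (fun y => a *: c y); split=> y; last first.
  by move=> x; rewrite -scalerBr (coZ bco) mulKf //; apply: cb.
have aoc o : oc (fun y => a *: c y) o = a *: oc c o by case: o => [z|] //=; rewrite scaler0.
have [cw cf ce] := cs y; split.
- by move=> j; rewrite linearZ /= cw !scalerA mulrC.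
- by rewrite linearZ /= cf aoc !scalerA mulrC.
by rewrite linearZ /= ce aoc !scalerA mulrC.
Qed.

Section Uniqueness.
Variables (X : finType) (C : crystal X) (x0 : X).
Hypothesis src : forall x, source C x -> x = x0.
Variables (M : Uq_module) (b : X -> M) (co : X -> M -> Qq).
Hypotheses (bco : coords b co) (bw : forall x, weight_vector (cwt C x) (b x)).
Hypothesis str : forall i, exists c, string_vectors C i c /\ forall y, inqL co (c y - b y).
Local Notation L0 := (inL co).

Lemma f_operator i : exists T : M -> M, [/\ forall u v, ktilde_f i u v <-> v = T u,
  forall a u v, T (a *: u + v) = a *: T u + T v, forall v, L0 v -> L0 (T v),
  forall v, inqL co v -> inqL co (T v) & forall x, inqL co (T (b x) - ob b (cf C i x))].
Proof.
have [c [cs cb]] := str i; have [cc ccco] := near_basis bco cb.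
exists (crystal_f C i c cc); split.
- exact: ktilde_fE.
- exact: crystal_f_linear.
- exact: (crystal_f_inL C i ccco bco cb).
- exact: (crystal_f_inqL C i ccco bco cb).
- exact: (crystal_f_modq C i ccco bco cb).
Qed.

Lemma e_operator i : exists T : M -> M, [/\ forall u v, ktilde_e i u v <-> v = T u,
  forall a u v, T (a *: u + v) = a *: T u + T v, forall v, L0 v -> L0 (T v),
  forall v, inqL co v -> inqL co (T v) & forall x, inqL co (T (b x) - ob b (ce C i x))].
Proof.
have [c [cs cb]] := str i; have [cc ccco] := near_basis bco cb.
exists (crystal_e C i c cc); split.
- exact: ktilde_eE.
- exact: crystal_e_linear.
- exact: (crystal_e_inL C i ccco bco cb).
- exact: (crystal_e_inqL C i ccco bco cb).
- exact: (crystal_e_modq C i ccco bco cb).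
Qed.

Lemma linear_modq (T : M -> M) (o : X -> option X) v y :
  (forall a u v, T (a *: u + v) = a *: T u + T v) ->
  (forall x, inqL co (T (b x) - ob b (o x))) -> L0 v ->
  small (co y (T v) - \sum_(x | o x == Some y) co x v).
Proof.
move=> Tlin To vL; have T0 : T 0 = 0.
  by have := Tlin (-1) 0 0; rewrite scaler0 addr0 scaleN1r addNr.
have -> : T v = \sum_x co x v *: T (b x).
  rewrite {1}[v](co_span bco); apply: (big_rec2 (fun u w => T u = w)) => // x u w _ <-.
  exact: Tlin.
rewrite (co_sum bco) [X in _ - X]big_mkcond -sumrB; apply: small_sum => x _.
have := To x y; rewrite (coB bco) (coZ bco) => h.
have -> : (if o x == Some y then co x v else 0) = co x v * co y (ob b (o x)).
  case: (o x) => [z|] /=; last by rewrite (co0 bco) mulr0.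
  by rewrite (co_basis bco) (inj_eq Some_inj) eq_sym; case: eqP => _; rewrite ?mulr1 ?mulr0.
by rewrite -mulrBr; apply: smallMl.
Qed.

(** Modulo [q], Kashiwara's [e_i] moves coordinates along crystal arrows and raises heights. While a
    coordinate away from the source is a unit, some [e_i] keeps the vector nonzero modulo [q];
    heights being bounded, this ends with a vector supported at [x0] modulo [q]. *)
Lemma climb_modq (W : M -> Prop) v : (forall i u u', ktilde_e i u u' -> W u -> W u') ->
  L0 v -> W v -> (exists x, ~ small (co x v)) ->
  exists w, [/\ L0 w, W w, ~ small (co x0 w) & forall x, x != x0 -> small (co x w)].
Proof.
move=> We; have [H Hb] := ht_bound C.
suff key n v' : (forall x, ~ small (co x v') -> H%:Z - ht (cwt C x) < n%:Z) -> L0 v' -> W v' ->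
    (exists x, ~ small (co x v')) ->
    exists w, [/\ L0 w, W w, ~ small (co x0 w) & forall x, x != x0 -> small (co x w)].
  apply: (key (\max_x `|H%:Z - ht (cwt C x)|.+1)%N v) => x _.
  have := @leq_bigmax _ (fun x => `|H%:Z - ht (cwt C x)|.+1)%N x; rewrite /=; lia.
elim: n v' => [|n IHn] {}v vn vL Wv [x vx]; first by have := vn x vx; have := Hb x; lia.
have [[y [yx0 vy]]|none] := classic (exists y, y != x0 /\ ~ small (co y v)); last first.
  have sm y : y != x0 -> small (co y v).
    by move=> yx0; apply: NNPP => ns; apply: none; exists y.
  exists v; split=> //; have [<- //|/sm //] := eqVneq x x0.
have [i [z yz]] : exists i z, ce C i y = Some z.
  apply: NNPP => none'; case/eqP: yx0; apply: src => i; case E: (ce C i y) => [z|//].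
  by case: none'; exists i, z.
have [T [TE Tlin TL _ To]] := e_operator i.
have Tco z' y' : ce C i y' = Some z' -> small (co z' (T v) - co y' v).
  move=> yz'; have := linear_modq z' Tlin To vL; rewrite (bigD1 y') ?yz' //= big1 ?addr0 //.
  move=> w /andP[/eqP /ce_cf wz /eqP wy]; case: wy; move/ce_cf: yz'.
  by rewrite wz => -[].
apply: (IHn (T v)).
- move=> z' z'v; have [[y' yz']|none] := classic (exists y', ce C i y' = Some z').
    have /vn : ~ small (co y' v).
      move=> h; apply: z'v; rewrite -[co z' _](subrK (co y' v)); apply: smallD => //; exact: Tco.
    by rewrite (ht_ce yz'); lia.
  case: z'v; have := linear_modq z' Tlin To vL; rewrite big1 ?subr0 // => w /eqP wz.
  by case: none; exists w.
- exact: TL.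
- by apply: (We i v) => //; apply/TE.
exists z => zv; apply: vy; rewrite -[co y v](subKr (co z (T v))); apply: smallB => //; exact: Tco.
Qed.

Variables (L : M -> Prop) (Y : eqType) (b' : Y -> M).
Hypotheses (LB : crystal_basis L b') (uL : L (b x0)) (uqL : ~ L (qvar^-1 *: b x0)).

Let latL : lattice L. Proof. by case: LB => -[]. Qed.
Let Le i u v : ktilde_e i u v -> L u -> L v.
Proof. by case: LB => -[_ _ h] _ _ _ _ uv /(h i u v)[/(_ uv)]. Qed.
Let Lf i u v : ktilde_f i u v -> L u -> L v.
Proof. by case: LB => -[_ _ h] _ _ _ _ uv /(h i u v)[_ /(_ uv)]. Qed.

(** Applying Kashiwara's operators to [b x0], which is in [L], gives vectors of [L] congruent to all
    the [b x]; by the Nakayama argument these span the model lattice. *)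
Lemma basis_lattice_sub v : L0 v -> L v.
Proof.
have lift x : exists w, L w /\ inqL co (w - b x).
  move: x; apply: (crystal_ind src) => [|i x y xy [w [wL wx]]].
    by exists (b x0); split=> // x; rewrite subrr (co0 bco); apply: small0.
  have [T [TE Tlin _ Tq Tf]] := f_operator i; exists (T w); split.
    by apply: (Lf (i := i) (u := w)) => //; apply/TE.
  have := Tq _ wx; have -> : T (w - b x) = T w - T (b x).
    by rewrite -scaleN1r addrC Tlin scaleN1r addrC.
  by move/(inqL_trans bco); apply; have := Tf x; rewrite xy.
have [w wP] := fin_all_exists lift; have [cw cwP] := near_basis bco (fun x => (wP x).2).
move=> /(near_basis_inL bco (fun x => (wP x).2) cwP) vL; rewrite [v](co_span cwP).
by apply: (lattice_sum latL) => x; apply: (lattice_Z latL) => //; case: (wP x).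
Qed.

(** If [v] in [L] needed a positive power of [q] to enter the model lattice, the scaled vector would
    be primitive there and divisible by [q] in [L]. Climbing preserves both properties and would put
    [b x0] divided by [q] in [L], against the normalization. *)
Lemma lattice_sub_basis v : L v -> L0 v.
Proof.
move=> vL; have [->|v0] := eqVneq v 0; first exact: (inL0 bco).
have [k [kL kns]] := primitive_vector bco v0; have [k0|k0] := leP k 0.
  rewrite -[v](scalerK (expfz_neq0 k qvar_neq0)) invr_expz.
  by apply: (inLZ bco) => //; apply: regular0_exprz; lia.
pose W u := L (qvar^-1 *: u).
have Wv : W (qvar ^ k *: v).
  rewrite /W scalerA (_ : qvar^-1 * qvar ^ k = qvar ^ (k - 1)); last by rewrite expfzDr ?qvar_neq0 // mulrC exprN1.
  by apply: (lattice_Z latL) => //; apply: regular0_exprz; lia.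
have We i u u' : ktilde_e i u u' -> W u -> W u'.
  have [T [TE Tlin _ _ _]] := e_operator i => /TE -> Wu; apply: (Le (i := i) (u := qvar^-1 *: u)) => //; apply/TE.
  have T0 : T 0 = 0 by have := Tlin (-1) 0 0; rewrite scaler0 addr0 scaleN1r addNr.
  by rewrite -[qvar^-1 *: u]addr0 Tlin T0 addr0.
have [w [wL Ww w0 wx]] := climb_modq We kL Wv kns; case: uqL.
have h : L (qvar^-1 *: (co x0 w *: b x0)).
  rewrite -[X in _ *: X](subKr w) scalerBr -scaleN1r addrC; apply: (lattice_lin latL) => //.
    by apply: regular0_opp; apply: regular0_1.
  apply: basis_lattice_sub; apply/(inqLP bco) => x; rewrite (coB bco) (coZ bco) (co_basis bco).
  have [->|xx0] := eqVneq x x0; first by rewrite mulr1 subrr; apply: small0.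
  by rewrite mulr0 subr0; apply: wx.
rewrite scalerA mulrC -scalerA in h; rewrite -[_ *: b x0](scalerK (a := co x0 w)).
  by apply: (lattice_Z latL) => //; apply: regular0_inv.
by apply/eqP => w00; apply: w0; rewrite w00; apply: small0.
Qed.

Lemma eqmodq_inqL u v : eqmodq L u v <-> inqL co (u - v).
Proof.
rewrite -(eqmodqP bco); split=> -[w [wL uv]]; exists w; split=> //; first exact: lattice_sub_basis.
exact: basis_lattice_sub.
Qed.

(** Some class of the given crystal basis involves [b x0]. Its representative is a weight vector,
    and the weight of the source occurs only once, so it is a multiple of [b x0]; the residue [r] of
    the factor is nonzero because the class is. *)
Lemma source_class : exists r y, r != 0 /\ inqL co (b' y - ratQq r *: b x0).
Proof.
have [_ b'L [b'free b'span] b'f _] := LB.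
have [l [a /eqmodq_inqL la]] := b'span _ (basis_lattice_sub (inL_basis bco x0)).
have [y ly] : exists y, co x0 (b' y) != 0.
  apply: NNPP => none; apply: not_small1; have := la x0.
  rewrite (coB bco) (co_basis bco) eqxx (co_sum bco) big1 ?subr0 // => y _.
  rewrite (coZ bco); have [->|h] := eqVneq (co x0 (b' y)) 0; first by rewrite mulr0.
  by case: none; exists y.
have [yL [mu ymu]] := b'L y; have yL0 := lattice_sub_basis yL.
have yE : b' y = co x0 (b' y) *: b x0.
  rewrite {1}[b' y](co_span bco) (bigD1 x0) //= big1 ?addr0 // => x xx0.
  have [->|h] := eqVneq (co x (b' y)) 0; first by rewrite scale0r.
  case/eqP: xx0; apply: (cwt_source_uniq src) => j.
  by rewrite -(weight_basis_coord bco bw ymu h) (weight_basis_coord bco bw ymu ly).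
have [r rP] := regular0_residue (yL0 x0).
have yr : inqL co (b' y - ratQq r *: b x0).
  rewrite yE -scalerBl; apply: (inqL_smallZ bco) => //; exact: (inL_basis bco).
exists r, y; split=> //; apply/eqP => r0; have /eqP := oner_neq0 rat; apply.
apply: (b'free [:: y] (fun=> 1)) (mem_head _ _) => //.
apply/eqmodq_inqL; rewrite big_seq1 subr0 [ratQq 1](_ : _ = 1); last by rewrite /ratQq polyC1 rmorph1.
by move: yr; rewrite r0 ratQq0 scale0r subr0 scale1r.
Qed.

(** Kashiwara's operators commute with scalars and both bases are stable under them, so the scalar
    [r] found at the source propagates along all arrows. *)
Lemma basis_class : exists r, r != 0 /\ forall s, exists y, inqL co (b' y - ratQq r *: b s).
Proof.
have [_ b'L [b'free b'span] b'f _] := LB.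
have [r [y0 [r0 y0r]]] := source_class; exists r; split=> // s.
move: s; apply: (crystal_ind src) => [|i s t st [y yr]]; first by exists y0.
have [T [TE Tlin TL Tq Tf]] := f_operator i.
have T0 : T 0 = 0 by have := Tlin (-1) 0 0; rewrite scaler0 addr0 scaleN1r addNr.
have Tt : inqL co (T (b' y) - ratQq r *: b t).
  have := Tq _ yr; rewrite addrC -scaleNr Tlin scaleNr addrC => /(inqL_trans bco); apply.
  rewrite -scalerBr; apply: (inqLZ bco); first exact: regular0_rat.
  by have := Tf s; rewrite st.
have [|[z /eqmodq_inqL yz]] := b'f i y (T (b' y)) (or_intror ((TE _ _).2 erefl)).
  move=> /eqmodq_inqL; rewrite subr0 => h; have := inqL_trans bco (w := 0) (inqL_sym bco Tt) _.
  rewrite !subr0 => /(_ h t); rewrite (coZ bco) (co_basis bco) eqxx mulr1 => /small_rat /eqP.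
  by rewrite (negPf r0).
by exists z; apply: (inqL_trans bco) (inqL_sym bco yz) Tt.
Qed.

(** Send [s] to the element whose class is [r] times that of [b s]. Injectivity holds because [r] is
    nonzero; an element outside the image would depend linearly on the classes in the image, against
    freeness. *)
Lemma crystal_graph_uniq : isomorphic (cgraph_of C) (crystal_graph L b').
Proof.
have [_ b'L [b'free b'span] b'f _] := LB.
have [r [r0 /fin_all_exists[g gE]]] := basis_class.
have ginj : injective g.
  move=> s t st; have := inqL_trans bco (inqL_sym bco (gE s)) (_ : inqL co (_ - ratQq r *: b t)).
  rewrite st => /(_ (gE t) s); rewrite (coB bco) !(coZ bco) !(co_basis bco) eqxx mulr1.
  case: eqVneq => // _; rewrite mulr0 subr0 => /small_rat /eqP.
  by rewrite (negPf r0).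
have gsurj y : exists s, g s == y.
  apply: NNPP => none; have yL0 := lattice_sub_basis (b'L y).1.
  have /fin_all_exists[c cP] := fun x => regular0_residue (yL0 x).
  (* Coefficients of a relation modulo [q] between the missing class of [y] and the classes of the
     [g s]. *)
  pose h z := if z == y then 1 else if [pick s | g s == z] is Some s then - (c s / r) else 0 : rat.
  have yg : y \notin [seq g s | s <- enum X].
    by apply/negP => /mapP[s _ ys]; apply: none; exists s; rewrite ys.
  have hg s : h (g s) = - (c s / r).
    rewrite /h; case: eqP => [ys|_]; first by case: none; exists s; apply/eqP.
    by case: pickP => [s' /eqP/ginj -> //|/(_ s)]; rewrite eqxx.
  have := @b'free (y :: [seq g s | s <- enum X]) h; rewrite cons_uniq yg (map_inj_uniq ginj) enum_uniq.
  move=> /(_ isT) free.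
  have /eqP : h y != 0 by rewrite /h eqxx oner_neq0.
  apply; apply: (free) (mem_head _ _); apply/eqmodq_inqL; rewrite subr0 big_cons big_map big_enum /= {1}/h eqxx.
  have -> : ratQq 1 = 1 by rewrite /ratQq polyC1 rmorph1.
  rewrite scale1r => x; rewrite (coD bco) (co_sum bco).
  rewrite -[co x (b' y)](subrK (ratQq (c x))) -addrA; apply: smallD; first exact: cP.
  rewrite -[ratQq (c x)](co_comb bco x (fun z => ratQq (c z))) (co_sum bco) -big_split /=.
  apply: small_sum => z _; rewrite hg -(coD bco).
  have -> : ratQq (c z) *: b z + ratQq (- (c z / r)) *: b' (g z) =
      - (ratQq (c z / r) *: (b' (g z) - ratQq r *: b z)).
    have -> : ratQq (- (c z / r)) = - ratQq (c z / r) by rewrite /ratQq polyCN rmorphN.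
    rewrite scalerBr scalerA -ratQqM divfK // opprB scaleNr addrC.
    by rewrite addrC.
  rewrite (coN bco) (coZ bco); apply/smallN/smallMl; [exact: regular0_rat|exact: gE].
have [gV gVP] : exists gV : Y -> X, forall y, g (gV y) = y.
  by apply: (@functional_choice Y X (fun y s => g s = y)) => y; have [s /eqP] := gsurj y; exists s.
exists g; split; first by exists gV => // s; apply: ginj; rewrite gVP.
move=> i s t /=; have [T [TE Tlin TL Tq Tf]] := f_operator i.
have Tg : inqL co (T (b' (g s)) - ratQq r *: ob b (cf C i s)).
  have := Tq _ (gE s); rewrite addrC -scaleNr Tlin scaleNr addrC => /(inqL_trans bco); apply.
  by rewrite -scalerBr; apply: (inqLZ bco) => //; exact: regular0_rat.
split=> [st|[v [/TE -> /eqmodq_inqL h]]].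
  exists (T (b' (g s))); split; first exact/TE.
  apply/eqmodq_inqL; apply: (inqL_trans bco) Tg _; rewrite st.
  exact: (inqL_sym bco).
have := inqL_trans bco (inqL_trans bco (inqL_sym bco Tg) h) (gE t) => /(_ t).
rewrite (coB bco) !(coZ bco) (co_basis bco) eqxx mulr1.
case: (cf C i s) => [z|] /=; rewrite ?(co_basis bco) ?(co0 bco).
  case: eqVneq => [-> //|_]; rewrite mulr0 sub0r => /smallN; rewrite opprK => /small_rat/eqP.
  by rewrite (negPf r0).
rewrite mulr0 sub0r => /smallN; rewrite opprK => /small_rat/eqP.
by rewrite (negPf r0).
Qed.

End Uniqueness.

Definition model_graph a b : cgraph := cgraph_of (model_crystal a b).

Lemma regular_model (H : cgraph) : regular_B2_crystal H ->
  exists a b, isomorphic (model_graph a b) H.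
Proof.
move=> [M [Mirr [la [v [v0 lv ev gen]]] Mint [L [Y [b' [LB ->]]]]]].
have [a aE] := highest_weight_nonneg Mint v0 lv (ev col1).
have [b bE] := highest_weight_nonneg Mint v0 lv (ev col2).
exists a, b; have lx : la =1 cwt (model_crystal a b) (model_source a b).
  by case; rewrite ?aE ?bE /cwt /=; lia.
have [c [co [cco cw cstr]]] := hw_model_basis Mirr v0 lv ev gen (model_realizable a b) lx.
have latL : lattice L by case: LB => -[].
set x0 := model_source a b in lx; have cx0 := basis_neq0 x0 cco.
have src x : source (model_crystal a b) x -> x = x0 by move/model_sourceP.
                                                    
(* The realized basis is rescaled by the power of [q] that puts its highest weight vector in [L] but
   not in [q] times [L]. *)
have [m mL] := lattice_scaling latL (c x0).
have u0 : qvar ^+ m *: c x0 != 0 by rewrite scaler_eq0 negb_or cx0 expf_neq0 ?qvar_neq0.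
have [k [kL knL]] : exists k : nat, L (qvar ^- k *: (qvar ^+ m *: c x0)) /\
    ~ L (qvar ^- k.+1 *: (qvar ^+ m *: c x0)).
  apply: NNPP => none; case/eqP: u0; apply: (lattice_separated latL); elim=> [|k IHk].
    by rewrite expr0 invr1 scale1r.
  by apply: NNPP => nL; apply: none; exists k.
pose al := qvar ^- k * qvar ^+ m.
have al0 : al != 0 by rewrite mulf_neq0 ?invr_eq0 ?expf_neq0 ?qvar_neq0.
have [co' [cco' cw' cstr']] := rescale_basis al0 cco cw cstr.
apply: (crystal_graph_uniq src cco' cw' cstr' LB); first by rewrite -scalerA.
by rewrite !scalerA mulrA -invfM -exprS -scalerA.
Qed.

Lemma regular_iff_model (G : cgraph) :
  (exists H, regular_B2_crystal H /\ isomorphic G H) <-> exists a b, isomorphic G (model_graph a b).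
Proof.
split=> [[H [/regular_model[a [b ab]] GH]]|[a [b ab]]].
  by exists a, b; apply: isomorphic_trans GH (isomorphic_sym ab).
have [H [Hr aH]] := realizable_regular (model_realizable a b).
by exists H; split=> //; apply: isomorphic_trans ab aH.
Qed.

(** * S-graphs and the model *)

Ltac qcases := repeat match goal with
  | |- context [if ?c then _ else _] => case: (boolP c) => ? end.

Section SailModel.
Variables a b : nat.

(** The colour 2 line of abscissa [p] in a left sail starts at the ordinary diagonal point (p, p) or
    (p, 2p). This point is the vertex (i, i + p, j, j), respectively (i, i, j, j + 2p), of C(A, B),
    and the last coordinate is the distance to it; [rq] does the same for right sails, whose lines
    end on the diagonal. *)
Definition lq (i j p s : int) : qpoint :=
  if p <= 0 then (i, i + p, j, 0, s - p) else (i, i, j, p, s - 2 * p).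
Definition rq (i j p s : int) : qpoint :=
  if 0 <= p then (i + p, i, j, 0, s - p) else (i, i, j + 2 * p, - p, s - 2 * p).

Definition to_q (u : spoint) : qpoint :=
  match u with
  | SC (x, y, k, l) => (x, y, k, ((l - k) %/ 2)%Z, 0)
  | SL i j p s => lq i j p s
  | SR i j p s => rq i j p s
  end.

Definition to_s (q : qpoint) : spoint :=
  let: (x, y, k, j, s) := q in
  if s == 0 then SC (x, y, k, k + 2 * j)
  else if 0 < s then SL x k (if 0 < j then j else y - x) (s + (y - x) + 2 * j)
  else SR y (k + 2 * j) (if 0 < j then - j else x - y) (s + (x - y) - 2 * j).

(** Turns parity into integer division, a form that linear arithmetic can use. *)
Lemma eqz_nat_parity (z : int) : odd (`|z|)%N = (z != (z %/ 2)%Z * 2).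
Proof. lia. Qed.

Lemma to_q_in u : is_S_vertex (Seg a) (Seg b) u -> in_model a b (to_q u).
Proof.
case: u => [[[[x y] k] l]|i j p s|i j p s].
- rewrite /= /in_model => /andP[h1]; rewrite eqz_nat_parity => h2; lia.
- rewrite /= /lsail /left_sail /lq /=; qcases => //; rewrite /in_model; lia.
rewrite /= /rsail /right_sail /rq /=; qcases => //; rewrite /in_model; lia.
Qed.

Lemma to_s_in q : in_model a b q -> is_S_vertex (Seg a) (Seg b) (to_s q).
Proof.
move: q => [[[[x y] k] j] s] /=; rewrite /in_model => h.
qcases; rewrite /= ?eqz_nat_parity /lsail /rsail /=; qcases; rewrite ?andbT ?andbF; try lia.
Qed.

Lemma to_sK q : in_model a b q -> to_q (to_s q) = q.
Proof.
move: q => [[[[x y] k] j] s] /=; rewrite /in_model => h.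
qcases; rewrite /= /lq /rq; qcases; congr (_, _, _, _, _); lia.
Qed.

Lemma to_qK u : is_S_vertex (Seg a) (Seg b) u -> to_s (to_q u) = u.
Proof.
case: u => [[[[x y] k] l]|i j p s|i j p s].
- by rewrite /= eqz_nat_parity => h; congr (SC (_, _, _, _)); lia.
- rewrite /= /lsail /left_sail /lq /=; qcases => /and4P[h1 h2 h3 /eqP h4] //; rewrite /to_s; qcases; try (congr SL); lia.
rewrite /= /rsail /right_sail /rq /=; qcases => /and4P[h1 h2 h3 /eqP h4] //; rewrite /to_s; qcases; try (congr SR); lia.
Qed.

Lemma to_q_inj u v : is_S_vertex (Seg a) (Seg b) u -> is_S_vertex (Seg a) (Seg b) v ->
  to_q u = to_q v -> u = v.
Proof. by move=> /to_qK {2}<- /to_qK {2}<- ->. Qed.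

Local Notation A := (Seg a).
Local Notation B := (Seg b).

Lemma at_leftE i j p s : mem_ix A i -> mem_ix B j -> lsail A B i j (Pt p s) ->
  is_S_vertex A B (at_left i j (Pt p s)) /\ to_q (at_left i j (Pt p s)) = lq i j p s.
Proof.
rewrite /at_left /stringII /inR /inL /= /lsail /left_sail /= => iA jB h.
qcases; rewrite /= ?eqz_nat_parity /lq /lsail /left_sail /=; (split; [qcases; rewrite ?eqxx; lia|]); qcases; congr (_, _, _, _, _); lia.
Qed.

Lemma at_rightE i j p s : mem_ix A i -> mem_ix B j -> rsail A B i j (Pt p s) ->
  is_S_vertex A B (at_right i j (Pt p s)) /\ to_q (at_right i j (Pt p s)) = rq i j p s.
Proof.
rewrite /at_right /stringI /inR /inL /= /rsail /right_sail /= => iA jB h.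
qcases; rewrite /= ?eqz_nat_parity /rq /rsail /right_sail /=; (split; [qcases; rewrite ?eqxx; lia|]); qcases; congr (_, _, _, _, _); lia.
Qed.

Lemma S_edge_qf c u v : is_S_vertex A B u -> is_S_vertex A B v ->
  S_edge A B c u v -> qf a b c (to_q u) = Some (to_q v).
Proof.
move=> uS vS [].
- move=> [i [j [_ [_ [/andP[iA jB] [p [s [-> -> yS zS]]] -> ->]]]]].
  have [_ ->] := at_leftE iA jB yS; have [_ ->] := at_leftE iA jB zS.
  move: yS zS iA jB; rewrite /lsail /left_sail /lq; case: c => /=; qcases => /= *; qcases;
    first [by exfalso; lia|congr (Some (_, _, _, _, _)); lia].
- move=> [i [j [_ [_ [/andP[iA jB] [p [s [-> -> yS zS]]] -> ->]]]]].
  have [_ ->] := at_rightE iA jB yS; have [_ ->] := at_rightE iA jB zS.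
  move: yS zS iA jB; rewrite /rsail /right_sail /rq; case: c => /=; qcases => /= *; qcases;
    first [by exfalso; lia|congr (Some (_, _, _, _, _)); lia].
move=> [-> [w [wC wo [i [j [_ [_ [/andP[iA jB] [h [-> -> yS zS]] -> wE]]]]]
  [i' [j' [_ [_ [/andP[iA' jB'] [h' [-> -> yS' zS']] wE' ->]]]]]]]].
have [_ ->] := at_leftE iA jB yS; have [_ ->] := at_rightE iA' jB' zS'.
move: wE wE'; rewrite /at_left /at_right /= /stringI /stringII /inL /inR.
rewrite (_ : (2 * h%:Z + 1 <= 0) = false); last by clear; lia.
rewrite (_ : (- (2 * h'%:Z) - 1 <= 0) = true); last by clear; lia.
(* The two half-edges share their half point; equating its two codes gives i' = i, h' = h and j' = j
   + 2h + 1. *)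
move=> -[->] [ii _ jj jj']; rewrite -ii; have {jj jj'} [-> ->] : j' = j + 2 * h%:Z + 1 /\ h' = h by clear -jj jj'; lia.
clear; rewrite /lq /rq; qcases => /=; qcases; first [by exfalso; lia|congr (Some (_, _, _, _, _)); lia].
Qed.

Lemma qf_S_edge c u v : is_S_vertex A B u -> is_S_vertex A B v ->
  qf a b c (to_q u) = Some (to_q v) -> S_edge A B c u v.
Proof.
move=> uS vS uv; have uQ := to_q_in uS; have vQ := to_q_in vS.
have left_ i j p s : mem_ix A i -> mem_ix B j -> lsail A B i j (Pt p s) ->
    lsail A B i j (Pt (step c p s).1 (step c p s).2) ->
    to_q u = lq i j p s -> to_q v = lq i j (step c p s).1 (step c p s).2 -> S_edge A B c u v.
  move=> iA jB yS zS uE vE; constructor 1; exists i, j, (Pt p s), (Pt (step c p s).1 (step c p s).2).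
  have [yV yE] := at_leftE iA jB yS; have [zV zE] := at_leftE iA jB zS.
  split; [by rewrite iA|by exists p, s|apply: to_q_inj => //; congruence|apply: to_q_inj => //; congruence].
have right_ i j p s : mem_ix A i -> mem_ix B j -> rsail A B i j (Pt p s) ->
    rsail A B i j (Pt (step c p s).1 (step c p s).2) ->
    to_q u = rq i j p s -> to_q v = rq i j (step c p s).1 (step c p s).2 -> S_edge A B c u v.
  move=> iA jB yS zS uE vE; constructor 2; exists i, j, (Pt p s), (Pt (step c p s).1 (step c p s).2).
  have [yV yE] := at_rightE iA jB yS; have [zV zE] := at_rightE iA jB zS.
  split; [by rewrite iA|by exists p, s|apply: to_q_inj => //; congruence|apply: to_q_inj => //; congruence].
case Eu: (to_q u) uv uQ => [[[[x y] k] j] s]; case Ev: (to_q v) vQ => [[[[x' y'] k'] j'] s'].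
rewrite /in_model => vQ uv uQ; have dv n (P : Prop) : P -> n = n :> nat -> P by [].
(* Arrows leaving a positive height, and 2-arrows leaving height 0, lie in a left sail, except the
   1-arrow from height 1 with x = y, which is a merged pair of half-edges; all other arrows lie in a
   right sail. *)
have [s0|s0] := boolP ((0 < s) || (s == 0) && if c is col2 then true else false).
  have [cc|cc] := boolP ((if c is col1 then true else false) && (x == y) && (s == 1)).
    case: c uv left_ right_ s0 cc => //= uv _ _ _ cc.
    constructor 3; split=> //; exists (x, x, k, k + 2 * j + 1); split.
    - rewrite /=; lia.
    - rewrite /is_otimes eqz_nat_parity; lia.
    - exists x, k, (Pt j (2 * j + 1)), (Half `|j|); split; [rewrite /=; lia| | | ].
      + by exists `|j|%N; split; [congr (Pt _ _); lia|by []|rewrite /left_sail /=; lia|rewrite /=; lia].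
      + have [|||yV yE] := @at_leftE x k j (2 * j + 1); try (rewrite /lsail /=; lia).
        apply: to_q_inj => //; rewrite Eu yE /lq; qcases; congr (_, _, _, _, _); lia.
      by rewrite /at_left /= /stringII /inL; qcases; congr (SC (_, _, _, _)); lia.
    exists x, (k + 2 * j + 1), (Half `|j|), (Pt (- j) (- (2 * j) - 1)); split; [rewrite /=; lia| | | ].
    + by exists `|j|%N; split; [by []|congr (Pt _ _); lia|rewrite /=; lia|rewrite /right_sail /=; lia].
    + by rewrite /at_right /= /stringI /inL; qcases; congr (SC (_, _, _, _)); lia.
    have [|||yV yE] := @at_rightE x (k + 2 * j + 1) (- j) (- (2 * j) - 1); try (rewrite /rsail /=; lia).
    apply: to_q_inj => //; rewrite Ev yE; move: uv; rewrite /= /rq; qcases; try lia; move=> -[<- <- <- <- <-];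
      congr (_, _, _, _, _); lia.
  apply: (left_ x k (if 0 < j then j else y - x) (s + (y - x) + 2 * j)).
  - rewrite /=; lia.
  - rewrite /=; lia.
  - move: s0; clear -uQ; case: (c) => /= ?; rewrite /lsail /=; case: (boolP (0 < j)) => ?; qcases; lia.
  - move: uv; rewrite /lsail; case: (c) s0 cc => /= ? ?; case: (boolP (0 < j)) => ?; qcases => //= -[] *; subst; qcases; lia.
  - move: s0; rewrite Eu; clear -uQ; case: (c) => /= ?; rewrite /lq; case: (boolP (0 < j)) => ?; qcases; congr (_, _, _, _, _); lia.
  rewrite Ev /lq; move: uv; case: (c) s0 cc => /= ? ?; case: (boolP (0 < j)) => ?; qcases => //= -[] *; subst; qcases; congr (_, _, _, _, _); lia.
apply: (right_ y (k + 2 * j) (if 0 < j then - j else x - y) (s + (x - y) - 2 * j)).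
- rewrite /=; lia.
- rewrite /=; lia.
- move: uv; rewrite /rsail; case: (c) s0 => /= ?; case: (boolP (0 < j)) => ?; qcases => //= -[] *; subst; qcases; lia.
- move: uv; rewrite /rsail; case: (c) s0 => /= ?; case: (boolP (0 < j)) => ?; qcases => //= -[] *; subst; qcases; lia.
- move: uv; rewrite Eu /rq; case: (c) s0 => /= ?; case: (boolP (0 < j)) => ?; qcases => //= -[] *; subst; qcases; congr (_, _, _, _, _); lia.
rewrite Ev /rq; move: uv; case: (c) s0 => /= ?; case: (boolP (0 < j)) => ?; qcases => //= -[] *; subst; qcases; congr (_, _, _, _, _); lia.
Qed.

Lemma S_graph_model : isomorphic (S_graph A B) (model_graph a b).
Proof.
exists (fun u => to_model (to_q_in (valP u))); split.
  exists (fun q : model a b => exist _ (to_s (val q)) (to_s_in (model_in q))).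
    by move=> [u uS]; apply: val_inj; rewrite /= to_qK.
  by move=> q; apply: val_inj; rewrite /= to_sK // model_in.
move=> c [u uS] [v vS]; rewrite [edge _ _ _ in X in _ <-> X]/= model_fP /=.
by split=> [|h]; [apply: S_edge_qf|apply: qf_S_edge].
Qed.
End SailModel.

(** * The axioms hold in the model *)

Lemma inj_surj_bij (S T : Type) (f : S -> T) : injective f -> (forall y, exists x, f x = y) ->
  bijective f.
Proof.
move=> finj fsurj; have [g fg] : exists g : T -> S, forall y, f (g y) = y.
  exact: (@functional_choice T S (fun y x => f x = y)).
by exists g => // x; apply: finj; rewrite fg.
Qed.

Section Strings.
Variables (G : cgraph) (i : color).
Hypothesis edge_inj : forall u u' v : G, edge i u v -> edge i u' v -> u = u'.
Hypothesis edge_fun : forall u v v' : G, edge i u v -> edge i u v' -> v = v'.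

Lemma before_eqVbefore (u v : G) : before_eq i u v -> u = v \/ before i u v.
Proof.
elim=> [x y xy|x|x y z _ [->|xy] _ [<-|yz]]; [by right; apply: t_step|by left|by left|by right|by right|].
by right; apply: t_trans yz.
Qed.

Lemma beforeW (u v : G) : before i u v -> before_eq i u v.
Proof. by elim=> [x y xy|x y z _ xy _ yz]; [apply: rt_step|apply: rt_trans yz]. Qed.

Lemma before_eq_string (u v : G) : before_eq i u v -> same_string i u v.
Proof.
elim=> [x y xy|x|x y z _ xy _ yz]; [exact: rst_step|exact: rst_refl|exact: rst_trans yz].
Qed.

                                                                             
(** As all in- and outdegrees are at most 1, each step of an undirected walk lengthens or shortens
    the directed path built so far. *)
Lemma string_total (u v : G) : same_string i u v -> before_eq i u v \/ before_eq i v u.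
Proof.
move/clos_rst_rst1n_iff; elim=> [x|x y z [xy|yx] _ [yz|zy]]; first by left; apply: rt_refl.
- by left; apply: rt_trans yz; apply: rt_step.
- move/clos_rt_rtn1_iff: zy xy => []; first by left; apply: rt_step.
  by move=> y' z' y'z /clos_rt_rtn1_iff zy xz; right; rewrite (edge_inj xz y'z).
- move/clos_rt_rt1n_iff: yz yx => [yx|y' z' yy' /clos_rt_rt1n_iff yz yx].
    by right; apply: rt_step.
  by left; rewrite (edge_fun yx yy').
by right; apply: rt_trans zy _; apply: rt_step.
Qed.

Lemma before_eq_step (u w v : G) : edge i u w -> before_eq i u v -> u = v \/ before_eq i w v.
Proof.
move=> uw /clos_rt_rt1n_iff uv; case: uv uw => [|w' v' uw' /clos_rt_rt1n_iff wv uw]; first by left.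
by right; rewrite (edge_fun uw uw').
Qed.

Lemma before_eq_pred (u w v : G) : edge i w v -> before_eq i u v -> u = v \/ before_eq i u w.
Proof.
move=> wv /clos_rt_rtn1_iff uv; case: uv wv => [|w' v' wv' /clos_rt_rtn1_iff uw wv]; first by left.
by right; rewrite (edge_inj wv wv').
Qed.
End Strings.

Lemma RA2_edgeE i x y k l x' y' k' l' : RA2_edge i (x, y, k, l) (x', y', k', l') <->
  if i is col1 then (k = l /\ k' = l' /\ x' = x + 1 /\ y' = y /\ k' = k) \/
                    (x = y /\ x' = y' /\ x' = x /\ k' = k + 1 /\ l' = l)
  else (k = l /\ k' = l' /\ x' = x /\ y' = y + 1 /\ k' = k) \/
       (x = y /\ x' = y' /\ x' = x /\ k' = k /\ l' = l + 1).
Proof.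
split.
  by case=> -[? [? [? [[? ? ? ?] [? ? ? ?]]]]]; subst; case: i => /=; [left|left|right|right].
rewrite /RA2_edge /inR /inL; case: i => /= -[[? [? [? [? ?]]]]|[? [? [? [? ?]]]]]; subst.
- by left; do 3 eexists.
- by right; do 3 eexists.
- by left; do 3 eexists.
by right; do 3 eexists.
Qed.

Definition height (p : qpoint) : int := p.2.

Lemma qf1_height a b p r : in_model a b p -> qf a b col1 p = Some r -> height r < height p.
Proof.
move: p r => [[[[x y] k] j] s] [[[[x' y'] k'] j'] s']; rewrite /in_model /height /= => h.
by qcases => // -[*]; subst; lia.
Qed.

Lemma qf2_height a b p r : qf a b col2 p = Some r -> height r = height p + 1.
Proof.
move: p r => [[[[x y] k] j] s] [[[[x' y'] k'] j'] s']; rewrite /height /=.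
by qcases => // -[*]; subst.
Qed.

Definition central_pair (p r : qpoint) : bool :=
  let: (x, y, k, j, s) := p in [&& x == y, s == 1 & r == (x, y, k + 1, j, -1)].

Section ModelAxioms.
Variables (a b : nat) (G : cgraph) (c : G -> qpoint).
Hypotheses (cin : forall u, in_model a b (c u)) (cinj : injective c).
Hypothesis csurj : forall q, in_model a b q -> exists u, c u = q.
Hypothesis edgeE : forall i u v, edge i u v <-> qf a b i (c u) = Some (c v).

Implicit Types u v w : G.

(** Here [c] identifies [G] with the model. Central vertices are the points of height 0; by
    [model_left] and [model_right], left and right will mean positive and negative height. *)
Definition model_cv : pred G := fun u => height (c u) == 0.
Definition model_ce : rel G := fun u v => central_pair (c u) (c v).
Local Notation cv := model_cv.
Local Notation ce := model_ce.

Lemma model_edge i u q : qf a b i (c u) = Some q -> exists v, c v = q /\ edge i u v.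
Proof.
move=> uq; have [v vq] := csurj (qf_in (cin u) uq).
by exists v; split=> //; apply/edgeE; rewrite uq vq.
Qed.

Lemma model_coedge i u q : qe i (c u) = Some q -> exists v, c v = q /\ edge i v u.
Proof.
move=> uq; have qin := qe_in (cin u) uq; have [v vq] := csurj qin.
by exists v; split=> //; apply/edgeE; rewrite vq; apply/(qe_qf _ (cin u) qin).
Qed.

Lemma model_edge_inj i u u' v : edge i u v -> edge i u' v -> u = u'.
Proof.
move=> /edgeE/(qe_qf i (cin v) (cin u)) h /edgeE/(qe_qf i (cin v) (cin u')).
by rewrite h => -[/cinj].
Qed.

Lemma model_edge_fun i u v v' : edge i u v -> edge i u v' -> v = v'.
Proof. by move=> /edgeE h /edgeE; rewrite h => -[/cinj]. Qed.

Lemma before1_height u v : before col1 u v -> height (c v) < height (c u).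
Proof. by elim=> [{}u {}v /edgeE/(qf1_height (cin u))//|x y z _ h _ h']; apply: lt_trans h. Qed.

Lemma before2_height u v : before col2 u v -> height (c u) < height (c v).
Proof.
by elim=> [{}u {}v /edgeE/qf2_height ->|x y z _ h _ h']; [rewrite ltrDl|apply: lt_trans h'].
Qed.

Lemma before1_eq_height u v : before_eq col1 u v -> height (c v) <= height (c u).
Proof. by case/before_eqVbefore => [->//|/before1_height/ltW]. Qed.

Lemma model_ceE u v : ce u v -> [/\ edge col1 u v, height (c u) = 1 & height (c v) = -1].
Proof.
rewrite /model_ce => uv.
suff [uv' u1 v1] : [/\ qf a b col1 (c u) = Some (c v), height (c u) = 1 & height (c v) = -1].
  by split=> //; apply/edgeE.
move: uv; have := cin u; have := cin v.
move: (c u) (c v) => [[[[x y] k] j] s] [[[[x' y'] k'] j'] s']; rewrite /in_model /height /=.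
move=> h h' /and3P[/eqP xy /eqP s1 /eqP[? ? ? ? ?]]; subst; rewrite ltxx /=; split=> //.
Qed.

(** Along 1-arrows the height decreases, and the only arrows from a positive to a negative height
    are the central edges; so the path meets height 0 or crosses a central edge. *)
Lemma central_after u : 0 < height (c u) ->
  (exists v, cv v /\ before col1 u v) \/ (exists v w, ce v w /\ before_eq col1 u v).
Proof.
move=> u0; have [n nE] : exists n : nat, height (c u) < n%:Z by exists `|height (c u)|.+1; lia.
elim: n u u0 nE => [|n IHn] u u0 un; first by lia.
have [v uv] : exists v, edge col1 u v.
  have [q uq] : exists q, qf a b col1 (c u) = Some q.
    move: u0; case: (c u) => [[[[x y] k] j] s] /= s0.
    by rewrite (_ : 1 <= s) //; qcases; eexists.
  by have [v [_ uv]] := model_edge uq; exists v.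
have vu := qf1_height (cin u) ((edgeE _ _ _).1 uv); have [v0|v0|v0] := ltgtP (height (c v)) 0.
- right; exists u, v; split; last exact: rt_refl.
  move: u0 v0; move/edgeE: uv; rewrite /model_ce; have := cin u; have := cin v.
  move: (c u) (c v) => [[[[x y] k] j] s] [[[[x' y'] k'] j'] s']; rewrite /in_model /height /=.
  by move=> h h'; qcases => // -[*]; subst; rewrite ?eqxx ?andbT; lia.
- have [|[w [wc vw]]|[w [w' [wc vw]]]] := IHn v v0; first by lia.
    by left; exists w; split=> //; apply: t_trans vw; apply: t_step.
  by right; exists w, w'; split=> //; apply: rt_trans vw; apply: rt_step.
by left; exists v; split; [apply/eqP|apply: t_step].
Qed.

Lemma central_before u : height (c u) < 0 ->
  (exists v, cv v /\ before col1 v u) \/ (exists v w, ce v w /\ before_eq col1 w u).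
Proof.
move=> u0; have [n nE] : exists n : nat, - height (c u) < n%:Z by exists `|height (c u)|.+1; lia.
elim: n u u0 nE => [|n IHn] u u0 un; first by lia.
have [v vu] : exists v, edge col1 v u.
  have [q uq] : exists q, qe col1 (c u) = Some q.
    move: u0; case: (c u) => [[[[x y] k] j] s] /= s0.
    by rewrite (_ : s <= -1); [qcases; eexists|move: s0; rewrite /height /=; lia].
  by have [v [_ vu]] := model_coedge uq; exists v.
have uv := qf1_height (cin v) ((edgeE _ _ _).1 vu); have [v0|v0|v0] := ltgtP (height (c v)) 0.
- have [|[w [wc vw]]|[w [w' [wc vw]]]] := IHn v v0; first by lia.
    by left; exists w; split=> //; apply: t_trans vw _; apply: t_step.
  by right; exists w, w'; split=> //; apply: rt_trans vw _; apply: rt_step.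
- right; exists v, u; split; last exact: rt_refl.
  move: u0 v0; move/edgeE: vu; rewrite /model_ce; have := cin u; have := cin v.
  move: (c v) (c u) => [[[[x y] k] j] s] [[[[x' y'] k'] j'] s']; rewrite /in_model /height /=.
  by move=> h h'; qcases => // -[*]; subst; rewrite ?eqxx ?andbT; lia.
by left; exists v; split; [apply/eqP|apply: t_step].
Qed.

Lemma model_left u : left_vertex cv ce u <-> 0 < height (c u).
Proof.
split; last exact: central_after.
case=> [[v [/eqP v0 /before1_height]]|[v [w [/model_ceE[_ v1 _] /before1_eq_height]]]]; lia.
Qed.

Lemma model_right u : right_vertex cv ce u <-> height (c u) < 0.
Proof.
split; last exact: central_before.
case=> [[v [/eqP v0 /before1_height]]|[v [w [/model_ceE[_ _ w1] /before1_eq_height]]]]; lia.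
Qed.

Lemma model_B0 : axiom_B0 G.
Proof.
move=> i; split=> [u u' v|u v v'|u]; [exact: model_edge_inj|exact: model_edge_fun|].
by case: i => [/before1_height|/before2_height]; rewrite ltxx.
Qed.

Lemma central_string1_uniq u x x' : central_in_1string cv ce u x -> central_in_1string cv ce u x' ->
  x = x'.
Proof.
have tot := string_total (@model_edge_inj col1) (@model_edge_fun col1).
have cmp v v' : same_string col1 u v -> same_string col1 u v' -> before_eq col1 v v' \/ before_eq col1 v' v.
  by move=> uv uv'; apply: tot; apply: rst_trans uv'; apply: rst_sym.
have sep v v' w' : cv v -> ce v' w' -> same_string col1 u v -> same_string col1 u v' -> False.
  move=> /eqP v0 /model_ceE[e v1 w1] h h'; have [|vv'] := cmp _ _ h h'.
    by move/before1_eq_height; rewrite v0 v1.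
  have [vE|] := before_eq_step (@model_edge_fun col1) e vv'; first by rewrite vE v0 in v1.
  by move/before1_eq_height; rewrite v0 w1.
case: x x' => [v|[v w]] [v'|[v' w']] //=.
- move=> [/eqP v0 uv] [/eqP v0' uv']; have [/before_eqVbefore|/before_eqVbefore] := cmp _ _ uv uv'.
    by case=> [-> //|/before1_height]; rewrite v0 v0'.
  by case=> [-> //|/before1_height]; rewrite v0 v0'.
- by move=> [v0 uv] [vw uv' _]; case: (sep _ _ _ v0 vw uv uv').
- by move=> [vw uv' _] [v0 uv]; case: (sep _ _ _ v0 vw uv uv').
move=> [/model_ceE[e v1 _] uv _] [/model_ceE[e' v1' _] uv' _].
have vv' : v = v'.
  have [/before_eqVbefore|/before_eqVbefore] := cmp _ _ uv uv'.
    by case=> [-> //|/before1_height]; rewrite v1 v1'.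
  by case=> [-> //|/before1_height]; rewrite v1 v1'.
by rewrite -vv' in e' *; rewrite (model_edge_fun e e').
Qed.

Lemma model_B1 : axiom_B1 cv ce.
Proof.
move=> u; suff [x ux] : exists x, central_in_1string cv ce u x.
  by exists x; split=> // x'; apply: central_string1_uniq.
have [u0|u0|u0] := ltgtP (height (c u)) 0.
- case: (central_before u0) => [[v [v0 vu]]|[v [w [vw wu]]]].
    by exists (inl v); split=> //; apply/rst_sym/before_eq_string/beforeW.
  have [e _ _] := model_ceE vw; exists (inr (v, w)); split=> //.
    by apply: rst_sym; apply: rst_trans (before_eq_string wu); apply: rst_step.
  exact/rst_sym/before_eq_string.
- case: (central_after u0) => [[v [v0 vu]]|[v [w [vw wu]]]].
    by exists (inl v); split=> //; apply/before_eq_string/beforeW.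
  have [e _ _] := model_ceE vw; exists (inr (v, w)); split=> //; first exact: before_eq_string.
  by apply: rst_trans (before_eq_string wu) _; apply: rst_step.
by exists (inl u); split; [apply/eqP|apply: rst_refl].
Qed.

(** A 2-arrow raises the height by 1, and the admissible heights of a 2-string form an interval
    containing 0. *)
Lemma model_B2 : axiom_B2 cv ce.
Proof.
split=> [u|v /eqP v0]; last first.
  by split=> u /before2_height; rewrite v0 => ?; [apply/model_right|apply/model_left].
suff [v [v0 uv]] : exists v, cv v /\ same_string col2 u v.
  exists v; split=> // v' [v0' uv'].
  have [] : before_eq col2 v v' \/ before_eq col2 v' v.
  + apply: (string_total (@model_edge_inj col2) (@model_edge_fun col2)).
    by apply: rst_trans uv'; apply: rst_sym.
  + by case/before_eqVbefore => // /before2_height; rewrite (eqP v0) (eqP v0').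
  by case/before_eqVbefore => // /before2_height; rewrite (eqP v0) (eqP v0').
have [n nE] : exists n : nat, `|height (c u)| = n%:Z by exists `|height (c u)|%N; lia.
elim: n u nE => [|n IHn] u un; first by exists u; split; [apply/eqP; lia|apply: rst_refl].
have [u0|u0] := ltP (height (c u)) 0.
  have [w [wc uw]] : exists w, height (c w) = height (c u) + 1 /\ edge col2 u w.
    case cu: (c u) u0 (cin u) => [[[[x y] k] j] s]; rewrite /height /in_model /= => s0 h.
    have [|w [wc uw]] := @model_edge col2 u (x, y, k, j, s + 1).
      by rewrite cu /=; qcases => //; lia.
    by exists w; rewrite wc.
  have [|v [v0 wv]] := IHn w; first by lia.
  by exists v; split=> //; apply: rst_trans wv; apply: rst_step.
have [w [wc uw]] : exists w, height (c w) = height (c u) - 1 /\ edge col2 w u.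
  case cu: (c u) u0 un (cin u) => [[[[x y] k] j] s]; rewrite /height /in_model /= => s0 sn h.
  have [|w [wc uw]] := @model_coedge col2 u (x, y, k, j, s - 1).
    by rewrite cu /=; qcases => //; lia.
  by exists w; rewrite wc.
have [|v [v0 wv]] := IHn w; first by lia.
by exists v; split=> //; apply: rst_trans wv; apply: rst_sym; apply: rst_step.
Qed.


Lemma point2_eq u v : edge col2 u v <->
  c v = ((c u).1, height (c u) + 1).
Proof.
rewrite edgeE; have := cin v; have := cin u.
move: (c u) (c v) => [[[[x y] k] j] s] [[[[x' y'] k'] j'] s']; rewrite /height /in_model /= => h h'.
split; first by qcases => // -[*]; subst.
by move=> -[*]; subst; qcases => //; lia.
Qed.

Definition up (q : qpoint) : qpoint := (q.1, height q + 1).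

Lemma square_up (p r : qpoint) : in_model a b p -> in_model a b r ->
  qf a b col1 p = Some r -> 0 <= height r \/ height p < 0 ->
  in_model a b (up p) || in_model a b (up r) ->
  [/\ in_model a b (up p), in_model a b (up r) & qf a b col1 (up p) = Some (up r)].
Proof.
move: p r => [[[[x y] k] j] s] [[[[x' y'] k'] j'] s'].
rewrite /up /height /in_model /= => h1 h2 h3 h4 h5.
by move: h3; qcases => // -[*]; subst; split;
  first [lia|by exfalso; lia|congr (Some (_, _, _, _, _)); lia].
Qed.

Lemma square_down (p r : qpoint) : in_model a b (up p) -> in_model a b (up r) ->
  qf a b col1 (up p) = Some (up r) -> 0 <= height r \/ height p < 0 ->
  in_model a b p || in_model a b r ->
  [/\ in_model a b p, in_model a b r & qf a b col1 p = Some r].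
Proof.
move: p r => [[[[x y] k] j] s] [[[[x' y'] k'] j'] s'].
rewrite /up /height /in_model /= => h1 h2 h3 h4 h5.
by move: h3; qcases => // -[*]; subst; split;
  first [lia|by exfalso; lia|congr (Some (_, _, _, _, _)); lia].
Qed.

Lemma edge2_up u v : edge col2 u v -> c v = up (c u).
Proof. by move/point2_eq. Qed.

Lemma noncentral_left u v : edge col1 u v -> ~ ce u v -> 0 < height (c u) -> 0 <= height (c v).
Proof.
move=> /edgeE; rewrite /model_ce; have := cin u; have := cin v.
move: (c u) (c v) => [[[[x y] k] j] s] [[[[x' y'] k'] j'] s']; rewrite /in_model /height /=.
move=> h h' uv /negP nc s0; move: uv nc; qcases => // -[? ? ? ? ?]; subst; rewrite ?eqxx ?andbT => ?; lia.
Qed.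

Lemma noncentral_right u v : edge col1 u v -> ~ ce u v -> height (c v) < 0 -> height (c u) <= 0.
Proof.
move=> /edgeE; rewrite /model_ce; have := cin u; have := cin v.
move: (c u) (c v) => [[[[x y] k] j] s] [[[[x' y'] k'] j'] s']; rewrite /in_model /height /=.
move=> h h' uv /negP nc s0; move: uv nc; qcases => // -[? ? ? ? ?]; subst; rewrite ?eqxx ?andbT => ?; lia.
Qed.

Lemma right_edge_height u v : edge col1 u v -> height (c u) <= 0 -> height (c v) < 0.
Proof. by move=> /edgeE /(qf1_height (cin u)); lia. Qed.

Lemma height_up q : height (up q) = height q + 1. Proof. by []. Qed.

Lemma edge_up u v : edge col2 u v <-> c v = up (c u).
Proof. exact: point2_eq. Qed.

Lemma upK q : up (q.1, height q - 1) = q.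
Proof. by rewrite /up /height /= subrK; case: q. Qed.

Lemma model_square_up u v : edge col1 u v -> 0 <= height (c v) \/ height (c u) < 0 ->
  (exists x, edge col2 u x) \/ (exists y, edge col2 v y) ->
  exists x y, [/\ edge col2 u x, edge col2 v y & edge col1 x y].
Proof.
move=> /edgeE uv h hx; have [|x0 y0 xy] := square_up (cin u) (cin v) uv h.
  by case: hx => -[x /edge_up <-]; rewrite cin ?orbT.
have [x xE] := csurj x0; have [y yE] := csurj y0; exists x, y.
by split; [apply/edge_up|apply/edge_up|apply/edgeE; rewrite xE yE].
Qed.

Lemma model_square_down u v : edge col1 u v -> 0 < height (c v) \/ height (c u) <= 0 ->
  (exists x, edge col2 x u) \/ (exists y, edge col2 y v) ->
  exists x y, [/\ edge col2 x u, edge col2 y v & edge col1 x y].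
Proof.
move=> /edgeE uv h hx; rewrite -(upK (c u)) -(upK (c v)) in uv.
have := cin u; have := cin v; rewrite -[in X in X -> _](upK (c v)) => vin; rewrite -[in X in X -> _](upK (c u)) => uin.
have [||x0 y0 xy] := square_down uin vin uv; first by rewrite /height /=; move: h; rewrite /height; lia.
  have dn w w' : edge col2 w w' -> ((c w').1, height (c w') - 1) = c w.
    by move=> /edge_up ->; rewrite /up /height /= addrK; case: (c w).
  by case: hx => -[x /dn ->]; rewrite cin ?orbT.
have [x xE] := csurj x0; have [y yE] := csurj y0; exists x, y.
by split; [apply/edge_up; rewrite xE upK|apply/edge_up; rewrite yE upK|apply/edgeE; rewrite xE yE].
Qed.

Lemma model_B3 : axiom_B3 cv ce.
Proof.
have fun2 := @model_edge_fun col2; have inj2 := @model_edge_inj col2.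
split=> [u v [uv nc /model_left u0]|v w [vw /model_left w0]].
  have v0 := noncentral_left uv nc u0.
  split=> [x ux|y vy].
    have [||x' [y' [ux' vy' xy]]] := model_square_up uv; [by left|by left; exists x|].
    by rewrite (fun2 _ _ _ ux ux'); exists y'.
  have [||x' [y' [ux' vy' xy]]] := model_square_up uv; [by left|by right; exists y|].
  by rewrite (fun2 _ _ _ vy vy'); exists x'.
have wE := edge2_up vw; split=> [x xv|y yw].
  have [||x' [y' [ux' vy' xy]]] := model_square_up xv.
  - by left; move: w0; rewrite wE height_up; lia.
  - by right; exists w.
  by exists x'; rewrite (fun2 _ _ _ vw vy').
have [||x' [y' [ux' vy' xy]]] := model_square_down yw; [by left|by right; exists v|].
by exists x'; rewrite (inj2 _ _ _ vw vy').
Qed.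

Lemma model_B3' : axiom_B3' cv ce.
Proof.
have fun2 := @model_edge_fun col2; have inj2 := @model_edge_inj col2.
split=> [u v [uv nc /model_right v0]|v w [vw /model_right w0]].
  have u0 := noncentral_right uv nc v0.
  split=> [x xu|y yv].
    have [||x' [y' [ux' vy' xy]]] := model_square_down uv; [by right|by left; exists x|].
    by rewrite (inj2 _ _ _ xu ux'); exists y'.
  have [||x' [y' [ux' vy' xy]]] := model_square_down uv; [by right|by right; exists y|].
  by rewrite (inj2 _ _ _ yv vy'); exists x'.
have wE := edge2_up vw; split=> [x vx|y wy].
  have [||x' [y' [ux' vy' xy]]] := model_square_up vx; [by right|by left; exists w|].
  by exists y'; rewrite (fun2 _ _ _ vw ux').
have [||x' [y' [ux' vy' xy]]] := model_square_down wy.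
- by right; rewrite wE height_up; lia.
- by left; exists v.
by exists y'; rewrite (inj2 _ _ _ vw ux').
Qed.

(** The path 2, 1, 2 from (x, x, k, j, 1) ends in (x, x, k, j + 1, 1), again the beginning of a
    central edge. *)
Lemma model_B4 : axiom_B4 ce.
Proof.
move=> u w w' v [u' uu'] uw ww' w'v.
suff [q vq] : exists q, in_model a b q && central_pair (c v) q.
  by case/andP: vq => /csurj[v' <-] h; exists v'.
move: uu' ww'; rewrite /model_ce; move/edge_up: uw => wE /[swap] /edgeE.
move/edge_up: w'v => vE; have := cin v; rewrite vE wE; have := cin w'; have := cin u.
move: (c u) (c u') (c w') => [[[[x y] k] j] s] q0 [[[[x' y'] k'] j'] s']; rewrite /up /height /in_model /=.
move=> h1 h2 h3 h4 /and3P[/eqP xy /eqP s1 _]; move: h4; subst.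
rewrite ltxx /=; move=> -[*]; subst.
by exists (y', y', k' + 1, j + 1, -1); rewrite !eqxx !andbT; lia.
Qed.

Lemma model_B4' : axiom_B4' ce.
Proof.
move=> u w w' v [u' u'u] wu w'w vw'.
suff [q vq] : exists q, in_model a b q && central_pair q (c v).
  by case/andP: vq => /csurj[v' <-] h; exists v'.
move/edge_up: wu => uE; move/edge_up: vw' => vE.
move/edgeE/(qe_qf _ (cin w) (cin w')): w'w; rewrite vE; move: u'u; rewrite /model_ce uE.
have := cin v; have := cin w; have := cin u'.
move: (c u') (c w) (c v) => [[[[x y] k] j] s] [[[[x' y'] k'] j'] s'] [[[[x2 y2] k2] j2] s2].
rewrite /up /height /in_model /= => h1 h2 h3 /and3P[/eqP xy /eqP s1 /eqP[? ? ? ? s'E]].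
have {s'E} ? : s' = - 2 by lia.
have -> : (y' < x') = false by lia.
have -> : (s' <= -1) = true by lia.
have -> : (s' <= -2) = true by lia.
move=> -[? ? ? ? ?]; exists (x2, y2, k2 - 1, j2, 1); apply/andP; split; first lia.
by apply/and3P; split=> //; [lia|apply/eqP; congr (_, _, _, _, _); lia].
Qed.

(** The mid-point of the central edge leaving (x, x, k, j, 1) becomes the vertex (x, x, k, k + 2j +
    1), lying on the diagonals between the centres of its two end points. *)
Definition central_image (z : central_vertex cv ce) : cpoint :=
  match z with
  | inl v => let: (x, y, k, j, s) := c (val v) in (x, y, k, k + 2 * j)
  | inr vw => let: (x, y, k, j, s) := c (val vw).1 in (x, y, k, k + 2 * j + 1)
  end.

Lemma central_image_in z : is_RA2_vertex (Seg a) (Seg b) (central_image z).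
Proof.
case: z => [[v vc]|[[v w] vw]] /=.
  have := cin v; move: vc; rewrite /model_cv; case: (c v) => [[[[x y] k] j] s].
  by rewrite /height /in_model /=; lia.
have := cin v; have := cin w; move: vw; rewrite /model_ce /=.
move: (c v) (c w) => [[[[x y] k] j] s] q; rewrite /in_model /= => /and3P[/eqP ? /eqP ? /eqP ->]; lia.
Qed.

Lemma central_image_odd z : is_midpoint z = is_otimes (central_image z).
Proof.
case: z => [[v vc]|[[v w] vw]] /=; case: (c v) => [[[[x y] k] j] s];
  rewrite /is_otimes eqz_nat_parity; lia.
Qed.

Lemma central_image_inj : injective central_image.
Proof.
move=> z z' zz'; have := central_image_odd z; rewrite zz' -central_image_odd; move: zz'.
case: z z' => [[v vc]|[[v w] vw]] [[v' vc']|[[v' w'] vw']] //= h _.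
  congr inl; apply: val_inj; apply: cinj; move: vc vc' h; rewrite /model_cv /=.
  move: (c v) (c v') => [[[[x y] k] j] s] [[[[x' y'] k'] j'] s'] /eqP /= + /eqP + [? ? ? ?].
  by rewrite /height /= => *; subst; congr (_, _, _, _, _); lia.
have vv' : v = v'.
  apply: cinj; move: vw vw' h; rewrite /model_ce /=.
  move: (c v) (c v') => [[[[x y] k] j] s] [[[[x' y'] k'] j'] s'] /and3P[_ /eqP ? _] /and3P[_ /eqP ? _] [? ? ? ?].
  by subst; congr (_, _, _, _, _); lia.
have ww' : w = w'.
  have [/= e _ _] := model_ceE vw; have [/= e' _ _] := model_ceE vw'; rewrite -vv' in e'.
  exact: model_edge_fun e e'.
by congr inr; apply: val_inj; rewrite /= vv' ww'.
Qed.

Lemma central_image_surj (w : cpoint) : is_RA2_vertex (Seg a) (Seg b) w -> exists z, central_image z = w.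
Proof.
move: w => [[[x y] k] l] /= h; have [odd_|even_] := boolP (is_otimes (x, y, k, l)).
  move: odd_; rewrite /is_otimes eqz_nat_parity => odd_.
  have [|u uE] := @csurj (x, y, k, ((l - k) %/ 2)%Z, 1); first by rewrite /in_model; lia.
  have [|v vE] := @csurj (x, y, k + 1, ((l - k) %/ 2)%Z, -1); first by rewrite /in_model; lia.
  have uv : ce u v by rewrite /model_ce uE vE /= !eqxx; lia.
  exists (inr (exist _ (u, v) uv)); rewrite /= uE; congr (_, _, _, _); lia.
move: even_; rewrite /is_otimes eqz_nat_parity => even_.
have [|u uE] := @csurj (x, y, k, ((l - k) %/ 2)%Z, 0); first by rewrite /in_model; lia.
have uv : cv u by rewrite /model_cv uE.
exists (inl (exist _ u uv)); rewrite /= uE; congr (_, _, _, _); lia.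
Qed.

Lemma central_image_edge i z z' :
  edge i (z : central_graph cv ce) z' <-> RA2_edge i (central_image z) (central_image z').
Proof.
have P12 v w : (exists x, edge col1 v x /\ edge col2 x w) <->
    qf a b col1 (c v) = Some ((c w).1, height (c w) - 1).
  split=> [[x [/edgeE -> /edge_up ->]]|/model_edge[x [xE vx]]].
    by rewrite /up /height /= addrK; case: (c x).
  by exists x; split=> //; apply/edge_up; rewrite xE upK.
have P21 v w : (exists x, edge col2 v x /\ edge col1 x w) <->
    in_model a b (up (c v)) /\ qf a b col1 (up (c v)) = Some (c w).
  split=> [[x [/edge_up <- /edgeE ->]]|[/csurj[x xE] vw]]; first by rewrite cin.
  by exists x; split; [apply/edge_up|apply/edgeE; rewrite xE].
have := central_image_in z; have := central_image_in z'; rewrite /edge /=.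
case: z z' => [[v vc]|[[v w] vw]] [[v' vc']|[[v' w'] vw']].
- case: i => /=.
    rewrite P12; move: vc vc' (cin v) (cin v'); rewrite /model_cv.
    move: (c v) (c v') => [[[[x y] k] j] s] [[[[x' y'] k'] j'] s'] /eqP /= + /eqP +.
    rewrite /height /in_model /= => s0 s0' h h' m' m; rewrite RA2_edgeE; subst.
    split; first by qcases => // -[*]; subst; lia.
    by move=> e; qcases; first [by exfalso; lia|congr (Some (_, _, _, _, _)); lia].
  rewrite P21; move: vc vc' (cin v) (cin v'); rewrite /model_cv.
  move: (c v) (c v') => [[[[x y] k] j] s] [[[[x' y'] k'] j'] s'] /eqP /= + /eqP +.
  rewrite /height /in_model /up /height /= => s0 s0' h h' m' m; rewrite RA2_edgeE; subst.
  split; first by move=> [? +]; qcases => // -[*]; subst; lia.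
  by move=> e; split; [lia|qcases; first [by exfalso; lia|congr (Some (_, _, _, _, _)); lia]].
- have := vw'; rewrite /model_ce /=; case: i => /=.
    rewrite P12; move: vc (cin v) (cin v') (cin w'); rewrite /model_cv.
    move: (c v) (c v') (c w') => [[[[x y] k] j] s] [[[[x' y'] k'] j'] s'] [[[[x2 y2] k2] j2] s2] /eqP /= +.
    rewrite /height /in_model /= => s0 h h' h2 /and3P[/eqP ? /eqP ? /eqP[? ? ? ? ?]] m' m; rewrite RA2_edgeE; subst.
    split; first by qcases => // -[*]; subst; lia.
    by move=> e; qcases; first [by exfalso; lia|congr (Some (_, _, _, _, _)); lia].
  rewrite edge_up; move: vc (cin v) (cin v') (cin w'); rewrite /model_cv.
  move: (c v) (c v') (c w') => [[[[x y] k] j] s] [[[[x' y'] k'] j'] s'] [[[[x2 y2] k2] j2] s2] /eqP /= +.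
  rewrite /height /in_model /up /height /= => s0 h h' h2 /and3P[/eqP ? /eqP ? /eqP[? ? ? ? ?]] m' m; rewrite RA2_edgeE; subst.
  split; first by move=> -[*]; subst; lia.
  by move=> e; congr (_, _, _, _, _); lia.
- have := vw; rewrite /model_ce /=; case: i => /=.
    rewrite edge_up; move: vc' (cin v) (cin v') (cin w); rewrite /model_cv.
    move: (c v) (c v') (c w) => [[[[x y] k] j] s] [[[[x' y'] k'] j'] s'] [[[[x2 y2] k2] j2] s2] /eqP /= +.
    rewrite /height /in_model /up /height /= => s0 h h' h2 /and3P[/eqP ? /eqP ? /eqP[? ? ? ? ?]] m' m; rewrite RA2_edgeE; subst.
    split; first by move=> -[*]; subst; lia.
    by move=> e; congr (_, _, _, _, _); lia.
  rewrite P21; move: vc' (cin v) (cin v') (cin w); rewrite /model_cv.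
  move: (c v) (c v') (c w) => [[[[x y] k] j] s] [[[[x' y'] k'] j'] s'] [[[[x2 y2] k2] j2] s2] /eqP /= +.
  rewrite /height /in_model /up /height /= => s0 h h' h2 /and3P[/eqP ? /eqP ? /eqP[? ? ? ? ?]] m' m; rewrite RA2_edgeE; subst.
  split; first by move=> [? +]; qcases => // -[*]; subst; lia.
  by move=> e; split; [lia|qcases; first [by exfalso; lia|congr (Some (_, _, _, _, _)); lia]].
have := central_image_odd (inr (exist _ (v, w) vw)); have := central_image_odd (inr (exist _ (v', w') vw')).
rewrite /=; case: (c v) (c v') => [[[[x y] k] j] s] [[[[x' y'] k'] j'] s'].
rewrite /is_otimes !eqz_nat_parity => o' o m' m; rewrite RA2_edgeE.
by case: (i) m m' => /= m m'; split=> // e; lia.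
Qed.

Lemma model_BA : axiom_BA cv ce.
Proof.
exists (Seg a), (Seg b), (fun z => exist _ (central_image z) (central_image_in z)); split; last first.
  exact: central_image_odd.
split; last by move=> i z z'; apply: central_image_edge.
apply: inj_surj_bij => [z z' [/central_image_inj //]|[w win]].
by have [z zw] := central_image_surj win; exists z; apply: val_inj.
Qed.

Lemma model_axioms : central_edges_wf ce /\ B2_axioms cv ce.
Proof.
split; first by move=> u v /model_ceE[].
split; split; [exact: model_B0|exact: model_B1|exact: model_B2|exact: model_B3|exact: model_B3'|
  exact: model_B4|exact: model_B4'|exact: model_BA].
Qed.

End ModelAxioms.

(** * Reversal of arrows, left and right vertices *)

(** Reversal exchanges left with right and (B3) with (B3'), so only the left half of a graph has to
    be analysed. *)
Definition opg (G : cgraph) : cgraph := @CGraph G (fun i u v => edge i v u).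

Lemma clos_trans_op (T : Type) (R : T -> T -> Prop) u v :
  clos_trans T (fun x y => R y x) u v <-> clos_trans T R v u.
Proof.
split; elim=> [x y xy|x y z _ xy _ yz]; [exact: t_step|exact: t_trans xy|exact: t_step|exact: t_trans xy].
Qed.

Lemma clos_refl_trans_op (T : Type) (R : T -> T -> Prop) u v :
  clos_refl_trans T (fun x y => R y x) u v <-> clos_refl_trans T R v u.
Proof.
split; elim=> [x y xy|x|x y z _ xy _ yz]; [exact: rt_step|exact: rt_refl|exact: rt_trans xy|
  exact: rt_step|exact: rt_refl|exact: rt_trans xy].
Qed.

Lemma clos_refl_sym_trans_op (T : Type) (R : T -> T -> Prop) u v :
  clos_refl_sym_trans T (fun x y => R y x) u v <-> clos_refl_sym_trans T R u v.
Proof.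
split; elim=> [x y xy|x|x y _ xy|x y z _ xy _ yz]; by [apply/rst_sym/rst_step|apply: rst_refl|apply: rst_sym|
  apply: rst_trans xy yz].
Qed.

Section Op.
Variables (G : cgraph) (cv : pred G) (ce : rel G).
Definition opce : rel G := fun u v => ce v u.

Lemma op_before i (u v : G) : before (G := opg G) i u v <-> before i v u.
Proof. exact: clos_trans_op. Qed.

Lemma op_before_eq i (u v : G) : before_eq (G := opg G) i u v <-> before_eq i v u.
Proof. exact: clos_refl_trans_op. Qed.

Lemma op_same_string i (u v : G) : same_string (G := opg G) i u v <-> same_string i u v.
Proof. exact: clos_refl_sym_trans_op. Qed.

Lemma op_left u : left_vertex (G := opg G) cv opce u <-> right_vertex cv ce u.
Proof.
split=> -[[v [cvv /op_before h]]|[v [w [cvw /op_before_eq h]]]].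
- by left; exists v.
- by right; exists w, v.
- by left; exists v; split=> //; apply/op_before.
by right; exists w, v; split=> //; apply/op_before_eq.
Qed.

Lemma op_right u : right_vertex (G := opg G) cv opce u <-> left_vertex cv ce u.
Proof.
split=> -[[v [cvv /op_before h]]|[v [w [cvw /op_before_eq h]]]].
- by left; exists v.
- by right; exists w, v.
- by left; exists v; split=> //; apply/op_before.
by right; exists w, v; split=> //; apply/op_before_eq.
Qed.

Lemma op_B0 : axiom_B0 G -> axiom_B0 (opg G).
Proof.
move=> B0 i; have [inj fun_ acyc] := B0 i; split=> [u u' v|u v v'|u /op_before].
- exact: fun_.
- exact: inj.
exact: acyc.
Qed.

Lemma op_B1 : axiom_B1 cv ce -> axiom_B1 (G := opg G) cv opce.
Proof.
pose sw (x : G + G * G) := if x is inr (v, w) then inr (w, v) else x.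
have swP u x : central_in_1string (G := opg G) cv opce u x <-> central_in_1string cv ce u (sw x).
  case: x => [v|[v w]] /=; first by rewrite op_same_string.
  by split=> -[h /op_same_string h1 /op_same_string h2]; split=> //; apply/op_same_string.
have swK x : sw (sw x) = x by case: x => [v|[v w]].
move=> B1 u; have [x [ux xu]] := B1 u; exists (sw x); split; first by apply/swP; rewrite swK.
by move=> x' /swP/xu ->; rewrite swK.
Qed.

Lemma op_B2 : axiom_B2 cv ce -> axiom_B2 (G := opg G) cv opce.
Proof.
case=> B2 B2'; split=> [u|v vc].
  have [v [[vc uv] vu]] := B2 u; exists v; split; first by split=> //; apply/op_same_string.
  by move=> v' [vc' /op_same_string uv']; apply: vu.
have [h h'] := B2' v vc; split=> u /op_before; first by move/h'/op_right.
by move/h/op_left.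
Qed.

Lemma op_B3 : axiom_B3' cv ce -> axiom_B3 (G := opg G) cv opce.
Proof.
case=> Bi Bii; split=> [u v [vu nc /op_left ul]|v w [wv /op_left vl]].
  have [h1 h2] := Bi v u (And3 vu nc ul); split=> x /= xu.
    by have [y [? ? ? ?]] := h2 _ xu; exists y; split.
  by have [y [? ? ? ?]] := h1 _ xu; exists y; split.
have [h1 h2] := Bii w v (conj wv vl); split=> x /= xu.
  by have [y [? ? ? ?]] := h2 _ xu; exists y; split.
by have [y [? ? ? ?]] := h1 _ xu; exists y; split.
Qed.
End Op.

Section Sides.
Variables (G : cgraph) (cv : pred G) (ce : rel G).
Hypotheses (wf : central_edges_wf ce) (B0 : axiom_B0 G) (B1 : axiom_B1 cv ce) (B2 : axiom_B2 cv ce).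
Implicit Types u v w : G.
Local Notation left := (left_vertex cv ce).
Local Notation right := (right_vertex cv ce).

Lemma edge_inj i u u' v : edge i u v -> edge i u' v -> u = u'.
Proof. by case: (B0 i) => h _ _; apply: h. Qed.

Lemma edge_fun i u v v' : edge i u v -> edge i u v' -> v = v'.
Proof. by case: (B0 i) => _ h _; apply: h. Qed.

Lemma acyclic i u : ~ before i u u.
Proof. by case: (B0 i). Qed.

Lemma central_uniq u x x' : central_in_1string cv ce u x -> central_in_1string cv ce u x' -> x = x'.
Proof. by have [y [_ yu]] := B1 u; move=> /yu <- /yu. Qed.

Lemma left_elt u : left u -> exists x, central_in_1string cv ce u x /\
  match x with inl v => before col1 u v | inr (v, w) => edge col1 v w /\ before_eq col1 u v end.
Proof.
case=> [[v [vc uv]]|[v [w [vw uv]]]].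
  by exists (inl v); split=> //; split=> //; apply/before_eq_string/beforeW.
exists (inr (v, w)); split; last by split=> //; apply: wf.
split=> //; first exact: before_eq_string.
by apply: rst_trans (before_eq_string uv) _; apply/rst_step/wf.
Qed.

Lemma right_elt u : right u -> exists x, central_in_1string cv ce u x /\
  match x with inl v => before col1 v u | inr (v, w) => edge col1 v w /\ before_eq col1 w u end.
Proof.
case=> [[v [vc vu]]|[v [w [vw wu]]]].
  by exists (inl v); split=> //; split=> //; apply/rst_sym/before_eq_string/beforeW.
exists (inr (v, w)); split; last by split=> //; apply: wf.
split=> //; last exact/rst_sym/before_eq_string.
by apply/rst_sym; apply: rst_trans (before_eq_string wu); apply/rst_step/wf.
Qed.

Lemma cv_elt u : cv u -> central_in_1string cv ce u (inl u).
Proof. by move=> uc; split=> //; apply: rst_refl. Qed.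

Lemma cv_not_left u : cv u -> ~ left u.
Proof.
move=> /cv_elt uu /left_elt[x [ux]]; rewrite (central_uniq ux uu); exact: acyclic.
Qed.

Lemma cv_not_right u : cv u -> ~ right u.
Proof.
move=> /cv_elt uu /right_elt[x [ux]]; rewrite (central_uniq ux uu); exact: acyclic.
Qed.

Lemma left_not_right u : left u -> ~ right u.
Proof.
move=> /left_elt[x [ux h]] /right_elt[x' [ux' h']]; move: h h'; rewrite (central_uniq ux' ux).
case: {ux} x => [v|[v w]]; first by move=> uv vu; apply: (@acyclic col1 u); apply: t_trans vu.
move=> [vw uv] [_ wu]; apply: (@acyclic col1 v); have wv : before_eq col1 w v by apply: rt_trans uv.
case: (before_eqVbefore wv) => [wv'|wv']; first by apply: t_step; rewrite -{2}wv'.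
by apply: t_trans wv'; apply: t_step.
Qed.

Lemma left_succ u : left u -> exists v, edge col1 u v.
Proof.
have first_ v w : before col1 v w -> exists v', edge col1 v v' by elim=> [x y xy|//]; exists y.
case=> [[v [_ /first_ //]]|[v [w [/wf vw /before_eqVbefore[->|/first_ //]]]]].
by exists w.
Qed.

Lemma left_edge_split u v : edge col1 u v -> left u -> ce u v \/ left v \/ cv v.
Proof.
move=> uv; case=> [[z [zc uz]]|[z [w [zw uz]]]].
  have [uz'|vz] := before_eq_step (@edge_fun col1) uv (beforeW uz).
    by rewrite uz' in uz; case: (acyclic uz).
  have [->|vz'] := before_eqVbefore vz; first by right; right.
  by right; left; left; exists z.
have [uz'|vz] := before_eq_step (@edge_fun col1) uv uz.
  by left; rewrite uz' in uv *; rewrite (edge_fun uv (wf zw)).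
by right; left; right; exists z, w.
Qed.

Lemma cv_succ u v : cv u -> edge col1 u v -> right v.
Proof. by move=> uc uv; left; exists u; split=> //; apply: t_step. Qed.

Lemma ce_succ u v : ce u v -> right v.
Proof. by move=> uv; right; exists u, v; split=> //; apply: rt_refl. Qed.

Lemma ce_left u v : ce u v -> left u.
Proof. by move=> uv; right; exists u, v; split=> //; apply: rt_refl. Qed.

Lemma string2_center u : exists v, cv v /\ (before_eq col2 v u \/ before_eq col2 u v).
Proof.
have [v [[vc uv] _]] := B2.1 u; exists v; split=> //.
by case: (string_total (@edge_inj col2) (@edge_fun col2) uv); [right|left].
Qed.

Lemma center2_uniq u v v' : cv v -> cv v' -> same_string col2 u v -> same_string col2 u v' -> v = v'.
Proof. by have [w [_ wu]] := B2.1 u => vc vc' uv uv'; rewrite -(wu v) // -(wu v'). Qed.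

Lemma after_center2 u v : cv v -> before col2 v u -> left u.
Proof. by move=> vc; apply: (B2.2 v vc).2. Qed.

Lemma before_center2 u v : cv v -> before col2 u v -> right u.
Proof. by move=> vc; apply: (B2.2 v vc).1. Qed.

(** By (B2) the vertices before the centre of a 2-string are right, and left excludes both right and
    central. *)
Lemma left_center2 u : left u -> exists v, cv v /\ before col2 v u.
Proof.
move=> ul; have [v [vc [vu|uv]]] := string2_center u.
  by exists v; split=> //; case: (before_eqVbefore vu) => // uv; rewrite uv in vc; case: (cv_not_left vc).
case: (before_eqVbefore uv) => [vu|/(before_center2 vc) ur]; last by case: (left_not_right ul).
by rewrite -vu in vc; case: (cv_not_left vc).
Qed.

Lemma edge2_left u v : edge col2 u v -> cv u \/ left u -> left v.
Proof.
move=> uv [uc|/left_center2[w [wc wu]]]; first by apply: (after_center2 uc); apply: t_step.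
by apply: (after_center2 wc); apply: t_trans wu _; apply: t_step.
Qed.

Lemma left_pred2 v : left v -> exists u, edge col2 u v /\ (cv u \/ left u).
Proof.
move=> /left_center2[w [wc /clos_trans_tn1_iff wv]]; case: wv => [z wz|z t zt /clos_trans_tn1_iff wz].
  by exists w; split=> //; left.
by exists z; split=> //; right; apply: (after_center2 wc).
Qed.
End Sides.

                                                                                                   
                                                            
(** * Coordinates of the central graph *)

(** The isomorphism of (BA) in relational form: [K v w] gives the central vertex [v] the coordinates
    [w], and [Mi p p' w] does so for the mid-point of a central edge. This avoids dependent pairs
    and is stable under reversal ([central_coords_op]). *)
Record central_coords (G : cgraph) (cv : pred G) (ce : rel G) (a b : nat)
    (K : G -> cpoint -> Prop) (Mi : G -> G -> cpoint -> Prop) : Prop := CentralCoords {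
  cc_K : forall v w, K v w -> [/\ cv v, is_RA2_vertex (Seg a) (Seg b) w & ~~ is_otimes w];
  cc_M : forall p p' w, Mi p p' w -> [/\ ce p p', is_RA2_vertex (Seg a) (Seg b) w & is_otimes w];
  cc_Kex : forall v, cv v -> exists w, K v w;
  cc_Mex : forall p p', ce p p' -> exists w, Mi p p' w;
  cc_Konto : forall w, is_RA2_vertex (Seg a) (Seg b) w -> ~~ is_otimes w -> exists v, K v w;
  cc_Monto : forall w, is_RA2_vertex (Seg a) (Seg b) w -> is_otimes w -> exists p p', Mi p p' w;
  cc_Kinj : forall v v' w, K v w -> K v' w -> v = v';
  cc_Kfun : forall v w w', K v w -> K v w' -> w = w';
  cc_KK2 : forall v w v' w', K v w -> K v' w' ->
    (RA2_edge col2 w w' <-> exists x, edge col2 v x /\ edge col1 x v');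
  cc_KM2 : forall v w p p' w', K v w -> Mi p p' w' -> (RA2_edge col2 w w' <-> edge col2 v p);
  cc_MK2 : forall p p' w v' w', Mi p p' w -> K v' w' ->
    (RA2_edge col2 w w' <-> exists x, edge col2 p x /\ edge col1 x v');
  cc_KK1 : forall v w v' w', K v w -> K v' w' ->
    (RA2_edge col1 w w' <-> exists x, edge col1 v x /\ edge col2 x v');
  cc_KM1 : forall v w p p' w', K v w -> Mi p p' w' ->
    (RA2_edge col1 w w' <-> exists x, edge col1 v x /\ edge col2 x p');
  cc_MK1 : forall p p' w v' w', Mi p p' w -> K v' w' -> (RA2_edge col1 w w' <-> edge col2 p' v') }.

(** The symmetry of C(A, B) that reverses edges and exchanges the colours I and II. *)
Definition dual (a b : nat) (w : cpoint) : cpoint :=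
  let: (x, y, k, l) := w in (a%:Z - y, a%:Z - x, b%:Z - l, b%:Z - k).

Lemma dualK a b : involutive (dual a b).
Proof. by move=> [[[x y] k] l]; congr (_, _, _, _); rewrite /=; lia. Qed.

Lemma dual_vertex a b w : is_RA2_vertex (Seg a) (Seg b) (dual a b w) = is_RA2_vertex (Seg a) (Seg b) w.
Proof. by move: w => [[[x y] k] l] /=; apply/idP/idP; lia. Qed.

Lemma dual_otimes a b w : is_otimes (dual a b w) = is_otimes w.
Proof. by move: w => [[[x y] k] l] /=; congr (odd `|_|%N); lia. Qed.

Lemma dual_edge1 a b w w' : RA2_edge col1 (dual a b w') (dual a b w) <-> RA2_edge col2 w w'.
Proof. by move: w w' => [[[x y] k] l] [[[x' y'] k'] l']; rewrite !RA2_edgeE; lia. Qed.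

Lemma dual_edge2 a b w w' : RA2_edge col2 (dual a b w') (dual a b w) <-> RA2_edge col1 w w'.
Proof. by move: w w' => [[[x y] k] l] [[[x' y'] k'] l']; rewrite !RA2_edgeE; lia. Qed.

Lemma central_coords_op (G : cgraph) (cv : pred G) (ce : rel G) a b K Mi :
  central_coords cv ce a b K Mi ->
  central_coords (G := opg G) cv (opce ce) a b (fun v w => K v (dual a b w))
    (fun p p' w => Mi p' p (dual a b w)).
Proof.
move=> CC; split.
- by move=> v w /(cc_K CC); rewrite dual_vertex dual_otimes.
- by move=> p p' w /(cc_M CC); rewrite dual_vertex dual_otimes.
- by move=> v /(cc_Kex CC)[w vw]; exists (dual a b w); rewrite dualK.
- by move=> p p' /(cc_Mex CC)[w vw]; exists (dual a b w); rewrite dualK.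
- by move=> w wv wo; apply: (cc_Konto CC); rewrite ?dual_vertex ?dual_otimes.
- move=> w wv wo; have [||p [p' h]] := cc_Monto CC (w := dual a b w); rewrite ?dual_vertex ?dual_otimes //.
  by exists p', p.
- by move=> v v' w; apply: (cc_Kinj CC).
- by move=> v w w' h h'; rewrite -[w](dualK a b) (cc_Kfun CC h h') dualK.
- move=> v w v' w' h h'; rewrite -(dual_edge1 a b) (cc_KK1 CC h' h).
  by split=> -[x [? ?]]; exists x.
- by move=> v w p p' w' h h'; rewrite -(dual_edge1 a b) (cc_MK1 CC h' h).
- move=> p p' w v' w' h h'; rewrite -(dual_edge1 a b) (cc_KM1 CC h' h).
  by split=> -[x [? ?]]; exists x.
- move=> v w v' w' h h'; rewrite -(dual_edge2 a b) (cc_KK2 CC h' h).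
  by split=> -[x [? ?]]; exists x.
- move=> v w p p' w' h h'; rewrite -(dual_edge2 a b) (cc_MK2 CC h' h).
  by split=> -[x [? ?]]; exists x.
by move=> p p' w v' w' h h'; rewrite -(dual_edge2 a b) (cc_KM2 CC h' h).
Qed.

Lemma iso_central_coords (G : cgraph) (cv : pred G) (ce : rel G) a b
    (g : central_graph cv ce -> RA2_graph (Seg a) (Seg b)) :
  graph_iso g -> (forall z, is_midpoint z = is_otimes (val (g z))) ->
  exists K Mi, central_coords cv ce a b K Mi.
Proof.
move=> [gb ge] go.
exists (fun v w => exists h : cv v, val (g (inl (exist _ v h))) = w),
  (fun p p' w => exists h : ce p p', val (g (inr (exist _ (p, p') h))) = w).
have gedge i z z' : RA2_edge i (val (g z)) (val (g z')) <-> edge i (z : central_graph cv ce) z'.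
  by rewrite ge.
have ginj z z' : val (g z) = val (g z') -> z = z' by move/val_inj/(bij_inj gb).
split.
- move=> v w [h <-]; split=> //; first exact: (valP (g (inl (exist _ v h)))).
  by rewrite -go.
- move=> p p' w [h <-]; split=> //; first exact: (valP (g (inr (exist _ (p, p') h)))).
  by rewrite -go.
- by move=> v vc; exists (val (g (inl (exist _ v vc)))), vc.
- by move=> p p' pc; exists (val (g (inr (exist _ (p, p') pc)))), pc.
- move=> w win wo; case: gb => gV gVK gK; pose z := gV (exist _ w win).
  have zE : val (g z) = w by rewrite /z gK.
  move: wo; rewrite -zE -go; case: (z) => [[v vc]|//] _; by exists v, vc.
- move=> w win wo; case: gb => gV gVK gK; pose z := gV (exist _ w win).
  have zE : val (g z) = w by rewrite /z gK.
  move: wo; rewrite -zE -go; case: (z) => [//|[[p p'] pc]] _; by exists p, p', pc.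
- by move=> v v' w [h hE] [h' hE']; have [] := ginj _ _ (etrans hE (esym hE')).
- move=> v w w' [h <-] [h' <-]; congr (val (g (inl _))); exact: val_inj.
- by move=> v w v' w' [h <-] [h' <-]; rewrite gedge.
- by move=> v w p p' w' [h <-] [h' <-]; rewrite gedge.
- by move=> p p' w v' w' [h <-] [h' <-]; rewrite gedge.
- by move=> v w v' w' [h <-] [h' <-]; rewrite gedge.
- by move=> v w p p' w' [h <-] [h' <-]; rewrite gedge.
by move=> p p' w v' w' [h <-] [h' <-]; rewrite gedge.
Qed.

Fixpoint path2 (G : cgraph) (n : nat) (u v : G) : Prop :=
  if n is n'.+1 then exists w, path2 n' u w /\ edge col2 w v else u = v.

(** * The left half of a graph satisfying the axioms *)

Section Half.
Variables (G : cgraph) (cv : pred G) (ce : rel G) (a b : nat).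
Variables (K : G -> cpoint -> Prop) (Mi : G -> G -> cpoint -> Prop).
Hypothesis CC : central_coords cv ce a b K Mi.
Hypotheses (wf : central_edges_wf ce) (B0 : axiom_B0 G) (B1 : axiom_B1 cv ce) (B2 : axiom_B2 cv ce).
Hypothesis B3 : axiom_B3 cv ce.
Implicit Types u v w : G.
Local Notation left := (left_vertex cv ce).

Let fun1 u v v' : edge col1 u v -> edge col1 u v' -> v = v' := @edge_fun _ B0 col1 u v v'.
Let fun2 u v v' : edge col2 u v -> edge col2 u v' -> v = v' := @edge_fun _ B0 col2 u v v'.
Let inj2 u u' v : edge col2 u v -> edge col2 u' v -> u = u' := @edge_inj _ B0 col2 u u' v.

Definition central_or_left u : Prop := cv u \/ left u.

Lemma central_or_left_not_right u : central_or_left u -> ~ right_vertex cv ce u.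
Proof. by case=> [uc|ul]; [apply: (cv_not_right wf B0 B1)|apply: (left_not_right wf B0 B1)]. Qed.

Lemma path2_trans u v m n w : path2 m u v -> path2 n v w -> path2 (m + n) u w.
Proof.
move=> uv; elim: n w => [w <-|n IHn w [z [vz zw]]]; first by rewrite addn0.
by rewrite addnS; exists z; split=> //; apply: IHn.
Qed.

Lemma path2_first n u v w : edge col2 u w -> path2 n.+1 u v -> path2 n w v.
Proof.
move=> uw; elim: n v => [v [_ [<- uv]]|n IHn v [z [uz zv]]]; first exact: fun2 uw uv.
by exists z; split=> //; apply: (IHn).
Qed.

Lemma path2_uncons n u v : path2 n.+1 u v -> exists w, edge col2 u w /\ path2 n w v.
Proof.
elim: n v => [v [_ [<- uv]]|n IHn v [z [/IHn[w [uw wz]] zv]]]; first by exists v.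
by exists w; split=> //; exists z.
Qed.

Lemma path2_left n u v : central_or_left u -> path2 n.+1 u v -> left v.
Proof.
move=> ucl; elim: n v => [v [_ [<- uv]]|n IHn v [z [/IHn zl zv]]]; first exact: (edge2_left wf B0 B1 B2 uv).
by apply: (edge2_left wf B0 B1 B2 zv); right.
Qed.

Lemma noncentral_edge u v : central_or_left v -> ~ ce u v.
Proof. by move=> /central_or_left_not_right vr /ce_succ. Qed.

Lemma ladder u0 c1 n : left u0 -> edge col1 u0 c1 -> central_or_left c1 ->
  (forall u, path2 n u0 u -> exists w, edge col1 u w /\ path2 n c1 w) /\
  (forall w, path2 n c1 w -> exists u, edge col1 u w /\ path2 n u0 u).
Proof.
move=> u0l uc c1l; elim: n => [|n [IH1 IH2]].
  by split=> [u <-|w <-]; [exists c1|exists u0].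
have pl z m x : central_or_left z -> path2 m z x -> central_or_left x.
  by case: m => [zl <- //|m zl /(path2_left zl)]; right.
have left_u u : path2 n u0 u -> left u.
  by case: (n) => [<- //|m]; apply: path2_left; right.
split=> [u [z [uz zu]]|w [z [cz zw]]].
  have [t [zt ct]] := IH1 _ uz.
  have [h _] := B3.1 z t (And3 zt (noncentral_edge (pl _ _ _ c1l ct)) (left_u _ uz)).
  by have [y [_ _ uy ty]] := h _ zu; exists y; split=> //; exists t.
have [t [tz ut]] := IH2 _ cz.
have [_ h] := B3.1 t z (And3 tz (noncentral_edge (pl _ _ _ c1l cz)) (left_u _ ut)).
by have [x [_ tx xw _]] := h _ zw; exists x; split=> //; exists t.
Qed.

                                                                                                  
                                   
(** If [v] were left, it would have a 2-predecessor that is central or left, and the square of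
    (B3)(ii) would give a 1-edge from [t] to that predecessor, which is excluded. *)
Lemma succ_central t q v : edge col2 t q -> left q -> ~ ce q v -> edge col1 q v ->
  (forall x, edge col1 t x -> ~ central_or_left x) -> cv v.
Proof.
move=> tq ql nc qv tx; case: (left_edge_split wf B0 qv ql) => [//|[vl|//]].
have [x [xv xcl]] := left_pred2 wf B0 B1 B2 vl.
have [_ h] := B3.2 x v (conj xv vl); have [y [yx yq _ _]] := h _ qv.
by case: (tx x) => //; rewrite -(inj2 yq tq).
Qed.

Lemma succ2_center c u : cv c -> edge col2 c u ->
  (exists w, ce u w) \/ exists w, cv w /\ edge col1 u w.
Proof.
move=> cc cu; have ul := edge2_left wf B0 B1 B2 cu (or_introl cc).
have [w uw] := left_succ wf ul; have [cuw|/negP nc] := boolP (ce u w); first by left; exists w.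
right; exists w; split=> //; apply: (succ_central cu ul nc uw) => x cx /central_or_left_not_right.
by apply; apply: cv_succ cx.
Qed.

(** In C(A, B) each mid-point (x, y, k, l) is entered by a II-edge from the ordinary vertex (x, y,
    k, l - 1). *)
Lemma central_edge_pred u w : ce u w -> exists v, cv v /\ edge col2 v u.
Proof.
move=> /(cc_Mex CC)[[[[x y] k] l] m]; have [_ win wo] := cc_M CC m.
move: wo; rewrite /is_otimes eqz_nat_parity => wo.
have [||v vK] := cc_Konto CC (w := (x, y, k, l - 1)); first by move: win; rewrite /=; lia.
  by rewrite /is_otimes eqz_nat_parity; move: win; rewrite /=; lia.
exists v; split; first by case: (cc_K CC vK).
by apply/(cc_KM2 CC vK m); rewrite RA2_edgeE; move: win; rewrite /=; lia.
Qed.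

Lemma succ2_mid c u w q : cv c -> edge col2 c u -> ce u w -> edge col2 u q ->
  exists v, cv v /\ edge col1 q v.
Proof.
move=> cc cu uw uq; have ul := edge2_left wf B0 B1 B2 cu (or_introl cc).
have ql := edge2_left wf B0 B1 B2 uq (or_intror ul).
have [v qv] := left_succ wf ql; exists v; split=> //.
apply: (succ_central uq ql _ qv) => [/central_edge_pred[z [zc zq]]|x ux /central_or_left_not_right].
  by move: ul; rewrite (inj2 uq zq); apply: (cv_not_left wf B0 B1 zc).
by apply; rewrite (fun1 ux (wf uw)); apply: ce_succ uw.
Qed.

Definition valid (x y k j : int) : bool :=
  [&& 0 <= y, y <= x, x <= a%:Z, 0 <= k, 0 <= j, k + 2 * j <= b%:Z & (x == y) || (j == 0)].

Variable cen : int -> int -> int -> int -> G.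
Hypothesis cenK : forall x y k j, valid x y k j -> K (cen x y k j) (x, y, k, k + 2 * j).

Lemma cen_cv x y k j : valid x y k j -> cv (cen x y k j).
Proof. by move=> /cenK/(cc_K CC)[]. Qed.

Lemma cen_row x y k j : valid x y k j -> y < x ->
  exists u, edge col2 (cen x y k j) u /\ edge col1 u (cen x (y + 1) k j).
Proof.
move=> h yx; have h' : valid x (y + 1) k j by move: h; rewrite /valid; lia.
by apply/(cc_KK2 CC (cenK h) (cenK h')); rewrite RA2_edgeE; move: h; rewrite /valid; lia.
Qed.

Lemma mid_onto x k j : valid x x k j -> k + 2 * j < b%:Z -> exists p p', Mi p p' (x, x, k, k + 2 * j + 1).
Proof.
move=> h kb; apply: (cc_Monto CC); first by move: h; rewrite /valid /=; lia.
by rewrite /is_otimes eqz_nat_parity; lia.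
Qed.

Lemma cen_mid x k j : valid x x k j -> k + 2 * j < b%:Z -> exists u w,
  [/\ Mi u w (x, x, k, k + 2 * j + 1), edge col2 (cen x x k j) u, ce u w &
    edge col2 w (cen x x (k + 1) j)].
Proof.
move=> h kb; have [p [p' m]] := mid_onto h kb; exists p, p'; split=> //.
- by apply/(cc_KM2 CC (cenK h) m); rewrite RA2_edgeE; lia.
- by case: (cc_M CC m).
have h' : valid x x (k + 1) j by move: h; rewrite /valid; lia.
by apply/(cc_MK1 CC m (cenK h')); rewrite RA2_edgeE; lia.
Qed.

Lemma cen_mid2 x k j : valid x x k j -> k + 2 * j + 2 <= b%:Z -> exists u q,
  [/\ edge col2 (cen x x k j) u, edge col2 u q & edge col1 q (cen x x k (j + 1))].
Proof.
move=> h kb; have [|u [w [m cu uw _]]] := cen_mid h; first by lia.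
have h' : valid x x k (j + 1) by move: h; rewrite /valid; lia.
have /(cc_MK2 CC m (cenK h'))[q [uq qc]] : RA2_edge col2 (x, x, k, k + 2 * j + 1) (x, x, k, k + 2 * (j + 1)).
  by rewrite RA2_edgeE; lia.
by exists u, q.
Qed.

Lemma cen_out x y k j u : valid x y k j -> edge col2 (cen x y k j) u -> y < x \/ k + 2 * j < b%:Z.
Proof.
move=> h cu; have [[w uw]|[w [wc uw]]] := succ2_center (cen_cv h) cu.
  have [[[[x' y'] k'] l'] m] := cc_Mex CC uw; have [_ win _] := cc_M CC m.
  have /RA2_edgeE := (cc_KM2 CC (cenK h) m).2 cu.
  by move: win h; rewrite /valid /=; lia.
have [[[[x' y'] k'] l'] m] := cc_Kex CC wc; have [_ win _] := cc_K CC m.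
have /RA2_edgeE := (cc_KK2 CC (cenK h) m).2 (ex_intro _ u (conj cu uw)).
by move: win h; rewrite /valid /=; lia.
Qed.

Lemma cen_out2 x k j u q : valid x x k j -> edge col2 (cen x x k j) u -> edge col2 u q ->
  k + 2 * j + 2 <= b%:Z.
Proof.
move=> h cu uq; have kb : k + 2 * j < b%:Z by case: (cen_out h cu) => //; rewrite ltxx.
have [p [p' [m cp pp' _]]] := cen_mid h kb; have up := fun2 cu cp; rewrite up in cu uq.
have [v [vc qv]] := succ2_mid (cen_cv h) cu pp' uq.
have [[[[x' y'] k'] l'] vK] := cc_Kex CC vc; have [_ win _] := cc_K CC vK.
have /RA2_edgeE := (cc_MK2 CC m vK).2 (ex_intro _ q (conj uq qv)).
by move: win h; rewrite /valid /=; lia.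
Qed.

(** The next centre is known from C(A, B): one diagonal step away if y < x, otherwise two steps away
    unless a central edge is crossed. The ladder above the 1-arrow reaching that centre carries the
    rule to every height. *)
Lemma left_steps x y k j n u : valid x y k j -> path2 n.+1 (cen x y k j) u ->
  if y < x then exists w, edge col1 u w /\ path2 n (cen x (y + 1) k j) w
  else if n is n'.+1 then exists w, edge col1 u w /\ path2 n' (cen x y k (j + 1)) w
  else exists w, ce u w /\ edge col2 w (cen x y (k + 1) j).
Proof.
move=> h cu; have cc := cen_cv h; case: ifP => yx.
  have [u0 [c0 u0c]] := cen_row h yx; have u0l := edge2_left wf B0 B1 B2 c0 (or_introl cc).
  have h' : valid x (y + 1) k j by move: h; rewrite /valid; lia.
  have [lad _] := ladder n u0l u0c (or_introl (cen_cv h')).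
  exact/lad/(path2_first c0).
have xy : y = x by move: h; rewrite /valid; lia.
subst y; case: n cu => [[_ [<- cu]]|n cu].
  have kb : k + 2 * j < b%:Z by case: (cen_out h cu) => //; rewrite ltxx.
  by have [p [p' [m cp pp' pc]]] := cen_mid h kb; rewrite (fun2 cu cp); exists p'.
have [z [cz zu]] := path2_uncons cu; have [t [zt tu]] := path2_uncons zu.
have kb := cen_out2 h cz zt; have [u0 [q [c0 uq qc]]] := cen_mid2 h kb.
have u0l := edge2_left wf B0 B1 B2 c0 (or_introl cc).
have ql := edge2_left wf B0 B1 B2 uq (or_intror u0l).
have h' : valid x x k (j + 1) by move: h; rewrite /valid; lia.
have [lad _] := ladder n ql qc (or_introl (cen_cv h')).
by apply: lad; apply: (path2_first uq); apply: (path2_first c0).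
Qed.

(** Induction on the claimed length: by the ladder, paths above this centre correspond to paths
    above the next one, shorter by one step if y < x and by two steps otherwise. When too little
    room is left in B, [cen_out] and [cen_out2] stop the string. *)
Lemma left_count x y k j n : valid x y k j ->
  (exists u, path2 n (cen x y k j) u) <-> n%:Z <= x - y + b%:Z - k - 2 * j.
Proof.
move=> h; have [N NE] : exists N : nat, x - y + b%:Z - k - 2 * j = N%:Z.
  by exists (absz (x - y + b%:Z - k - 2 * j)%R); move: h; rewrite /valid; lia.
rewrite NE; elim/ltn_ind: N x y k j n h NE => N IHN x y k j n h NE.
have hv := h; rewrite /valid in hv.
case: n => [|n]; first by split=> // _; exists (cen x y k j).
have cc := cen_cv h; have [yx|xy'] := boolP (y < x).
  have [u0 [c0 u0c]] := cen_row h yx; have u0l := edge2_left wf B0 B1 B2 c0 (or_introl cc).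
  have h' : valid x (y + 1) k j by move: h; rewrite /valid; lia.
  have [lad1 lad2] := ladder n u0l u0c (or_introl (cen_cv h')).
  have -> : (exists u, path2 n.+1 (cen x y k j) u) <-> (exists u, path2 n (cen x (y + 1) k j) u).
    split=> [[u /(path2_first c0)/lad1[w [_ cw]]]|[w /lad2[u [_ u0u]]]]; first by exists w.
    by exists u; apply: (@path2_trans _ u0 1 n) => //; exists (cen x y k j).
  by rewrite (IHN N.-1 _ _ _ _ _ n h'); lia.
have xy : y = x by move: h; rewrite /valid; lia.
subst y; have [kb|kb] := boolP (k + 2 * j + 2 <= b%:Z).
  have [u0 [q [c0 uq qc]]] := cen_mid2 h kb.
  case: n => [|n]; first by split=> [_|_]; [lia|exists u0, (cen x x k j)].
  have u0l := edge2_left wf B0 B1 B2 c0 (or_introl cc).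
  have ql := edge2_left wf B0 B1 B2 uq (or_intror u0l).
  have h' : valid x x k (j + 1) by move: h; rewrite /valid; lia.
  have [lad1 lad2] := ladder n ql qc (or_introl (cen_cv h')).
  have -> : (exists u, path2 n.+2 (cen x x k j) u) <-> (exists u, path2 n (cen x x k (j + 1)) u).
    split=> [[u /(path2_first c0)/(path2_first uq)/lad1[w [_ cw]]]|[w /lad2[u [_ u0u]]]]; first by exists w.
    exists u; apply: (@path2_trans _ q 2 n) => //; exists u0; split=> //.
    by exists (cen x x k j).
  by rewrite (IHN N.-2 _ _ _ _ _ n h'); lia.
split=> [[u cu]|nN]; last first.
  have n0 : n = 0%N by lia.
  subst n; have [|u0 [w [_ c0 _ _]]] := cen_mid h; first by lia.
  by exists u0, (cen x x k j).
have [z [cz zu]] := path2_uncons cu; have kb' : k + 2 * j < b%:Z by case: (cen_out h cz) => //; rewrite ltxx.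
case: n zu {cu} => [|n] zu; first by lia.
have [t [zt tu]] := path2_uncons zu; have := cen_out2 h cz zt; lia.
Qed.

End Half.

(** * Gluing the two halves *)

Lemma path2_op (G : cgraph) n (u v : G) : path2 (G := opg G) n u v <-> path2 n v u.
Proof.
elim: n v => [|n IHn] v; first by split=> ->.
split=> [[w [/IHn wu vw]]|/path2_uncons[w [vw /IHn wu]]]; last by exists w.
by apply: (@path2_trans _ v w 1 n) => //; exists v.
Qed.

Lemma path2_det (G : cgraph) (c u v : G) m n : axiom_B0 G ->
  path2 m c u -> path2 (m + n) c v -> path2 n u v.
Proof.
move=> B0; elim: m c => [c <- //|m IHm c /path2_uncons[z [cz zu]] cv].
exact: IHm zu (path2_first B0 cz cv).
Qed.

Lemma path2_cycle (G : cgraph) (u : G) n : axiom_B0 G -> ~ path2 n.+1 u u.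
Proof.
move=> B0; suff pb m v : path2 m.+1 u v -> before col2 u v by move/pb; apply: (acyclic B0).
elim: m v => [v [_ [<- uv]]|m IHm v [w [/IHm uw wv]]]; first exact: t_step.
by apply: t_trans uw _; apply: t_step.
Qed.

Lemma path2_length (G : cgraph) (c u : G) m n : axiom_B0 G -> path2 m c u -> path2 n c u -> m = n.
Proof.
move=> B0; wlog mn : m n / (m <= n)%N.
  by move=> W cm cn; case: (leqP m n) => [/W ->|/ltnW/W ->].
move=> cm; rewrite -(subnKC mn) => cn; have := path2_det B0 cm cn.
by case: (n - m)%N => [|d]; [rewrite addn0|move/(path2_cycle B0)].
Qed.

Lemma before_eq_path2 (G : cgraph) (u v : G) : before_eq col2 u v -> exists n, path2 n u v.
Proof.
elim=> [x y xy|x|x y z _ [m xy] _ [n yz]]; [by exists 1%N, x|by exists 0%N|].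
by exists (m + n)%N; apply: path2_trans xy yz.
Qed.

Lemma path2_string (G : cgraph) (u v : G) n : path2 n u v -> same_string col2 u v.
Proof.
elim: n v => [v <-|n IHn v [w [/IHn uw wv]]]; first exact: rst_refl.
by apply: rst_trans uw _; apply: rst_step.
Qed.

Section Assembly.
Variables (G : cgraph) (cv : pred G) (ce : rel G) (a b : nat).
Variables (K : G -> cpoint -> Prop) (Mi : G -> G -> cpoint -> Prop).
Hypothesis CC : central_coords cv ce a b K Mi.
Hypotheses (wf : central_edges_wf ce) (B0 : axiom_B0 G) (B1 : axiom_B1 cv ce) (B2 : axiom_B2 cv ce).
Hypotheses (B3 : axiom_B3 cv ce) (B3' : axiom_B3' cv ce).
Implicit Types u v w : G.
Local Notation left := (left_vertex cv ce).
Local Notation right := (right_vertex cv ce).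

Variable cen : int -> int -> int -> int -> G.
Hypothesis cenK : forall x y k j, valid a b x y k j -> K (cen x y k j) (x, y, k, k + 2 * j).

Let CC' := central_coords_op CC.
Let wf' : central_edges_wf (G := opg G) (opce ce). Proof. by move=> u v; apply: wf. Qed.
Let B0' := op_B0 B0.
Let B1' := op_B1 B1.
Let B2' := op_B2 B2.
Let B3op := op_B3 B3'.
(** The centres of the reversed graph in dual coordinates: [dual] sends (x, y, k, k + 2j) to (a - y,
    a - x, b - k - 2j, b - k) and keeps [j]. *)
Let cen' (x y k j : int) : opg G := cen (a%:Z - y) (a%:Z - x) (b%:Z - k - 2 * j) j.

Let cenK' x y k j : valid a b x y k j -> K (cen' x y k j) (dual a b (x, y, k, k + 2 * j)).
Proof.
move=> h; have h' : valid a b (a%:Z - y) (a%:Z - x) (b%:Z - k - 2 * j) j by move: h; rewrite /valid; lia.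
have := cenK h'; rewrite /cen' /dual; congr K; congr (_, _, _, _); lia.
Qed.

Let cen'E (x y k j : int) : cen' (a%:Z - y) (a%:Z - x) (b%:Z - k - 2 * j) j = cen x y k j.
Proof. by rewrite /cen'; congr cen; lia. Qed.

(** [u] sits at signed distance [s] from the centre with coordinates (x, y, k, j); the lemmas that
    follow show that this is a bijection between the vertices and the points of the model. *)
Definition located (q : qpoint) u : Prop :=
  let: (x, y, k, j, s) := q in valid a b x y k j /\
  if 0 <= s then path2 `|s|%N (cen x y k j) u else path2 `|s|%N u (cen x y k j).

Lemma located_in q u : located q u -> in_model a b q.
Proof.
move: q => [[[[x y] k] j] s] [h]; case: ifP => s0 p.
  have := (left_count CC wf B0 B1 B2 B3 cenK `|s|%N h).1 (ex_intro _ u p).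
  by move: h; rewrite /valid /in_model; lia.
have h' : valid a b (a%:Z - y) (a%:Z - x) (b%:Z - k - 2 * j) j by move: h; rewrite /valid; lia.
have := (left_count CC' wf' B0' B1' B2' B3op cenK' `|s|%N h').1; rewrite cen'E => hh.
have {}hh := hh (ex_intro _ u ((path2_op _ _ _).2 p)).
by move: hh h; rewrite /valid /in_model; lia.
Qed.

Lemma located_ex q : in_model a b q -> exists u, located q u.
Proof.
move: q => [[[[x y] k] j] s] q; have h : valid a b x y k j by move: q; rewrite /valid /in_model; lia.
have [s0|/negPf s0] := boolP (0 <= s).
  have [|u cu] := (left_count CC wf B0 B1 B2 B3 cenK `|s|%N h).2; last by exists u; rewrite /located s0.
  by move: q; rewrite /in_model; lia.
have h' : valid a b (a%:Z - y) (a%:Z - x) (b%:Z - k - 2 * j) j by move: h; rewrite /valid; lia.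
have [|u /path2_op cu] := (left_count CC' wf' B0' B1' B2' B3op cenK' `|s|%N h').2.
  by move: q; rewrite /in_model; lia.
by exists u; split=> //; rewrite s0; rewrite cen'E in cu.
Qed.

Lemma cen_onto v : cv v -> exists x y k j, valid a b x y k j /\ v = cen x y k j.
Proof.
move=> /(cc_Kex CC)[[[[x y] k] l] vK]; have [_ win wo] := cc_K CC vK.
move: wo; rewrite /is_otimes eqz_nat_parity => wo.
have h : valid a b x y k ((l - k) %/ 2)%Z by move: win; rewrite /valid /=; lia.
exists x, y, k, ((l - k) %/ 2)%Z; split=> //; apply: (cc_Kinj CC) vK _.
by have := cenK h; congr K; congr (_, _, _, _); lia.
Qed.

Lemma located_some u : exists q, located q u.
Proof.
have [v [vc [/before_eq_path2[n vu]|/before_eq_path2[n uv]]]] := string2_center B0 B2 u;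
  have [x [y [k [j [h vE]]]]] := cen_onto vc; rewrite vE in vc *.
  by exists (x, y, k, j, n%:Z); split=> //; rewrite -vE.
exists (x, y, k, j, - n%:Z); split=> //; rewrite -vE; case: ifP => [|_]; last by rewrite abszN absz_nat.
case: n uv => [uv _|//]; exact: esym.
Qed.

Lemma located_center q u : located q u ->
  let: (x, y, k, j, s) := q in [/\ valid a b x y k j, cv (cen x y k j) & same_string col2 u (cen x y k j)].
Proof.
move: q => [[[[x y] k] j] s] [h p]; split=> //; first exact: (cen_cv CC cenK h).
by move: p; case: ifP => _ /path2_string // p; apply: rst_sym.
Qed.

Lemma located_fun q q' u : located q u -> located q' u -> q = q'.
Proof.
move=> qu qu'; have := located_center qu; have := located_center qu'; move: q q' qu qu'.
move=> [[[[x y] k] j] s] [[[[x' y'] k'] j'] s'] [h p] [h' p'] [_ c' u'] [_ c u0].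
have cc := center2_uniq B2 c c' u0 u'.
have [xx yy kk jj] : [/\ x' = x, y' = y, k' = k & j' = j].
  by have := cenK h'; rewrite -cc => /(cc_Kfun CC (cenK h))[-> -> -> ?]; split=> //; lia.
subst x' y' k' j'; congr (_, _, _, _, _).
move: p p'; case: (ifP (0 <= s)) => s0; case: (ifP (0 <= s')) => s0' p p'.
- by have := path2_length B0 p p'; lia.
- exfalso; have := path2_trans p p'; rewrite (_ : (`|s| + `|s'| = (`|s| + `|s'|).-1.+1)%N); last by lia.
  exact: (path2_cycle B0).
- exfalso; have := path2_trans p' p; rewrite (_ : (`|s'| + `|s| = (`|s'| + `|s|).-1.+1)%N); last by lia.
  exact: (path2_cycle B0).
by move/path2_op: p => p; move/path2_op: p' => p'; have := path2_length B0' p p'; lia.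
Qed.

Lemma located_inj q u u' : located q u -> located q u' -> u = u'.
Proof.
move: q => [[[[x y] k] j] s] [h p] [h' p']; move: p p'; case: ifP => s0 p p'.
  by rewrite -[`|s|%N]addn0 in p'; have := path2_det B0 p p'.
move/path2_op: p => p; move/path2_op: p' => p'.
by rewrite -[`|s|%N]addn0 in p'; have := path2_det B0' p p'.
Qed.

Lemma located_side q u : located q u ->
  [/\ 0 < height q -> left u, height q < 0 -> right u & height q = 0 -> cv u].
Proof.
move: q => [[[[x y] k] j] s] [h]; have cc := cen_cv CC cenK h; rewrite /height /=.
case: ifP => s0 p; split=> s1; try lia.
- by rewrite (_ : `|s|%N = `|s|.-1.+1) in p; [apply: (path2_left wf B0 B1 B2 _ p); left|lia].
- by move: p; rewrite s1 /= => <-.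
move/path2_op: p => p; apply/op_left.
by rewrite (_ : `|s|%N = `|s|.-1.+1) in p; [apply: (path2_left wf' B0' B1' B2' _ p); left|lia].
Qed.

Lemma located_up q u v : located q u -> edge col2 u v -> located (up q) v.
Proof.
move: q => [[[[x y] k] j] s] [h p] uv; rewrite /up /height /=; split=> //.
move: p; case: ifP => s0 p.
  have -> : 0 <= s + 1 by lia.
  have -> : absz (s + 1)%R = `|s|.+1 by lia.
  by rewrite /=; exists u.
rewrite (_ : `|s|%N = (absz (s + 1)%R).+1) in p; last by lia.
have [w [uw wc]] := path2_uncons p; rewrite -(edge_fun B0 uv uw) in wc.
case: ifP => // s1; rewrite (_ : absz (s + 1)%R = 0%N) in wc *; last by lia.
exact: esym.
Qed.

Lemma located_up_edge q u v : located q u -> located (up q) v -> edge col2 u v.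
Proof.
move=> qu qv; suff [w uw] : exists w, edge col2 u w.
  by rewrite (located_inj qv (located_up qu uw)).
move: q qu qv => [[[[x y] k] j] s] [h p] [_ p']; move: p p'; rewrite /up /height /=.
case: (ifP (0 <= s)) => s0 p.
  have -> : 0 <= s + 1 by lia.
  have -> : absz (s + 1)%R = `|s|.+1 by lia.
  move=> /= [w [cw wv]]; exists v; rewrite -[`|s|%N]addn0 in cw; by rewrite (path2_det B0 p cw).
rewrite (_ : `|s|%N = (absz (s + 1)%R).+1) in p; last by lia.
by have [w [uw _]] := path2_uncons p; exists w.
Qed.

Lemma located_succ q u : located q u -> 0 < height q ->
  exists v q', [/\ located q' v, edge col1 u v & qf a b col1 q = Some q'].
Proof.
move=> qu; have := located_in qu; move: q qu => [[[[x y] k] j] s] [h p] qin; rewrite /height /= => s0.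
move: p; rewrite (ltW s0) (_ : `|s|%N = `|s|.-1.+1) => [p|]; last by lia.
rewrite (_ : 1 <= s) //; have := left_steps CC wf B0 B1 B2 B3 cenK h p; move: qin; rewrite /in_model => qin.
case: ifP => yx.
  move=> [w [uw cw]]; exists w, (x, y + 1, k, j, s - 1); split=> //; split; first by move: h; rewrite /valid; lia.
  have -> : 0 <= s - 1 by lia.
  by have -> : absz (s - 1)%R = `|s|.-1 by lia.
case n1: (`|s|.-1) => [|n].
  move=> [w [uw wc]]; rewrite (_ : (2 <= s) = false); last by lia.
  exists w, (x, y, k + 1, j, -1); split=> //; last exact: wf.
  by split; [move: h; rewrite /valid; lia|exists w].
move=> [w [uw cw]]; rewrite (_ : (2 <= s) = true); last by lia.
exists w, (x, y, k, j + 1, s - 2); split=> //; split; first by move: h; rewrite /valid; lia.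
have -> : 0 <= s - 2 by lia.
by have -> : absz (s - 2)%R = n by lia.
Qed.

(** [left_steps] for the reversed graph, translated back through [cen']. *)
Lemma located_pred q u : located q u -> height q < 0 ->
  exists v q', [/\ located q' v, edge col1 v u & qe col1 q = Some q'].
Proof.
move=> qu; have := located_in qu; move: q qu => [[[[x y] k] j] s] [h p] qin; rewrite /height /= => s0.
have h' : valid a b (a%:Z - y) (a%:Z - x) (b%:Z - k - 2 * j) j by move: h; rewrite /valid; lia.
have s0' : (0 <= s) = false by lia.
have [n sn] : exists n, `|s|%N = n.+1 by exists `|s|.-1; lia.
move: p; rewrite s0' sn => /path2_op p.
rewrite -(cen'E x y k j) in p; rewrite (_ : s <= -1); last by lia.
have := left_steps CC' wf' B0' B1' B2' B3op cenK' h' p; move: qin; rewrite /in_model => qin.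
rewrite (_ : (a%:Z - x < a%:Z - y) = (y < x)); last by lia.
case: ifP => yx.
  move=> [w [uw /path2_op cw]]; exists w, (x - 1, y, k, j, s + 1); split=> //.
  split; first by move: h; rewrite /valid; lia.
  move: cw; rewrite (_ : cen' _ _ _ _ = cen (x - 1) y k j); last by rewrite /cen'; congr cen; lia.
  case: ifP => s1; last by have -> : absz (s + 1)%R = n by lia.
  have -> : n = 0%N by lia.
  by have -> : absz (s + 1)%R = 0%N by lia.
case: n sn p => [|n] sn p.
  move=> [w [uw wc]]; rewrite (_ : (s <= -2) = false); last by lia.
  exists w, (x, y, k - 1, j, 1); split=> //; last exact: wf.
  split; first by move: h; rewrite /valid; lia.
  exists (cen x y (k - 1) j); split=> //; move: wc.
  by rewrite (_ : cen' _ _ _ _ = cen x y (k - 1) j) //; rewrite /cen'; congr cen; lia.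
move=> [w [uw /path2_op cw]]; rewrite (_ : (s <= -2) = true); last by lia.
exists w, (x, y, k - 2, j + 1, s + 2); split=> //; split; first by move: h; rewrite /valid; lia.
move: cw; rewrite (_ : cen' _ _ _ _ = cen x y (k - 2) (j + 1)); last by rewrite /cen'; congr cen; lia.
case: ifP => s1; last by have -> : absz (s + 2)%R = n by lia.
have -> : n = 0%N by lia.
by have -> : absz (s + 2)%R = 0%N by lia.
Qed.

Lemma right_after u v : edge col1 u v -> cv u \/ right u -> right v.
Proof.
move=> uv [uc|[[w [wc wu]]|[w [w' [ww' wu]]]]].
- exact: cv_succ uv.
- by left; exists w; split=> //; apply: t_trans wu _; apply: t_step.
by right; exists w, w'; split=> //; apply: rt_trans wu _; apply: rt_step.
Qed.

(** The location of vertices is the isomorphism. 2-arrows raise the height by 1; a 1-arrow is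
    recovered from its beginning when that is left, and from its end otherwise. *)
Lemma assembly : isomorphic G (model_graph a b).
Proof.
have [c cP] : exists c : G -> qpoint, forall u, located (c u) u.
  by apply: (@functional_choice G qpoint (fun u q => located q u)); apply: located_some.
have cin u : in_model a b (c u) := located_in (cP u).
have cE q u : located q u -> c u = q := located_fun (cP u).
have cinj : injective c by move=> u v uv; apply: (located_inj (cP u)); rewrite uv.
exists (fun u => to_model (cin u)); split.
  apply: inj_surj_bij => [u v /(congr1 val)/cinj //|q].
  have [u qu] := located_ex (model_in q); exists u; apply: val_inj; exact: cE.
have side1 u : left u -> 0 < height (c u).
  move=> ul; have [_ h h'] := located_side (cP u); case: (ltgtP (height (c u)) 0) => // [/h|/h'].
    by case/(left_not_right wf B0 B1 ul).
  by move/(cv_not_left wf B0 B1).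
have side2 u : right u -> height (c u) < 0.
  move=> ur; have [h _ h'] := located_side (cP u); case: (ltgtP (height (c u)) 0) => // [/h|/h'].
    by move/(left_not_right wf B0 B1).
  by move/(cv_not_right wf B0 B1).
move=> i u v; rewrite [X in _ <-> X](_ : _ = (model_f i (to_model (cin u)) = Some (to_model (cin v)))) //.
rewrite model_fP /=; case: i; last first.
  split=> [/(located_up (cP u))/cE cv'|].
    have := cin v; rewrite cv'; case: (c u) => [[[[x y] k] j] s]; rewrite /up /height /in_model /= => h.
    by rewrite (_ : s < _) //; lia.
  move=> uv; apply: (located_up_edge (cP u)); have := cP v.
  move: uv; case: (c u) (c v) => [[[[x y] k] j] s] q; rewrite /up /height /=.
  by case: ifP => // _ [<-].
have [u0|u0] := ltP 0 (height (c u)).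
  have [v' [q' [/cE vE uv' ->]]] := located_succ (cP u) u0; rewrite -vE.
  by split=> [uv|[/cinj <-] //]; rewrite (edge_fun B0 uv uv').
(* A 1-arrow leaving a central or right vertex ends in a right vertex, where [located_pred]
   applies. *)
have uside : cv u \/ right u.
  have [_ h h'] := located_side (cP u); case: (ltgtP (height (c u)) 0) u0 => // h1 _; [right|left]; auto.
split=> [uv|uv].
  have [u' [q' [/cE uE uv']]] := located_pred (cP v) (side2 _ (right_after uv uside)).
  by rewrite (edge_inj B0 uv uv') -uE; apply: (qe_qf _ (cin v) (cin u')).1.
have v0 : height (c v) < 0 by have := qf1_height (cin u) uv; lia.
have [u' [q' [/cE uE uv']]] := located_pred (cP v) v0.
by move/(qe_qf _ (cin v) (cin u)): uv => ->; rewrite -uE => -[/cinj ->].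
Qed.

End Assembly.

Lemma seg_of_bounded (A : index_set) (n : nat) :
  (forall f : nat -> int, injective f -> ~ forall m, mem_ix A (f m)) -> exists a, A = Seg a.
Proof.
case: A => [a|h|h|h]; first by exists a.
- by case: (h (fun m => m%:Z)) => [m m' []|].
- by case: (h (fun m => - m%:Z)) => [m m' /oppr_inj[]|m] //=; lia.
by case: (h (fun m => m%:Z)) => [m m' []|].
Qed.

(** An infinite index set would give infinitely many vertices of C(A, B), hence infinitely many
    central points in a finite graph. So A and B are segments, and a choice of the centres [cen]
    lets [assembly] conclude. *)
Lemma axioms_model (T : finType) (E : color -> rel T) (cv : pred (finite_graph E))
    (ce : rel (finite_graph E)) : central_edges_wf ce -> B2_axioms cv ce ->
  exists a b, isomorphic (finite_graph E) (model_graph a b).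
Proof.
move=> wf [[B0 B1 B2 B3 B3'] [_ _ [A [B [g [[gb ge] go]]]]]].
have fin (w : nat -> cpoint) : injective w -> ~ forall n, is_RA2_vertex A B (w n).
  move=> winj win; case: gb => gV gVK gK.
  (* Central points are injected into the finite type of vertices and pairs of vertices, to be
     counted there. *)
  pose tag (z : central_vertex cv ce) : T + T * T := match z with inl v => inl (val v) | inr xx => inr (val xx) end.
  have tinj : injective tag.
    by move=> [v|v] [v'|v'] //= [] h; congr (_ _); apply: val_inj => //; case: (val v) (val v') h => ? ? [? ?] /= [-> ->].
  pose f (i : 'I_(#|{: T + T * T}|.+1)) := tag (gV (exist _ (w i) (win i))).
  have finj : injective f.
    move=> i j /tinj/(can_inj gK)/(congr1 val)/= /winj; exact: val_inj.
  by have := leq_card f finj; rewrite card_ord ltnn.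
have A0 : mem_ix A 0 by case: A {g gb ge go fin}.
have B0_ : mem_ix B 0 by case: B {g gb ge go fin}.
have [t0 _] : exists t : T, true.
  have w0 : is_RA2_vertex A B (0, 0, 0, 0) by rewrite /= A0 B0_.
  case: gb => gV _ _; case: (gV (exist (fun w => is_RA2_vertex A B w) _ w0)) => [[v _]|[[v _] _]]; by exists v.
have [a aE] : exists a, A = Seg a.
  apply: (@seg_of_bounded A 0) => f finj fA; apply: (fin (fun n => (f n, f n, 0, 0))).
    by move=> m n [/finj].
  by move=> n /=; rewrite fA B0_ !lexx ?eqxx ?orbT.
have [b bE] : exists b, B = Seg b.
  apply: (@seg_of_bounded B 0) => f finj fB; apply: (fin (fun n => (0, 0, f n, f n))).
    by move=> m n [/finj].
  by move=> n /=; rewrite fB A0 !lexx ?eqxx ?orbT.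
subst A B; have [K [Mi CC]] := iso_central_coords (conj gb ge) go.
have [cen cenP] : exists cen : int * int * int * int -> T, forall q,
    let: (x, y, k, j) := q in valid a b x y k j -> K (cen q) (x, y, k, k + 2 * j).
  apply: (@functional_choice (int * int * int * int)%type T
    (fun q u => let: (x, y, k, j) := q in valid a b x y k j -> K u (x, y, k, k + 2 * j))).
  move=> [[[x y] k] j]; have [h|_] := boolP (valid a b x y k j); last by exists t0.
  have [||v vK] := cc_Konto CC (w := (x, y, k, k + 2 * j)); last by exists v.
    by move: h; rewrite /valid /=; lia.
  by rewrite /is_otimes eqz_nat_parity; lia.
exists a, b; apply: (assembly CC wf B0 B1 B2 B3 B3' (cen := fun x y k j => cen (x, y, k, j))).
by move=> x y k j; apply: (cenP (x, y, k, j)).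
Qed.

Lemma model_axioms_iso (G : cgraph) a b : isomorphic G (model_graph a b) ->
  exists (cv : pred G) (ce : rel G), central_edges_wf ce /\ B2_axioms cv ce.
Proof.
move=> [f [[g fK gK] fe]]; pose c u := val (f u : model a b).
have cin u : in_model a b (c u) by apply: model_in.
have cinj : injective c by move=> u v /val_inj/(can_inj fK).
exists (model_cv c), (model_ce c); apply: (@model_axioms a b) => // [q qin|i u v].
  by exists (g (to_model qin)); rewrite /c gK.
by rewrite fe -model_fP.
Qed.

Theorem mainTheorem1 (T : finType) (E : color -> rel T)
    (hsimple : no_multiple_edges (finite_graph E))
    (hconn : weakly_connected (finite_graph E)) :
  ((exists H : cgraph, regular_B2_crystal H /\ isomorphic (finite_graph E) H) <->
   (exists a b : nat,
      isomorphic (finite_graph E) (S_graph (Seg a) (Seg b)))) /\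
  ((exists a b : nat,
      isomorphic (finite_graph E) (S_graph (Seg a) (Seg b))) <->
   (exists (cv : pred (finite_graph E)) (ce : rel (finite_graph E)),
      central_edges_wf ce /\ B2_axioms cv ce)).
Proof.
have SQ : (exists a b, isomorphic (finite_graph E) (S_graph (Seg a) (Seg b))) <->
    (exists a b, isomorphic (finite_graph E) (model_graph a b)).
  split=> -[a [b ab]]; exists a, b; apply: isomorphic_trans ab _.
    exact: S_graph_model.
  exact/isomorphic_sym/S_graph_model.
split; rewrite SQ; first exact: regular_iff_model.
split=> [[a [b /model_axioms_iso //]]|[cv [ce [wf ax]]]].
exact: axioms_model wf ax.
Qed.
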